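(* Let $M$ be a closed oriented $6$-manifold with nowhere vanishing $6$-vector field $\nu$ and closed $3$-form $H$. Fix a chirality $\pm$, let $\gamma\in\Gamma(\mathbf{S}_\pm)$, and let $\tau\in\Gamma(\mathbf{S}_\pm)$ be a stable $d_\nu$-closed spinor field. Then $\tau$ is a critical point in its $d_\nu$-cohomology class (restricted to stable spinor fields) for the functional $$\mathbf{V}(\tau)=\int_M\langle\tau^\dagger,\tau\rangle\,\varpi_\nu$$ subject to the constraint $\mathbf{C}_\gamma(\tau)=\int_M\langle\gamma,\tau\rangle\,\varpi_\nu=\mathrm{const}$ if and only if $$d_\nu\tau^\dagger=\lambda\,d_\nu\gamma\quad\text{for some }\lambda\in\mathbb{R}.$$
   Context: $\mathbf{E}=\mathbf{E}(H)$ is the generalised tangent bundle (isomorphic to $TM\oplus T^*M$, structure group $SO(6,6)$, transition functions twisted by local potentials of $H$), with real chiral spinor bundles $\mathbf{S}_\pm$. The choice of $\nu$ (with dual volume form $\varpi_\nu$) gives isomorphisms $\rho\mapsto\rho^\nu$, $\Gamma(\mathbf{S}_\pm)\cong\Omega^{ev,od}(M)$ under which Clifford multiplication is $(X\oplus\xi)\bullet\rho=-X\llcorner\rho+\xi\wedge\rho$ and the differential $d_\nu:\Gamma(\mathbf{S}_\pm)\to\Gamma(\mathbf{S}_\mp)$ is $(d_\nu\rho)^\nu=d_H\rho^\nu=d\rho^\nu+H\wedge\rho^\nu$. The $Spin(6,6)_+$-invariant pairing is $\langle\rho,\tau\rangle=\nu([\rho^\nu\wedge\widehat{\tau^\nu}]^6)$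 with $\widehat\alpha=(-1)^{p(p+1)/2}\alpha$ on $p$-forms and $[\cdot]^6$ the degree $6$ part; it is extended complex-bilinearly. A real spinor field $\tau\in\Gamma(\mathbf{S}_\pm)$ is stable if at each point it is the real part of a pure complex spinor $\rho$ (annihilator maximally isotropic in $\mathbf{E}\otimes\mathbb{C}$) with $\langle\rho,\overline\rho\rangle\neq0$; equivalently it lies pointwise in the open orbit $\mathbb{R}_{>0}\times Spin(6,6)_+/SU(3,3)$. Stable spinor fields form an open subset $\mathcal{U}\subset\Gamma(\mathbf{S}_\pm)$. A stable $\tau$ determines (non-linearly) a stable $\tau^\dagger$ such that $\rho=\tau+i\tau^\dagger$ is pure with $\langle\rho,\overline\rho\rangle\ne0$; this determines $\tau^\dagger$ up to sign (the other possibility being $-\tau^\dagger$), and the sign is fixed once and for all by a $Spin(6,6)_+$-equivariant smooth choice; $\tau^{\dagger\dagger}=-\tau$. ''Critical point subject to the constraint'' means: the first variation of $\mathbf{V}$ at $\tau$ vanishes on all tangent directions $\dot\tau=d_\nu\sigma$ on which the first variation of $\mathbf{C}_\gamma$ vanishes. *)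

(* Defs.v *)
From HB Require Import structures.
From mathcomp Require Import all_boot all_order all_algebra.
From mathcomp Require Import all_classical all_reals all_analysis.
From mathcomp Require Export complex.
Set Implicit Arguments.
Unset Strict Implicit.
Unset Printing Implicit Defensive.
Import Order.TTheory GRing.Theory Num.Theory.
Import numFieldNormedType.Exports.
Local Open Scope classical_set_scope.
Local Open Scope ring_scope.

(* Exterior algebra of (K^n)^*: w I is the coefficient of dx_{i_1}...dx_{i_p},
   where i_1 < ... < i_p are the elements of I. *)
Notation ext K n := {ffun {set 'I_n} -> K}.

Notation topset n := (finset.setTfor 'I_n).

Section ExteriorAlgebra.
Variables (K : comNzRingType) (n : nat).
Implicit Types (v w : ext K n) (I J : {set 'I_n}).

(* dx_I /\ dx_J = wedge_sign I J dx_(I u J) for disjoint I, J *)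
Definition wedge_sign I J : K :=
  (-1) ^+ #|[pred p : 'I_n * 'I_n |
              [&& p.1 \in I, p.2 \in J & (p.2 < p.1)%N]]|.

Definition wedge v w : ext K n :=
  [ffun I : {set 'I_n} =>
     \sum_(J : {set 'I_n} | J \subset I)
        wedge_sign J (I :\: J) * (v J * w (I :\: J))].

Definition ext1 : ext K n := [ffun I => (I == finset.set0)%:R].

Definition covector (xi : 'rV[K]_n) : ext K n :=
  [ffun I : {set 'I_n} => \sum_i (I == finset.set1 i)%:R * xi ord0 i].

Definition contract (X : 'rV[K]_n) w : ext K n :=
  [ffun I : {set 'I_n} =>
     \sum_(i | i \notin I)
        wedge_sign (finset.set1 i) I * (X ord0 i * w (i |: I)%SET)].

Definition hat w : ext K n :=
  [ffun I : {set 'I_n} => (-1) ^+ 'C(#|I|.+1, 2) * w I].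

Definition homogeneous p w := forall I, #|I| != p -> w I = 0.

(* eps = false: even forms, eps = true: odd forms *)
Definition chiral (eps : bool) w := forall I, odd #|I| != eps -> w I = 0.

Definition chiral_part (eps : bool) w : ext K n :=
  [ffun I : {set 'I_n} => if odd #|I| == eps then w I else 0].

(* A^* w, where dy_j is pulled back to the j-th row of A *)
Definition pull (A : 'M[K]_n) w : ext K n :=
  [ffun I : {set 'I_n} =>
     \sum_(J : {set 'I_n})
        w J * (\big[wedge/ext1]_(j in J) covector (row j A)) I].

(* The fibre E = T (+) T^* with its Clifford action on forms; one has
   v . (v . w) = - edot v v *: w. *)
Definition clifford (v : 'rV[K]_n * 'rV[K]_n) w : ext K n :=
  [ffun I : {set 'I_n} => - contract v.1 w I + wedge (covector v.2) w I].

(* [v /\ hat w]^n as a number *)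
Definition mukai v w : K := wedge v (hat w) (topset n).

End ExteriorAlgebra.

Definition edot (K : fieldType) (n : nat) (v w : 'rV[K]_n * 'rV[K]_n) : K :=
  2^-1 * \sum_i (v.2 ord0 i * w.1 ord0 i + w.2 ord0 i * v.1 ord0 i).

(* e^B /\ w *)
Definition expact (R : realType) (n : nat) (B w : ext R n) : ext R n :=
  [ffun I : {set 'I_n} =>
     \sum_(k < n.+1) (k`!%:R)^-1 * iter k (@wedge R n B) w I].

Section Purity.
Variables (R : realType) (n : nat).

Definition isotropic (L : {vspace 'rV[R[i]]_n * 'rV[R[i]]_n}) :=
  forall v w, v \in L -> w \in L -> edot v w = 0.

Definition maximally_isotropic (L : {vspace 'rV[R[i]]_n * 'rV[R[i]]_n}) :=
  isotropic L /\
  forall L' : {vspace 'rV[R[i]]_n * 'rV[R[i]]_n},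
    isotropic L' -> (L <= L')%VS -> L' = L.

Definition pure (rho : ext R[i] n) :=
  exists2 L : {vspace 'rV[R[i]]_n * 'rV[R[i]]_n},
    (forall v, v \in L <-> clifford v rho = 0) & maximally_isotropic L.

Definition ext_conj (rho : ext R[i] n) : ext R[i] n :=
  [ffun I => (rho I)^*%C].

Definition ext_complex (t u : ext R n) : ext R[i] n :=
  [ffun I => (t I +i* u I)%C].

Definition nondegenerate_pure (rho : ext R[i] n) :=
  pure rho /\ mukai rho (ext_conj rho) != 0.

Definition stable (t : ext R n) :=
  exists u, nondegenerate_pure (ext_complex t u).

(* Spin(n,n)_+ consists of the products of vectors of square +1 or -1, with
   an even number of each; the list s stands for the product of its entries. *)
Definition spin_plus (s : seq ('rV[R]_n * 'rV[R]_n)) :=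
  [/\ all [pred v | (edot v v == 1) || (edot v v == -1)] s,
      ~~ odd (count [pred v | edot v v == 1] s) &
      ~~ odd (count [pred v | edot v v == -1] s)].

Definition spin_act (s : seq ('rV[R]_n * 'rV[R]_n)) (t : ext R n) :=
  foldr (@clifford R n) t s.

End Purity.

Section Smoothness.
Variables (R : realType) (n : nat).

Definition partial (i : 'I_n) (f : 'rV[R]_n -> R) (x : 'rV[R]_n) : R :=
  derive1 (fun h : R => f (x + h *: delta_mx ord0 i)) 0.

Definition smooth_on (U : set 'rV[R]_n) (f : 'rV[R]_n -> R) :=
  open U /\
  forall (s : seq 'I_n) x, U x ->
    let g := foldr partial f s in
    {for x, continuous g} /\
    forall i, derivable (fun h : R => g (x + h *: delta_mx ord0 i)) 0 1.

(* jac f x j i = d f_j / d x_i *)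
Definition jac (f : 'rV[R]_n -> 'rV[R]_n) (x : 'rV[R]_n) : 'M[R]_n :=
  \matrix_(j, i) partial i (fun y => f y ord0 j) x.

Definition extd (w : 'rV[R]_n -> ext R n) (x : 'rV[R]_n) : ext R n :=
  [ffun I : {set 'I_n} =>
     \sum_(i in I) wedge_sign R (finset.set1 i) (I :\ i)%SET
                   * partial i (fun y => w y (I :\ i)%SET) x].

End Smoothness.

Fixpoint iterated_integral (R : realType) (n : nat) : ('rV[R]_n -> R) -> R :=
  match n with
  | 0 => fun f => f 0
  | m.+1 => fun f =>
      (\int[@lebesgue_measure R]_t
         iterated_integral (fun v : 'rV[R]_m => f (row_mx (t%:M : 'rV_1) v)))%R
  end.

(* An equivariant smooth choice of t |-> t^dagger on the stable elements of the
   fibre of S_eps; the values elsewhere are irrelevant. Smoothness on S_eps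
   (over an open set, see smooth_on) is expressed by composing with the projection of the full exterior
   algebra onto S_eps. *)
Definition dagger_choice (R : realType) (n : nat) (eps : bool)
    (dag : ext R n -> ext R n) :=
  [/\ forall t, chiral eps t -> stable t ->
        nondegenerate_pure (ext_complex t (dag t)),
      forall s t, spin_plus s -> chiral eps t -> stable t ->
        dag (spin_act s t) = spin_act s (dag t) &
      forall I : {set 'I_n},
        let fibre (v : 'rV[R]_#|{set 'I_n}|) : ext R n :=
          chiral_part eps [ffun J => v ord0 (enum_rank J)] in
        smooth_on [set v | stable (fibre v)] (fun v => dag (fibre v) I)].

(* An oriented smooth n-dimensional atlas on M; chart_inv a extends the inverse
   of the chart a by arbitrary values. *)
Record oriented_atlas (R : realType) (n : nat) (M : topologicalType) := {
  chart_idx : Type;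
  chart_dom : chart_idx -> set M;
  chart : chart_idx -> M -> 'rV[R]_n;
  chart_inv : chart_idx -> 'rV[R]_n -> M;
  chart_dom_open : forall a, open (chart_dom a);
  chart_cover : forall p, exists a, chart_dom a p;
  chartK : forall a p, chart_dom a p -> chart_inv a (chart a p) = p;
  chart_img_open : forall a, open (chart a @` chart_dom a);
  chart_continuous : forall a, {within chart_dom a, continuous (chart a)};
  chart_inv_continuous : forall a,
    {within chart a @` chart_dom a, continuous (chart_inv a)};
  transition_smooth : forall a b (j : 'I_n),
    smooth_on (chart a @` (chart_dom a `&` chart_dom b))
              (fun x => chart b (chart_inv a x) ord0 j);
  transition_oriented : forall a b x,
    (chart a @` (chart_dom a `&` chart_dom b)) x ->
    0 < \det (jac (chart b \o chart_inv a) x) }.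

Section Manifold.
Variables (R : realType) (n : nat) (M : topologicalType).
Variable A : oriented_atlas R n M.

(* Differential forms, spinor fields and functions are given by their
   representatives in all charts; only the values on chart_img a matter. *)
Definition field (V : Type) := chart_idx A -> 'rV[R]_n -> V.

Definition chart_img (a : chart_idx A) : set 'rV[R]_n := chart a @` chart_dom a.
Definition overlap (a b : chart_idx A) : set 'rV[R]_n :=
  chart a @` (chart_dom a `&` chart_dom b).
Definition transition (a b : chart_idx A) : 'rV[R]_n -> 'rV[R]_n := chart b \o chart_inv a.

Definition field_eq V (f g : field V) := forall a x, chart_img a x -> f a x = g a x.

Definition field_smooth (w : field (ext R n)) :=
  forall a I, smooth_on (chart_img a) (fun x => w a x I).

Definition field_d (w : field (ext R n)) : field (ext R n) :=
  fun a => extd (w a).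

Definition is_form (p : nat) (w : field (ext R n)) :=
  [/\ field_smooth w,
      forall a x, chart_img a x -> homogeneous p (w a x) &
      forall a b x, overlap a b x ->
        w a x = pull (jac (transition a b) x) (w b (transition a b x))].

Definition closed_form (w : field (ext R n)) :=
  forall a x, chart_img a x -> field_d w a x = 0.

(* nu a is the coefficient of d/dx_1 /\ ... /\ d/dx_n *)
Definition nowhere_vanishing_multivector (nu : field R) :=
  [/\ forall a, smooth_on (chart_img a) (nu a),
      forall a x, chart_img a x -> nu a x != 0 &
      forall a b x, overlap a b x ->
        nu b (transition a b x) = \det (jac (transition a b) x) * nu a x].

Definition dual_volume (nu : field R) : field (ext R n) :=
  fun a x => [ffun I => (I == topset n)%:R * (nu a x)^-1].

Definition partition_of_unity (N : nat) (c : 'I_N -> chart_idx A)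
    (chi : 'I_N -> M -> R) :=
  [/\ forall k a, smooth_on (chart_img a) (chi k \o chart_inv a),
      forall k p, 0 <= chi k p,
      forall k, exists2 C : set M,
        compact C /\ C `<=` chart_dom (c k) &
        forall p, ~ C p -> chi k p = 0 &
      forall p, \sum_(k < N) chi k p = 1].

(* The sum does not depend on the partition of unity; the default value 0 is
   not reached when M is compact Hausdorff. *)
Definition form_integral (w : field (ext R n)) : R :=
  xget 0 [set s : R |
    exists N (c : 'I_N -> chart_idx A) (chi : 'I_N -> M -> R),
      partition_of_unity c chi /\
      s = \sum_(k < N) iterated_integral
            (fun x => if x \in chart_img (c k)
                      then chi k (chart_inv (c k) x) * w (c k) x (topset n)
                      else 0)].

(* B a is a potential of H on the chart a. The bundle E(H) is obtained by gluing
   the T (+) T^* of the charts: pulling back along the transition from a to b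
   is followed by the shift X (+) xi |-> X (+) (xi + contract X beta), where
   beta = B a - (pullback of B b). *)
Definition local_potentials (H B : field (ext R n)) :=
  [/\ field_smooth B,
      forall a x, chart_img a x -> homogeneous 2 (B a x) &
      field_eq (field_d B) H].

(* Spin lift of the transition function of E(H): the shift by beta acts on
   forms as wedging with e^beta. The factor det^(-1/2) comes
   from the lift of GL_+(n) to Spin(n,n)_+: spinors are forms tensored with
   the square root of the line bundle of n-vectors. *)
Definition spin_transition (B : field (ext R n)) a b (x : 'rV[R]_n)
    (t : ext R n) : ext R n :=
  let J := jac (transition a b) x in
  (Num.sqrt (\det J))^-1 *:
    expact (B a x - pull J (B b (transition a b x))) (pull J t).

Definition is_spinor_field (B : field (ext R n)) (eps : bool)
    (rho : field (ext R n)) :=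
  [/\ field_smooth rho,
      forall a x, chart_img a x -> chiral eps (rho a x) &
      forall a b x, overlap a b x ->
        rho a x = spin_transition B a b x (rho b (transition a b x))].

(* The isomorphism rho |-> rho^nu from spinor fields to forms, and its inverse *)
Definition to_form (B : field (ext R n)) (nu : field R)
    (rho : field (ext R n)) : field (ext R n) :=
  fun a x => (Num.sqrt `|nu a x|)^-1 *: expact (- B a x) (rho a x).

Definition of_form (B : field (ext R n)) (nu : field R)
    (w : field (ext R n)) : field (ext R n) :=
  fun a x => Num.sqrt `|nu a x| *: expact (B a x) (w a x).

Definition twisted_d (H w : field (ext R n)) : field (ext R n) :=
  fun a x => field_d w a x + wedge (H a x) (w a x).

Definition d_nu (H B : field (ext R n)) (nu : field R)
    (rho : field (ext R n)) : field (ext R n) :=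
  of_form B nu (twisted_d H (to_form B nu rho)).

(* In each chart this is mukai (rho a x) (tau a x) up to the sign of nu a x. *)
Definition pairing (B : field (ext R n)) (nu : field R)
    (rho tau : field (ext R n)) : field R :=
  fun a x => nu a x * mukai (to_form B nu rho a x) (to_form B nu tau a x).

Definition function_integral (nu : field R) (f : field R) : R :=
  form_integral (fun a x => f a x *: dual_volume nu a x).

Definition stable_field (tau : field (ext R n)) :=
  forall a x, chart_img a x -> stable (tau a x).

Definition dagger (dag : ext R n -> ext R n) (tau : field (ext R n))
    : field (ext R n) := fun a x => dag (tau a x).

Definition V_functional B nu (dag : ext R n -> ext R n)
    (tau : field (ext R n)) : R :=
  function_integral nu (pairing B nu (dagger dag tau) tau).

Definition C_functional B nu (gamma tau : field (ext R n)) : R :=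
  function_integral nu (pairing B nu gamma tau).

Definition first_variation (F : field (ext R n) -> R)
    (tau taudot : field (ext R n)) (l : R) :=
  is_derive (0 : R) (1 : R)
    (fun t : R => F (fun a x => tau a x + t *: taudot a x)) l.

Definition constrained_critical (H B : field (ext R n)) (nu : field R)
    (eps : bool) (dag : ext R n -> ext R n) (gamma tau : field (ext R n)) :=
  forall sigma, is_spinor_field B (~~ eps) sigma ->
    first_variation (C_functional B nu gamma) tau (d_nu H B nu sigma) 0 ->
    first_variation (V_functional B nu dag) tau (d_nu H B nu sigma) 0.

End Manifold.

(* Main.v *)
(* For a pure spinor rho one has <rho, v . w . rho> = 0, so the tangent vectors to the cone of pure
   spinors at rho pair to second order with rho.  Along a family of stable spinors with velocity theta this
   gives <D tau^dagger, tau> = <tau^dagger, theta>, that is, the first variation of V is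
   2 C_(tau^dagger).  Under the isomorphism with forms, Stokes' theorem turns C_gamma(d_nu sigma) into the
   integral of - <d_nu gamma, sigma>.  Criticality therefore means that the kernel of the functional
   <d_nu gamma, .> lies in the kernel of <d_nu tau^dagger, .>, i.e. that these functionals are
   proportional, and the pairing with bump forms is nondegenerate.

   The integral of a top form is a sum of iterated integrals in charts, so its independence of the
   partition of unity needs the change of variables formula near a point.  It is proved as by Lax: replace
   the transition map by one that is affine away from the point; a compactly supported f dy_1 ... dy_n is
   the differential of g dy_2 ... dy_n, and the two pullbacks of the latter differ by a compactly supported
   form, whose differential has integral 0. *)
Require Import Defs.
From HB Require Import structures.
From mathcomp Require Import all_boot all_order all_algebra.
From mathcomp Require Import ring lra zify.
From mathcomp Require normed_module.
From mathcomp Require Import reals.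
Set Implicit Arguments.
Unset Strict Implicit.
Unset Printing Implicit Defensive.
Import Order.TTheory GRing.Theory Num.Theory.
Import normed_module.numFieldNormedType.Exports.
Local Open Scope ring_scope.

(** * The exterior algebra *)

(** The dagger is given only fibrewise and nonlinearly, so [dagger dag tau] is a spinor field only
    because the transition functions act through the group under which the choice is equivariant. To
    see this, exponentials of two-forms and lifts of matrices of positive determinant are written as
    explicit products of unit vectors, by splitting into monomials c dx_i dx_j and into elementary
    matrices. The same elementary factorisation identifies the action on top forms with the
    determinant and gives the linear change of variables. The dimension enters in three ways. n > 2
    leaves a free index for an auxiliary unit vector and forces annihilators of pure spinors to have
    dimension at least 3. n even makes Clifford multiplication self-adjoint for the pairing.
    n(n+1)/2 odd makes the pairing skew, and this sign is what lets the two halves of the variation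
    of V add up instead of cancelling. Compactness of M serves twice: for the integral, and to keep
    tau + t theta stable for all small t, so that V can be differentiated under the integral
    sign. *)

Section ExteriorBasis.
Variables (K : numFieldType) (n : nat).
Implicit Types (v w u : ext K n) (I J L : {set 'I_n}) (i j : 'I_n).

Definition dx J : ext K n := [ffun I => (I == J)%:R].

Lemma scale_extE (a : K) w I : (a *: w) I = a * w I.
Proof. by rewrite ffunE. Qed.

Lemma add_extE v w I : (v + w) I = v I + w I.
Proof. by rewrite ffunE. Qed.

Lemma opp_extE w I : (- w) I = - w I.
Proof. by rewrite ffunE. Qed.

Lemma ext0E I : (0 : ext K n) I = 0.
Proof. by rewrite ffunE. Qed.

Lemma ext_basis w : w = \sum_J w J *: dx J.
Proof.
apply/ffunP => I; rewrite sum_ffunE (bigD1 I)//= scale_extE ffunE eqxx mulr1.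
by rewrite big1 ?addr0// => J JI; rewrite scale_extE ffunE eq_sym (negPf JI) mulr0.
Qed.

Lemma big_disjointU (T : finType) (V : comPzSemiRingType) (A B : {set T}) (F : T -> V) :
  [disjoint A & B] ->
  \prod_(i in (A :|: B)%SET) F i = \prod_(i in A) F i * \prod_(i in B) F i.
Proof. by move=> dAB; rewrite -bigU//; apply: eq_bigl => i; rewrite !inE. Qed.

(** Writing the inversion count as a product over pairs makes the sign multiplicative in each
    argument over disjoint unions; associativity of the wedge product rests on this. *)
Lemma wedge_sign_prod I J :
  wedge_sign K I J = \prod_(i in I) \prod_(j in J) (-1) ^+ (j < i)%N.
Proof.
rewrite /wedge_sign pair_big_dep/= prodrXr; congr (_ ^+ _).
rewrite -sum1_card big_mkcond/= [RHS]big_mkcond/=.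
by apply: eq_bigr => p _; rewrite inE/=; case: (p.1 \in I); case: (p.2 \in J);
  case: (p.2 < p.1)%N.
Qed.

Lemma wedge_sign0r I : wedge_sign K I set0 = 1.
Proof. by rewrite wedge_sign_prod big1// => i _; rewrite big_set0. Qed.

Lemma wedge_sign0l I : wedge_sign K set0 I = 1.
Proof. by rewrite wedge_sign_prod big_set0. Qed.

Lemma wedge_signUl I J L : [disjoint I & J] ->
  wedge_sign K (I :|: J)%SET L = wedge_sign K I L * wedge_sign K J L.
Proof. by move=> dIJ; rewrite !wedge_sign_prod big_disjointU. Qed.

Lemma wedge_signUr I J L : [disjoint I & J] ->
  wedge_sign K L (I :|: J)%SET = wedge_sign K L I * wedge_sign K L J.
Proof.
move=> dIJ; rewrite !wedge_sign_prod -big_split/=.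
by apply: eq_bigr => i _; rewrite big_disjointU.
Qed.

Lemma wedge_sign_sqr I J : wedge_sign K I J * wedge_sign K I J = 1.
Proof. by rewrite /wedge_sign -expr2 sqrr_sign. Qed.

(** For distinct i and j exactly one of the two orders is an inversion, so every pair contributes
    one sign. *)
Lemma wedge_signC I J : [disjoint I & J] ->
  wedge_sign K I J * wedge_sign K J I = (-1) ^+ (#|I| * #|J|).
Proof.
move=> dIJ; rewrite !wedge_sign_prod [X in _ * X]exchange_big/= -big_split/=.
transitivity (\prod_(i in I) (-1) ^+ #|J| : K); last first.
  by rewrite prodr_const -exprM mulnC.
apply: eq_bigr => i iI; rewrite -big_split/= -prodr_const; apply: eq_bigr => j jJ.
case: ltngtP => [||/val_inj ij]; rewrite ?mul1r ?mulr1//.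
by have := disjointFr dIJ iI; rewrite -ij jJ.
Qed.

Lemma wedge_dx I J : wedge (dx I) (dx J) =
  if [disjoint I & J] then wedge_sign K I J *: dx (I :|: J)%SET else 0.
Proof.
apply/ffunP => L; rewrite ffunE.
have E (P : {set 'I_n}) : P \subset L -> P != I ->
    wedge_sign K P (L :\: P) * (dx I P * dx J (L :\: P)%SET) = 0.
  by move=> _ PI; rewrite ffunE (negPf PI) mul0r mulr0.
have [IL|IL] := boolP (I \subset L); last first.
  rewrite big1 => [|P PL]; last by apply: E => //; apply: contraNneq IL => <-.
  case: ifP => _; rewrite ?ext0E// scale_extE ffunE.
  case: eqP => [LE|]; rewrite ?mulr0//.
  by move: IL; rewrite LE subsetUl.
rewrite (bigD1 I)//= [X in _ + X]big1 ?addr0; last by move=> P /andP[]; exact: E.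
rewrite !ffunE eqxx mul1r.
have [dIJ|dIJ] := ifPn; last first.
  rewrite ext0E; case: eqP => [LE|]; rewrite ?mulr0//.
  by move: dIJ; rewrite -LE -setI_eq0 setIDA setIC -setIDA setDv setI0 eqxx.
rewrite scale_extE ffunE; case: eqP => [LE|LE].
  have -> : L = (I :|: J)%SET by rewrite -LE setUC setDE setUIl setUC (setUC _ I) setUCr setIT; apply/esym/setUidPr.
  by rewrite eqxx setDUl setDv set0U; congr (wedge_sign K I _ * _); apply/setDidPl; rewrite disjoint_sym.
rewrite mulr0; case: eqP => [LE'|]; rewrite ?mulr0//.
by case: LE; rewrite LE' setDUl setDv set0U; apply/setDidPl; rewrite disjoint_sym.
Qed.

Lemma wedgeDl u v w : wedge (u + v) w = wedge u w + wedge v w.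
Proof.
apply/ffunP => I; rewrite !ffunE -big_split/=; apply: eq_bigr => J _.
by rewrite !ffunE mulrDl mulrDr.
Qed.

Lemma wedgeDr u v w : wedge u (v + w) = wedge u v + wedge u w.
Proof.
apply/ffunP => I; rewrite !ffunE -big_split/=; apply: eq_bigr => J _.
by rewrite !ffunE mulrDr mulrDr.
Qed.

Lemma wedgeZl (a : K) v w : wedge (a *: v) w = a *: wedge v w.
Proof.
apply/ffunP => I; rewrite scale_extE !ffunE mulr_sumr; apply: eq_bigr => J _.
by rewrite scale_extE -mulrA mulrCA.
Qed.

Lemma wedgeZr (a : K) v w : wedge v (a *: w) = a *: wedge v w.
Proof.
apply/ffunP => I; rewrite scale_extE !ffunE mulr_sumr; apply: eq_bigr => J _.
by rewrite scale_extE; ring.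
Qed.

Lemma wedge0l w : wedge 0 w = 0.
Proof. by rewrite -[X in wedge X _](scale0r (0 : ext K n)) wedgeZl scale0r. Qed.

Lemma wedge0r w : wedge w 0 = 0.
Proof. by rewrite -[X in wedge _ X](scale0r (0 : ext K n)) wedgeZr scale0r. Qed.

Lemma wedge_suml T (r : seq T) P (F : T -> ext K n) w :
  wedge (\sum_(x <- r | P x) F x) w = \sum_(x <- r | P x) wedge (F x) w.
Proof.
by rewrite (big_morph (fun v => wedge v w) (fun u v => wedgeDl u v w) (wedge0l w)).
Qed.

Lemma wedge_sumr T (r : seq T) P (F : T -> ext K n) w :
  wedge w (\sum_(x <- r | P x) F x) = \sum_(x <- r | P x) wedge w (F x).
Proof.
by rewrite (big_morph (fun v => wedge w v) (fun u v => wedgeDr w u v) (wedge0r w)).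
Qed.

Lemma ext1E : ext1 K n = dx set0.
Proof. by []. Qed.

Lemma wedge1l w : wedge (ext1 K n) w = w.
Proof.
rewrite [RHS]ext_basis {1}(ext_basis w) wedge_sumr; apply: eq_bigr => J _.
by rewrite wedgeZr ext1E wedge_dx -setI_eq0 set0I eqxx wedge_sign0l scale1r set0U.
Qed.

Lemma wedge1r w : wedge w (ext1 K n) = w.
Proof.
rewrite [RHS]ext_basis {1}(ext_basis w) wedge_suml; apply: eq_bigr => J _.
by rewrite wedgeZl ext1E wedge_dx -setI_eq0 setI0 eqxx wedge_sign0r scale1r setU0.
Qed.

(** On basis monomials both sides vanish unless the three index sets are pairwise disjoint, and
    otherwise the signs agree by multiplicativity. *)
Lemma wedgeA : associative (@wedge K n).
Proof.
suff A I J L : wedge (dx I) (wedge (dx J) (dx L)) = wedge (wedge (dx I) (dx J)) (dx L).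
  move=> u v w; rewrite (ext_basis u) !wedge_suml; apply: eq_bigr => I _.
  rewrite !wedgeZl; congr (_ *: _).
  rewrite (ext_basis v) !(wedge_suml, wedge_sumr); apply: eq_bigr => J _.
  rewrite !(wedgeZl, wedgeZr); congr (_ *: _).
  rewrite (ext_basis w) !wedge_sumr; apply: eq_bigr => L _.
  by rewrite !wedgeZr A.
rewrite !wedge_dx.
have D1 : [disjoint I & (J :|: L)%SET] = [disjoint I & J] && [disjoint I & L].
  by rewrite -!setI_eq0 setIUr setU_eq0.
have D2 : [disjoint (I :|: J)%SET & L] = [disjoint I & L] && [disjoint J & L].
  by rewrite -!setI_eq0 setIUl setU_eq0.
case dJL: [disjoint J & L]; case dIJ: [disjoint I & J];
  rewrite ?wedge0l ?wedge0r ?wedgeZl ?wedgeZr ?wedge_dx ?D1 ?D2 ?dJL ?dIJ ?andbF ?andFb ?scaler0//=.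
case dIL: [disjoint I & L]; rewrite ?scaler0//= !scalerA wedge_signUr// wedge_signUl// setUA.
by congr (_ *: _); rewrite mulrC mulrA.
Qed.

End ExteriorBasis.

(** * Clifford action and Mukai pairing *)

Section CliffordOperators.
Variables (K : numFieldType) (n : nat).
Implicit Types (v w u : ext K n) (I J L : {set 'I_n}) (i j : 'I_n).
Local Notation dx := (@dx K n).

(** Creation operator. With the annihilation operator [iot i], contraction with d/dx_i, it spans the
    Clifford action, whose algebra is thereby reduced to the canonical anticommutation relations
    below. *)
Definition eps i w := wedge (dx [set i]) w.

Definition iot i w : ext K n :=
  [ffun I : {set 'I_n} => if i \in I then 0 else wedge_sign K [set i] I * w (i |: I)].

Lemma eps_dx i J : eps i (dx J) =
  if i \in J then 0 else wedge_sign K [set i] J *: dx (i |: J).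
Proof. by rewrite /eps wedge_dx disjoints1; case: (i \in J). Qed.

Lemma iotD i v w : iot i (v + w) = iot i v + iot i w.
Proof. by apply/ffunP => I; rewrite !ffunE; case: ifP; rewrite ?addr0// mulrDr. Qed.

Lemma iotZ i (a : K) w : iot i (a *: w) = a *: iot i w.
Proof.
apply/ffunP => I; rewrite scale_extE ffunE [in RHS]ffunE scale_extE.
by case: ifP; rewrite ?mulr0// mulrCA.
Qed.

Lemma epsD i v w : eps i (v + w) = eps i v + eps i w. Proof. exact: wedgeDr. Qed.
Lemma epsZ i (a : K) w : eps i (a *: w) = a *: eps i w. Proof. exact: wedgeZr. Qed.

Lemma iot0 i : iot i 0 = 0.
Proof. by rewrite -[X in iot _ X](scale0r (0 : ext K n)) iotZ scale0r. Qed.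

Lemma eps0 i : eps i 0 = 0. Proof. exact: wedge0r. Qed.

Lemma iot_sum i T (r : seq T) P (F : T -> ext K n) :
  iot i (\sum_(x <- r | P x) F x) = \sum_(x <- r | P x) iot i (F x).
Proof. exact: (big_morph (iot i) (iotD i) (iot0 i)). Qed.

Lemma eps_sum i T (r : seq T) P (F : T -> ext K n) :
  eps i (\sum_(x <- r | P x) F x) = \sum_(x <- r | P x) eps i (F x).
Proof. exact: wedge_sumr. Qed.

Lemma iot_dx i J : iot i (dx J) =
  if i \in J then wedge_sign K [set i] (J :\ i) *: dx (J :\ i) else 0.
Proof.
apply/ffunP => I; rewrite ffunE; case: ifPn => iI.
  case: ifP => iJ; rewrite ?ext0E// scale_extE ffunE.
  by case: eqP iI => [->|]; rewrite ?mulr0// !inE eqxx.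
rewrite ffunE; case: ifPn => iJ; last first.
  by rewrite ext0E; case: eqP iJ => [<-|]; rewrite ?mulr0// setU11.
rewrite scale_extE ffunE.
have -> : (i |: I == J) = (I == J :\ i).
  by apply/eqP/eqP => [<-|->]; rewrite ?setU1K ?setD1K.
by case: eqP => [->//|]; rewrite !mulr0.
Qed.

Lemma epsE i w I : eps i w I =
  if i \in I then wedge_sign K [set i] (I :\ i) * w (I :\ i) else 0.
Proof.
rewrite ffunE; case: ifPn => iI; last first.
  rewrite big1// => J JI; rewrite ffunE; case: eqP JI => [->|]; rewrite ?mul0r ?mulr0//.
  by rewrite sub1set (negPf iI).
rewrite (bigD1 [set i])/= ?sub1set// big1 ?addr0 ?ffunE ?eqxx ?mul1r// => J /andP[_ Ji].
by rewrite ffunE (negPf Ji) mul0r mulr0.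
Qed.

Lemma wedge_sign11 i j : i != j -> wedge_sign K [set i] [set j] * wedge_sign K [set j] [set i] = -1.
Proof. by move=> ij; rewrite wedge_signC ?disjoints1 ?inE// !cards1. Qed.

Lemma eps_anti i j w : i != j -> eps i (eps j w) = - eps j (eps i w).
Proof.
move=> ij; rewrite /eps !wedgeA -scaleN1r -wedgeZl; congr wedge.
have ji : j != i by rewrite eq_sym.
rewrite -(wedge_sign11 ij) !wedge_dx !disjoints1 !inE (negPf ij) (negPf ji)/=.
by rewrite scalerA setUC -mulrA wedge_sign_sqr mulr1.
Qed.

Lemma eps_sqr i w : eps i (eps i w) = 0.
Proof. by rewrite /eps wedgeA wedge_dx disjoints1 set11 wedge0l. Qed.

Lemma wedge_signD1 i j J : j \in J ->
  wedge_sign K [set i] J = wedge_sign K [set i] [set j] * wedge_sign K [set i] (J :\ j).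
Proof. by move=> jJ; rewrite -{1}(setD1K jJ) wedge_signUr// disjoints1 !inE eqxx. Qed.

Lemma iot_anti i j w : i != j -> iot i (iot j w) = - iot j (iot i w).
Proof.
move=> ij; have ji : j != i by rewrite eq_sym.
apply/ffunP => I; rewrite opp_extE !ffunE !inE (negPf ij) (negPf ji)/=.
case: ifPn => iI; case: ifPn => jI; rewrite ?mulr0 ?oppr0//.
rewrite !wedge_signUr ?disjoints1 ?inE ?(negPf ij) ?(negPf ji)//.
rewrite (setUCA [set j]).
have -> : wedge_sign K [set j] [set i] = - wedge_sign K [set i] [set j].
  by rewrite -[LHS]mul1r -(wedge_sign_sqr K [set i] [set j]) -mulrA wedge_sign11// mulrN1.
ring.
Qed.

Lemma iot_sqr i w : iot i (iot i w) = 0.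
Proof.
apply/ffunP => I; rewrite ffunE ext0E ffunE setU11 mulr0.
by case: ifP.
Qed.

Lemma iot_eps_anti i j w : i != j -> iot i (eps j w) = - eps j (iot i w).
Proof.
move=> ij; have ji : j != i by rewrite eq_sym.
apply/ffunP => I; rewrite opp_extE ffunE !epsE !inE (negPf ji)/= ffunE !inE (negPf ij)/=.
case: ifPn => iI; case: ifPn => jI; rewrite ?mulr0 ?oppr0//.
have E : (i |: I) :\ j = i |: (I :\ j).
  by apply/setP => k; rewrite !inE; case: (k =P i) => [->|]//; rewrite (negPf ij).
rewrite E (wedge_signD1 i jI) wedge_signUr ?disjoints1 ?inE ?(negPf iI) ?andbF//.
have := wedge_sign11 ij.
set a := wedge_sign _ [set i] [set j]; set b := wedge_sign _ [set j] [set i].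
set c := wedge_sign _ _ _; set d := wedge_sign _ _ _ => ab.
have -> : a * c * (b * d * w (i |: I :\ j)) = (a * b) * (d * (c * w (i |: I :\ j))) by ring.
by rewrite ab mulN1r.
Qed.

Lemma iot_eps i w : iot i (eps i w) + eps i (iot i w) = w.
Proof.
apply/ffunP => I; rewrite add_extE ffunE epsE.
case: ifPn => iI; rewrite ?add0r.
  by rewrite epsE iI ffunE setD11 setD1K// mulrA wedge_sign_sqr mul1r.
by rewrite epsE (negPf iI) addr0 setU11 setU1K// mulrA wedge_sign_sqr mul1r.
Qed.

Lemma covectorE (xi : 'rV[K]_n) : covector xi = \sum_i xi ord0 i *: dx [set i].
Proof.
apply/ffunP => I; rewrite ffunE sum_ffunE; apply: eq_bigr => i _.
by rewrite scale_extE ffunE mulrC.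
Qed.

Lemma cliffordE (x : 'rV[K]_n * 'rV[K]_n) w :
  clifford x w = \sum_i (x.2 ord0 i *: eps i w - x.1 ord0 i *: iot i w).
Proof.
apply/ffunP => I; rewrite ffunE sum_ffunE addrC covectorE wedge_suml sum_ffunE.
have -> : contract x.1 w I = \sum_i x.1 ord0 i * iot i w I.
  rewrite ffunE big_mkcond; apply: eq_bigr => i _; rewrite ffunE.
  by case: (i \in I); rewrite ?mulr0// mulrCA.
rewrite -sumrB; apply: eq_bigr => i _.
by rewrite add_extE opp_extE wedgeZl !scale_extE.
Qed.

Lemma cliffordD (x : 'rV[K]_n * 'rV[K]_n) v w : clifford x (v + w) = clifford x v + clifford x w.
Proof.
rewrite !cliffordE -big_split/=; apply: eq_bigr => i _.
by rewrite epsD iotD !scalerDr opprD addrACA.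
Qed.

Lemma cliffordZ (x : 'rV[K]_n * 'rV[K]_n) (a : K) w : clifford x (a *: w) = a *: clifford x w.
Proof.
rewrite !cliffordE scaler_sumr; apply: eq_bigr => i _.
by rewrite epsZ iotZ scalerBr !scalerA !(mulrC a).
Qed.

Lemma cliffordDl (x y : 'rV[K]_n * 'rV[K]_n) w : clifford (x + y) w = clifford x w + clifford y w.
Proof.
rewrite !cliffordE -big_split/=; apply: eq_bigr => i _.
by rewrite !mxE !scalerDl opprD addrACA.
Qed.

Lemma cliffordZl (a : K) (x : 'rV[K]_n * 'rV[K]_n) w : clifford (a *: x) w = a *: clifford x w.
Proof.
rewrite !cliffordE scaler_sumr; apply: eq_bigr => i _.
by rewrite !mxE scalerBr !scalerA.
Qed.

Lemma clifford0 (x : 'rV[K]_n * 'rV[K]_n) : clifford x 0 = 0.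
Proof. by rewrite -[X in clifford _ X](scale0r (0 : ext K n)) cliffordZ scale0r. Qed.

Lemma clifford_sum (x : 'rV[K]_n * 'rV[K]_n) T (r : seq T) P (F : T -> ext K n) :
  clifford x (\sum_(t <- r | P t) F t) = \sum_(t <- r | P t) clifford x (F t).
Proof. by rewrite (big_morph (clifford x) (cliffordD x) (clifford0 x)). Qed.

(** Both actions are sums over i of combinations of [eps i] and [iot i]. Operators with different
    indices anticommute, and for equal indices the mixed products add up to the identity by
    [iot_eps]. *)
Lemma clifford_anticomm (x y : 'rV[K]_n * 'rV[K]_n) w :
  clifford x (clifford y w) + clifford y (clifford x w) = - (2 * edot x y) *: w.
Proof.
pose g (a b : K) i u : ext K n := a *: eps i u - b *: iot i u.
have G a b c d i j : g a b i (g c d j w) + g c d j (g a b i w) =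
    - (if i == j then a * d + b * c else 0) *: w.
  have epsB k (p q : K) (s t : ext K n) : eps k (p *: s - q *: t) = p *: eps k s - q *: eps k t.
    by rewrite epsD epsZ -scaleNr epsZ scaleNr.
  have iotB k (p q : K) (s t : ext K n) : iot k (p *: s - q *: t) = p *: iot k s - q *: iot k t.
    by rewrite iotD iotZ -scaleNr iotZ scaleNr.
  rewrite /g !epsB !iotB.
  case: eqP => [<-|/eqP ij].
    rewrite !eps_sqr !iot_sqr -[in RHS](iot_eps i w).
    by apply/ffunP => I; rewrite !(add_extE, scale_extE, opp_extE, ext0E); ring.
  have ji : j != i by rewrite eq_sym.
  rewrite (eps_anti _ ij) (iot_anti _ ij) (iot_eps_anti _ ij) (iot_eps_anti _ ji).
  by rewrite oppr0 scale0r; apply/ffunP => I; rewrite !(add_extE, scale_extE, opp_extE, ext0E); ring.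
have E z u : clifford z u = \sum_i g (z.2 ord0 i) (z.1 ord0 i) i u by exact: cliffordE.
have gs a b i T (r : seq T) P (F : T -> ext K n) :
    g a b i (\sum_(t <- r | P t) F t) = \sum_(t <- r | P t) g a b i (F t).
  by rewrite /g eps_sum iot_sum !scaler_sumr -sumrB.
have H z t : clifford z (clifford t w) =
    \sum_i \sum_j g (z.2 ord0 i) (z.1 ord0 i) i (g (t.2 ord0 j) (t.1 ord0 j) j w).
  by rewrite E; apply: eq_bigr => i _; rewrite E gs.
rewrite !H [X in _ + X]exchange_big -big_split/=.
under eq_bigr => i _.
  rewrite -big_split/=.
  under eq_bigr => j _ do rewrite addrC G.
  rewrite (bigD1 i)//= eqxx [X in _ + X]big1 ?addr0; last first.
    by move=> j ji; rewrite (negPf ji) oppr0 scale0r.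
  over.
rewrite -scaler_suml; congr (_ *: _).
rewrite /edot mulrA divff ?pnatr_eq0// mul1r -sumrN; apply: eq_bigr => i _.
by ring.
Qed.

Lemma clifford_sqr (x : 'rV[K]_n * 'rV[K]_n) w :
  clifford x (clifford x w) = - edot x x *: w.
Proof.
have := clifford_anticomm x x w; rewrite -mulr2n -scaler_nat => /(congr1 (fun u => 2^-1 *: u)).
by rewrite !scalerA mulVf ?pnatr_eq0// scale1r mulrN mulrA mulVf ?pnatr_eq0// mul1r.
Qed.

End CliffordOperators.

Section MukaiPairing.
Variables (K : numFieldType) (n : nat).
Implicit Types (v w u : ext K n) (I J L : {set 'I_n}) (i j : 'I_n).
Local Notation dx := (@dx K n).

Lemma hatD v w : hat (v + w) = hat v + hat w.
Proof. by apply/ffunP => I; rewrite !ffunE mulrDr. Qed.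

Lemma hatZ (a : K) w : hat (a *: w) = a *: hat w.
Proof. by apply/ffunP => I; rewrite scale_extE ffunE [in RHS]ffunE scale_extE mulrCA. Qed.

Lemma mukaiDl u v w : mukai (u + v) w = mukai u w + mukai v w.
Proof. by rewrite /mukai wedgeDl add_extE. Qed.

Lemma mukaiDr u v w : mukai u (v + w) = mukai u v + mukai u w.
Proof. by rewrite /mukai hatD wedgeDr add_extE. Qed.

Lemma mukaiZl (a : K) v w : mukai (a *: v) w = a * mukai v w.
Proof. by rewrite /mukai wedgeZl scale_extE. Qed.

Lemma mukaiZr (a : K) v w : mukai v (a *: w) = a * mukai v w.
Proof. by rewrite /mukai hatZ wedgeZr scale_extE. Qed.

Lemma mukai0l w : mukai 0 w = 0.
Proof. by rewrite -[X in mukai X _](scale0r (0 : ext K n)) mukaiZl mul0r. Qed.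

Lemma mukai0r w : mukai w 0 = 0.
Proof. by rewrite -[X in mukai _ X](scale0r (0 : ext K n)) mukaiZr mul0r. Qed.

Lemma mukaiNl v w : mukai (- v) w = - mukai v w.
Proof. by rewrite -scaleN1r mukaiZl mulN1r. Qed.

Lemma mukaiNr v w : mukai v (- w) = - mukai v w.
Proof. by rewrite -scaleN1r mukaiZr mulN1r. Qed.

Lemma mukaiBl u v w : mukai (u - v) w = mukai u w - mukai v w.
Proof. by rewrite mukaiDl mukaiNl. Qed.

Lemma mukaiBr u v w : mukai u (v - w) = mukai u v - mukai u w.
Proof. by rewrite mukaiDr mukaiNr. Qed.

Lemma mukai_suml T (r : seq T) P (F : T -> ext K n) w :
  mukai (\sum_(x <- r | P x) F x) w = \sum_(x <- r | P x) mukai (F x) w.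
Proof. exact: (big_morph (fun v => mukai v w) (fun u v => mukaiDl u v w) (mukai0l w)). Qed.

Lemma mukai_sumr T (r : seq T) P (F : T -> ext K n) w :
  mukai w (\sum_(x <- r | P x) F x) = \sum_(x <- r | P x) mukai w (F x).
Proof. exact: (big_morph (fun v => mukai w v) (fun u v => mukaiDr w u v) (mukai0r w)). Qed.

Definition hat_sign (k : nat) : K := (-1) ^+ 'C(k.+1, 2).

Lemma hat_dx J : hat (dx J) = hat_sign #|J| *: dx J.
Proof.
apply/ffunP => I; rewrite scale_extE !ffunE /hat_sign.
by case: eqP => [->|]//; rewrite !mulr0.
Qed.

Lemma mukai_dx I J : mukai (dx I) (dx J) =
  if J == ~: I then wedge_sign K I J * hat_sign #|J| else 0.
Proof.
rewrite /mukai hat_dx wedgeZr scale_extE wedge_dx.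
case: eqP => [->|JI].
  by rewrite -setI_eq0 setICr eqxx scale_extE ffunE setUCr eqxx mulr1 mulrC.
have [dIJ|] := ifPn; rewrite ?ext0E ?mulr0// scale_extE ffunE.
case: eqP => [E|]; rewrite ?mulr0//; case: JI; apply/setP => k; rewrite inE.
have := in_setT k; rewrite E inE.
case kI: (k \in I) => /=; last by move->.
by rewrite (disjointFr dIJ kI).
Qed.

Lemma mukaiE v w : mukai v w =
  \sum_J v J * w (~: J) * (wedge_sign K J (~: J) * hat_sign #|~: J|).
Proof.
rewrite {1}(ext_basis v) mukai_suml; apply: eq_bigr => J _.
rewrite mukaiZl -mulrA; congr (_ * _).
rewrite {1}(ext_basis w) mukai_sumr (bigD1 (~: J))//= mukaiZr mukai_dx eqxx big1 ?addr0//.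
by move=> I IJ; rewrite mukaiZr mukai_dx (negPf IJ) mulr0.
Qed.

(** The cross term p q is what makes the symmetry sign of the pairing depend on p + q alone. *)
Lemma bin2_addS (p q : nat) : 'C((p + q).+1, 2) = ('C(p.+1, 2) + 'C(q.+1, 2) + p * q)%N.
Proof.
elim: p => [|p IH]; first by rewrite [in RHS]bin_small// add0n mul0n addn0.
by rewrite addSn binS IH bin1 [in RHS]binS bin1; lia.
Qed.

(** Exchanging forms of complementary degrees p and q costs (-1)^(pq), and the two [hat] signs
    convert this into a sign that depends only on n = p + q. For n = 6 it is (-1)^21, so the pairing
    is skew. *)
Lemma mukaiC v w : mukai v w = (-1) ^+ 'C(n.+1, 2) * mukai w v.
Proof.
rewrite !mukaiE (reindex_inj (inv_inj (@setCK _)))/= mulr_sumr; apply: eq_bigr => J _.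
rewrite setCK.
have dJ : [disjoint J & ~: J] by rewrite -setI_eq0 setICr.
have -> : wedge_sign K (~: J) J = wedge_sign K J (~: J) * (-1) ^+ (#|J| * #|~: J|).
  by rewrite -(wedge_signC _ dJ) mulrA wedge_sign_sqr mul1r.
have key : (-1) ^+ (#|J| * #|~: J|) * hat_sign #|J| =
           (-1) ^+ 'C(n.+1, 2) * hat_sign #|~: J| :> K.
  rewrite /hat_sign -!exprD -signr_odd -[RHS]signr_odd; congr (_ ^+ nat_of_bool _).
  have -> : 'C(n.+1, 2) = 'C((#|J| + #|~: J|).+1, 2) by rewrite cardsC card_ord.
  rewrite bin2_addS; move: (_ * _)%N 'C(_, _) 'C(_, _) => a b c; rewrite !oddD.
  by move: (odd a) (odd b) (odd c) => [] [] [].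
set a := wedge_sign _ _ _.
transitivity (v (~: J) * w J * a * ((-1) ^+ (#|J| * #|~: J|) * hat_sign #|J|)); first by ring.
by rewrite key; ring.
Qed.

(** Moving dx_i past dx_I costs (-1)^|I|, while raising the degree of the second form from |J| to
    |J| + 1 changes its [hat] sign by (-1)^(|J| + 1). The two agree because |I| + |J| + 1 = n is
    even. *)
Lemma mukai_eps i v w : ~~ odd n -> mukai (eps i v) w = mukai v (eps i w).
Proof.
move=> n_even; rewrite (ext_basis v) (ext_basis w).
rewrite !eps_sum !mukai_suml; apply: eq_bigr => I _; rewrite !epsZ !mukaiZl; congr (_ * _).
rewrite !mukai_sumr; apply: eq_bigr => J _; rewrite epsZ !mukaiZr; congr (_ * _).
rewrite !eps_dx; case: ifPn => iI; case: ifPn => iJ; rewrite ?mukai0l ?mukai0r//.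
- rewrite mukaiZr mukai_dx; case: eqP => [E|]; rewrite ?mulr0//.
  by have := setU11 i J; rewrite E inE iI.
- rewrite mukaiZl mukai_dx; case: eqP => [E|]; rewrite ?mulr0//.
  by move: iJ; rewrite E inE setU11.
rewrite mukaiZl mukaiZr !mukai_dx.
have -> : (J == ~: (i |: I)) = (i |: J == ~: I).
  apply/eqP/eqP => [->|E]; apply/setP => k.
    by rewrite !inE; case: (k =P i) => [->|]//=; rewrite iI.
  have /setP/(_ k) := E; rewrite !inE.
  by case: (k =P i) => [->|]//=; rewrite iI (negPf iJ).
case: eqP => [E|]; rewrite ?mulr0//.
have dIJ : [disjoint I & J].
  rewrite -setI_eq0; apply/eqP/setP => k; rewrite !inE; have /setP/(_ k) := E; rewrite !inE.
  by case: (k \in I) => //=; case: (k \in J) => //; rewrite orbT.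
have cIJ : (#|I| + #|J|).+1 = n.
  have := cardsC I; rewrite card_ord -E cardsU1 iJ; lia.
rewrite wedge_signUl ?disjoints1// wedge_signUr ?disjoints1//.
have -> : wedge_sign K I [set i] = wedge_sign K [set i] I * (-1) ^+ #|I|.
  rewrite -[#|I|]mul1n -(cards1 i) -wedge_signC ?disjoints1//.
  by rewrite mulrA wedge_sign_sqr mul1r.
rewrite cardsU1 iJ add1n /hat_sign.
have -> : (-1) ^+ 'C(#|J|.+2, 2) = (-1) ^+ #|I| * (-1) ^+ 'C(#|J|.+1, 2) :> K.
  rewrite -exprD -signr_odd -[RHS]signr_odd; congr (_ ^+ nat_of_bool _).
  have : odd #|I| (+) odd #|J| by move: n_even; have := congr1 odd cIJ; rewrite oddS oddD => <-; rewrite negbK.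
  have -> : 'C(#|J|.+2, 2) = ('C(#|J|.+1, 2) + #|J|.+1)%N by rewrite binS bin1.
  move: 'C(_, _) => c; rewrite !oddD oddS.
  by move: (odd c) (odd #|I|) (odd #|J|) => [] [] [].
set a := wedge_sign _ [set i] I; set b := wedge_sign _ [set i] J; set c := wedge_sign _ I J.
set s := _ ^+ #|I|; have ss : s * s = 1 by rewrite /s -expr2 sqrr_sign.
transitivity (a * b * c * (-1) ^+ 'C(#|J|.+1, 2)); first by ring.
transitivity (a * b * c * (-1) ^+ 'C(#|J|.+1, 2) * (s * s)); last by ring.
by rewrite ss mulr1.
Qed.

(** Two forms in the image of [iot i] contain no dx_i, so their product has no top part. Splitting
    each argument by [iot_eps] then reduces the claim to the self-adjointness of [eps i]. *)
Lemma mukai_iot i v w : ~~ odd n -> mukai (iot i v) w = mukai v (iot i w).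
Proof.
move=> n_even.
have E (a b : ext K n) : mukai (iot i a) (iot i b) = 0.
  rewrite mukaiE big1// => J _; rewrite !ffunE inE.
  by case: (i \in J); rewrite /= ?mul0r ?mulr0 ?mul0r.
rewrite -{1}(iot_eps i w) mukaiDr E add0r -mukai_eps//.
by rewrite -{2}(iot_eps i v) mukaiDl E add0r.
Qed.

Lemma mukai_clifford (x : 'rV[K]_n * 'rV[K]_n) v w : ~~ odd n ->
  mukai (clifford x v) w = mukai v (clifford x w).
Proof.
move=> n_even; rewrite !cliffordE mukai_suml mukai_sumr; apply: eq_bigr => i _.
by rewrite mukaiBl mukaiBr !mukaiZl !mukaiZr mukai_eps// mukai_iot.
Qed.

End MukaiPairing.

(** * Pullback of forms *)

Section Degrees.
Variables (K : numFieldType) (n : nat).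
Implicit Types (v w u : ext K n) (I J L : {set 'I_n}) (i j : 'I_n).

Lemma homogeneousD p v w : homogeneous p v -> homogeneous p w -> homogeneous p (v + w).
Proof. by move=> hv hw I Ip; rewrite add_extE hv// hw// addr0. Qed.

Lemma homogeneousZ p (a : K) w : homogeneous p w -> homogeneous p (a *: w).
Proof. by move=> hw I Ip; rewrite scale_extE hw// mulr0. Qed.

Lemma homogeneous_sum p T (r : seq T) (P : pred T) (F : T -> ext K n) :
  (forall x, P x -> homogeneous p (F x)) -> homogeneous p (\sum_(x <- r | P x) F x).
Proof.
move=> hF; apply: big_ind => //; first by move=> I _; rewrite ext0E.
by move=> v w; exact: homogeneousD.
Qed.

Lemma homogeneous_dx J : homogeneous #|J| (dx K J).
Proof.
move=> I /negPf IJ; rewrite ffunE; case: eqP => // E.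
by rewrite E eqxx in IJ.
Qed.

Lemma homogeneous_wedge p q v w :
  homogeneous p v -> homogeneous q w -> homogeneous (p + q) (wedge v w).
Proof.
move=> hv hw I Ipq; rewrite ffunE big1// => J JI.
have [Jp|Jp] := eqVneq #|J| p; last by rewrite hv// mul0r mulr0.
rewrite (hw (I :\: J)%SET) ?mulr0//; apply: contraNneq Ipq => Iq.
by rewrite -Jp -Iq -(cardsID J I) (setIidPr JI).
Qed.

Lemma homogeneous_covector (xi : 'rV[K]_n) : homogeneous 1%N (covector xi).
Proof.
rewrite covectorE; apply: homogeneous_sum => i _.
by apply: homogeneousZ; rewrite -(cards1 i); exact: homogeneous_dx.
Qed.

Lemma chiralD e v w : chiral e v -> chiral e w -> chiral e (v + w).
Proof. by move=> hv hw I Ip; rewrite add_extE hv// hw// addr0. Qed.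

Lemma chiralZ e (a : K) w : chiral e w -> chiral e (a *: w).
Proof. by move=> hw I Ip; rewrite scale_extE hw// mulr0. Qed.

Lemma chiral_sum e T (r : seq T) (P : pred T) (F : T -> ext K n) :
  (forall x, P x -> chiral e (F x)) -> chiral e (\sum_(x <- r | P x) F x).
Proof.
move=> hF; apply: big_ind => //; first by move=> I _; rewrite ext0E.
by move=> v w; exact: chiralD.
Qed.

Lemma chiral_wedge p e v w :
  homogeneous p v -> chiral e w -> chiral (odd p (+) e) (wedge v w).
Proof.
move=> hv hw I Ipq; rewrite ffunE big1// => J JI.
have [Jp|Jp] := eqVneq #|J| p; last by rewrite hv// mul0r mulr0.
rewrite (hw (I :\: J)%SET) ?mulr0//; apply: contraNneq Ipq => <-.
by rewrite -Jp -oddD -(cardsID J I) (setIidPr JI).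
Qed.

Lemma chiral_eps e i w : chiral e w -> chiral (~~ e) (eps i w).
Proof.
move=> hw; have h1 : homogeneous 1%N (dx K [set i]) by rewrite -(cards1 i); exact: homogeneous_dx.
exact: chiral_wedge h1 hw.
Qed.

Lemma chiral_iot e i w : chiral e w -> chiral (~~ e) (iot i w).
Proof.
move=> hw I Ie; rewrite ffunE; case: ifPn => // iI; rewrite hw ?mulr0//.
by rewrite cardsU1 iI/=; case: (odd #|I|) e Ie {hw} => [] [].
Qed.

Lemma chiral_clifford e (x : 'rV[K]_n * 'rV[K]_n) w : chiral e w -> chiral (~~ e) (clifford x w).
Proof.
move=> hw; rewrite cliffordE; apply: chiral_sum => i _; rewrite -scaleNr.
by apply: chiralD; apply: chiralZ; [exact: chiral_eps|exact: chiral_iot].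
Qed.

Lemma wedge_homogeneous2C v w : homogeneous 2%N v -> wedge v w = wedge w v.
Proof.
move=> hv; rewrite (ext_basis v) wedge_suml wedge_sumr; apply: eq_bigr => I _.
rewrite wedgeZl wedgeZr; have [I2|I2] := eqVneq #|I| 2; last by rewrite hv// !scale0r.
congr (_ *: _); rewrite {1}(ext_basis w) [in RHS](ext_basis w) wedge_suml wedge_sumr.
apply: eq_bigr => J _; rewrite wedgeZl wedgeZr; congr (_ *: _).
rewrite !wedge_dx disjoint_sym; case: ifPn => // dJI; rewrite setUC; congr (_ *: _).
rewrite -[LHS]mulr1 -(wedge_sign_sqr K J I) mulrA wedge_signC 1?disjoint_sym//.
by rewrite I2 exprM sqrrN !expr1n mul1r.
Qed.

End Degrees.

(** * Ordered products of anticommuting one-forms *)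

HB.instance Definition _ (K : numFieldType) (n : nat) :=
  Monoid.isLaw.Build (ext K n) (ext1 K n) (@wedge K n)
    (@wedgeA K n) (@wedge1l K n) (@wedge1r K n).

Section AnticommutingProducts.
Variables (K : numFieldType) (n : nat).
Implicit Types (v w u : ext K n) (I J L : {set 'I_n}) (i j : 'I_n).

Lemma sorted_enum_ord (J : {set 'I_n}) : sorted (fun i j : 'I_n => (i < j)%N) (enum J).
Proof.
apply: (@subseq_sorted _ (fun i j : 'I_n => (i < j)%N) _ _ (enum 'I_n)).
- by move=> a b d; exact: ltn_trans.
- by rewrite [enum J]/enum_mem -enumT; exact: filter_subseq.
- by have := iota_ltn_sorted 0 n; rewrite -val_enum_ord sorted_map.
Qed.

Lemma enum_setU_lt I J : (forall i j, i \in I -> j \in J -> (i < j)%N) ->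
  enum (I :|: J)%SET = enum I ++ enum J.
Proof.
move=> IJ; have tr : transitive (fun i j : 'I_n => (i < j)%N) by move=> a b c; exact: ltn_trans.
apply: (irr_sorted_eq (leT := fun i j : 'I_n => (i < j)%N)) => //.
- by move=> a; exact: ltnn.
- exact: sorted_enum_ord.
- rewrite (sorted_pairwise tr) pairwise_cat -!(sorted_pairwise tr) !sorted_enum_ord !andbT.
  by apply/allrelP => i j; rewrite !mem_enum; exact: IJ.
- by move=> i; rewrite mem_cat !mem_enum inE.
Qed.

(** Both dx_J and its pullback have this shape, for the family dx_i and for the rows of a matrix.
    Computing with an arbitrary anticommuting family gives the same signs in both cases, whence
    pullback is multiplicative. *)
Definition ordered_prod (c : 'I_n -> ext K n) J := \big[@wedge K n/ext1 K n]_(j in J) c j.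

Lemma ordered_prod_enum (c : 'I_n -> ext K n) J : ordered_prod c J = \big[@wedge K n/ext1 K n]_(j <- enum J) c j.
Proof. by rewrite /ordered_prod -big_filter deprecated_filter_index_enum. Qed.

Lemma homogeneous_ordered_prod (c : 'I_n -> ext K n) J : (forall i, homogeneous 1%N (c i)) -> homogeneous #|J| (ordered_prod c J).
Proof.
move=> hc; rewrite ordered_prod_enum cardE; elim: (enum J) => [|j s IH].
  by rewrite big_nil ext1E/=; have := @homogeneous_dx K n set0; rewrite cards0.
by rewrite big_cons/= -add1n; exact: homogeneous_wedge.
Qed.

Variable c : 'I_n -> ext K n.
Hypothesis c_sqr : forall i, wedge (c i) (c i) = 0.
Hypothesis c_anti : forall i j, wedge (c i) (c j) = - wedge (c j) (c i).
Local Notation P := (ordered_prod c).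

Lemma ordered_prodU I J : (forall i j, i \in I -> j \in J -> (i < j)%N) ->
  P (I :|: J)%SET = wedge (P I) (P J).
Proof.
by move=> IJ; rewrite !ordered_prod_enum enum_setU_lt// big_cat.
Qed.

Lemma ordered_prod0 : P finset.set0 = ext1 K n.
Proof. by rewrite /ordered_prod big_set0. Qed.

Lemma ordered_prod1 i : P [set i] = c i.
Proof. by rewrite /ordered_prod big_set1. Qed.

Lemma wedge_ordered_prodC i J :
  wedge (c i) (P J) = (-1) ^+ #|J| *: wedge (P J) (c i).
Proof.
rewrite ordered_prod_enum cardE; elim: (enum J) => [|j s IH].
  by rewrite !big_nil wedge1l wedge1r scale1r.
rewrite !big_cons wedgeA c_anti -scaleN1r wedgeZl -wedgeA IH wedgeZr scalerA -wedgeA.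
by rewrite -exprS.
Qed.

(** Split J into the indices below and above i: moving c_i past the first block costs one sign per
    index, and if i lies in J it then meets its own copy. *)
Lemma wedge_ordered_prod1 i J : wedge (c i) (P J) =
  if i \in J then 0 else wedge_sign K [set i] J *: P (i |: J).
Proof.
pose J1 := [set j in J | (j < i)%N]; pose J2 := [set j in J | (i < j)%N].
have sgnE : wedge_sign K [set i] J = (-1) ^+ #|J1|.
  rewrite wedge_sign_prod big_set1 (bigID (fun j : 'I_n => (j < i)%N))/=.
  rewrite [X in _ * X]big1 ?mulr1; last by move=> j /andP[_ /negPf ->].
  rewrite (eq_bigr (fun=> -1)); last by move=> j /andP[_ ->].
  by rewrite prodr_const; congr (_ ^+ _); apply: eq_card => j; rewrite !inE unfold_in.
have J1c (X : {set 'I_n}) : (forall j, j \in X -> (i <= j)%N) ->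
    wedge (c i) (wedge (P J1) (P X)) = (-1) ^+ #|J1| *: wedge (P J1) (wedge (c i) (P X)).
  by move=> iX; rewrite wedgeA wedge_ordered_prodC wedgeZl wedgeA.
have iJ2 : P (i |: J2) = wedge (c i) (P J2).
  by rewrite ordered_prodU ?ordered_prod1// => a b; rewrite !inE => /eqP-> /andP[].
have [iJ|iJ] := boolP (i \in J).
  have -> : J = (J1 :|: (i |: J2))%SET.
    apply/setP => j; rewrite !inE; case: eqP => [->|/eqP ji]; first by rewrite iJ orbT.
    by rewrite -val_eqE/= in ji; rewrite -andb_orr -neq_ltn ji andbT.
  rewrite ordered_prodU; last first.
    move=> a b; rewrite !inE => /andP[_ ai] /orP[/eqP->//|/andP[_ ib]].
    exact: ltn_trans ib.
  rewrite J1c; last by move=> j; rewrite !inE => /orP[/eqP->//|/andP[_ /ltnW]].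
  by rewrite iJ2 (wedgeA (c i)) c_sqr wedge0l wedge0r scaler0.
have eJ : J = (J1 :|: J2)%SET.
  apply/setP => j; rewrite !inE; case: (ltngtP j i) => [||/val_inj ->];
    by rewrite ?andbT ?andbF ?orbF ?(negPf iJ).
have ei : (i |: J)%SET = (J1 :|: (i |: J2))%SET by rewrite {1}eJ setUCA.
rewrite ei sgnE {1}eJ ordered_prodU; last first.
  by move=> a b; rewrite !inE => /andP[_ ai] /andP[_]; exact: ltn_trans.
rewrite J1c; last by move=> j; rewrite !inE => /andP[_ /ltnW].
rewrite -iJ2 -ordered_prodU// => a b; rewrite !inE => /andP[_ ai] /orP[/eqP->//|/andP[_]].
exact: ltn_trans.
Qed.

Lemma ordered_prod_rec i J : i \in J ->
  P J = wedge_sign K [set i] (J :\ i) *: wedge (c i) (P (J :\ i)).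
Proof.
by move=> iJ; rewrite wedge_ordered_prod1 setD11 scalerA wedge_sign_sqr scale1r setD1K.
Qed.

Lemma wedge_ordered_prod I J : wedge (P I) (P J) =
  if [disjoint I & J] then wedge_sign K I J *: P (I :|: J)%SET else 0.
Proof.
move: {2}#|I| (erefl #|I|) => k; elim: k I => [|k IH] I.
  move=> /cards0_eq->; rewrite -setI_eq0 set0I eqxx.
  by rewrite ordered_prod0 wedge1l wedge_sign0l scale1r set0U.
move=> Ik; have [i iI] : exists i, i \in I by apply/set0Pn; rewrite -cards_eq0 Ik.
have Ik' : #|I :\ i| = k by move: Ik; rewrite (cardsD1 i) iI => -[].
rewrite (ordered_prod_rec iI) wedgeZl -wedgeA IH//.
have dE : [disjoint I & J] = (i \notin J) && [disjoint I :\ i & J].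
  by rewrite -{1}(setD1K iI) -!setI_eq0 setIUl setU_eq0 !setI_eq0 disjoints1.
rewrite dE; case: ifPn => dIJ; rewrite ?andbF ?wedge0r ?scaler0// andbT.
rewrite wedgeZr wedge_ordered_prod1 !inE eqxx/=.
case: ifPn => iJ; rewrite ?scaler0//= setUA setD1K// !scalerA; congr (_ *: _).
rewrite wedge_signUr// -[in RHS](setD1K iI) wedge_signUl ?disjoints1 ?setD11//.
set a := wedge_sign _ [set i] _; have aa : a * a = 1 by exact: wedge_sign_sqr.
set b := wedge_sign _ _ _; set d := wedge_sign _ _ _.
by transitivity (a * a * (b * d)); [ring|rewrite aa; ring].
Qed.

End AnticommutingProducts.

Section Pullback.
Variables (K : numFieldType) (n : nat).
Implicit Types (v w u : ext K n) (I J L : {set 'I_n}) (i j : 'I_n) (A B : 'M[K]_n).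

Lemma clifford_covector (xi : 'rV[K]_n) w : clifford (0, xi) w = wedge (covector xi) w.
Proof.
rewrite cliffordE covectorE wedge_suml; apply: eq_bigr => i _.
by rewrite mxE scale0r subr0 wedgeZl.
Qed.

(** A covector is a null vector for the pairing of vectors and covectors, so its square is read off
    from the Clifford relation. *)
Lemma covector_sqr (a : 'rV[K]_n) : wedge (covector a) (covector a) = 0.
Proof.
have := clifford_sqr (0, a) (ext1 K n); rewrite !clifford_covector wedge1r => ->.
by rewrite /edot big1 ?mulr0 ?oppr0 ?scale0r// => i _; rewrite !mxE !mulr0 addr0.
Qed.

Lemma covector_anti (a b : 'rV[K]_n) :
  wedge (covector a) (covector b) = - wedge (covector b) (covector a).
Proof.
apply/eqP; rewrite -addr_eq0; apply/eqP.
have := clifford_anticomm (0, a) (0, b) (ext1 K n); rewrite !clifford_covector !wedge1r => ->.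
by rewrite /edot big1 ?mulr0 ?oppr0 ?scale0r// => i _; rewrite !mxE !mulr0 addr0.
Qed.

Definition row_covector A j := covector (row j A).

Lemma pullE A w : pull A w = \sum_J w J *: ordered_prod (row_covector A) J.
Proof.
apply/ffunP => I; rewrite ffunE sum_ffunE; apply: eq_bigr => J _.
by rewrite scale_extE.
Qed.

Lemma pullD A v w : pull A (v + w) = pull A v + pull A w.
Proof.
by rewrite !pullE -big_split/=; apply: eq_bigr => J _; rewrite add_extE scalerDl.
Qed.

Lemma pullZ A (a : K) w : pull A (a *: w) = a *: pull A w.
Proof.
by rewrite !pullE scaler_sumr; apply: eq_bigr => J _; rewrite scale_extE scalerA.
Qed.

Lemma pull0 A : pull A 0 = 0.
Proof. by rewrite -[X in pull _ X](scale0r (0 : ext K n)) pullZ scale0r. Qed.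

Lemma pull_sum A T (r : seq T) P (F : T -> ext K n) :
  pull A (\sum_(x <- r | P x) F x) = \sum_(x <- r | P x) pull A (F x).
Proof. exact: (big_morph (pull A) (pullD A) (pull0 A)). Qed.

Lemma pull_dx A J : pull A (dx K J) = ordered_prod (row_covector A) J.
Proof.
rewrite pullE (bigD1 J)//= ffunE eqxx scale1r big1 ?addr0// => I IJ.
by rewrite ffunE (negPf IJ) scale0r.
Qed.

Lemma pull_wedge A v w : pull A (wedge v w) = wedge (pull A v) (pull A w).
Proof.
rewrite (ext_basis v) (ext_basis w) !(pull_sum, wedge_suml); apply: eq_bigr => I _.
rewrite pullZ !wedgeZl pullZ; congr (_ *: _).
rewrite !wedge_sumr pull_sum; apply: eq_bigr => J _.
rewrite pullZ !wedgeZr pullZ; congr (_ *: _).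
rewrite !pull_dx wedge_ordered_prod; [|by move=> i; exact: covector_sqr|by move=> i j; exact: covector_anti].
by rewrite wedge_dx; case: ifP => _; rewrite ?pull0// pullZ pull_dx.
Qed.

Lemma pull_ext1 A : pull A (ext1 K n) = ext1 K n.
Proof. by rewrite ext1E pull_dx ordered_prod0. Qed.

Lemma pull_covector A (xi : 'rV[K]_n) : pull A (covector xi) = covector (xi *m A).
Proof.
rewrite covectorE pull_sum.
under eq_bigr do rewrite pullZ pull_dx ordered_prod1 /row_covector covectorE scaler_sumr.
rewrite exchange_big/= covectorE; apply: eq_bigr => j _.
rewrite mxE scaler_suml; apply: eq_bigr => i _.
by rewrite scalerA mxE.
Qed.

Lemma pullM A B w : pull B (pull A w) = pull (A *m B) w.
Proof.
rewrite [in RHS]pullE [X in pull B X]pullE pull_sum; apply: eq_bigr => J _; rewrite pullZ; congr (_ *: _).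
rewrite /ordered_prod (big_morph (pull B) (pull_wedge B) (pull_ext1 B)).
by apply: eq_bigr => j _; rewrite /row_covector pull_covector row_mul.
Qed.

Lemma ordered_prod_dx J : ordered_prod (fun i => dx K [set i]) J = dx K J.
Proof.
have cE i : dx K [set i] = covector (delta_mx ord0 i).
  rewrite covectorE (bigD1 i)//= mxE !eqxx scale1r big1 ?addr0// => j ji.
  by rewrite mxE (negPf ji) andbF scale0r.
have s1 i : wedge (dx K [set i]) (dx K [set i]) = 0 by rewrite cE covector_sqr.
have s2 i j : wedge (dx K [set i]) (dx K [set j]) = - wedge (dx K [set j]) (dx K [set i]).
  by rewrite !cE covector_anti.
move: {2}#|J| (erefl #|J|) => k; elim: k J => [|k IH] J.
  by move=> /cards0_eq->; rewrite ordered_prod0 ext1E.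
move=> Jk; have [i iJ] : exists i, i \in J by apply/set0Pn; rewrite -cards_eq0 Jk.
have Jk' : #|J :\ i| = k by move: Jk; rewrite (cardsD1 i) iJ => -[].
rewrite (ordered_prod_rec s1 s2 iJ) IH// wedge_dx disjoints1 setD11 scalerA wedge_sign_sqr.
by rewrite scale1r setD1K.
Qed.

Lemma row_covector1 (c : K) i j k :
  row_covector (1%:M + c *: delta_mx i j) k = dx K [set k] + (k == i)%:R * c *: dx K [set j].
Proof.
rewrite /row_covector covectorE.
under eq_bigr do rewrite !mxE scalerDl.
rewrite big_split/=; congr (_ + _).
  by rewrite (bigD1 k)//= eqxx scale1r big1 ?addr0// => l lk; rewrite eq_sym (negPf lk) scale0r.
rewrite (bigD1 j)//= eqxx andbT mulrC big1 ?addr0// => l lj.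
by rewrite (negPf lj) andbF mulr0 scale0r.
Qed.

(** Only row i differs from the identity, where dx_i becomes dx_i + c dx_j. Since dx_i occurs at
    most once in a monomial, the expansion stops at first order in [c]. *)
Lemma pull_elementary (c : K) i j w :
  pull (1%:M + c *: delta_mx i j) w = w + c *: eps j (iot i w).
Proof.
rewrite (ext_basis w) pull_sum iot_sum eps_sum scaler_sumr -big_split/=.
apply: eq_bigr => J _; rewrite pullZ iotZ epsZ scalerA mulrC -scalerA -scalerDr; congr (_ *: _).
rewrite pull_dx.
have noti L : i \notin L -> ordered_prod (row_covector (1%:M + c *: delta_mx i j)) L = dx K L.
  move=> iL; rewrite -[RHS]ordered_prod_dx; apply: eq_bigr => k kL.
  rewrite row_covector1; case: eqP => [ki|]; last by rewrite mul0r scale0r addr0.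
  by move: iL; rewrite -ki kL.
have [iJ|iJ] := boolP (i \in J); last by rewrite noti// iot_dx (negPf iJ) eps0 scaler0 addr0.
rewrite (ordered_prod_rec _ _ iJ) ?noti ?setD11//; last first.
- by move=> a b; exact: covector_anti.
- by move=> a; exact: covector_sqr.
rewrite row_covector1 eqxx mul1r wedgeDl scalerDr; congr (_ + _).
  by rewrite wedge_dx disjoints1 setD11 scalerA wedge_sign_sqr scale1r setD1K.
by rewrite wedgeZl iot_dx iJ epsZ !scalerA mulrC.
Qed.

Lemma pull1 w : pull 1%:M w = w.
Proof.
rewrite pullE [RHS]ext_basis; apply: eq_bigr => J _; congr (_ *: _).
rewrite -[RHS]ordered_prod_dx; apply: eq_bigr => k _.
rewrite /row_covector covectorE (bigD1 k)//= !mxE eqxx scale1r big1 ?addr0// => l lk.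
by rewrite !mxE eq_sym (negPf lk) scale0r.
Qed.

Lemma pull_eq_card A w I : pull A w I = \sum_(J : {set 'I_n} | #|J| == #|I|) w J * pull A (dx K J) I.
Proof.
rewrite pullE sum_ffunE [RHS]big_mkcond; apply: eq_bigr => J _.
rewrite scale_extE pull_dx; case: ifPn => // JI.
rewrite (@homogeneous_ordered_prod _ _ _ J) ?mulr0 1?eq_sym// => i.
exact: homogeneous_covector.
Qed.

Lemma homogeneous_pull A p w : homogeneous p w -> homogeneous p (pull A w).
Proof.
move=> hw I Ip; rewrite pull_eq_card big1// => J /eqP JI.
by rewrite hw ?mul0r// JI.
Qed.

Lemma chiral_pull A e w : chiral e w -> chiral e (pull A w).
Proof.
move=> hw I Ip; rewrite pull_eq_card big1// => J /eqP JI.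
by rewrite hw ?mul0r// JI.
Qed.

(** The determinant in disguise. Its multiplicativity is immediate from functoriality of pullback;
    it is matched with [\det] through elementary matrices, for positive determinants, in
    [top_factor_det]. *)
Definition top_factor A : K := pull A (dx K (topset n)) (topset n).

Lemma pull_top A w : pull A w (topset n) = w (topset n) * top_factor A.
Proof.
rewrite pull_eq_card (big_pred1 (topset n))// => J /=.
apply/eqP/eqP => [E|->//]; apply/eqP; rewrite eqEcard E subsetT leqnn//.
Qed.

Lemma top_factorM A B : top_factor (A *m B) = top_factor A * top_factor B.
Proof. by rewrite /top_factor -pullM pull_top. Qed.

Lemma top_factor1 : top_factor 1%:M = 1.
Proof. by rewrite /top_factor pull1 ffunE eqxx. Qed.

Lemma top_factor_elementary (c : K) i j :
  top_factor (1%:M + c *: delta_mx i j) = 1 + (i == j)%:R * c.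
Proof.
rewrite /top_factor pull_elementary add_extE scale_extE iot_dx inE epsZ scale_extE eps_dx.
rewrite ffunE eqxx !inE andbT eq_sym; case: (i =P j) => [<-|_] /=; last by rewrite ext0E !mulr0 mul0r.
rewrite scale_extE ffunE setD1K ?inE// eqxx mulr1 wedge_sign_sqr; ring.
Qed.

Lemma det_elementary (c : K) i j :
  \det (1%:M + c *: delta_mx i j) = 1 + (i == j)%:R * c.
Proof.
wlog ji : i j / (j <= i)%N => [H|].
  have [/H//|ij] := leqP j i.
  have E : (1%:M + c *: delta_mx i j)^T = 1%:M + c *: delta_mx j i :> 'M[K]_n.
    by apply/matrixP => k l; rewrite !mxE andbC eq_sym.
  by rewrite -det_tr E (H _ _ (ltnW ij)) eq_sym.
rewrite det_trig; last first.
  apply/is_trig_mxP => k l kl; rewrite !mxE (_ : k == l = false); last by apply/negbTE; rewrite neq_ltn kl.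
  rewrite add0r; case: eqP kl => [->|_]; rewrite ?mulr0//.
  by case: eqP => [->|]; rewrite ?mulr0// ltnNge ji.
rewrite (bigD1 i)//= big1 ?mulr1 => [|k ki]; last by rewrite !mxE eqxx (negPf ki) mulr0 addr0.
by rewrite !mxE !eqxx mulrC.
Qed.

Lemma mukai_pull A v w : mukai (pull A v) (pull A w) = mukai v w * top_factor A.
Proof.
have hp u : hat (pull A u) = pull A (hat u).
  apply/ffunP => I; rewrite ffunE pull_eq_card [RHS]pull_eq_card mulr_sumr; apply: eq_bigr => J /eqP JI.
  by rewrite [hat u J]ffunE JI mulrA.
by rewrite /mukai hp -pull_wedge pull_top.
Qed.

End Pullback.

(** * Spin groups *)

Section ElementaryMatrices.
Variable K : realFieldType.

Definition elementary_mx n i j (c : K) : 'M[K]_n := 1%:M + c *: delta_mx i j.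

(** The diagonal factors are restricted to positive entries, so that the products stay in the
    positive component, where every factor has a spin lift and can be deformed to the identity
    through invertible matrices. *)
Inductive elementary_product n : 'M[K]_n -> Prop :=
| ElementaryProduct1 : elementary_product 1%:M
| ElementaryProductT i j c : i != j -> elementary_product (elementary_mx i j c)
| ElementaryProductD i c : 0 < 1 + c -> elementary_product (elementary_mx i i c)
| ElementaryProductM A B :
    elementary_product A -> elementary_product B -> elementary_product (A *m B).

Lemma elementary_mxK n (i j : 'I_n) (c : K) : i != j ->
  elementary_mx i j (- c) *m elementary_mx i j c = 1%:M.
Proof.
move=> ij; rewrite /elementary_mx mulmxDl mul1mx mulmxDr mulmx1 -!scalemxAl -!scalemxAr.
by rewrite mul_delta_mx_cond eq_sym (negPf ij) mulr0n !scaler0 addr0 scaleNr addrK.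
Qed.

Lemma elementary_product_block n (B : 'M[K]_n) : elementary_product B ->
  elementary_product (block_mx (1%:M : 'M_1) 0 0 B).
Proof.
have E i j c : block_mx (1%:M : 'M_1) 0 0 (elementary_mx i j c) =
    elementary_mx (rshift 1 i) (rshift 1 j) c :> 'M[K]_(1 + n).
  rewrite /elementary_mx (_ : delta_mx _ _ = block_mx 0 0 0 (delta_mx i j)).
    by rewrite scale_block_mx !scaler0 (scalar_mx_block 1 n) add_block_mx !addr0.
  apply/matrixP => k l; rewrite !mxE.
  case: splitP => k' kk; rewrite ?mxE; case: splitP => l' ll; rewrite ?mxE//.
  - by rewrite -val_eqE/= kk; case: k' kk => -[]//= k0 _; rewrite add1n.
  - by rewrite -val_eqE/= kk; case: k' kk => -[]//= k0 _; rewrite add1n.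
  - by rewrite andbC -val_eqE/= ll; case: l' ll => -[]//= k0 _; rewrite add1n.
  - by rewrite -!val_eqE/= kk ll !eqn_add2l.
elim=> [|i j c ij|i c c0|A B' _ IA _ IB].
- by rewrite -scalar_mx_block; exact: ElementaryProduct1.
- by rewrite E; apply: ElementaryProductT; rewrite (inj_eq (@rshift_inj _ _)).
- by rewrite E; exact: ElementaryProductD.
- have -> : block_mx (1%:M : 'M_1) 0 0 (A *m B') = block_mx 1%:M 0 0 A *m block_mx 1%:M 0 0 B'.
    by rewrite mulmx_block !mul0mx !mulmx0 !mul1mx !addr0 add0r.
  exact: ElementaryProductM.
Qed.

Lemma elementary_product_lower n (v : 'cV[K]_n) :
  elementary_product (block_mx (1%:M : 'M_1) 0 v 1%:M).
Proof.
pose Q (u : 'cV[K]_n) := elementary_product (block_mx (1%:M : 'M_1) 0 u 1%:M).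
suff : Q v by [].
rewrite (matrix_sum_delta v); apply: (big_ind Q) => [|v1 v2 h1 h2|i _]; rewrite /Q.
- by rewrite -scalar_mx_block; exact: ElementaryProduct1.
- have -> : block_mx (1%:M : 'M_1) 0 (v1 + v2) 1%:M =
      block_mx 1%:M 0 v1 1%:M *m block_mx 1%:M 0 v2 1%:M :> 'M[K]_(1 + n).
    by rewrite mulmx_block !mul0mx !mulmx0 !mul1mx !mulmx1 !addr0 add0r.
  exact: ElementaryProductM.
rewrite big_ord1.
have -> : block_mx (1%:M : 'M_1) 0 (v i ord0 *: delta_mx i ord0) 1%:M =
   elementary_mx (rshift 1 i) (lshift n ord0) (v i ord0) :> 'M[K]_(1 + n).
  rewrite /elementary_mx (_ : delta_mx (rshift 1 i) _ = block_mx 0 0 (delta_mx i ord0) 0).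
    by rewrite scale_block_mx !scaler0 (scalar_mx_block 1 n) add_block_mx !addr0 add0r.
  apply/matrixP => k l; rewrite !mxE.
  case: splitP => k' kk; rewrite ?mxE; case: splitP => l' ll; rewrite ?mxE//.
  - by rewrite -val_eqE/= kk; case: k' kk => -[]//= k0 _; rewrite add1n.
  - by rewrite -val_eqE/= kk; case: k' kk => -[]//= k0 _; rewrite add1n.
  - by rewrite -!val_eqE/= kk ll eqn_add2l.
  - by rewrite andbC -val_eqE/= ll add1n.
by apply: ElementaryProductT; rewrite eq_rlshift.
Qed.

Lemma elementary_product_tr n (A : 'M[K]_n) : elementary_product A -> elementary_product A^T.
Proof.
have E i j c : (elementary_mx i j c)^T = elementary_mx j i c :> 'M[K]_n.
  by apply/matrixP => k l; rewrite !mxE andbC eq_sym.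
elim=> [|i j c ij|i c c0|B C _ IB _ IC].
- by rewrite trmx1; exact: ElementaryProduct1.
- by rewrite E; apply: ElementaryProductT; rewrite eq_sym.
- by rewrite E; exact: ElementaryProductD.
- by rewrite trmx_mul; exact: ElementaryProductM.
Qed.

Lemma elementary_product_cancel n (A : 'M[K]_n) i j c : i != j ->
  elementary_product (elementary_mx i j c *m A) -> elementary_product A.
Proof.
move=> ij h; rewrite -(mul1mx A) -(elementary_mxK c ij) -mulmxA.
exact: ElementaryProductM (ElementaryProductT _ ij) h.
Qed.

Lemma det_elementary_mul n (A : 'M[K]_n) i j c : i != j ->
  \det (elementary_mx i j c *m A) = \det A.
Proof. by move=> ij; rewrite det_mulmx det_elementary (negPf ij) mul0r addr0 mul1r. Qed.

Lemma elementary_mul_row n (A : 'M[K]_n) i j c k l :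
  (elementary_mx i j c *m A) k l = A k l + (k == i)%:R * c * A j l.
Proof.
rewrite /elementary_mx mulmxDl mul1mx -scalemxAl mxE mxE; congr (_ + _).
rewrite mxE (bigD1 j)//= mxE eqxx andbT big1 ?addr0 ?mulrA 1?[c * _]mulrC// => m mj.
by rewrite mxE (negPf mj) andbF mul0r.
Qed.

(** Gaussian elimination that keeps every pivot positive. A positive corner entry splits off by a
    Schur complement; any nonzero entry below the corner can be used to make the corner equal to
    1. *)
Lemma elementary_product_det n (A : 'M[K]_n) : 0 < \det A -> elementary_product A.
Proof.
elim: n A => [|n IH] A dA.
  by rewrite (_ : A = 1%:M); [exact: ElementaryProduct1|apply/matrixP => -[]].
have H1 (C : 'M[K]_(1 + n)) : 0 < \det C -> 0 < C ord0 ord0 -> elementary_product C.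
  move=> dC C0; set a := C ord0 ord0 in C0.
  have a0 : a != 0 by rewrite gt_eqF.
  have aE : ulsubmx C = a%:M.
    by apply/matrixP => i j; rewrite !ord1 !mxE eqxx mulr1n; congr (C _ _); apply: val_inj.
  (* The Schur complement of the corner entry a; its determinant is \det C / a, hence positive. *)
  pose S := drsubmx C - a^-1 *: (dlsubmx C *m ursubmx C).
  have CE : C = block_mx (1%:M : 'M_1) 0 (a^-1 *: dlsubmx C) 1%:M *m
      (block_mx (a%:M : 'M_1) 0 0 1%:M *m (block_mx (1%:M : 'M_1) 0 0 S *m
       block_mx (1%:M : 'M_1) (a^-1 *: ursubmx C) 0 1%:M)).
    rewrite !mulmx_block !mul0mx !mulmx0 !mul1mx !mulmx1 ?mul0mx ?mulmx0 ?addr0 ?add0r.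
    rewrite -{1}(submxK C) aE; congr block_mx.
    - by rewrite mulmx1.
    - by rewrite mul_scalar_mx scalerA mulfV// scale1r.
    - by rewrite mulmx1 -scalemxAl mul_mx_scalar scalerA mulVf// scale1r.
    - by rewrite mul_scalar_mx scalerA mulfV// scale1r /S -scalemxAl addrC subrK.
  have dS : 0 < \det S.
    move: dC; rewrite CE !det_mulmx !det_ublock !det_lblock ?det1 ?mulr1 ?mul1r.
    by rewrite det_scalar1 pmulr_rgt0.
  rewrite CE; apply: ElementaryProductM; first exact: elementary_product_lower.
  apply: ElementaryProductM; last apply: ElementaryProductM.
  - have -> : block_mx (a%:M : 'M_1) 0 0 1%:M =
        elementary_mx (lshift n ord0) (lshift n ord0) (a - 1) :> 'M[K]_(1 + n).
      rewrite /elementary_mx (_ : delta_mx _ _ = block_mx (1%:M : 'M_1) 0 0 0).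
        rewrite scale_block_mx !scaler0 (scalar_mx_block 1 n) add_block_mx !addr0.
        by rewrite scale_scalar_mx mulr1 -raddfD/= addrC subrK.
      apply/matrixP => k l; rewrite !mxE.
      case: splitP => k' kk; rewrite ?mxE; case: splitP => l' ll; rewrite ?mxE//.
      - by rewrite -!val_eqE/= kk ll !ord1.
      - by rewrite andbC -val_eqE/= ll add1n.
      - by rewrite -val_eqE/= kk add1n.
      - by rewrite -val_eqE/= kk add1n.
    by apply: ElementaryProductD; rewrite addrC subrK.
  - exact/elementary_product_block/IH.
  - rewrite -[X in elementary_product X]trmxK; apply: elementary_product_tr.
    by rewrite tr_block_mx !trmx1 !trmx0; exact: elementary_product_lower.
have H2 (C : 'M[K]_(1 + n)) i : 0 < \det C -> i != ord0 -> C i ord0 != 0 -> elementary_product C.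
  move=> dC i0 Ci; have oi : ord0 != i by rewrite eq_sym.
  (* This multiple of row i, added to the first row, turns the corner entry into 1. *)
  apply: (elementary_product_cancel (c := (1 - C ord0 ord0) / C i ord0) oi).
  apply: H1; first by rewrite det_elementary_mul.
  by rewrite elementary_mul_row eqxx mul1r divfK// addrC subrK ltr01.
have [/existsP[i /andP[i0 Ai]]|nA] := boolP [exists i : 'I_n.+1, (i != ord0) && (A i ord0 != 0)].
  exact: (H2 _ i).
have A0 i : i != ord0 -> A i ord0 = 0.
  by move=> i0; apply/eqP; apply: contraNT nA => Ai; apply/existsP; exists i; rewrite i0.
have A00 : A ord0 ord0 != 0.
  apply: contraTneq dA => Az; rewrite (expand_det_col A ord0) big1 ?ltxx// => i _.
  by have [->|/A0 ->] := eqVneq i ord0; rewrite ?Az mul0r.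
(* The first column now vanishes below the corner, which may be negative. In size 1 the corner is
   the determinant; otherwise adding the first row to the second creates a nonzero entry below the
   corner. *)
case: n => [|n] in IH A dA H1 H2 nA A0 A00 *; first by apply: H1; rewrite // -det_mx11.
have i0 : lift ord0 ord0 != ord0 :> 'I_n.+2 by [].
apply: (elementary_product_cancel (c := 1) i0).
apply: (H2 _ (lift ord0 ord0)) => //; first by rewrite det_elementary_mul.
by rewrite elementary_mul_row eqxx A0// add0r !mul1r.
Qed.

End ElementaryMatrices.

Lemma top_factor_det (K : realFieldType) n (A : 'M[K]_n) : 0 < \det A -> top_factor A = \det A.
Proof.
move=> /elementary_product_det; elim=> {A} [|i j c ij|i c c0|A B _ IA _ IB].
- by rewrite top_factor1 det1.
- by rewrite top_factor_elementary det_elementary.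
- by rewrite top_factor_elementary det_elementary.
- by rewrite top_factorM det_mulmx IA IB.
Qed.

Section BilinearForm.
Variables (K : fieldType) (n : nat).
Implicit Types x y z : 'rV[K]_n * 'rV[K]_n.

Lemma edotDl x y z : edot (x + y) z = edot x z + edot y z.
Proof.
rewrite /edot -mulrDr -big_split; congr (_ * _); apply: eq_bigr => i _ /=.
by rewrite !mxE; ring.
Qed.

Lemma edotZl (a : K) x z : edot (a *: x) z = a * edot x z.
Proof.
rewrite /edot [RHS]mulrCA; congr (_ * _); rewrite mulr_sumr; apply: eq_bigr => i _ /=.
by rewrite !mxE; ring.
Qed.

Lemma edotC x y : edot x y = edot y x.
Proof. by rewrite /edot; congr (_ * _); apply: eq_bigr => i _; rewrite addrC. Qed.

Lemma edotDr x y z : edot x (y + z) = edot x y + edot x z.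
Proof. by rewrite !(edotC x) edotDl. Qed.

Lemma edotZr (a : K) x z : edot x (a *: z) = a * edot x z.
Proof. by rewrite !(edotC x) edotZl. Qed.

End BilinearForm.

(** * Products of unit vectors acting on forms *)

Section SpinElements.
Variables (R : realType) (n : nat).
Implicit Types (v w u : ext R n) (I J L : {set 'I_n}) (i j k : 'I_n).
Local Notation vec := ('rV[R]_n * 'rV[R]_n)%type.

(** Even products of vectors of square +1 form part of the group of [spin_plus]. The lifts of
    exponentials of two-forms and of matrices of positive determinant are constructed inside this
    class. *)
Definition unit_product (s : seq vec) := all (fun x => edot x x == 1) s && ~~ odd (size s).

Definition spin_op (g : ext R n -> ext R n) :=
  exists2 s, unit_product s & forall t, spin_act s t = g t.

Lemma spin_op_ext g h : g =1 h -> spin_op g -> spin_op h.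
Proof. by move=> gh [s us sg]; exists s => // t; rewrite sg gh. Qed.

Lemma spin_op_id : spin_op id.
Proof. by exists [::]. Qed.

Lemma spin_op_comp g h : spin_op g -> spin_op h -> spin_op (g \o h).
Proof.
move=> [s /andP[us es] sg] [r /andP[ur er] rh]; exists (s ++ r).
  by rewrite /unit_product all_cat us ur size_cat oddD (negPf es) (negPf er).
by move=> t; rewrite /spin_act foldr_cat [foldr _ t r]rh [LHS]sg.
Qed.

Lemma unit_product_spin_plus s : unit_product s -> spin_plus s.
Proof.
case/andP => us es; split.
- by apply: sub_all us => x /= ->.
- suff -> : count [pred v | edot v v == 1] s = size s by [].
  by apply/eqP; rewrite -all_count.
- suff -> : count [pred v | edot v v == -1] s = 0%N by [].
  apply/eqP; rewrite -leqn0 leqNgt -has_count -all_predC; apply: sub_all us => x /= /eqP->.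
  by rewrite -subr_eq0 opprK (pnatr_eq0 R 2).
Qed.

(** In the Clifford algebra e (e + c n2) = -1 + c e n2 and (e + n1)(e + n1 - c n2) = -1 - c (e + n1)
    n2. In their product the terms in e n2 cancel, and the term in c^2 vanishes because n2
    anticommutes with e + n1 and squares to zero. *)
Lemma clifford_null_pair (e n1 n2 : vec) (c : R) w :
  edot e e = 1 -> edot e n1 = 0 -> edot e n2 = 0 -> edot n1 n1 = 0 -> edot n2 n2 = 0 ->
  edot n1 n2 = 0 ->
  spin_act [:: e; e + c *: n2; e + n1; e + n1 - c *: n2] w = w + c *: clifford n1 (clifford n2 w).
Proof.
move=> ee en1 en2 n11 n22 n12.
have anti (x y : vec) t : edot x y = 0 -> clifford x (clifford y t) = - clifford y (clifford x t).
  move=> xy; apply/eqP; rewrite -addr_eq0 clifford_anticomm xy mulr0 oppr0 scale0r//.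
have sq (x : vec) t : edot x x = 0 -> clifford x (clifford x t) = 0.
  by move=> xx; rewrite clifford_sqr xx oppr0 scale0r.
have cN (x : vec) t : clifford x (- t) = - clifford x t.
  by rewrite -scaleN1r cliffordZ scaleN1r.
have en : edot (e + n1) (e + n1) = 1.
  by rewrite edotDl !edotDr ee en1 edotC en1 n11 !addr0.
have N2 (x : vec) : edot x n2 = 0 -> clifford n2 (clifford x (clifford n2 w)) = 0.
  by move=> xn; rewrite -[LHS]opprK -(anti x)// sq// clifford0 oppr0.
rewrite /spin_act /= -(scaleNr c n2) (cliffordDl (e + n1) _ w) cliffordZl.
rewrite cliffordD cliffordZ clifford_sqr en cliffordDl.
set x := -1 *: w + _.
have N2x : clifford n2 x = - clifford n2 w.
  rewrite /x cliffordD !cliffordZ cliffordDl cliffordD !N2// addr0 scaler0 addr0.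
  by rewrite scaleN1r.
rewrite cliffordD clifford_sqr ee cliffordZl cliffordZ N2x cN /x cliffordDl.
by apply/ffunP => I; rewrite !(add_extE, scale_extE, opp_extE); ring.
Qed.

(** An index k that does not occur in n1 and n2 supplies the auxiliary unit vector d/dx_k + dx_k,
    orthogonal to both. Later n1 and n2 involve two indices i and j, so n > 2 guarantees such a
    k. *)
Lemma spin_op_null_pair k (n1 n2 : vec) (c : R) :
  edot n1 n1 = 0 -> edot n2 n2 = 0 -> edot n1 n2 = 0 ->
  n1.1 ord0 k = 0 -> n1.2 ord0 k = 0 -> n2.1 ord0 k = 0 -> n2.2 ord0 k = 0 ->
  spin_op (fun w => w + c *: clifford n1 (clifford n2 w)).
Proof.
move=> n11 n22 n12 n1k n1k' n2k n2k'.
pose e : vec := (delta_mx ord0 k, delta_mx ord0 k).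
have eE (x : vec) : edot e x = 2^-1 * (x.1 ord0 k + x.2 ord0 k).
  rewrite /edot (bigD1 k)//= !mxE !eqxx mul1r mulr1 big1 ?addr0// => i ik.
  by rewrite !mxE (negPf ik) mul0r mulr0 addr0.
have ee : edot e e = 1 by rewrite eE !mxE !eqxx mulVf// pnatr_eq0.
have en1 : edot e n1 = 0 by rewrite eE n1k n1k' addr0 mulr0.
have en2 : edot e n2 = 0 by rewrite eE n2k n2k' addr0 mulr0.
exists [:: e; e + c *: n2; e + n1; e + n1 - c *: n2]; last first.
  by move=> t; rewrite clifford_null_pair.
rewrite /unit_product /= -scaleNr.
have sqE (x y : vec) (a : R) : edot x x = 1 -> edot x y = 0 -> edot y y = 0 -> edot (x + a *: y) (x + a *: y) = 1.
  by move=> xx xy yy; rewrite edotDl !edotDr !edotZl !edotZr xx (edotC y x) xy yy !mulr0 !addr0.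
have e1 : edot (e + n1) (e + n1) = 1 by rewrite -[n1]scale1r sqE.
have e2 : edot (e + n1) n2 = 0 by rewrite edotDl en2 n12 addr0.
by rewrite ee !sqE// e1 eqxx.
Qed.

Lemma spin_op_opp : (0 < n)%N -> spin_op (fun w => - w).
Proof.
move=> n0; pose k := Ordinal n0; pose e : vec := (delta_mx ord0 k, delta_mx ord0 k).
have ee : edot e e = 1.
  rewrite /edot (bigD1 k)//= !mxE !eqxx mul1r big1 ?addr0 ?mulVf ?pnatr_eq0// => i ik.
  by rewrite !mxE (negPf ik) mul0r addr0.
exists [:: e; e]; first by rewrite /unit_product /= ee eqxx.
by move=> t; rewrite /spin_act /= clifford_sqr ee scaleN1r.
Qed.

Lemma exists_ord_neq2 i j : (2 < n)%N -> exists k, (k != i) && (k != j).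
Proof.
move=> n2; have : (0 < #|~: [set i; j]|)%N.
  by have := cardsC [set i; j]; rewrite card_ord cards2; case: eqP; lia.
by case/card_gt0P => k; rewrite !inE negb_or => h; exists k.
Qed.

Lemma clifford_vector i w : clifford (delta_mx ord0 i, 0) w = - iot i w.
Proof.
rewrite cliffordE (bigD1 i)//= !mxE !eqxx scale0r scale1r sub0r big1 ?addr0// => j ji.
by rewrite !mxE (negPf ji) !scale0r subr0.
Qed.

Lemma clifford_form i w : clifford (0, delta_mx ord0 i) w = eps i w.
Proof.
rewrite cliffordE (bigD1 i)//= !mxE !eqxx scale0r scale1r subr0 big1 ?addr0// => j ji.
by rewrite !mxE (negPf ji) !scale0r subr0.
Qed.

Lemma spin_op_eps_eps i j (c : R) : (2 < n)%N -> spin_op (fun w => w + c *: eps i (eps j w)).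
Proof.
move=> n2; have [k /andP[/negPf ki /negPf kj]] := exists_ord_neq2 i j n2.
have e0 (a b : 'I_n) : edot (0, delta_mx ord0 a) (0, delta_mx ord0 b) = 0 :> R.
  by rewrite /edot big1 ?mulr0// => l _; rewrite !mxE !mulr0 addr0.
apply: (spin_op_ext _ (@spin_op_null_pair k (0, delta_mx ord0 i) (0, delta_mx ord0 j) c _ _ _ _ _ _ _));
  rewrite ?e0 ?mxE ?ki ?kj ?andbF//.
by move=> w; rewrite !clifford_form.
Qed.

Lemma spin_op_eps_iot i j (c : R) : (2 < n)%N -> i != j ->
  spin_op (fun w => w + c *: eps j (iot i w)).
Proof.
move=> n2 ij; have [k /andP[/negPf ki /negPf kj]] := exists_ord_neq2 i j n2.
apply: (spin_op_ext _ (@spin_op_null_pair k (0, delta_mx ord0 j) (delta_mx ord0 i, 0) (- c) _ _ _ _ _ _ _));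
  rewrite ?mxE ?ki ?kj ?andbF//.
- by move=> w; rewrite clifford_vector clifford_form /= -[- iot i w]scaleN1r epsZ scalerA mulrN1 opprK.
- by rewrite /edot big1 ?mulr0// => l _; rewrite !mxE !mulr0 addr0.
- by rewrite /edot big1 ?mulr0// => l _; rewrite !mxE !mul0r addr0.
- rewrite /edot big1 ?mulr0// => l _; rewrite !mxE mulr0 addr0/=.
  by have [->|] := eqVneq l j; rewrite ?mul0r// eq_sym (negPf ij) mulr0.
Qed.

(** For e_b = b d/dx_i + b^-1 dx_i, a unit vector, minus the product e_1 e_a multiplies by a on the
    image of [eps i] and by a^-1 on the image of [iot i]. With a = sqrt d this is dilation of dx_i
    by d, up to the factor d^(-1/2): the origin of the determinant factor in the lift. *)
Lemma spin_op_scaling i (d : R) : 0 < d -> 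
  spin_op (fun w => (Num.sqrt d)^-1 *: (w + (d - 1) *: eps i (iot i w))).
Proof.
move=> d0; have n0 : (0 < n)%N by case: n i => // -[].
have a0 : Num.sqrt d != 0 by rewrite gt_eqF// sqrtr_gt0.
have aa : Num.sqrt d * Num.sqrt d = d by rewrite -expr2 sqr_sqrtr// ltW.
move: (Num.sqrt d) a0 aa => a a0 aa.
pose e (b : R) : vec := (b *: delta_mx ord0 i, b^-1 *: delta_mx ord0 i).
have ee b : b != 0 -> edot (e b) (e b) = 1.
  move=> b0; rewrite /edot (bigD1 i)//= !mxE !eqxx !mulr1 mulVf// big1 ?addr0 ?mulVf ?pnatr_eq0// => j ji.
  by rewrite !mxE (negPf ji) !mulr0 addr0.
have eE b w : clifford (e b) w = b^-1 *: eps i w - b *: iot i w.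
  have -> : e b = b^-1 *: (0, delta_mx ord0 i) + b *: (delta_mx ord0 i, 0).
    by rewrite /e; congr pair; rewrite /= scaler0 ?addr0 ?add0r.
  by rewrite cliffordDl !cliffordZl clifford_vector clifford_form scalerN.
apply: (spin_op_ext _ (spin_op_comp (spin_op_opp n0)
  (ex_intro2 _ _ [:: e 1; e a] _ (fun t => erefl)))); last first.
  by rewrite /unit_product /= !ee ?oner_eq0// eqxx.
move=> w /=; rewrite /spin_act /= !eE invr1 !scale1r.
rewrite -!scaleNr !epsD !epsZ !iotD !iotZ eps_sqr iot_sqr.
apply/ffunP => I; have wE : w I = iot i (eps i w) I + eps i (iot i w) I.
  by rewrite -add_extE iot_eps.
by rewrite !(add_extE, scale_extE, opp_extE, ext0E) wE -aa; field.
Qed.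

(** The factor det^(-1/2) is multiplicative, so it suffices to lift elementary matrices:
    off-diagonal ones come from a null pair, diagonal ones from [spin_op_scaling]. *)
Lemma spin_op_pull A : (2 < n)%N -> 0 < \det A ->
  spin_op (fun w => (Num.sqrt (\det A))^-1 *: pull A w).
Proof.
move=> n2 dA; have := elementary_product_det dA.
suff H B : elementary_product B ->
    0 < \det B /\ spin_op (fun w => (Num.sqrt (\det B))^-1 *: pull B w) by case/H.
elim=> {B dA} [|i j c ij|i c c0|B C _ [dB IB] _ [dC IC]].
- rewrite det1; split=> //; apply: (spin_op_ext _ spin_op_id) => w /=.
  by rewrite sqrtr1 invr1 scale1r pull1.
- rewrite det_elementary (negPf ij) mul0r addr0; split=> //.
  apply: (spin_op_ext _ (spin_op_eps_iot c n2 ij)) => w /=.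
  by rewrite sqrtr1 invr1 scale1r pull_elementary.
- rewrite det_elementary eqxx mul1r; split=> //.
  apply: (spin_op_ext _ (spin_op_scaling i c0)) => w /=.
  by rewrite pull_elementary addrAC subrr add0r.
- rewrite det_mulmx mulr_gt0//; split=> //.
  apply: (spin_op_ext _ (spin_op_comp IC IB)) => w /=.
  by rewrite pullZ pullM scalerA sqrtrM ?ltW// invfM mulrC.
Qed.

(** A vector of square +1 is self-adjoint and acts with square -1, so it reverses the pairing; an
    even number of them preserves it. *)
Lemma mukai_spin_op g v w : ~~ odd n -> spin_op g -> mukai (g v) (g w) = mukai v w.
Proof.
move=> n_even [s /andP[us es] sg]; rewrite -!sg.
suff : mukai (spin_act s v) (spin_act s w) = (-1) ^+ size s * mukai v w.
  by rewrite -signr_odd (negPf es) mul1r.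
elim: s us {es sg} => [|x s IH] /=; first by rewrite mul1r.
move=> /andP[/eqP xx us]; rewrite mukai_clifford// clifford_sqr xx scaleN1r mukaiNr.
by rewrite (IH us) exprS mulN1r mulNr.
Qed.

Lemma chiral_spin_op e g w : spin_op g -> chiral e w -> chiral e (g w).
Proof.
move=> [s /andP[_ es] sg] hw; rewrite -sg.
suff : chiral (e (+) odd (size s)) (spin_act s w) by rewrite (negPf es) addbF.
elim: s {es sg} => [|x s IH] /=; first by rewrite addbF.
by rewrite addbN; exact: chiral_clifford.
Qed.

End SpinElements.

(** * Exponentials of two-forms *)

Section FormExponential.
Variables (R : realType) (n : nat).
Implicit Types (B C v w u : ext R n) (I J L : {set 'I_n}) (i j k : 'I_n).

Lemma wedge_iterC B C w (k : nat) : wedge B C = wedge C B ->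
  iter k (wedge B) (wedge C w) = wedge C (iter k (wedge B) w).
Proof. by move=> BC; elim: k => //= k ->; rewrite !wedgeA BC. Qed.

Lemma expactE B w : expact B w = \sum_(k < n.+1) (k`!%:R)^-1 *: iter k (wedge B) w.
Proof. by apply/ffunP => I; rewrite ffunE sum_ffunE; apply: eq_bigr => k _; rewrite scale_extE. Qed.

Lemma iter_wedge_low B w (k d : nat) I : homogeneous 2%N B ->
  (forall J, (#|J| < d)%N -> w J = 0) -> (#|I| < k.*2 + d)%N -> iter k (wedge B) w I = 0.
Proof.
move=> hB hw; elim: k I => [|k IH] I /= Ik; first exact: hw.
rewrite ffunE big1// => J JI; have [J2|J2] := eqVneq #|J| 2; last by rewrite hB// mul0r mulr0.
rewrite IH ?mulr0//; move: Ik; rewrite -(cardsID J I) (setIidPr JI) J2; lia.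
Qed.

(** As C commutes with B and squares to zero, the binomial formula leaves (B + C)^(k+1) = B^(k+1) +
    (k+1) B^k C. The sum in [expact] is truncated at n, so degrees have to be watched at the end. *)
Lemma expact_add_square0 B C w : homogeneous 2%N B -> homogeneous 2%N C -> wedge C C = 0 ->
  expact (B + C) w = expact B (w + wedge C w).
Proof.
move=> hB hC CC; have BC : wedge B C = wedge C B by exact: wedge_homogeneous2C.
have iterD (k : nat) : iter k.+1 (wedge (B + C)) w =
    iter k.+1 (wedge B) w + k.+1%:R *: wedge C (iter k (wedge B) w).
  elim: k => [|k IH]; first by rewrite /= wedgeDl scale1r.
  rewrite [LHS]iterS IH wedgeDl !wedgeDr !wedgeZr (wedgeA C C) CC wedge0l scaler0 addr0.
  rewrite (wedgeA B C) BC -wedgeA -(iterS k (wedge B)) -addrA; congr (_ + _).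
  by rewrite -[X in _ + X]scale1r -scalerDl natr1.
have iterD2 (k : nat) v1 v2 : iter k (wedge B) (v1 + v2) = iter k (wedge B) v1 + iter k (wedge B) v2.
  by elim: k => //= k ->; rewrite wedgeDr.
rewrite !expactE [in RHS](eq_bigr (fun k : 'I_n.+1 => (k`!%:R)^-1 *: iter k (wedge B) w +
    (k`!%:R)^-1 *: wedge C (iter k (wedge B) w))); last first.
  by move=> k _; rewrite iterD2 scalerDr wedge_iterC.
rewrite big_split/= [X in _ = X + _]big_ord_recl [LHS]big_ord_recl/= -addrA; congr (_ + _).
rewrite (eq_bigr (fun k : 'I_n => ((bump 0 k)`!%:R)^-1 *: iter (bump 0 k) (wedge B) w +
   (k`!%:R)^-1 *: wedge C (iter k (wedge B) w))); last first.
  move=> k _; rewrite /bump leq0n add1n add0n -(iterS k (wedge (B + C))) iterD scalerDr; congr (_ + _).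
  rewrite scalerA factS natrM invfM mulrC mulrA mulfV ?mul1r// pnatr_eq0//.
rewrite big_split; congr (_ + _).
(* The unmatched last term C B^n w equals B^n applied to C w, which starts in degree 2; it would
   live in degree at least 2n + 2 and so vanishes. *)
rewrite [RHS]big_ord_recr/= [X in _ = _ + X](_ : _ = 0) ?addr0//.
rewrite -wedge_iterC// (_ : iter _ _ _ = 0) ?scaler0//; apply/ffunP => I; rewrite ext0E.
apply: (@iter_wedge_low _ _ _ 2%N) => // [J J2|].
  by apply: (@iter_wedge_low C w 1 0 J) => //; rewrite addn0.
by have := max_card I; rewrite card_ord; lia.
Qed.

Lemma expact0 w : expact 0 w = w.
Proof.
rewrite expactE big_ord_recl/= invr1 scale1r big1 ?addr0// => k _.
by rewrite /= wedge0l scaler0.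
Qed.

(** A two-form is a sum of monomials c dx_i dx_j with vanishing square, so exponentials can be built
    up one monomial at a time. *)
Lemma homogeneous2_ind (P : ext R n -> Prop) :
  P 0 ->
  (forall B C, homogeneous 2%N B -> homogeneous 2%N C -> wedge C C = 0 ->
    (exists i j (c : R), forall w, wedge C w = c *: eps i (eps j w)) -> P B -> P (B + C)) ->
  forall B, homogeneous 2%N B -> P B.
Proof.
move=> P0 PD B hB; rewrite (ext_basis B).
suff [] : homogeneous 2%N (\sum_I B I *: dx R I) /\ P (\sum_I B I *: dx R I) by [].
elim: (index_enum _) => [|I r [hr Pr]].
  by rewrite big_nil; split=> // I _; rewrite ext0E.
rewrite big_cons; have [I2|I2] := eqVneq #|I| 2%N; last by rewrite hB// scale0r add0r.
have hI : homogeneous 2%N (B I *: dx R I).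
  by apply: homogeneousZ; rewrite -I2; exact: homogeneous_dx.
split; first exact: homogeneousD.
rewrite addrC; apply: PD => //.
  rewrite wedgeZl wedgeZr wedge_dx -setI_eq0 setIid -cards_eq0 I2 /=.
  by rewrite !scaler0.
have [i [j [ij IE]]] : exists i j, i != j /\ I = [set i; j] by apply/cards2P; rewrite I2.
exists i, j, (B I * wedge_sign R [set i] [set j]) => w.
rewrite /eps wedgeA wedge_dx disjoints1 inE ij !wedgeZl scalerA -mulrA wedge_sign_sqr mulr1.
by rewrite IE.
Qed.

Lemma expactD B C w : homogeneous 2%N B -> homogeneous 2%N C ->
  expact (B + C) w = expact B (expact C w).
Proof.
move=> hB hC; move: C hC w B hB; apply: homogeneous2_ind => [w B hB|C D hC hD DD _ IH w B hB].
  by rewrite addr0 expact0.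
rewrite addrA (expact_add_square0 _ (homogeneousD hB hC) hD DD).
by rewrite (expact_add_square0 _ hC hD DD) IH.
Qed.

Lemma expactK B w : homogeneous 2%N B -> expact (- B) (expact B w) = w.
Proof.
move=> hB; rewrite -expactD ?addNr ?expact0// -scaleN1r; exact: homogeneousZ.
Qed.

Lemma expactDr B v w : expact B (v + w) = expact B v + expact B w.
Proof.
have iterD (k : nat) : iter k (wedge B) (v + w) = iter k (wedge B) v + iter k (wedge B) w.
  by elim: k => //= k ->; rewrite wedgeDr.
by rewrite !expactE -big_split/=; apply: eq_bigr => k _; rewrite iterD scalerDr.
Qed.

Lemma expactZ B (a : R) w : expact B (a *: w) = a *: expact B w.
Proof.
have iterZ (k : nat) : iter k (wedge B) (a *: w) = a *: iter k (wedge B) w.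
  by elim: k => //= k ->; rewrite wedgeZr.
by rewrite !expactE scaler_sumr; apply: eq_bigr => k _; rewrite iterZ !scalerA mulrC.
Qed.

Lemma pull_expact A B w : pull A (expact B w) = expact (pull A B) (pull A w).
Proof.
have iterP (k : nat) : pull A (iter k (wedge B) w) = iter k (wedge (pull A B)) (pull A w).
  by elim: k => //= k <-; rewrite pull_wedge.
by rewrite !expactE pull_sum; apply: eq_bigr => k _; rewrite pullZ iterP.
Qed.

Lemma spin_op_expact B : (2 < n)%N -> homogeneous 2%N B -> spin_op (expact B).
Proof.
move=> n2 hB; move: B hB; apply: homogeneous2_ind => [|B C hB hC CC [i [j [c CE]]] IH].
  by apply: (spin_op_ext _ (@spin_op_id R n)) => w; rewrite expact0.
apply: (spin_op_ext _ (spin_op_comp IH (spin_op_eps_eps i j c n2))) => w /=.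
by rewrite expact_add_square0// CE.
Qed.

Lemma chiral_expact e B w : (2 < n)%N -> homogeneous 2%N B -> chiral e w -> chiral e (expact B w).
Proof. by move=> n2 hB; apply: chiral_spin_op; exact: spin_op_expact. Qed.

Lemma mukai_expact B v w : (2 < n)%N -> ~~ odd n -> homogeneous 2%N B ->
  mukai (expact B v) (expact B w) = mukai v w.
Proof. by move=> n2 n_even hB; apply: mukai_spin_op => //; exact: spin_op_expact. Qed.

End FormExponential.

(** * Pure spinors *)

Section PureSpinors.
Variables (C : numClosedFieldType) (n : nat).
Local Notation vec := ('rV[C]_n * 'rV[C]_n)%type.
Implicit Types (x y z u v w : vec) (rho : ext C n).

Definition edot_row (s : seq vec) (x : vec) : 'rV[C]_(size s) := \row_i edot x s`_i.

Fact edot_row_is_linear s : linear (edot_row s).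
Proof. by move=> a x y; apply/rowP => i; rewrite !mxE edotDl edotZl. Qed.

HB.instance Definition _ s := GRing.isLinear.Build C vec 'rV[C]_(size s) _ (edot_row s) (edot_row_is_linear s).

Definition perp (s : seq vec) : {vspace vec} := lker (linfun (edot_row s)).

Lemma mem_perp s x : x \in perp s -> forall y, y \in s -> edot x y = 0.
Proof.
rewrite memv_ker lfunE => /eqP/rowP xs y /(nthP 0)[i si <-].
by have := xs (Ordinal si); rewrite !mxE.
Qed.

Lemma dim_perp s (U : {vspace vec}) : (\dim U <= \dim (U :&: perp s) + size s)%N.
Proof.
rewrite -(limg_ker_dim (linfun (edot_row s)) U) leq_add2l.
by rewrite (leq_trans (dimvS (subvf _)))// dimvf /dim /= mul1n.
Qed.

Lemma dim_vec : \dim {: vec} = n.*2.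
Proof.
rewrite dimvf; have -> : dim vec = (1 * n + 1 * n)%N by [].
by rewrite !mul1n addnn.
Qed.

(** If dim L <= 2, the orthogonal space of L has dimension at least 2n - 2 >= 4, so it contains a
    and b independent modulo L. Over an algebraically closed field the quadratic form has a null
    vector b or a + t b; adjoining it to L contradicts maximality. *)
Lemma maximally_isotropic_dim (L : {vspace vec}) : (2 < n)%N ->
  (forall v w, v \in L -> w \in L -> edot v w = 0) ->
  (forall L' : {vspace vec}, (forall v w, v \in L' -> w \in L' -> edot v w = 0) ->
    (L <= L')%VS -> L' = L) ->
  (2 < \dim L)%N.
Proof.
move=> n2 iL mL; rewrite ltnNge; apply/negP => dL.
pose P := perp (vbasis L).
have PL x y : x \in P -> y \in L -> edot x y = 0.
  move=> xP /coord_vbasis ->; rewrite edotC.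
  have sumE (T : finType) (F : T -> vec) : edot (\sum_i F i) x = \sum_i edot (F i) x.
    by apply: (big_morph (fun t => edot t x)) => [a b|]; rewrite ?edotDl// -[0](scale0r (0 : vec)) edotZl mul0r.
  rewrite sumE big1// => i _; rewrite edotZl edotC (mem_perp xP) ?mulr0//.
  by rewrite memt_nth// size_tuple.
have dP : (n.*2 <= \dim P + 2)%N.
  have := dim_perp (vbasis L) {: vec}; rewrite dim_vec capfv size_tuple => h.
  by apply: (leq_trans h); rewrite leq_add2l.
have [a aP aL] : exists2 a, a \in P & a \notin L.
  apply/subvPn; apply/negP => /dimvS; move: n2 dP dL; rewrite -muln2; lia.
have [b bP bL] : exists2 b, b \in P & b \notin (L + <[a]>)%VS.
  apply/subvPn; apply/negP => /dimvS h.
  have := leq_trans h (dimv_add_leqif L <[a]>%VS); rewrite dim_vline; move: n2 dP dL; rewrite -muln2; lia.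
have [x [xP xL xx]] : exists x, [/\ x \in P, x \notin L & edot x x = 0].
  have [bb|bb] := eqVneq (edot b b) 0.
    by exists b; split=> //; apply: contra bL; apply/subvP; exact: addvSl.
  have [t tE] : exists t : C, edot b b * t ^+ 2 + 2 * edot a b * t + edot a a = 0.
    pose D := (edot a b) ^+ 2 - edot a a * edot b b.
    exists ((sqrtC D - edot a b) / edot b b).
    have := sqrtCK D; set r := sqrtC D; rewrite /D => rE.
    transitivity ((r ^+ 2 - (edot a b ^+ 2 - edot a a * edot b b)) / edot b b); first by field.
    by rewrite rE subrr mul0r.
  exists (a + t *: b); split; first by rewrite memvD// memvZ.
    apply: contra bL => abL; have [t0|t0] := eqVneq t 0.
      by move: abL; rewrite t0 scale0r addr0 (negPf aL).
    have -> : b = t^-1 *: (a + t *: b) + - t^-1 *: a.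
      by rewrite scalerDr scalerA mulVf// scale1r scaleNr addrAC subrr add0r.
    by apply: memv_add; rewrite memvZ// memv_line.
  rewrite edotDl !edotDr !edotZl !edotZr (edotC b a) -tE; ring.
have isoL v w : v \in (L + <[x]>)%VS -> w \in (L + <[x]>)%VS -> edot v w = 0.
  move=> /memv_addP[p pL [_ /vlineP[s ->] ->]] /memv_addP[q qL [_ /vlineP[t ->] ->]].
  rewrite edotDl !edotDr !edotZl !edotZr xx (PL x q)// (edotC p x) (PL x p)// iL//.
  by rewrite !mulr0 !addr0.
have LE := mL _ isoL (addvSl _ _).
by move: xL; rewrite -LE (subvP (addvSr _ _))// memv_line.
Qed.

Lemma edot_nondegenerate x : x != 0 -> exists y, edot x y != 0.
Proof.
move=> x0; have half : (2^-1 : C) != 0 by rewrite invr_eq0 pnatr_eq0.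
have [i xi] : exists i, (x.1 ord0 i != 0) || (x.2 ord0 i != 0).
  apply/existsP; apply: contraNT x0 => /existsPn h; apply/eqP.
  have h1 i : x.1 ord0 i = 0 /\ x.2 ord0 i = 0.
    by have := h i; rewrite negb_or !negbK => /andP[/eqP-> /eqP->].
  rewrite [x]surjective_pairing; congr pair; apply/rowP => i; rewrite mxE;
    by case: (h1 i).
case/orP: xi => xi.
  exists (0, delta_mx ord0 i); rewrite /edot (bigD1 i)//= big1 ?addr0 => [|j ji].
    by rewrite !mxE !eqxx mulr0 add0r mul1r mulf_neq0.
  by rewrite !mxE (negPf ji) mulr0 mul0r addr0.
exists (delta_mx ord0 i, 0); rewrite /edot (bigD1 i)//= big1 ?addr0 => [|j ji].
  by rewrite !mxE !eqxx mulr1 mul0r addr0 mulf_neq0.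
by rewrite !mxE (negPf ji) mulr0 mul0r addr0.
Qed.

Hypothesis n2 : (2 < n)%N.
Hypothesis n_even : ~~ odd n.
Hypothesis n_skew : odd 'C(n.+1, 2).

Lemma mukai_skew rho (sigma : ext C n) : mukai rho sigma = - mukai sigma rho.
Proof. by rewrite mukaiC -signr_odd n_skew mulN1r. Qed.

Lemma clifford_swap x y rho : edot x y = 0 -> clifford x (clifford y rho) = - clifford y (clifford x rho).
Proof.
move=> xy; apply/eqP; rewrite -addr_eq0 clifford_anticomm xy mulr0 oppr0 scale0r//.
Qed.

Lemma cliffordN x rho : clifford x (- rho) = - clifford x rho.
Proof. by rewrite -scaleN1r cliffordZ scaleN1r. Qed.

(** Dimension 3 is what it takes for the annihilator to contain a nonzero vector orthogonal to two
    given ones. *)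
Definition large_annihilator rho := exists2 L : {vspace vec},
  (forall v, v \in L -> clifford v rho = 0) & (2 < \dim L)%N.

(* The component of rho (x) rho in the second exterior power of E vanishes:
   insert a vector u of the annihilator orthogonal to v and w. *)
Lemma pure_moment rho v w : large_annihilator rho -> mukai rho (clifford v (clifford w rho)) = 0.
Proof.
move=> [L Lann dL].
have [u uL /and3P[u0 /eqP uv /eqP uw]] :
    exists2 u, u \in L & [&& u != 0, edot u v == 0 & edot u w == 0].
  have dU := dim_perp [:: v; w] L.
  exists (vpick (L :&: perp [:: v; w])); first by have := memv_pick (L :&: perp [:: v; w]); rewrite memv_cap => /andP[].
  apply/and3P; split.
  - by rewrite vpick0 -dimv_eq0; move: dU dL => /=; lia.
  - have := memv_pick (L :&: perp [:: v; w]); rewrite memv_cap => /andP[_ /mem_perp ->]//.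
    by rewrite inE eqxx.
  - have := memv_pick (L :&: perp [:: v; w]); rewrite memv_cap => /andP[_ /mem_perp ->]//.
    by rewrite !inE eqxx orbT.
have [z uz] := edot_nondegenerate u0.
have urho : clifford u rho = 0 by exact/Lann.
have : mukai rho (clifford u (clifford v (clifford w (clifford z rho)))) = 0.
  by rewrite -mukai_clifford// urho mukai0l.
rewrite (clifford_swap _ uv) (clifford_swap _ uw) cliffordN opprK.
have -> : clifford u (clifford z rho) = - (2 * edot u z) *: rho.
  by rewrite -clifford_anticomm urho clifford0 addr0.
rewrite !cliffordZ mukaiZr => /eqP; rewrite mulf_eq0 oppr_eq0 mulf_eq0 pnatr_eq0 (negPf uz)/=.
by move/eqP.
Qed.

(** Take v in the annihilator of rho0 and z with v.z nonzero, so that v . z . rho0 = -2 (v.z) rho0.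
    In the vanishing moment of rho = rho0 + d only the pairing of d with this multiple of rho0 and
    the term quadratic in d survive; solving for the first gives the normalisation of the
    witness. *)
Lemma pure_second_order rho0 : large_annihilator rho0 -> exists v w, forall rho, large_annihilator rho ->
  mukai rho0 (rho - rho0) = mukai (rho - rho0) (clifford v (clifford w (rho - rho0))).
Proof.
move=> p0; have [L Lann dL] := p0.
have v0 : vpick L != 0 by rewrite vpick0 -dimv_eq0; lia.
have vrho : clifford (vpick L) rho0 = 0 by apply/Lann; exact: memv_pick.
have [z vz] := edot_nondegenerate v0.
set v := vpick L in v0 vrho vz.
exists (- (2 * edot v z)^-1 *: v), z => rho p1.
have := pure_moment v z p1; rewrite -{1 2}(subrK rho0 rho) addrC.
move: (rho - rho0) => d.
have vzrho : mukai rho0 (clifford v (clifford z d)) = 0.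
  by rewrite -mukai_clifford// vrho mukai0l.
rewrite !cliffordD mukaiDl !mukaiDr (pure_moment v z p0) vzrho !add0r.
have -> : clifford v (clifford z rho0) = - (2 * edot v z) *: rho0.
  by rewrite -clifford_anticomm vrho clifford0 addr0.
rewrite mukaiZr mukai_skew cliffordZl mukaiZr => /eqP; rewrite addrC addr_eq0 => /eqP ->.
by field; rewrite vz.
Qed.

End PureSpinors.

From mathcomp Require Import all_classical all_reals all_analysis.
Import numFieldNormedType.Exports.
Local Open Scope classical_set_scope.
Local Open Scope ring_scope.

(** * Calculus of C^k functions *)

Lemma nbhs_forall (T : topologicalType) (I : finType) (x : T) (P : I -> T -> Prop) :
  (forall i, \forall y \near x, P i y) -> \forall y \near x, forall i, P i y.
Proof. by move=> H; exact: filter_forall. Qed.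

Lemma near_norm0 (R : realType) (V : normedModType R) (r : R) (P : V -> Prop) : 0 < r ->
  (forall v, `|v| < r -> P v) -> \forall v \near (0 : V), P v.
Proof.
move=> r0 H; apply/nbhs_ballP; exists r => // v.
by rewrite -ball_normE /ball_/= sub0r normrN; exact: H.
Qed.

Lemma near_normP (R : realType) (V : normedModType R) (x : V) (P : V -> Prop) : (\forall y \near x, P y) ->
  exists2 d : R, 0 < d & forall v, `|v| < d -> P (x + v).
Proof.
move=> /nbhs_ballP[d /= d0 H]; exists d => // v vd; apply: H.
by rewrite -ball_normE /ball_/= opprD addNKr normrN.
Qed.

Section DerivativeEstimates.
Variable R : realType.
Implicit Types (g : R -> R) (t l e h : R).

Lemma is_derive1P g t l : is_derive t 1 g l <->
  forall e, 0 < e -> \forall h \near (0 : R), `|g (t + h) - g t - h * l| <= e * `|h|.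
Proof.
have quotE h : h != 0 -> forall e,
    (`|l - h^-1 *: ((g \o shift t) (h *: 1) - g t)| <= e) = (`|g (t + h) - g t - h * l| <= e * `|h|).
  move=> h0 e; rewrite -ler_pdivrMr ?normr_gt0// -normfV -normrM distrC.
  congr (`|_| <= _); rewrite /= [h *: 1]mulr1 [h + t]addrC [_ *: _]mulrC mulrBl.
  by field.
split=> [gl e e0|H].
  have : (h^-1 *: ((g \o shift t) (h *: (1 : R)) - g t)) @[h --> 0^'] --> l.
    by case: gl => d <-; exact: d.
  move=> /cvgrPdist_le/(_ _ e0); rewrite near_withinE; apply: filterS => h Hh.
  have [->|h0] := eqVneq h 0; first by rewrite addr0 subrr mul0r subr0 !normr0 mulr0.
  by rewrite -quotE//; exact: Hh.
have C : (h^-1 *: ((g \o shift t) (h *: (1 : R)) - g t)) @[h --> 0^'] --> l.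
  apply/cvgrPdist_le => e e0; rewrite near_withinE; near=> h => h0.
  by rewrite quotE//; near: h; exact: H.
split; first by apply/cvg_ex; exists l.
exact: (cvg_lim _ C).
Unshelve. all: by end_near. Qed.

(** Mean value inequality for increments of either sign, bounding the error of a linearisation by
    the oscillation of the derivative. Taylor expansion, symmetry of mixed partials and
    differentiation under the integral all use it. *)
Lemma MVT_abs g (dg : R -> R) t c l e :
  (forall h, `|h| <= `|c| -> is_derive (t + h) 1 g (dg h)) ->
  (forall h, `|h| <= `|c| -> `|dg h - l| <= e) ->
  `|g (t + c) - g t - c * l| <= e * `|c|.
Proof.
move=> dgE dge.
have [c0|c0|->] := ltgtP c 0; last by rewrite addr0 subrr mul0r subr0 normr0 mulr0.
  have D x : x \in `[t + c, t] -> is_derive x 1 g (dg (x - t)).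
    rewrite in_itv/= => /andP[x1 x2]; have -> : x = t + (x - t) by rewrite addrC subrK.
    rewrite [t + (x - t) - t]addrC addKr; apply: dgE.
    by rewrite (ler0_norm (ltW c0)) ler0_norm ?subr_le0//; lra.
  have tc : t + c < t by lra.
  have D' x : x \in `]t + c, t[ -> is_derive x 1 g (dg (x - t)) by move=> /subset_itv_oo_cc/D.
  have cg : {within `[t + c, t], continuous g}.
    by apply: derivable_within_continuous => x /D [].
  have [x xc xE] := MVT tc D' cg.
  have -> : g (t + c) - g t - c * l = (dg (x - t) - l) * c.
    rewrite -[g (t + c) - g t]opprB xE; ring.
  rewrite normrM ler_wpM2r//; apply: dge.
  move: xc; rewrite in_itv/= => /andP[x1 x2].
  by rewrite (ler0_norm (ltW c0)) ler0_norm ?subr_le0//; lra.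
have D x : x \in `[t, t + c] -> is_derive x 1 g (dg (x - t)).
  rewrite in_itv/= => /andP[x1 x2]; have -> : x = t + (x - t) by rewrite addrC subrK.
  rewrite [t + (x - t) - t]addrC addKr; apply: dgE.
  by rewrite (gtr0_norm c0) ger0_norm ?subr_ge0//; lra.
have tc : t < t + c by lra.
have D' x : x \in `]t, t + c[ -> is_derive x 1 g (dg (x - t)) by move=> /subset_itv_oo_cc/D.
have cg : {within `[t, t + c], continuous g}.
  by apply: derivable_within_continuous => x /D [].
have [x xc xE] := MVT tc D' cg.
have -> : g (t + c) - g t - c * l = (dg (x - t) - l) * c.
  rewrite xE; ring.
rewrite normrM ler_wpM2r//; apply: dge.
move: xc; rewrite in_itv/= => /andP[x1 x2].
by rewrite (gtr0_norm c0) ger0_norm ?subr_ge0//; lra.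
Qed.

End DerivativeEstimates.

Section RowVectors.
Variables (R : realType) (n : nat).
Implicit Types (x v : 'rV[R]_n) (i j : 'I_n).

Definition unit_row i : 'rV[R]_n := delta_mx ord0 i.

Lemma coord_le_norm v i : `|v ord0 i| <= `|v|.
Proof.
by rewrite [`|v|]mx_normrE; apply: (le_bigmax _ (fun k : 'I_1 * 'I_n => `|v k.1 k.2|) (ord0, i)).
Qed.

Lemma norm_le_coord v (c : R) : 0 <= c -> (forall i, `|v ord0 i| <= c) -> `|v| <= c.
Proof.
by move=> c0 vc; rewrite [`|v|]mx_normrE; apply: bigmax_le => // -[i j] _ /=; rewrite ord1.
Qed.

Lemma norm_unit_row i : `|unit_row i| = 1.
Proof.
apply/eqP; rewrite eq_le norm_le_coord//=; last first.
  by move=> j; rewrite mxE eqxx/=; case: eqP => _; rewrite ?normr1// normr0.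
by apply: le_trans (coord_le_norm _ i); rewrite mxE !eqxx normr1.
Qed.

Lemma row_sum_unit v : v = \sum_i v ord0 i *: unit_row i.
Proof.
rewrite {1}[v]matrix_sum_delta big_ord1.
by apply: eq_bigr => i _.
Qed.

End RowVectors.

Section PartialDerivatives.
Variables (R : realType) (n : nat).
Implicit Types (x v : 'rV[R]_n) (i j : 'I_n) (f g : 'rV[R]_n -> R) (U V : set 'rV[R]_n).
Local Notation e := (@unit_row R n).

Definition has_partial i f x := derivable (fun h : R => f (x + h *: e i)) 0 1.

Lemma is_derive_partial i f x (t : R) : has_partial i f (x + t *: e i) ->
  is_derive t 1 (fun h : R => f (x + h *: e i)) (partial i f (x + t *: e i)).
Proof.
move=> D; apply/is_derive1P => d d0.
have : is_derive (0 : R) 1 (fun h : R => f (x + t *: e i + h *: e i)) (partial i f (x + t *: e i)).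
  by rewrite /partial derive1E; exact/derivableP.
move=> /is_derive1P/(_ _ d0); apply: filterS => h.
by rewrite add0r scale0r addr0 scalerDl addrA.
Qed.

Lemma partialP i f x l : is_derive (0 : R) 1 (fun h : R => f (x + h *: e i)) l <->
  has_partial i f x /\ partial i f x = l.
Proof.
rewrite /has_partial /partial derive1E; split=> [fl|[D <-]]; last exact/derivableP.
by split; [exact: ex_derive|exact: derive_val].
Qed.

Definition C1_at f x := (\forall y \near x, forall i, has_partial i f y) /\
  forall i, {for x, continuous (partial i f)}.

Definition gradient f x v := \sum_i v ord0 i * partial i f x.

Lemma taylor1 f x : C1_at f x -> forall d : R, 0 < d ->
  \forall v \near (0 : 'rV[R]_n), `|f (x + v) - f x - gradient f x v| <= d * `|v|.
Proof.
move=> [/near_normP[r1 r10 H1] H2] d d0.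
(* Each of the n coordinate steps below may cost this much; the denominator n + 1 also covers n =
   0. *)
have [r2 r20 H3] : exists2 r, 0 < r & forall v, `|v| < r ->
    forall i, `|partial i f (x + v) - partial i f x| <= d / (n%:R + 1).
  apply: (near_normP (P := fun y => forall i, `|partial i f y - partial i f x| <= d / (n%:R + 1))).
  apply: (@nbhs_forall _ 'I_n x (fun i y => `|partial i f y - partial i f x| <= d / (n%:R + 1))) => i.
  have dn : 0 < d / (n%:R + 1) by rewrite divr_gt0// ltr_wpDl.
  by have := H2 i; move/cvgrPdistC_le => /(_ _ dn).
pose r := Num.min r1 r2; have r0 : 0 < r by rewrite lt_min r10.
apply: (near_norm0 r0) => v vr.
(* The path from x to x + v changes one coordinate at a time: [p k] keeps the first k coordinates of
   v. *)
pose p (k : nat) : 'rV[R]_n := \row_j (if (j < k)%N then v ord0 j else 0).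
have pv k (h : R) (i : 'I_n) : `|h| <= `|v ord0 i| -> (k <= i)%N -> `|p k + h *: e i| <= `|v|.
  move=> hv ki; apply: norm_le_coord => // j; rewrite !mxE eqxx/=.
  have [->|ji] := eqVneq j i; first by rewrite ltnNge ki/= add0r mulr1 (le_trans hv)// coord_le_norm.
  by rewrite mulr0 addr0; case: ifP => _; rewrite ?normr0// coord_le_norm.
have step k (kn : (k < n)%N) : p k.+1 = p k + v ord0 (Ordinal kn) *: e (Ordinal kn).
  apply/rowP => j; rewrite !mxE eqxx/= ltnS leq_eqVlt -val_eqE/=.
  case: eqP => [jk|_]/=; last by rewrite mulr0 addr0.
  by rewrite jk ltnn add0r mulr1; congr (v _ _); exact: val_inj.
have S k : (k <= n)%N -> `|f (x + p k) - f x - \sum_(i < n | (i < k)%N) v ord0 i * partial i f x|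
    <= k%:R * (d / (n%:R + 1) * `|v|).
  elim: k => [_|k IH kn].
    rewrite mul0r (_ : p 0%N = 0) ?addr0; last by apply/rowP => j; rewrite !mxE.
    by rewrite subrr big_pred0// subr0 normr0.
  rewrite step; set i := Ordinal kn.
  have B : `|f (x + (p k + v ord0 i *: e i)) - f (x + p k) - v ord0 i * partial i f x|
      <= d / (n%:R + 1) * `|v|.
    have := @MVT_abs R (fun h => f (x + p k + h *: e i)) (fun h => partial i f (x + p k + h *: e i))
      0 (v ord0 i) (partial i f x) (d / (n%:R + 1)).
    rewrite add0r scale0r addr0 addrA => B; apply: (le_trans (B _ _)) => [h hv|h hv|].
    - rewrite add0r; apply: is_derive_partial; rewrite -addrA; apply: H1.
      by apply: le_lt_trans (pv _ _ _ hv _) _ => //; apply: (lt_le_trans vr); rewrite ge_min lexx.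
    - rewrite -addrA; apply: H3.
      by apply: le_lt_trans (pv _ _ _ hv _) _ => //; apply: (lt_le_trans vr); rewrite ge_min lexx orbT.
    - rewrite ler_wpM2l ?coord_le_norm// divr_ge0 ?(ltW d0)// addr_ge0//.
  rewrite (bigD1 i)//= (eq_bigl (fun j : 'I_n => (j < k)%N)); last first.
    move=> j; rewrite ltnS [(j <= k)%N]leq_eqVlt -val_eqE/=.
    by case: ltngtP.
  have -> : f (x + (p k + v ord0 i *: e i)) - f x -
     (v ord0 i * partial i f x + \sum_(j < n | (j < k)%N) v ord0 j * partial j f x) =
    (f (x + (p k + v ord0 i *: e i)) - f (x + p k) - v ord0 i * partial i f x) +
    (f (x + p k) - f x - \sum_(j < n | (j < k)%N) v ord0 j * partial j f x) by ring.
  apply: (le_trans (ler_normD _ _)); rewrite -natr1 mulrDl mul1r addrC.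
  by apply: lerD => //; apply: IH; exact: ltnW.
have pn : p n = v by apply/rowP => j; rewrite mxE ltn_ord.
have := S n (leqnn n); rewrite pn (eq_bigl xpredT); last by move=> i; rewrite ltn_ord.
move/le_trans; apply; rewrite mulrA ler_wpM2r// mulrCA ger_pMr//.
by rewrite ler_pdivrMr ?mul1r ?lerDl// ltr_wpDl.
Qed.

End PartialDerivatives.

Section ChainRule.
Variables (R : realType) (m : nat).

Lemma is_derive_chain (f : 'rV[R]_m -> R) (c : R -> 'rV[R]_m) (t : R) (dc : 'rV[R]_m) :
  C1_at f (c t) -> (forall j, is_derive t 1 (fun s => c s ord0 j) (dc ord0 j)) ->
  is_derive t 1 (f \o c) (gradient f (c t) dc).
Proof.
move=> fC1 cD; apply/is_derive1P => e e0.
pose C := `|dc| + 1; have C0 : 0 < C by rewrite ltr_wpDl.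
pose G := \sum_j `|partial j f (c t)| + 1.
have G0 : 0 < G by rewrite ltr_wpDl// sumr_ge0.
(* The bound 1 yields |v| <= C |h| for the increment v of the curve; the other bound keeps the error
   of the linear part below e/2. *)
pose d2 := Num.min 1 (e / 2 / G).
have d20 : 0 < d2 by rewrite lt_min ltr01 !divr_gt0.
have d1 : 0 < e / 2 / C by rewrite !divr_gt0.
have /near_normP[r r0 Hf] := taylor1 fC1 d1.
have : \forall h \near (0 : R), forall j, `|c (t + h) ord0 j - c t ord0 j - h * dc ord0 j| <= d2 * `|h|.
  apply: (@nbhs_forall _ 'I_m (0 : R) (fun j h => `|c (t + h) ord0 j - c t ord0 j - h * dc ord0 j| <= d2 * `|h|)) => j.
  by have /is_derive1P/(_ _ d20) := cD j.
have : \forall h \near (0 : R), C * `|h| < r.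
  apply: (@near_norm0 _ _ (r / C)); first by rewrite divr_gt0.
  by move=> h; rewrite ltr_pdivlMr// mulrC.
apply: filterS2 => h hr hj /=.
set v := c (t + h) - c t.
have vh j : `|v ord0 j - h * dc ord0 j| <= d2 * `|h| by have := hj j; rewrite /v !mxE.
have vC : `|v| <= C * `|h|.
  apply: norm_le_coord => [|j]; first by rewrite mulr_ge0// ltW.
  rewrite -[v ord0 j](subrK (h * dc ord0 j)); apply: (le_trans (ler_normD _ _)).
  apply: (le_trans (lerD (vh j) (lexx _))); rewrite normrM -[_ * `|dc ord0 j|]mulrC -mulrDl.
  rewrite ler_wpM2r// /C addrC lerD ?coord_le_norm//.
  by rewrite /d2 ge_min lexx.
have cE : c (t + h) = c t + v by rewrite /v [RHS]addrC subrK.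
have := Hf v (le_lt_trans vC hr); rewrite add0r => Hv.
have -> : f (c (t + h)) - f (c t) - h * gradient f (c t) dc =
   (f (c t + v) - f (c t) - gradient f (c t) v) + (gradient f (c t) v - h * gradient f (c t) dc).
  by rewrite cE; ring.
apply: (le_trans (ler_normD _ _)).
have -> : e * `|h| = e / 2 * `|h| + e / 2 * `|h| by rewrite -mulrDl -splitr.
apply: lerD.
  apply: (le_trans Hv); apply: (le_trans (ler_wpM2l (ltW d1) vC)).
  by rewrite mulrA divfK// gt_eqF.
rewrite /gradient mulr_sumr -sumrB; apply: (le_trans (ler_norm_sum _ _ _)).
apply: (@le_trans _ _ (\sum_j (d2 * `|h| * `|partial j f (c t)|))).
  by apply: ler_sum => j _; rewrite mulrA -mulrBl normrM ler_wpM2r.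
rewrite -mulr_sumr mulrAC ler_wpM2r//.
apply: (@le_trans _ _ (e / 2 / G * G)); last by rewrite divfK// gt_eqF.
apply: ler_pM => //; [exact: ltW|by apply: sumr_ge0|by rewrite /d2 ge_min lexx orbT|].
by rewrite /G lerDl.
Qed.

End ChainRule.

Lemma continuous_at_ext (S T : topologicalType) (U : set S) (f g : S -> T) x : open U -> U x ->
  (forall y, U y -> f y = g y) -> {for x, continuous f} -> {for x, continuous g}.
Proof.
move=> Uo Ux fg cf; suff : g @ x --> g x by [].
rewrite -fg//; apply: cvg_trans cf; apply: near_eq_cvg.
by have := open_nbhs_nbhs (conj Uo Ux); apply: filterS => y /fg ->.
Qed.

Lemma continuous_at_row (R : realType) (S : topologicalType) m (T : S -> 'rV[R]_m) x :
  (forall j, {for x, continuous (fun y => T y ord0 j)}) -> {for x, continuous T}.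
Proof.
move=> H; apply/cvgrPdist_le => e e0.
have : \forall y \near x, forall j, `|T x ord0 j - T y ord0 j| <= e.
  by apply: nbhs_forall => j; have /cvgrPdist_le/(_ _ e0) := H j.
apply: filterS => y Hy; apply: norm_le_coord => [|j]; first exact: ltW.
by rewrite !mxE.
Qed.

Section SmoothFunctions.
Variables (R : realType).

(** Finite order of differentiability lets closure properties be proved by induction on the order;
    [smooth_onP] identifies smoothness with all orders at once. *)
Fixpoint Ck n (k : nat) (U : set 'rV[R]_n) (f : 'rV[R]_n -> R) : Prop :=
  (forall x, U x -> {for x, continuous f}) /\
  match k with
  | 0 => True
  | k'.+1 => forall i, (forall x, U x -> has_partial i f x) /\ Ck k' U (partial i f)
  end.

Lemma Ck_continuous n k (U : set 'rV[R]_n) f x : Ck k U f -> U x -> {for x, continuous f}.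
Proof. by case: k => [|k] [H _] Ux; exact: H. Qed.

Lemma CkS n k (U : set 'rV[R]_n) f : Ck k.+1 U f -> Ck k U f.
Proof.
elim: k f => [|k IH] f [cf Hf]; first by split.
by split=> // i; have [D H] := Hf i; split => //; exact: IH.
Qed.

Lemma Ck_has_partial n k (U : set 'rV[R]_n) f i x : Ck k.+1 U f -> U x -> has_partial i f x.
Proof. by move=> [_ H] Ux; have [D _] := H i; exact: D. Qed.

Lemma Ck_partial n k (U : set 'rV[R]_n) f i : Ck k.+1 U f -> Ck k U (partial i f).
Proof. by move=> [_ H]; have [] := H i. Qed.

Lemma Ck_subset n k (U V : set 'rV[R]_n) f : V `<=` U -> Ck k U f -> Ck k V f.
Proof.
move=> VU; elim: k f => [|k IH] f [cf Hf]; first by split=> // x /VU; exact: cf.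
split=> [x /VU|i]; first exact: cf.
by have [D H] := Hf i; split=> [x /VU|]; [exact: D|exact: IH].
Qed.

Lemma near_line n (U : set 'rV[R]_n) x (v : 'rV[R]_n) : open U -> U x ->
  \forall h \near (0 : R), U (x + h *: v).
Proof.
move=> Uo Ux; have /near_normP[r r0 H] := open_nbhs_nbhs (conj Uo Ux).
apply: (@near_norm0 _ _ (r / (`|v| + 1))); first by rewrite divr_gt0// ltr_wpDl.
move=> h; rewrite ltr_pdivlMr ?ltr_wpDl// => hr; apply: H.
by rewrite normrZ; apply: le_lt_trans hr; rewrite ler_wpM2l// lerDl.
Qed.

Lemma partial_ext n (U : set 'rV[R]_n) f g i x : open U -> U x -> (forall y, U y -> f y = g y) ->
  partial i f x = partial i g x.
Proof.
move=> Uo Ux fg; rewrite /partial !derive1E; apply: near_eq_derive => //.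
by have := near_line (unit_row R i) Uo Ux; apply: filterS => h Uh; exact: fg.
Qed.

Lemma has_partial_ext n (U : set 'rV[R]_n) f g i x : open U -> U x -> (forall y, U y -> f y = g y) ->
  has_partial i f x -> has_partial i g x.
Proof.
move=> Uo Ux fg; apply: near_eq_derivable.
by have := near_line (unit_row R i) Uo Ux; apply: filterS => h Uh; exact: fg.
Qed.

Lemma Ck_ext n k (U : set 'rV[R]_n) f g : open U -> (forall x, U x -> f x = g x) ->
  Ck k U f -> Ck k U g.
Proof.
move=> Uo; elim: k f g => [|k IH] f g fg [cf Hf].
  by split=> // x Ux; exact: (continuous_at_ext Uo Ux fg (cf x Ux)).
split=> [x Ux|i]; first exact: (continuous_at_ext Uo Ux fg (cf x Ux)).
have [D H] := Hf i; split=> [x Ux|]; first exact: (has_partial_ext Uo Ux fg (D _ Ux)).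
by apply: IH H => x Ux; exact: partial_ext fg.
Qed.

Lemma Ck_C1_at n k (U : set 'rV[R]_n) f x : open U -> Ck k.+1 U f -> U x -> C1_at f x.
Proof.
move=> Uo fC Ux; split=> [|i].
  have := open_nbhs_nbhs (conj Uo Ux); apply: filterS => y Uy i.
  exact: Ck_has_partial fC Uy.
exact: Ck_continuous (Ck_partial i fC) Ux.
Qed.

Lemma smooth_onP n (U : set 'rV[R]_n) f : smooth_on U f <-> open U /\ forall k, Ck k U f.
Proof.
split=> [[Uo H]|[Uo H]]; split=> //.
  move=> k; elim: k f H => [|k IH] f H; first by split=> // x Ux; have [] := H [::] x Ux.
  split=> [x Ux|i]; first by have [] := H [::] x Ux.
  split=> [x Ux|]; first by have [_ /(_ i)] := H [::] x Ux.
  apply: IH => s x Ux; have := H (rcons s i) x Ux; by rewrite foldr_rcons.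
move=> s; elim/last_ind: s f H => [|s i IH] f H x Ux.
  rewrite /=; split; first exact: Ck_continuous (H 0%N) Ux.
  by move=> i; exact: Ck_has_partial (H 1%N) Ux.
by rewrite foldr_rcons; apply: IH => // k; exact: Ck_partial (H k.+1).
Qed.

Lemma Ck_local n k (U : set 'rV[R]_n) f :
  (forall x, U x -> exists2 V, open V & V x /\ Ck k V f) -> Ck k U f.
Proof.
elim: k f => [|k IH] f H.
  by split=> // x /H[V _ [Vx cV]]; exact: Ck_continuous cV Vx.
split=> [x /H[V _ [Vx cV]]|i]; first exact: Ck_continuous cV Vx.
split=> [x /H[V _ [Vx cV]]|]; first exact: Ck_has_partial cV Vx.
by apply: IH => x /H[V Vo [Vx cV]]; exists V => //; split=> //; exact: Ck_partial cV.
Qed.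

Lemma partial_cst n (c : R) i : partial i (fun _ : 'rV[R]_n => c) = fun=> 0.
Proof. by apply/funext => x; rewrite /partial derive1E derive_cst. Qed.

Lemma Ck_cst n k (U : set 'rV[R]_n) (c : R) : Ck k U (fun=> c).
Proof.
elim: k c => [|k IH] c; first by split=> // x _; exact: cst_continuous.
split=> [x _|i]; first exact: cst_continuous.
by split=> [x _|]; [exact: derivable_cst|rewrite partial_cst].
Qed.

Lemma is_derive_coord n (x v : 'rV[R]_n) j (t : R) :
  is_derive t 1 (fun h => (x + h *: v) ord0 j) (v ord0 j).
Proof.
apply/is_derive1P => e e0; near=> h; rewrite !mxE.
by rewrite (_ : _ - _ = 0) ?normr0 ?mulr_ge0// 1?ltW//; ring.
Unshelve. all: by end_near. Qed.

Lemma Ck_coord n k (U : set 'rV[R]_n) j : Ck k U (fun x => x ord0 j).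
Proof.
have cj x : {for x, continuous (fun x : 'rV[R]_n => x ord0 j)} by exact: coord_continuous.
have D i x : is_derive (0 : R) 1 (fun h : R => (x + h *: unit_row R i) ord0 j) ((i == j)%:R).
  have := is_derive_coord x (unit_row R i) j 0; by rewrite [unit_row _ _ _ _]mxE eqxx/= eq_sym.
case: k => [|k]; split=> // i.
split=> [x _|]; first by case: ((partialP i (fun y => y ord0 j) x _).1 (D i x)).
rewrite (_ : partial i _ = fun=> (i == j)%:R); first exact: Ck_cst.
by apply/funext => x; case: ((partialP i (fun y => y ord0 j) x _).1 (D i x)).
Qed.

Lemma Ck_partialE n k (U : set 'rV[R]_n) f (df : 'I_n -> 'rV[R]_n -> R) : open U ->
  (forall x, U x -> {for x, continuous f}) ->
  (forall i x, U x -> is_derive (0 : R) 1 (fun h : R => f (x + h *: unit_row R i)) (df i x)) ->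
  (forall i, Ck k U (df i)) -> Ck k.+1 U f.
Proof.
move=> Uo cf D H; split=> // i; split=> [x Ux|]; first by have /partialP[] := D i x Ux.
by apply: (Ck_ext Uo _ (H i)) => x Ux; have /partialP[] := D i x Ux.
Qed.

Lemma Ck_is_derive n k (U : set 'rV[R]_n) f i x : Ck k.+1 U f -> U x ->
  is_derive (0 : R) 1 (fun h : R => f (x + h *: unit_row R i)) (partial i f x).
Proof. by move=> fC Ux; apply/partialP; split=> //; exact: Ck_has_partial fC Ux. Qed.

Lemma Ck_add n k (U : set 'rV[R]_n) f g : open U -> Ck k U f -> Ck k U g -> Ck k U (fun x => f x + g x).
Proof.
move=> Uo; elim: k f g => [|k IH] f g fC gC.
  by split=> // x Ux; apply: continuousD; [exact: Ck_continuous fC Ux|exact: Ck_continuous gC Ux].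
apply: (Ck_partialE (df := fun i x => partial i f x + partial i g x)) => //.
- by move=> x Ux; apply: continuousD; [exact: Ck_continuous fC Ux|exact: Ck_continuous gC Ux].
- by move=> i x Ux; apply: is_deriveD; [exact: Ck_is_derive fC Ux|exact: Ck_is_derive gC Ux].
- by move=> i; apply: IH; exact: Ck_partial.
Qed.

Lemma Ck_mul n k (U : set 'rV[R]_n) f g : open U -> Ck k U f -> Ck k U g -> Ck k U (fun x => f x * g x).
Proof.
move=> Uo; elim: k f g => [|k IH] f g fC gC.
  by split=> // x Ux; apply: continuousM; [exact: Ck_continuous fC Ux|exact: Ck_continuous gC Ux].
apply: (Ck_partialE (df := fun i x => f x * partial i g x + g x * partial i f x)) => //.
- by move=> x Ux; apply: continuousM; [exact: Ck_continuous fC Ux|exact: Ck_continuous gC Ux].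
- move=> i x Ux; have := is_deriveM (Ck_is_derive i fC Ux) (Ck_is_derive i gC Ux).
  by rewrite scale0r addr0.
- by move=> i; apply: Ck_add => //; apply: IH; (try exact: CkS); exact: Ck_partial.
Qed.

Lemma Ck_sum n k (U : set 'rV[R]_n) (T : Type) (r : seq T) (P : pred T) (F : T -> 'rV[R]_n -> R) :
  open U -> (forall a, P a -> Ck k U (F a)) -> Ck k U (fun x => \sum_(a <- r | P a) F a x).
Proof.
move=> Uo H; rewrite (_ : (fun x => _) = \sum_(a <- r | P a) F a); last by apply/funext => x; rewrite fct_sumE.
apply: (big_ind (Ck k U)) => //; first exact: Ck_cst.
by move=> f g; exact: Ck_add.
Qed.

Lemma Ck_prod n k (U : set 'rV[R]_n) (T : Type) (r : seq T) (P : pred T) (F : T -> 'rV[R]_n -> R) :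
  open U -> (forall a, P a -> Ck k U (F a)) -> Ck k U (fun x => \prod_(a <- r | P a) F a x).
Proof.
move=> Uo H; elim: r => [|a r IH].
  by apply: (Ck_ext Uo _ (Ck_cst k U 1)) => x _; rewrite big_nil.
case Pa: (P a); last by apply: (Ck_ext Uo _ IH) => x _; rewrite big_cons Pa.
by apply: (Ck_ext Uo _ (Ck_mul Uo (H _ Pa) IH)) => x _; rewrite big_cons Pa.
Qed.

Lemma Ck_opp n k (U : set 'rV[R]_n) f : open U -> Ck k U f -> Ck k U (fun x => - f x).
Proof.
by move=> Uo fC; apply: (Ck_ext Uo _ (Ck_mul Uo (Ck_cst k U (-1)) fC)) => x _; rewrite mulN1r.
Qed.

Lemma Ck_comp n m k (U : set 'rV[R]_n) (V : set 'rV[R]_m) (f : 'rV[R]_m -> R) (T : 'rV[R]_n -> 'rV[R]_m) :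
  open U -> open V -> (forall x, U x -> V (T x)) -> (forall j, Ck k U (fun x => T x ord0 j)) ->
  Ck k V f -> Ck k U (f \o T).
Proof.
move=> Uo Vo UV; elim: k f => [|k IH] f TC fC.
  split=> // x Ux; apply: continuous_comp; last exact: Ck_continuous fC (UV _ Ux).
  by apply: continuous_at_row => j; exact: Ck_continuous (TC j) Ux.
apply: (Ck_partialE (df := fun i x => \sum_j partial i (fun y => T y ord0 j) x * partial j f (T x))) => //.
- move=> x Ux; apply: continuous_comp; last exact: Ck_continuous fC (UV _ Ux).
  by apply: continuous_at_row => j; exact: Ck_continuous (TC j) Ux.
- move=> i x Ux.
  have H := @is_derive_chain R m f (fun h => T (x + h *: unit_row R i)) 0
     (\row_j partial i (fun y => T y ord0 j) x).
  have TE : T (x + 0 *: unit_row R i) = T x by rewrite scale0r addr0.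
  rewrite TE in H; rewrite (_ : \sum_j _ = gradient f (T x) (\row_j partial i (fun y => T y ord0 j) x)).
    apply: H => [|j]; first exact: Ck_C1_at fC (UV _ Ux).
    by rewrite mxE; exact: Ck_is_derive (TC j) Ux.
  by apply: eq_bigr => j _; rewrite mxE.
- move=> i; apply: Ck_sum => // j _; apply: Ck_mul => //; first exact: Ck_partial (TC j).
  apply: IH; last exact: Ck_partial.
  by move=> l; exact: CkS.
Qed.

Lemma Ck_le n k l (U : set 'rV[R]_n) f : (k <= l)%N -> Ck l U f -> Ck k U f.
Proof.
by move=> /subnK <-; elim: (l - k)%N => // d IH; rewrite addSn => /CkS.
Qed.

(** [Phi] is a class of functions of one variable closed under differentiation on [W]. Inverses use
    the multiples of t^-m, square roots those of sqrt(t) t^-m, and the flat function the span of its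
    derivatives. *)
Lemma Ck_comp1 (Phi : set (R -> R)) (W : set R) :
  (forall p, Phi p -> exists2 q, Phi q & forall t, W t -> is_derive t 1 p (q t)) ->
  forall n k (U : set 'rV[R]_n) (p : R -> R) f, open U -> Phi p -> (forall x, U x -> W (f x)) ->
    Ck k U f -> Ck k U (p \o f).
Proof.
move=> HPhi n k U p f Uo; elim: k p => [|k IH] p Phip UW fC.
  split=> // x Ux; apply: continuous_comp; first exact: Ck_continuous fC Ux.
  have [q _ pq] := HPhi p Phip; have [D _] := pq _ (UW _ Ux).
  exact/differentiable_continuous/derivable1_diffP.
have [q Phiq pq] := HPhi p Phip.
apply: (Ck_partialE (df := fun i x => q (f x) * partial i f x)) => //.
- move=> x Ux; apply: continuous_comp; first exact: Ck_continuous fC Ux.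
  have [D _] := pq _ (UW _ Ux); exact/differentiable_continuous/derivable1_diffP.
- move=> i x Ux; have h1 := Ck_is_derive i fC Ux.
  have h2 := pq _ (UW _ Ux).
  have fE : f (x + 0 *: unit_row R i) = f x by rewrite scale0r addr0.
  rewrite -{1}fE in h2.
  exact: (is_derive1_comp (f := p) (g := fun h => f (x + h *: unit_row R i)) h2 h1).
- move=> i; apply: Ck_mul => //; last exact: Ck_partial.
  by apply: IH => //; exact: CkS.
Qed.

Lemma Ck_inv n k (U : set 'rV[R]_n) f : open U -> (forall x, U x -> f x != 0) ->
  Ck k U f -> Ck k U (fun x => (f x)^-1).
Proof.
move=> Uo f0; apply: (@Ck_comp1 [set p | exists c m, p = fun t => c * t^-1 ^+ m] [set t | t != 0]) => //.
  move=> _ [c [m ->]]; exists (fun t => - c * m%:R * t^-1 ^+ m.+1); first by exists (- c * m%:R), m.+1.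
  move=> t t0.
  have h := is_deriveZ c (is_deriveX m (is_deriveV t0 (is_derive_id t (1 : R)))).
  rewrite (_ : (fun t1 => _) = (c \*: (fun t1 : R => t1^-1) ^+ m)); last first.
    by apply/funext => s; rewrite /= exprfctE.
  apply: (is_derive_eq h); rewrite /GRing.scale/= mulr1 -exprVn.
  by case: m {h} => [|m]; rewrite ?mul0r ?mulr0 ?mul0r//= !exprS; ring.
by exists 1, 1%N; apply/funext => t; rewrite mul1r expr1.
Qed.

Lemma Ck_sqrt n k (U : set 'rV[R]_n) f : open U -> (forall x, U x -> 0 < f x) ->
  Ck k U f -> Ck k U (fun x => Num.sqrt (f x)).
Proof.
move=> Uo f0; apply: (@Ck_comp1 [set p | exists c m, p = fun t => c * (Num.sqrt t * t^-1 ^+ m)] [set t | 0 < t]) => //.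
  move=> _ [c [m ->]]; exists (fun t => c * (2^-1 - m%:R) * (Num.sqrt t * t^-1 ^+ m.+1)).
    by exists (c * (2^-1 - m%:R)), m.+1.
  move=> t t0; have tn0 : t != 0 by rewrite gt_eqF.
  have h := is_deriveZ c (is_deriveM (is_derive1_sqrt t0) (is_deriveX m (is_deriveV tn0 (is_derive_id t (1 : R))))).
  rewrite (_ : (fun t1 => _) = (c \*: (Num.sqrt * (fun t1 : R => t1^-1) ^+ m))); last first.
    by apply/funext => s; rewrite /= [in RHS]/GRing.mul/= exprfctE.
  apply: (is_derive_eq h); rewrite /GRing.scale/= mulr1 exprfctE -exprVn.
  have tE : Num.sqrt t * Num.sqrt t = t by rewrite -expr2 sqr_sqrtr// ltW.
  have r0 : Num.sqrt t != 0 by rewrite gt_eqF// sqrtr_gt0.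
  have -> : (2 * Num.sqrt t)^-1 = 2^-1 * (Num.sqrt t * t^-1) by rewrite -{3}tE; field.
  by case: m {h} => [|m]; rewrite ?mul0r ?mulr0 ?expr0 ?mul0r//= !exprS ?expr0; ring.
by exists 1, 0%N; apply/funext => t; rewrite expr0 mulr1 mul1r.
Qed.

(** The second difference of f over a square of side s is symmetric in the two directions. Applying
    the mean value inequality twice shows that it equals s^2 times either mixed partial up to d
    s^2. *)
Lemma schwarz n (U : set 'rV[R]_n) f i j x : open U -> Ck 2 U f -> U x ->
  partial i (partial j f) x = partial j (partial i f) x.
Proof.
move=> Uo fC Ux.
have key (a b : 'I_n) (d : R) : 0 < d -> \forall s \near (0 : R),
   `|f (x + s *: unit_row R a + s *: unit_row R b) - f (x + s *: unit_row R a)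
     - (f (x + s *: unit_row R b) - f x) - s * (s * partial b (partial a f) x)| <= d * `|s| * `|s|.
  move=> d0.
  have [r r0 Hr] : exists2 r : R, 0 < r & forall v, `|v| < r -> U (x + v) /\
      `|partial b (partial a f) (x + v) - partial b (partial a f) x| <= d.
    apply: (near_normP (P := fun y => U y /\ `|partial b (partial a f) y - partial b (partial a f) x| <= d)).
    apply: filterI; first exact: open_nbhs_nbhs.
    have := Ck_continuous (Ck_partial b (Ck_partial a fC)) Ux.
    by move=> /cvgrPdistC_le/(_ _ d0).
  have : \forall s \near (0 : R), `|s| < r / 2.
    by apply: (@near_norm0 _ _ (r / 2)); rewrite ?divr_gt0.
  apply: filterS => s sr.
  have sm (h k : R) : `|h| <= `|s| -> `|k| <= `|s| -> `|h *: unit_row R a + k *: unit_row R b| < r.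
    move=> hs ks; apply: le_lt_trans (ler_normD _ _) _; rewrite !normrZ !norm_unit_row !mulr1.
    by rewrite [r]splitr; apply: ltrD; [exact: le_lt_trans hs sr|exact: le_lt_trans ks sr].
  have := @MVT_abs R (fun h => f (x + h *: unit_row R a + s *: unit_row R b) - f (x + h *: unit_row R a))
    (fun h => partial a f (x + h *: unit_row R a + s *: unit_row R b) - partial a f (x + h *: unit_row R a))
    0 s (s * partial b (partial a f) x) (d * `|s|).
  rewrite add0r scale0r addr0; apply=> h hs.
    rewrite add0r; apply: is_deriveB.
      have := @is_derive_partial R n a f (x + s *: unit_row R b) h.
      have E h0 : x + s *: unit_row R b + h0 *: unit_row R a = x + h0 *: unit_row R a + s *: unit_row R b.
        by rewrite addrAC.
      rewrite E (funext (fun h0 => congr1 f (E h0))); apply; apply: Ck_has_partial fC _.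
      by rewrite -addrA; have [] := Hr _ (sm h s hs (lexx _)).
    apply: is_derive_partial; apply: Ck_has_partial fC _.
    by have := Hr _ (sm h 0 hs _); rewrite scale0r addr0 normr0 => -[].
  have := @MVT_abs R (fun k => partial a f (x + h *: unit_row R a + k *: unit_row R b))
    (fun k => partial b (partial a f) (x + h *: unit_row R a + k *: unit_row R b))
    0 s (partial b (partial a f) x) d.
  rewrite add0r scale0r addr0; apply=> k ks.
    rewrite add0r; apply: is_derive_partial; apply: Ck_has_partial (Ck_partial a fC) _.
    by rewrite -addrA; have [] := Hr _ (sm h k hs ks).
  by rewrite -addrA; have [] := Hr _ (sm h k hs ks).
apply/eqP; rewrite -subr_eq0 -normr_le0; apply/ler_addgt0Pr => d d0.
have d20 : 0 < d / 2 by rewrite divr_gt0.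
have [s [s0 [h1 h2]]] : exists s : R, s != 0 /\
    (`|f (x + s *: unit_row R i + s *: unit_row R j) - f (x + s *: unit_row R i)
     - (f (x + s *: unit_row R j) - f x) - s * (s * partial j (partial i f) x)| <= d / 2 * `|s| * `|s| /\
     `|f (x + s *: unit_row R j + s *: unit_row R i) - f (x + s *: unit_row R j)
     - (f (x + s *: unit_row R i) - f x) - s * (s * partial i (partial j f) x)| <= d / 2 * `|s| * `|s|).
  have /near_normP[r1 r10 H1] := key i j _ d20.
  have /near_normP[r2 r20 H2] := key j i _ d20.
  have r0 : 0 < Num.min r1 r2 by rewrite lt_min r10.
  have s0 : 0 < Num.min r1 r2 / 2 by rewrite divr_gt0.
  have sr : `|Num.min r1 r2 / 2| < Num.min r1 r2.
    by rewrite gtr0_norm// ltr_pdivrMr// mulr_natr mulr2n ltrDr.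
  exists (Num.min r1 r2 / 2); rewrite gt_eqF//; split=> //; split.
    by have := H1 (Num.min r1 r2 / 2); rewrite add0r; apply; apply: (lt_le_trans sr); rewrite ge_min lexx.
  by have := H2 (Num.min r1 r2 / 2); rewrite add0r; apply; apply: (lt_le_trans sr); rewrite ge_min lexx orbT.
rewrite add0r -(@ler_pM2r _ (`|s| * `|s|)) ?mulr_gt0 ?normr_gt0// -!normrM.
set D1 := (X in `|X| <= _) in h1; set D2 := (X in `|X| <= _) in h2.
have -> : (partial i (partial j f) x - partial j (partial i f) x) * (s * s) = D1 - D2.
  rewrite /D1 /D2 (addrAC x (s *: unit_row R j)).
  move: (f (x + s *: unit_row R i + s *: unit_row R j)) (f (x + s *: unit_row R i))
    (f (x + s *: unit_row R j)) (f x) (partial j (partial i f) x) (partial i (partial j f) x).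
  by move=> c0 c1 c2 c3 c4 c5; ring.
apply: (le_trans (ler_normB _ _)); apply: (le_trans (lerD h1 h2)).
by rewrite normrM -2!mulrDl -splitr mulrA lexx.
Qed.

End SmoothFunctions.

(** * Iterated integrals *)

Section RealContinuity.
Variables (R : realType) (T : topologicalType).
Implicit Types f g : T -> R.

Lemma continuous_cst (c : R) : continuous (fun _ : T => c).
Proof. by move=> x; exact: cst_continuous. Qed.

Lemma continuous_add f g : continuous f -> continuous g -> continuous (fun x => f x + g x).
Proof. by move=> cf cg x; exact: (continuousD (cf x) (cg x)). Qed.

Lemma continuous_mul f g : continuous f -> continuous g -> continuous (fun x => f x * g x).
Proof. by move=> cf cg x; exact: (continuousM (cf x) (cg x)). Qed.

Lemma continuous_opp f : continuous f -> continuous (fun x => - f x).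
Proof. by move=> cf x; exact: (continuousN (cf x)). Qed.

Lemma continuous_sum (I : Type) (r : seq I) (F : I -> T -> R) :
  (forall i, continuous (F i)) -> continuous (fun x => \sum_(i <- r) F i x).
Proof.
move=> cF; elim: r => [|i r IH].
  by under [X in continuous X]eq_fun do rewrite big_nil; exact: continuous_cst.
by under [X in continuous X]eq_fun do rewrite big_cons; exact: continuous_add.
Qed.

Lemma continuous_pairl (S : topologicalType) (t : S) (x : T) : {for x, continuous (fun y : T => (t, y))}.
Proof.
move=> P [[A B] /= [A0 B0] AB]; apply: filterS B0 => y By; apply: AB; split=> //.
exact: nbhs_singleton.
Qed.

End RealContinuity.

Section IntegralOnLine.
Variable R : realType.
Implicit Types (f g : R -> R) (K c : R).
Local Notation mu := (@lebesgue_measure R).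

Lemma integrable_compact_support f K : continuous f -> (forall x, K < `|x| -> f x = 0) ->
  mu.-integrable setT (EFin \o f).
Proof.
move=> cf fK.
have -> : EFin \o f = (EFin \o f) \_ `[- K, K]%classic.
  apply/funext => x; rewrite patchE; case: ifPn => // /negP; rewrite inE/= in_itv/= -ler_norml.
  by move=> /negP; rewrite -ltNge => /fK /= ->.
have [H _] := @integrable_mkcond _ _ _ mu `[- K, K]%classic (EFin \o f) (measurable_itv _); apply: H.
apply: continuous_compact_integrable; first exact: segment_compact.
exact: continuous_subspaceT.
Qed.

Lemma Rintegral_compact_support f K : (forall x, K < `|x| -> f x = 0) ->
  (\int[mu]_x f x = \int[mu]_(x in `[(- K)%R, K]) f x)%R.
Proof.
move=> fK; rewrite [RHS]Rintegral_mkcond; congr Rintegral; apply/funext => x; rewrite patchE.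
case: ifPn => // /negP; rewrite inE/= in_itv/= -ler_norml.
by move=> /negP; rewrite -ltNge => /fK.
Qed.

Lemma Rintegral_le_bound f K c : 0 <= K -> 0 <= c -> continuous f -> (forall x, K < `|x| -> f x = 0) ->
  (forall x, `|f x| <= c) -> (`|\int[mu]_x f x| <= 2 * K * c)%R.
Proof.
move=> K0 c0 cf fK fc; have ci (g : R -> R) : continuous g -> mu.-integrable `[- K, K] (EFin \o g).
  move=> cg; apply: continuous_compact_integrable; first exact: segment_compact.
  exact: continuous_subspaceT.
have cn : continuous (fun x => `|f x|) by move=> x; apply: continuous_comp; [exact: cf|exact: norm_continuous].
rewrite (Rintegral_compact_support fK).
apply: (le_trans (le_normr_Rintegral _ _)) => //; first exact: ci.
apply: (@le_trans _ _ (\int[mu]_(x in `[(- K)%R, K]) c)%R).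
  apply: le_Rintegral => //; [exact: ci|apply: ci => x; exact: cst_continuous].
have E := lebesgue_measure_itv (`[(- K)%R, K] : interval R).
rewrite Rintegral_cst//= E /= lte_fin.
case: ifPn => _ /=; last by rewrite mulr0 !mulr_ge0.
by rewrite opprK mulrC -mulr2n mulr_natl.
Qed.

Lemma Rintegral_FTC f g K : 0 < K -> continuous f -> (forall x, is_derive x (1 : R) g (f x)) ->
  (forall x, K < `|x| -> f x = 0) -> (\int[mu]_x f x = g K - g (- K))%R.
Proof.
move=> K0 cf gf fK.
have cg : continuous g.
  by move=> x; have [D _] := gf x; exact/differentiable_continuous/derivable1_diffP.
rewrite (Rintegral_compact_support fK) /Rintegral (@continuous_FTC2 _ f g)//=.
- lra.
- exact: continuous_subspaceT.
- split; first by move=> x _; have [] := gf x.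
    exact/cvg_at_right_filter/cg.
  exact/cvg_at_left_filter/cg.
- by move=> x _; have [D dE] := gf x; rewrite derive1E.
Qed.

Lemma Rintegral_derivative f g K : 0 < K -> continuous f -> (forall x, is_derive x (1 : R) g (f x)) ->
  (forall x, K < `|x| -> g x = 0) -> (\int[mu]_x f x = 0)%R.
Proof.
move=> K0 cf gf gK; have K10 : 0 < K + 1 by rewrite addr_gt0.
(* Beyond K + 1 a whole unit neighbourhood lies beyond K, where g is zero, so its derivative f is
   zero as well. *)
have fK x : K + 1 < `|x| -> f x = 0.
  move=> Kx; have [_ <-] := gf x; rewrite -[RHS](@derive_cst R R R 0 x 1).
  apply: near_eq_derive => //; near=> y; apply: gK.
  have xy : `|x - y| < 1 by near: y; apply: cvgr_dist_lt => //; exact: cvg_id.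
  by have := ler_normD (x - y) y; rewrite subrK; lra.
have E := Rintegral_FTC K10 cf gf fK.
by rewrite E !gK ?subrr ?normrN ?gtr0_norm ?ltrDl.
Unshelve. all: by end_near. Qed.

Lemma Rintegral_gt0 f K t0 : continuous f -> (forall x, K < `|x| -> f x = 0) -> (forall x, 0 <= f x) ->
  0 < f t0 -> (0 < \int[mu]_x f x)%R.
Proof.
move=> cf fK f0 ft0.
have [r r0 Hr] : exists2 r : R, 0 < r & forall v, `|v| < r -> f t0 / 2 <= f (t0 + v).
  apply: (near_normP (P := fun y => f t0 / 2 <= f y)).
  have h : 0 < f t0 / 2 by rewrite divr_gt0.
  have /cvgrPdist_le/(_ _ h) := cf t0; apply: filterS => y.
  by rewrite ler_norml => /andP[_]; lra.
have r20 : 0 < r / 2 by rewrite divr_gt0.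
apply: (@lt_le_trans _ _ (\int[mu]_(x in `[(t0 - r / 2)%R, (t0 + r / 2)%R]) (f t0 / 2))%R).
  have E := lebesgue_measure_itv (`[(t0 - r / 2)%R, (t0 + r / 2)%R] : interval R).
  rewrite Rintegral_cst//= E /= lte_fin ifT; last lra.
  by rewrite /= mulr_gt0// ?divr_gt0//; lra.
apply: (@le_trans _ _ (\int[mu]_(x in `[(t0 - r / 2)%R, (t0 + r / 2)%R]) f x)%R).
  apply: le_Rintegral => //.
  - apply: continuous_compact_integrable; [exact: segment_compact|apply: continuous_subspaceT => x; exact: cst_continuous].
  - apply: continuous_compact_integrable; [exact: segment_compact|exact: continuous_subspaceT].
  - move=> x /=; rewrite in_itv/= => /andP[x1 x2].
    have := Hr (x - t0); rewrite [t0 + _]addrC subrK; apply.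
    by rewrite ltr_norml; apply/andP; split; lra.
rewrite Rintegral_mkcond; apply: le_Rintegral => //.
- have := @integrable_mkcond _ _ _ mu `[(t0 - r / 2)%R, (t0 + r / 2)%R]%classic (EFin \o f) (measurable_itv _).
  move=> [H _]; rewrite (_ : _ \o _ = (EFin \o f) \_ `[t0 - r / 2, t0 + r / 2]%classic).
    apply: H; apply: continuous_compact_integrable; [exact: segment_compact|exact: continuous_subspaceT].
  by apply/funext => x /=; rewrite !patchE; case: ifP.
- exact: integrable_compact_support cf fK.
- by move=> x _; rewrite patchE; case: ifP.
Qed.

End IntegralOnLine.

Section Slices.
Variables (R : realType) (m : nat).
Implicit Types (t : R) (v : 'rV[R]_m).

Definition cons_row t v : 'rV[R]_m.+1 := row_mx (t%:M : 'rV_1) v.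

Lemma cons_row_head t v : cons_row t v ord0 (lshift m (ord0 : 'I_1)) = t.
Proof. by rewrite [LHS](row_mxEl (t%:M : 'rV_1) v) mxE eqxx. Qed.

Lemma cons_row_tail t v j : cons_row t v ord0 (rshift 1 j) = v ord0 j.
Proof. exact: (row_mxEr (t%:M : 'rV_1) v). Qed.

Lemma cons_row_norm_head t v : `|t| <= `|cons_row t v|.
Proof. by rewrite -{1}(cons_row_head t v) coord_le_norm. Qed.

Lemma cons_row_norm_tail t v : `|v| <= `|cons_row t v|.
Proof. by apply: norm_le_coord => // j; rewrite -(cons_row_tail t v j) coord_le_norm. Qed.

Lemma cons_row_surj (x : 'rV[R]_m.+1) : exists t v, x = cons_row t v.
Proof.
exists ((lsubmx (x : 'rV_(1 + m))) ord0 ord0), (rsubmx (x : 'rV_(1 + m))).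
by rewrite /cons_row -mx11_scalar hsubmxK.
Qed.

Lemma cons_row_addl t v h : cons_row t v + h *: unit_row R (lshift m (ord0 : 'I_1)) = cons_row (t + h) v.
Proof.
apply/rowP => i; case: (split_ordP (i : 'I_(1 + m))) => k ->.
  by rewrite !ord1 [RHS]cons_row_head [LHS]mxE cons_row_head !mxE !eqxx mulr1.
by rewrite [RHS]cons_row_tail [LHS]mxE cons_row_tail !mxE eqxx eq_rlshift mulr0 addr0.
Qed.

Lemma cons_row_addr t v h j : cons_row t v + h *: unit_row R (rshift 1 j) = cons_row t (v + h *: unit_row R j).
Proof.
apply/rowP => i; case: (split_ordP (i : 'I_(1 + m))) => k ->.
  by rewrite !ord1 [RHS]cons_row_head [LHS]mxE cons_row_head !mxE eqxx eq_lrshift mulr0 addr0.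
by rewrite [RHS]cons_row_tail [LHS]mxE cons_row_tail !mxE eqxx (inj_eq (@rshift_inj _ _)).
Qed.

Lemma cons_row_continuous (p : R * 'rV[R]_m) : {for p, continuous (fun q : R * 'rV[R]_m => cons_row q.1 q.2)}.
Proof.
apply: continuous_at_row => i; case: (split_ordP (i : 'I_(1 + m))) => k ->.
  rewrite (_ : (fun q => _) = fst); first exact: cvg_fst.
  by apply/funext => q; rewrite !ord1 cons_row_head.
rewrite (_ : (fun q => _) = (fun v : 'rV[R]_m => v ord0 k) \o snd).
  by apply: continuous_comp; [exact: cvg_snd|exact: coord_continuous].
by apply/funext => q; rewrite cons_row_tail.
Qed.

Lemma cons_row_continuous_tail t v : {for v, continuous (cons_row t)}.
Proof.
apply: continuous_at_row => i; case: (split_ordP (i : 'I_(1 + m))) => k ->.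
  rewrite (_ : (fun q => _) = fun=> t); first exact: cst_continuous.
  by apply/funext => q; rewrite !ord1 cons_row_head.
rewrite (_ : (fun q => _) = (fun v : 'rV[R]_m => v ord0 k)); first exact: coord_continuous.
by apply/funext => q; rewrite cons_row_tail.
Qed.

End Slices.

Section UniformNear.

(** Tube lemma: continuity along the slice over x0 is uniform on a compact set. It drives both
    continuity of slice integrals and differentiation under the integral. *)
Lemma uniform_near (R : realType) (X Y : topologicalType) (F : X -> Y -> R) (x0 : X) (C : set Y) (e : R) :
  compact C -> 0 < e -> (forall y, C y -> {for (x0, y), continuous (fun p : X * Y => F p.1 p.2)}) ->
  \forall x \near x0, forall y, C y -> `|F x y - F x0 y| <= e.
Proof.
move=> cC e0 cF; have e20 : 0 < e / 2 by rewrite divr_gt0.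
have /compact_near_coveringP := cC => /(_ X (nbhs x0) (fun x y => `|F x y - F x0 y| <= e)).
apply => y Cy; have /cvgrPdist_le/(_ _ e20) [[A B] /= [A0 B0] H] := cF y Cy.
exists (B, A) => //= -[y' x'] /= [By' Ax'].
have h1 := H (x', y') (conj Ax' By').
have h2 := H (x0, y') (conj (nbhs_singleton A0) By').
rewrite /= in h1 h2; have -> : F x' y' - F x0 y' = (F x0 y - F x0 y') - (F x0 y - F x' y') by ring.
by apply: (le_trans (ler_normB _ _)); rewrite [e]splitr lerD.
Qed.

Lemma compact_box (R : realType) n (K : R) : compact [set v : 'rV[R]_n | `|v| <= K].
Proof.
apply: bounded_closed_compact.
  by exists K; split=> [|y Ky v /= vK]; [exact: num_real|rewrite (le_trans vK)// ltW].
rewrite (_ : [set v | _] = (fun v : 'rV[R]_n => `|v|) @^-1` [set x | x <= K])//.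
apply: closed_comp => [v _|]; last exact: closed_le.
exact: (@norm_continuous _ 'rV[R]_n).
Qed.

End UniformNear.

Section IteratedIntegral.
Variable R : realType.
Local Notation mu := (@lebesgue_measure R).
Local Notation II n := (@iterated_integral R n).

Definition vanishes_beyond n (K : R) (f : 'rV[R]_n -> R) := forall x, K < `|x| -> f x = 0.

Lemma iterated_integralS n (f : 'rV[R]_n.+1 -> R) :
  II n.+1 f = (\int[mu]_t II n (fun v => f (cons_row t v)))%R.
Proof. by []. Qed.

Lemma vanishes_beyond_le n (K L : R) (f : 'rV[R]_n -> R) : K <= L -> vanishes_beyond K f -> vanishes_beyond L f.
Proof. by move=> KL fK x Lx; apply: fK; exact: le_lt_trans Lx. Qed.

Lemma vanishes_beyond_slice n (K t : R) (f : 'rV[R]_n.+1 -> R) : vanishes_beyond K f ->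
  vanishes_beyond K (fun v => f (cons_row t v)).
Proof. by move=> fK v Kv; apply: fK; exact: lt_le_trans (cons_row_norm_tail t v). Qed.

Lemma continuous_slice n (t : R) (f : 'rV[R]_n.+1 -> R) : continuous f ->
  continuous (fun v => f (cons_row t v)).
Proof. by move=> cf v; apply: continuous_comp; [exact: cons_row_continuous_tail|exact: cf]. Qed.

Lemma ext0_II n : II n (fun=> 0) = 0.
Proof.
elim: n => [|n IH] //; rewrite iterated_integralS IH.
by rewrite /Rintegral integral0.
Qed.

(** The three properties have to be proved together. Linearity in dimension n + 1 needs
    integrability, hence continuity, of the slice integrals, and this follows from linearity and the
    bound in dimension n. *)
Definition II_linear_bounded n := [/\
  forall (f g : 'rV[R]_n -> R) K, 0 < K -> continuous f -> continuous g -> vanishes_beyond K f -> vanishes_beyond K g ->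
    II n (fun x => f x + g x) = II n f + II n g,
  forall (f : 'rV[R]_n -> R) K (c : R), 0 < K -> continuous f -> vanishes_beyond K f ->
    II n (fun x => c * f x) = c * II n f &
  forall (f : 'rV[R]_n -> R) K c, 0 < K -> 0 <= c -> continuous f -> vanishes_beyond K f ->
    (forall x, `|f x| <= c) -> `|II n f| <= (2 * K) ^+ n * c].

Lemma II_sub_bound n : II_linear_bounded n -> forall (f g : 'rV[R]_n -> R) K c,
  0 < K -> 0 <= c -> continuous f -> continuous g -> vanishes_beyond K f -> vanishes_beyond K g ->
  (forall x, `|f x - g x| <= c) -> `|II n f - II n g| <= (2 * K) ^+ n * c.
Proof.
move=> [iD iZ iB] f g K c K0 c0 cf cg fK gK fgc.
have cN : continuous (fun x => -1 * g x) by apply: continuous_mul => //; exact: continuous_cst.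
have NK : vanishes_beyond K (fun x => -1 * g x) by move=> x Kx; rewrite gK ?mulr0.
have -> : II n f - II n g = II n (fun x => f x + -1 * g x).
  by rewrite (iD _ _ K)// (iZ _ K)// mulN1r.
apply: iB => //.
- exact: continuous_add.
- by move=> x Kx; rewrite fK// NK// addr0.
- by move=> x; rewrite mulN1r.
Qed.

Lemma II_slice_continuous n : II_linear_bounded n -> forall (f : 'rV[R]_n.+1 -> R) K,
  0 < K -> continuous f -> vanishes_beyond K f -> continuous (fun t => II n (fun v => f (cons_row t v))).
Proof.
move=> Hn f K K0 cf fK t0; apply/cvgrPdist_le => e e0.
have K20 : 0 < (2 * K) ^+ n by rewrite exprn_gt0// mulr_gt0.
have d0 : 0 < e / (2 * K) ^+ n by rewrite divr_gt0.
have := @uniform_near R R 'rV[R]_n (fun t v => f (cons_row t v)) t0 [set v | `|v| <= K] _ (@compact_box R n K) d0.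
have cc v : [set v | `|v| <= K] v ->
    {for (t0, v), continuous (fun p : R * 'rV[R]_n => f (cons_row p.1 p.2))}.
  move=> _; apply: (@continuous_comp _ _ _ (fun p : R * 'rV[R]_n => cons_row p.1 p.2) f); last exact: cf.
  exact: cons_row_continuous.
move=> /(_ cc); apply: filterS => t Ht; rewrite distrC.
rewrite -[X in _ <= X](divfK (lt0r_neq0 K20)) [X in _ <= X]mulrC.
apply: (II_sub_bound Hn) => //; [exact: ltW|exact: continuous_slice|exact: continuous_slice|
  exact: vanishes_beyond_slice|exact: vanishes_beyond_slice|].
move=> v; have [vK|vK] := leP `|v| K; first exact: Ht.
by rewrite !(vanishes_beyond_slice _ fK)// subrr normr0 ltW.
Qed.

Lemma II_slice_vanishes n (f : 'rV[R]_n.+1 -> R) K : vanishes_beyond K f ->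
  forall t, K < `|t| -> II n (fun v => f (cons_row t v)) = 0.
Proof.
move=> fK t Kt; rewrite -(ext0_II n); congr (II n _); apply/funext => v.
by apply: fK; exact: lt_le_trans (cons_row_norm_head t v).
Qed.

Lemma II_linear_boundedP n : II_linear_bounded n.
Proof.
elim: n => [|n IH]; first by split=> //= f K c _ c0 _ _ fc; rewrite expr0 mul1r.
have [iD iZ iB] := IH; have cS := II_slice_continuous IH.
split=> [f g K K0 cf cg fK gK|f K c K0 cf fK|f K c K0 c0 cf fK fc]; rewrite !iterated_integralS.
- rewrite -RintegralD//.
  + congr Rintegral; apply/funext => t; apply: iD K0 _ _ _ _; [exact: continuous_slice|exact: continuous_slice|
      exact: vanishes_beyond_slice|exact: vanishes_beyond_slice].
  + by apply: integrable_compact_support (II_slice_vanishes fK); exact: cS K0 cf fK.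
  + by apply: integrable_compact_support (II_slice_vanishes gK); exact: cS K0 cg gK.
- rewrite -RintegralZl//.
  + congr Rintegral; apply/funext => t; apply: iZ K0 _ _; [exact: continuous_slice|exact: vanishes_beyond_slice].
  + by apply: integrable_compact_support (II_slice_vanishes fK); exact: cS K0 cf fK.
- rewrite exprS -mulrA; apply: Rintegral_le_bound (II_slice_vanishes fK) _.
  + exact: ltW.
  + by rewrite mulr_ge0// exprn_ge0// mulr_ge0// ltW.
  + exact: cS K0 cf fK.
  + move=> t; apply: iB => //; [exact: continuous_slice|exact: vanishes_beyond_slice].
Qed.

Lemma II_add n (f g : 'rV[R]_n -> R) K : 0 < K -> continuous f -> continuous g ->
  vanishes_beyond K f -> vanishes_beyond K g -> II n (fun x => f x + g x) = II n f + II n g.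
Proof. by have [H _ _] := II_linear_boundedP n; exact: H. Qed.

Lemma II_scale n (f : 'rV[R]_n -> R) K (c : R) : 0 < K -> continuous f -> vanishes_beyond K f ->
  II n (fun x => c * f x) = c * II n f.
Proof. by have [_ H _] := II_linear_boundedP n; exact: H. Qed.

Lemma II_opp n (f : 'rV[R]_n -> R) K : 0 < K -> continuous f -> vanishes_beyond K f ->
  II n (fun x => - f x) = - II n f.
Proof.
move=> K0 cf fK; rewrite -mulN1r -(II_scale (-1) K0 cf fK).
by congr (II n _); apply/funext => x; rewrite mulN1r.
Qed.

Lemma II_continuous_slice n (f : 'rV[R]_n.+1 -> R) K : 0 < K -> continuous f -> vanishes_beyond K f ->
  continuous (fun t => II n (fun v => f (cons_row t v))).
Proof. exact: (II_slice_continuous (II_linear_boundedP n)). Qed.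

Lemma II_gt0 n (f : 'rV[R]_n -> R) K x0 : 0 < K -> continuous f -> vanishes_beyond K f ->
  (forall x, 0 <= f x) -> 0 < f x0 -> 0 < II n f.
Proof.
elim: n f x0 => [|n IH] f x0 K0 cf fK f0 fx0.
  by rewrite /= (_ : 0 = x0)//; apply/rowP => -[].
have [t0 [v0 x0E]] := cons_row_surj x0; rewrite x0E in fx0.
have ge0 t : 0 <= II n (fun v => f (cons_row t v)).
  have [[v Hv]|Hv] := pselect (exists v, 0 < f (cons_row t v)).
    by apply/ltW/(IH _ v) => //; [exact: continuous_slice|exact: vanishes_beyond_slice].
  rewrite (_ : (fun v => _) = fun=> 0) ?ext0_II//; apply/funext => v.
  apply/eqP; rewrite eq_le f0 andbT leNgt; apply/negP => fv; apply: Hv; by exists v.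
rewrite iterated_integralS; apply: (Rintegral_gt0 (t0 := t0) _ (II_slice_vanishes fK) ge0).
  exact: II_continuous_slice K0 cf fK.
by apply: (IH _ v0) => //; [exact: continuous_slice|exact: vanishes_beyond_slice].
Qed.

(** The linearisation error of F in t is uniformly small on the box that contains all supports for t
    near t0, so it stays small after integration. *)
Lemma is_derive_II n (F G : R -> 'rV[R]_n -> R) (t0 K : R) : 0 < K ->
  (\forall t \near t0, vanishes_beyond K (F t)) ->
  (\forall t \near t0, continuous (F t)) ->
  (\forall t \near t0, forall x, is_derive t (1 : R) (fun s => F s x) (G t x)) ->
  (forall x, {for (t0, x), continuous (fun p : R * 'rV[R]_n => G p.1 p.2)}) ->
  [/\ continuous (G t0), vanishes_beyond K (G t0) & is_derive t0 1 (fun t => II n (F t)) (II n (G t0))].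
Proof.
move=> K0 FK cF FG cG.
have cG0 : continuous (G t0).
  move=> x; apply: (continuous_comp (f := fun y => (t0, y)) (g := fun p : R * 'rV[R]_n => G p.1 p.2)).
    exact: continuous_pairl.
  exact: cG.
have GK : vanishes_beyond K (G t0).
  move=> x Kx; have [_ <-] := nbhs_singleton FG x; rewrite -[RHS](@derive_cst R R R 0 t0 1).
  by apply: near_eq_derive => //; apply: filterS FK => t /(_ x Kx).
split=> //; apply/is_derive1P => e e0.
have K20 : 0 < (2 * K) ^+ n by rewrite exprn_gt0// mulr_gt0.
have d0 : 0 < e / (2 * K) ^+ n by rewrite divr_gt0.
have := @uniform_near R R 'rV[R]_n G t0 [set v | `|v| <= K] _ (@compact_box R n K) d0 (fun y _ => cG y).
move=> /near_normP[r1 r10 H1]; have /near_normP[r2 r20 H2] := FG.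
have /near_normP[r3 r30 H3] := FK; have /near_normP[r4 r40 H4] := cF.
apply: (@near_norm0 _ _ (Num.min r1 (Num.min r2 (Num.min r3 r4)))); first by rewrite !lt_min r10 r20 r30.
move=> h; rewrite !lt_min => /and4P[h1 h2 h3 h4].
have FK0 := nbhs_singleton FK; have cF0 := nbhs_singleton cF.
have cGh : continuous (fun x => h * G t0 x) by apply: continuous_mul => //; exact: continuous_cst.
have GhK : vanishes_beyond K (fun x => h * G t0 x) by move=> x Kx; rewrite GK ?mulr0.
have cD : continuous (fun x => F t0 x + h * G t0 x) by exact: continuous_add.
have DK : vanishes_beyond K (fun x => F t0 x + h * G t0 x) by move=> x Kx; rewrite FK0// GhK// addr0.
rewrite -addrA -opprD -(II_scale h K0 cG0 GK) -(II_add K0 cF0 cGh FK0 GhK).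
rewrite -[X in _ <= X * _](divfK (lt0r_neq0 K20)) [X in _ <= X * _]mulrC -mulrA.
apply: (II_sub_bound (II_linear_boundedP n)) => //.
- by rewrite mulr_ge0// ltW.
- exact: H4.
- exact: H3.
move=> x; have [xK|xK] := leP `|x| K; last first.
  by rewrite (H3 _ h3)// DK// subrr normr0 mulr_ge0// ltW.
rewrite opprD addrA.
apply: (@MVT_abs R (fun s => F s x) (fun k => G (t0 + k) x)) => k kh.
  by apply: H2; exact: le_lt_trans h2.
by apply: H1 => //; exact: le_lt_trans h1.
Qed.

End IteratedIntegral.

Section IntegralOfPartials.
Variable R : realType.
Local Notation II n := (@iterated_integral R n).

Lemma is_derive_shift0 (F : R -> R) t l :
  is_derive (0 : R) 1 (fun h => F (t + h)) l <-> is_derive t 1 F l.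
Proof.
split=> /is_derive1P H; apply/is_derive1P => e e0; have := H _ e0; apply: filterS => h;
by rewrite add0r addr0.
Qed.

Lemma vanishes_beyond_partial n K (f : 'rV[R]_n -> R) i : vanishes_beyond K f ->
  vanishes_beyond K (partial i f).
Proof.
move=> fK x Kx; have -> : partial i f x = partial i (fun=> 0) x; last by rewrite partial_cst.
apply: (@partial_ext _ _ [set y : 'rV[R]_n | K < `|y|]) => //.
rewrite (_ : [set y : 'rV[R]_n | _] = (fun v : 'rV[R]_n => `|v|) @^-1` [set y | K < y])//.
by apply: open_comp => [v _|]; [exact: (@norm_continuous _ 'rV[R]_n)|exact: open_gt].
Qed.

Lemma Ck_continuousT n k (f : 'rV[R]_n -> R) : Ck k setT f -> continuous f.
Proof. by move=> fC x; exact: Ck_continuous fC I. Qed.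

(** In the first coordinate the integrand is the derivative of a slice integral of compact support;
    the other coordinates are handled inside each slice by induction. *)
Lemma II_partial n (g : 'rV[R]_n -> R) i K : 0 < K -> Ck 1 setT g -> vanishes_beyond K g ->
  II n (partial i g) = 0.
Proof.
move=> K0; elim: n g i => [|n IH] g i gC gK; first by case: i.
have cpg k : continuous (partial k g) by exact: Ck_continuousT (Ck_partial k gC).
case: (split_ordP (i : 'I_(1 + n))) => k ->.
  rewrite ord1 iterated_integralS.
  have cf := II_continuous_slice K0 (cpg _) (vanishes_beyond_partial (lshift n (ord0 : 'I_1)) gK).
  apply: (Rintegral_derivative K0 cf _ (II_slice_vanishes gK)) => t.
  have [] // := @is_derive_II R n (fun t v => g (cons_row t v))
    (fun t v => partial (lshift n (ord0 : 'I_1)) g (cons_row t v)) t K K0.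
  - by near=> s; exact: vanishes_beyond_slice.
  - by near=> s; apply: continuous_slice; exact: Ck_continuousT gC.
  - near=> s => v; apply/is_derive_shift0.
    have := Ck_is_derive (lshift n (ord0 : 'I_1)) gC (I : setT (cons_row s v)).
    by rewrite (funext (fun h => congr1 g (cons_row_addl s v h))).
  - move=> v; apply: (@continuous_comp _ _ _ (fun p : R * 'rV[R]_n => cons_row p.1 p.2)); last exact: cpg.
    exact: cons_row_continuous.
rewrite iterated_integralS (_ : (fun t => _) = fun=> 0); first by rewrite /Rintegral integral0.
apply/funext => t.
have -> : (fun v => partial (rshift 1 k) g (cons_row t v)) = partial k (fun v => g (cons_row t v)).
  apply/funext => v; rewrite /partial; congr derive1; apply/funext => h.
  by rewrite -[delta_mx _ _]/(unit_row R (rshift 1 k)) cons_row_addr.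
apply: IH; last exact: vanishes_beyond_slice.
apply: (@Ck_comp R n n.+1 1 setT setT g (cons_row t)) => //; [exact: openT|exact: openT|].
move=> j; case: (split_ordP (j : 'I_(1 + n))) => l ->.
  apply: (@Ck_ext _ _ _ _ (fun=> t)); [exact: openT| |exact: Ck_cst].
  by move=> v _; rewrite !ord1 cons_row_head.
apply: (@Ck_ext _ _ _ _ (fun v : 'rV[R]_n => v ord0 l)); [exact: openT| |exact: Ck_coord].
by move=> v _; rewrite cons_row_tail.
Unshelve. all: by end_near. Qed.

(** * Elementary substitutions, by deformation to the identity *)

Section ElementaryChangeOfVariables.
Variables (n : nat) (f : 'rV[R]_n -> R) (K : R) (i j : 'I_n) (b d : R).
Hypothesis K0 : 0 < K.
Hypothesis fC : Ck 1 setT f.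
Hypothesis fK : vanishes_beyond K f.
Hypothesis bpos : i = j -> 0 < 1 + b.
Local Notation e := (unit_row R i).

(** The deformation from the identity, c = 0, to the substitution, c = 1. [w c] is the Jacobian
    determinant of [Y c], [F c] the pulled back density and [G c] its derivative in c. [bpos] keeps
    [w c] positive for c between 0 and 1. *)
Let Y c (x : 'rV[R]_n) : 'rV[R]_n := x + (c * (b * x ord0 j + d)) *: e.
Let w c : R := 1 + (i == j)%:R * (c * b).
Let F c x := w c * f (Y c x).
Let G c x := (i == j)%:R * b * f (Y c x) + w c * ((b * x ord0 j + d) * partial i f (Y c x)).

Let w_gt0 c : 0 <= c <= 1 -> 0 < w c.
Proof.
move=> /andP[c0 c1]; rewrite /w; case: eqP => [/bpos b0|_]; rewrite ?mul0r ?addr0// mul1r.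
have [bn|bn] := leP 0 b; first by rewrite ltr_wpDr// mulr_ge0.
nra.
Qed.

Let support (c : R) : 0 <= c <= 1 -> exists2 L : R, 0 < L & \forall s \near c, vanishes_beyond L (F s).
Proof.
move=> c01; have w0 := w_gt0 c01.
have m0 : 0 < w c / 2 by rewrite divr_gt0.
(* With |s| <= 2 and w s >= w c / 2, [q] bounds coordinate i when i = j, and K + 2 (r + |d|) bounds
   it when i and j differ; the other coordinates are unchanged, hence at most K. *)
pose q : R := (K + 2 * `|d|) / (w c / 2); pose r : R := `|b| * K.
pose L : R := K + 2 * (r + `|d|) + q.
have r0 : 0 <= r by rewrite mulr_ge0// ltW.
have d0 := normr_ge0 d.
have q0 : 0 <= q.
  by rewrite divr_ge0// ?(ltW m0)// addr_ge0// ?mulr_ge0// ltW.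
have s0 : 0 <= 2 * (r + `|d|) by rewrite mulr_ge0// addr_ge0.
have L0 : 0 < L by rewrite /L ltr_wpDr// ltr_wpDr.
have Lq : q <= L by rewrite /L lerDr addr_ge0// (ltW K0).
have LK : K <= L by rewrite /L -addrA lerDl addr_ge0.
have L3 : K + (2 * r + 2 * `|d|) <= L by rewrite /L -addrA lerD2l -mulrDr lerDl.
exists L => //.
have cw : {for c, continuous w}.
  have : continuous w; last by apply.
  rewrite /w; apply: continuous_add; first exact: continuous_cst.
  apply: continuous_mul; first exact: continuous_cst.
  by apply: continuous_mul; [move=> x; exact: cvg_id|exact: continuous_cst].
have /cvgrPdist_lt/(_ _ m0) cw' := cw.
have c2 : \forall s \near c, `|s| <= 2.
  have /cvgrPdist_le/(_ _ ltr01) : (fun s : R => s) @ c --> c by exact: cvg_id.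
  apply: filterS => s cs; rewrite -[s](subrK c); apply: (le_trans (ler_normD _ _)).
  rewrite distrC; move: c01 => /andP[c0 c1]; rewrite (ger0_norm c0); lra.
suff aux (s : R) : `|w c - w s| < w c / 2 -> `|s| <= 2 -> vanishes_beyond L (F s).
  by apply: filterS2 cw' c2; exact: aux.
move=> ws s2 x Lx; rewrite /F fK ?mulr0//.
rewrite ltNge; apply/negP => YK; move: Lx; rewrite ltNge => /negP; apply.
have yk k : `|Y s x ord0 k| <= K by exact: le_trans (coord_le_norm _ _) YK.
have ws0 : w c / 2 <= w s by move: ws; rewrite ltr_norml => /andP[_]; lra.
have xk k : k != i -> `|x ord0 k| <= K.
  by move=> ki; have := yk k; rewrite /Y !mxE eqxx (negPf ki) mulr0 addr0.
apply: norm_le_coord => [|k]; first exact: ltW.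
have [->|ki] := eqVneq k i; last exact: le_trans (xk k ki) LK.
have := yk i; rewrite /Y !mxE !eqxx mulr1.
have sd : `|s * d| <= 2 * `|d| by rewrite normrM ler_wpM2r.
have [ij|ij] := eqVneq i j.
  rewrite -ij => yi.
  have E : x ord0 i + s * (b * x ord0 i + d) = w s * x ord0 i + s * d by rewrite /w ij eqxx/= mulr1n; ring.
  have : `|w s * x ord0 i| <= K + 2 * `|d|.
    rewrite (_ : w s * _ = (x ord0 i + s * (b * x ord0 i + d)) - s * d); last by rewrite E addrK.
    by apply: (le_trans (ler_normB _ _)); rewrite lerD.
  rewrite normrM gtr0_norm ?(lt_le_trans m0)// => h.
  have : `|x ord0 i| <= q.
    by rewrite ler_pdivlMr// mulrC; apply: le_trans h; rewrite ler_wpM2r.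
  by move=> /le_trans; apply.
move=> yi; have -> : x ord0 i = (x ord0 i + s * (b * x ord0 j + d)) - (s * (b * x ord0 j) + s * d) by ring.
apply: (le_trans (ler_normB _ _)).
have h1 : `|s * (b * x ord0 j) + s * d| <= 2 * r + 2 * `|d|.
  apply: (le_trans (ler_normD _ _)); apply: lerD => //.
  by rewrite !normrM ler_pM// ?mulr_ge0// ler_wpM2l// xk// eq_sym.
by apply: le_trans L3; rewrite lerD.
Qed.

Let contY c : continuous (Y c).
Proof.
move=> x; apply: continuous_at_row => k; rewrite /Y.
have : continuous (fun y : 'rV[R]_n => (y + (c * (b * y ord0 j + d)) *: e) ord0 k); last by apply.
under [X in continuous X]eq_fun do rewrite mxE mxE.
apply: continuous_add; first exact: coord_continuous.
apply: continuous_mul; last exact: continuous_cst.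
apply: continuous_mul; first exact: continuous_cst.
apply: continuous_add; last exact: continuous_cst.
by apply: continuous_mul; [exact: continuous_cst|exact: coord_continuous].
Qed.

Let YC c k l : Ck k setT (fun x => Y c x ord0 l).
Proof.
rewrite /Y; under [X in Ck _ _ X]eq_fun do rewrite mxE mxE.
have oT := @openT 'rV[R]_n.
apply: (Ck_add oT); first exact: Ck_coord.
apply: (Ck_mul oT); last exact: Ck_cst.
apply: (Ck_mul oT); first exact: Ck_cst.
apply: (Ck_add oT); last exact: Ck_cst.
by apply: (Ck_mul oT); [exact: Ck_cst|exact: Ck_coord].
Qed.

Let derF c x : is_derive c (1 : R) (fun s => F s x) (G c x).
Proof.
have dw : is_derive c (1 : R) w ((i == j)%:R * b).
  apply/is_derive1P => r r0; near=> h; rewrite /w.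
  by rewrite (_ : _ - _ = 0) ?normr0 ?mulr_ge0// 1?ltW//; ring.
have df : is_derive c (1 : R) (fun s => f (Y s x)) ((b * x ord0 j + d) * partial i f (Y c x)).
  pose p := b * x ord0 j + d.
  have h1 : is_derive (c * p) (1 : R) (fun h => f (x + h *: e)) (partial i f (x + (c * p) *: e)).
    by apply: is_derive_partial; exact: Ck_has_partial fC I.
  have h2 : is_derive c (1 : R) (fun s : R => s * p) p.
    apply/is_derive1P => r r0; near=> h.
    by rewrite (_ : _ - _ = 0) ?normr0 ?mulr_ge0// 1?ltW//; ring.
  have := is_derive1_comp (f := fun h => f (x + h *: e)) (g := fun s : R => s * p) h1 h2.
  by rewrite mulrC.
have := is_deriveM dw df.
rewrite /G /F /GRing.scale/= addrC; congr is_derive.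
by rewrite [X in X + _ = _]mulrC.
Unshelve. all: by end_near. Qed.

Let contG c x : {for (c, x), continuous (fun p : R * 'rV[R]_n => G p.1 p.2)}.
Proof.
pose P := (R * 'rV[R]_n)%type.
have c1 : continuous (fun p : P => p.1) by move=> p; exact: cvg_fst.
have cx k : continuous (fun p : P => p.2 ord0 k).
  by move=> p; apply: (@continuous_comp _ _ _ snd (fun v : 'rV[R]_n => v ord0 k));
    [exact: cvg_snd|exact: coord_continuous].
have cst (r : R) : continuous (fun _ : P => r) by exact: continuous_cst.
have cp : continuous (fun p : P => b * p.2 ord0 j + d).
  by apply: continuous_add => //; exact: continuous_mul.
have cY : continuous (fun p : P => Y p.1 p.2).
  move=> p; apply: continuous_at_row => k.
  have : continuous (fun q : P => Y q.1 q.2 ord0 k); last by apply.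
  rewrite /Y; under [X in continuous X]eq_fun do rewrite mxE mxE.
  by apply: continuous_add => //; apply: continuous_mul => //; exact: continuous_mul.
have cfY (g : 'rV[R]_n -> R) : continuous g -> continuous (fun p : P => g (Y p.1 p.2)) .
  by move=> cg p; apply: (@continuous_comp _ _ _ (fun q : P => Y q.1 q.2) g); [exact: cY|exact: cg].
have cw : continuous (fun p : P => w p.1).
  by rewrite /w; apply: continuous_add => //; apply: continuous_mul => //; exact: continuous_mul.
suff : continuous (fun p : P => G p.1 p.2) by apply.
apply: continuous_add; apply: continuous_mul => //.
  by apply: cfY; exact: Ck_continuousT fC.
by apply: continuous_mul => //; apply: cfY; exact: Ck_continuousT (Ck_partial i fC).
Qed.

(** The derivative of the pulled back density along the deformation is a divergence, here of a
    vector field parallel to e_i. Its integral vanishes, so the integral of [F c] is constant in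
    c. *)
Let GE c : G c = partial i (fun x => (b * x ord0 j + d) * f (Y c x)).
Proof.
apply/funext => x; have oT := @openT 'rV[R]_n.
have h1 : is_derive (0 : R) 1 (fun h => b * (x + h *: e) ord0 j + d) ((i == j)%:R * b).
  apply/is_derive1P => r r0; near=> h; rewrite !mxE eqxx/= [j == i]eq_sym.
  by rewrite (_ : _ - _ = 0) ?normr0 ?mulr_ge0// 1?ltW//; ring.
have YE h : Y c (x + h *: e) = Y c x + (w c * h) *: e.
  apply/rowP => k; rewrite /Y /w !mxE eqxx/= [j == i]eq_sym.
  by case: (k == i); rewrite ?mulr1 ?mulr0; ring.
have h2 : is_derive (0 : R) 1 (fun h => f (Y c (x + h *: e))) (w c * partial i f (Y c x)).
  rewrite (funext (fun h => congr1 f (YE h))).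
  have k1 : is_derive (w c * 0) (1 : R) (fun h => f (Y c x + h *: e)) (partial i f (Y c x)).
    by rewrite mulr0; exact: Ck_is_derive fC I.
  have k2 : is_derive (0 : R) (1 : R) (fun s : R => w c * s) (w c).
    apply/is_derive1P => r r0; near=> h.
    by rewrite (_ : _ - _ = 0) ?normr0 ?mulr_ge0// 1?ltW//; ring.
  have := is_derive1_comp (f := fun h => f (Y c x + h *: e)) (g := fun s : R => w c * s) k1 k2.
  by rewrite mulrC.
have := is_deriveM h1 h2; rewrite scale0r addr0 /GRing.scale/= => h3.
have /(partialP i (fun x => (b * x ord0 j + d) * f (Y c x)) x)[_ ->] := h3.
by rewrite /G; ring.
Unshelve. all: by end_near. Qed.

Lemma II_elementary : II n (fun x => (1 + (i == j)%:R * b) * f (x + (b * x ord0 j + d) *: e)) = II n f.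
Proof.
have oT := @openT 'rV[R]_n.
have D (c : R) : 0 <= c <= 1 -> is_derive c (1 : R) (fun s : R => II n (F s)) 0.
  move=> c01; have [L L0 HL] := support c01.
  have [] := @is_derive_II R n F G c L L0 HL.
  - near=> s; rewrite /F; apply: continuous_mul; first exact: continuous_cst.
    by move=> x; apply: (@continuous_comp _ _ _ (Y s) f); [exact: contY|exact: (Ck_continuousT fC)].
  - by near=> s => x; exact: derF.
  - by move=> x; exact: contG.
  move=> _ _; rewrite GE (@II_partial _ _ _ L)//; last first.
    move=> x Lx; have w0 := w_gt0 c01.
    have HLc : vanishes_beyond L (F c) by exact: nbhs_singleton HL.
    have := HLc x Lx; rewrite /F => /eqP; rewrite mulf_eq0 (gt_eqF w0)/= => /eqP ->.
    by rewrite mulr0.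
  apply: (Ck_mul oT).
    apply: (Ck_add oT); last exact: Ck_cst.
    by apply: (Ck_mul oT); [exact: Ck_cst|exact: Ck_coord].
  by apply: (@Ck_comp R n n 1 setT setT f (Y c)); [exact: oT|exact: oT|move=> x _|exact: YC|exact: fC].
have D' (x : R) : x \in `]0, 1[ -> is_derive x (1 : R) (fun s : R => II n (F s)) 0.
  by rewrite in_itv/= => /andP[x0 x1]; apply: D; rewrite !ltW.
have cg : {within `[0, 1], continuous (fun s => II n (F s))}.
  by apply: derivable_within_continuous => x; rewrite in_itv/= => /D[].
have [c _] := MVT ltr01 D' cg; rewrite mul0r => /eqP; rewrite subr_eq0 => /eqP E.
have F1 : F 1 = fun x => (1 + (i == j)%:R * b) * f (x + (b * x ord0 j + d) *: e).
  by apply/funext => x; rewrite /F /w /Y !mul1r.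
have F0 : F 0 = f.
  by apply/funext => x; rewrite /F /w /Y !mul0r mulr0 addr0 mul1r scale0r addr0.
by rewrite -F1 E F0.
Unshelve. all: by end_near. Qed.

End ElementaryChangeOfVariables.

End IntegralOfPartials.

(** * Affine changes of variables *)

Section LinearChangeOfVariables.
Variables (R : realType) (n : nat).
Local Notation II := (@iterated_integral R n).
Implicit Types (f : 'rV[R]_n -> R) (A : 'M[R]_n) (x y : 'rV[R]_n).

Definition C1_bounded_support f := Ck 1 setT f /\ exists2 K, 0 < K & vanishes_beyond K f.

Lemma mulmx_bound A : exists2 c : R, 0 < c & forall x, `|x *m A| <= c * `|x|.
Proof.
pose c : R := 1 + \sum_i \sum_j `|A i j|.
have s0 : 0 <= \sum_i \sum_j `|A i j| by rewrite !sumr_ge0// => ? _; rewrite sumr_ge0.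
have c0 : 0 < c by rewrite ltr_wpDr.
exists c => // x; apply: norm_le_coord => [|j]; first by rewrite mulr_ge0// ltW.
rewrite mxE; apply: (le_trans (ler_norm_sum _ _ _)).
apply: (@le_trans _ _ (\sum_i `|x| * \sum_k `|A i k|)).
  apply: ler_sum => i _; rewrite normrM ler_pM// ?coord_le_norm//.
  by rewrite (bigD1 j)//= lerDl sumr_ge0.
by rewrite -mulr_sumr mulrC ler_wpM2r// /c lerDr.
Qed.

Lemma mulmx_expansive A : \det A != 0 -> exists2 c : R, 0 < c & forall x, c * `|x| <= `|x *m A|.
Proof.
move=> dA; have uA : A \in unitmx by rewrite unitmxE unitfE.
have [c c0 h] := mulmx_bound (invmx A); exists c^-1; first by rewrite invr_gt0.
by move=> x; rewrite ler_pdivrMl//; have := h (x *m A); rewrite mulmxK.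
Qed.

Lemma Ck_mulmx k (U : set 'rV[R]_n) A j : open U -> Ck k U (fun x => (x *m A) ord0 j).
Proof.
move=> Uo; apply: (@Ck_ext _ _ _ _ (fun x : 'rV[R]_n => \sum_i x ord0 i * A i j)) => //.
  by move=> x _; rewrite mxE.
by apply: Ck_sum => // i _; apply: (Ck_mul Uo); [exact: Ck_coord|exact: Ck_cst].
Qed.

Lemma C1_bounded_support_affine f A x0 y0 : \det A != 0 -> C1_bounded_support f ->
  C1_bounded_support (fun x => f (y0 + (x - x0) *m A)).
Proof.
move=> dA [fC [K K0 fK]]; split.
  apply: (@Ck_comp R n n 1 setT setT f (fun x => y0 + (x - x0) *m A)); [exact: openT|exact: openT|by []| |exact: fC].
  move=> j; apply: (@Ck_ext _ _ _ _ (fun x : 'rV[R]_n => y0 ord0 j - (x0 *m A) ord0 j + (x *m A) ord0 j)).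
  - exact: openT.
  - by move=> x _; rewrite mulmxBl !mxE; ring.
  - by apply: Ck_add; [exact: openT|exact: Ck_cst|apply: Ck_mulmx; exact: openT].
have [c c0 h] := mulmx_expansive dA.
have L0 : 0 < `|x0| + (K + `|y0|) / c by rewrite ltr_wpDl// divr_gt0// ltr_wpDr.
exists (`|x0| + (K + `|y0|) / c) => // x Lx; apply: fK; rewrite ltNge; apply/negP => yK.
move: Lx; rewrite ltNge => /negP; apply; rewrite -[x](subrK x0) addrC.
apply: (le_trans (ler_normD _ _)); rewrite lerD2l ler_pdivlMr// mulrC (le_trans (h _))//.
rewrite -[X in `|X| <= _](addKr y0) addrC (le_trans (ler_normB _ _))// lerD2r//.
Qed.

Lemma C1_bounded_support_scale f c : C1_bounded_support f -> C1_bounded_support (fun x => c * f x).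
Proof.
move=> [fC [K K0 fK]]; split; last by exists K => // x Kx; rewrite fK ?mulr0.
by apply: (Ck_mul openT); [exact: Ck_cst|exact: fC].
Qed.

Lemma II_C1_scale f c : C1_bounded_support f -> II (fun x => c * f x) = c * II f.
Proof. by move=> [fC [K K0 fK]]; apply: (II_scale _ K0) => //; exact: Ck_continuousT fC. Qed.

(** One coordinate at a time, each being the elementary substitution with b = 0. *)
Lemma II_translate f (d : 'rV[R]_n) : C1_bounded_support f -> II (fun x => f (x + d)) = II f.
Proof.
move=> fG; rewrite [d]row_sum_unit; elim: (index_enum _) f fG => [|i r IH] f fG.
  by congr iterated_integral; apply/funext => x; rewrite big_nil addr0.
pose g x := f (x + d ord0 i *: unit_row R i).
have gG : C1_bounded_support g.
  have := @C1_bounded_support_affine f 1%:M 0 (d ord0 i *: unit_row R i).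
  rewrite det1 oner_neq0 => /(_ isT fG); congr C1_bounded_support.
  by apply/funext => x; rewrite /g subr0 mulmx1 addrC.
rewrite -[RHS](_ : II g = _).
  rewrite -[RHS]IH//; congr iterated_integral; apply/funext => x.
  by rewrite /g big_cons addrAC addrA.
have [fC [K K0 fK]] := fG.
rewrite -[RHS](@II_elementary R n f K i i 0 (d ord0 i) K0)//.
by congr iterated_integral; apply/funext => x; rewrite mulr0 addr0 mul1r mul0r add0r.
Qed.

Lemma mulmx_elementary x i j c :
  x *m (elementary_mx i j c)^T = x + (c * x ord0 j) *: unit_row R i.
Proof.
rewrite /elementary_mx linearD/= trmx1 mulmxDr mulmx1 linearZ/= -scalemxAr; congr (_ + _).
rewrite -scalerA; congr (_ *: _); apply/rowP => k; rewrite !mxE (bigD1 j)//= big1 => [|l lj].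
  by rewrite !mxE eqxx andbT addr0.
by rewrite !mxE (negPf lj) andbF mulr0.
Qed.

Lemma elementary_product_gt0 A : elementary_product A -> 0 < \det A.
Proof.
elim=> {A} [|i j c ij|i c c0|A B _ IA _ IB]; rewrite ?det1 ?ltr01 ?det_elementary//.
- by rewrite (negPf ij) mul0r addr0.
- by rewrite eqxx mul1r.
- by rewrite det_mulmx mulr_gt0.
Qed.

Lemma II_linear f A : elementary_product A -> C1_bounded_support f ->
  II (fun x => \det A * f (x *m A^T)) = II f.
Proof.
move=> EA; elim: EA f => {A} [|i j c ij|i c c0|A B EA IA EB IB] f fG.
- by congr iterated_integral; apply/funext => x; rewrite det1 mul1r trmx1 mulmx1.
- have [fC [K K0 fK]] := fG.
  rewrite -[RHS](@II_elementary R n f K i j c 0 K0)//; last by move=> e; rewrite e eqxx in ij.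
  by rewrite det_elementary; congr iterated_integral; apply/funext => x; rewrite mulmx_elementary addr0.
- have [fC [K K0 fK]] := fG.
  rewrite -[RHS](@II_elementary R n f K i i c 0 K0)//.
  by rewrite det_elementary; congr iterated_integral; apply/funext => x; rewrite mulmx_elementary addr0.
have dA : 0 < \det A by exact: elementary_product_gt0.
have fA : C1_bounded_support (fun x => f (x *m A^T)).
  have := @C1_bounded_support_affine f A^T 0 0; rewrite det_tr gt_eqF// => /(_ isT fG).
  by congr C1_bounded_support; apply/funext => x; rewrite subr0 add0r.
rewrite -[RHS]IA// -[RHS]IB; last exact: C1_bounded_support_scale.
congr iterated_integral; apply/funext => x.
by rewrite det_mulmx trmx_mul mulmxA mulrA [\det A * _]mulrC.
Qed.

Lemma II_affine f A x0 y0 : 0 < \det A -> C1_bounded_support f ->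
  II (fun x => \det A * f (y0 + (x - x0) *m A^T)) = II f.
Proof.
move=> dA fG; have dA' : \det A^T != 0 by rewrite det_tr gt_eqF.
rewrite -(II_linear (elementary_product_det dA) fG).
have gG : C1_bounded_support (fun x => \det A * f (x *m A^T)).
  apply: C1_bounded_support_scale; have := @C1_bounded_support_affine f A^T 0 0 dA' fG.
  by congr C1_bounded_support; apply/funext => x; rewrite subr0 add0r.
rewrite -(II_translate (y0 *m invmx A^T - x0) gG); congr iterated_integral; apply/funext => x.
rewrite !mulmxDl mulmxKV ?unitmxE ?unitfE//; congr (_ * f _).
by rewrite addrCA.
Qed.

End LinearChangeOfVariables.

(** * Exterior derivative *)

Section FormDerivatives.
Variables (R : realType) (n : nat).
Implicit Types (v w : 'rV[R]_n -> ext R n) (x : 'rV[R]_n) (U V : set 'rV[R]_n) (i j : 'I_n) (k : nat).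

Lemma is_derive_mul (f g : R -> R) (t a b : R) : is_derive t (1 : R) f a -> is_derive t (1 : R) g b ->
  is_derive t (1 : R) (fun h => f h * g h) (a * g t + f t * b).
Proof.
move=> fa gb; have := is_deriveM fa gb; rewrite /GRing.scale/= addrC.
by rewrite [g t * a]mulrC.
Qed.

Lemma is_derive_suml (T : Type) (r : seq T) (P : pred T) (F : T -> R -> R) (L : T -> R) (t : R) :
  (forall a, P a -> is_derive t (1 : R) (F a) (L a)) ->
  is_derive t (1 : R) (fun h => \sum_(a <- r | P a) F a h) (\sum_(a <- r | P a) L a).
Proof.
move=> FL; elim: r => [|a r IH].
  rewrite big_nil (_ : (fun h => _) = fun=> 0); first exact: is_derive_cst.
  by apply/funext => h; rewrite big_nil.
rewrite big_cons (_ : (fun h => _) = fun h => if P a then F a h + \sum_(b <- r | P b) F b h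
  else \sum_(b <- r | P b) F b h); last by apply/funext => h; rewrite big_cons.
case: ifP => // Pa; exact: is_deriveD (FL _ Pa) IH.
Qed.

(** A relation rather than a function, so that existence and value of the derivative travel together
    through sum and product rules. *)
Definition form_derive i w x (l : ext R n) :=
  forall I, is_derive (0 : R) 1 (fun h : R => w (x + h *: unit_row R i) I) (l I).

Definition form_partial i w x : ext R n :=
  [ffun I : {set 'I_n} => partial i (fun y => w y I) x].

Definition form_Ck k U w := forall I, Ck k U (fun x => w x I).

Lemma form_derive_partial i w x l : form_derive i w x l -> form_partial i w x = l.
Proof. by move=> D; apply/ffunP => I; rewrite ffunE; have /(partialP i (fun y => w y I) x)[] := D I. Qed.

Lemma form_Ck_derive k U w i x : form_Ck k.+1 U w -> U x -> form_derive i w x (form_partial i w x).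
Proof. by move=> wC Ux I; rewrite ffunE; exact: Ck_is_derive (wC I) Ux. Qed.

Lemma form_Ck_partial k U w i : form_Ck k.+1 U w -> form_Ck k U (form_partial i w).
Proof.
move=> wC I; have := Ck_partial i (wC I).
by congr Ck; apply/funext => x; rewrite /form_partial ffunE.
Qed.

Lemma form_Ck_ext k U v w : open U -> (forall x, U x -> v x = w x) -> form_Ck k U v -> form_Ck k U w.
Proof. by move=> Uo E vC I; apply: (@Ck_ext _ _ _ _ (fun x => v x I)) => // x Ux; rewrite E. Qed.

Lemma extd_ext U v w x : open U -> U x -> (forall y, U y -> v y = w y) -> extd v x = extd w x.
Proof.
move=> Uo Ux E; apply/ffunP => I; rewrite !ffunE; apply: eq_bigr => i _; congr (_ * _).
by apply: (partial_ext i Uo Ux) => y Uy; rewrite E.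
Qed.

Lemma extdE w x : extd w x = \sum_i eps i (form_partial i w x).
Proof.
apply/ffunP => I; rewrite sum_ffunE ffunE [LHS]big_mkcond/=; apply: eq_bigr => i _.
by rewrite epsE; case: ifP; rewrite // ffunE.
Qed.

Lemma form_derive_extd w x (l : 'I_n -> ext R n) : (forall i, form_derive i w x (l i)) ->
  extd w x = \sum_i eps i (l i).
Proof. by move=> D; rewrite extdE; apply: eq_bigr => i _; rewrite (form_derive_partial (D i)). Qed.

Lemma form_derive_cst i (c : ext R n) x : form_derive i (fun=> c) x 0.
Proof. by move=> I; rewrite ffunE; exact: is_derive_cst. Qed.

Lemma form_derive_add i v w x a b : form_derive i v x a -> form_derive i w x b ->
  form_derive i (fun y => v y + w y) x (a + b).
Proof.
move=> va wb I; rewrite ffunE (_ : (fun h => _) =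
  fun h : R => v (x + h *: unit_row R i) I + w (x + h *: unit_row R i) I); first exact: is_deriveD.
by apply/funext => h; rewrite ffunE.
Qed.

Lemma form_derive_scale i (f : 'rV[R]_n -> R) w x (a : R) b :
  is_derive (0 : R) 1 (fun h : R => f (x + h *: unit_row R i)) a -> form_derive i w x b ->
  form_derive i (fun y => f y *: w y) x (a *: w x + f x *: b).
Proof.
move=> fa wb I; rewrite (_ : (fun h => _) =
  fun h : R => f (x + h *: unit_row R i) * w (x + h *: unit_row R i) I); last first.
  by apply/funext => h; rewrite scale_extE.
have := is_derive_mul fa (wb I).
by rewrite /= scale0r addr0 add_extE !scale_extE.
Qed.

Lemma form_derive_sum i (T : Type) (r : seq T) (P : pred T) (F : T -> 'rV[R]_n -> ext R n)
    (L : T -> ext R n) x : (forall a, P a -> form_derive i (F a) x (L a)) ->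
  form_derive i (fun y => \sum_(a <- r | P a) F a y) x (\sum_(a <- r | P a) L a).
Proof.
move=> FL I; rewrite sum_ffunE (_ : (fun h => _) =
  fun h : R => \sum_(a <- r | P a) F a (x + h *: unit_row R i) I); last first.
  by apply/funext => h; rewrite sum_ffunE.
by apply: is_derive_suml => a Pa; exact: FL.
Qed.

Lemma form_derive_wedge i v w x a b : form_derive i v x a -> form_derive i w x b ->
  form_derive i (fun y => wedge (v y) (w y)) x (wedge a (w x) + wedge (v x) b).
Proof.
move=> va wb I.
have -> : (wedge a (w x) + wedge (v x) b) I = \sum_(J : {set 'I_n} | J \subset I)
    wedge_sign R J (I :\: J)%SET * (a J * w x (I :\: J)%SET + v x J * b (I :\: J)%SET).
  by rewrite add_extE !ffunE -big_split/=; apply: eq_bigr => J _; rewrite mulrDr.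
rewrite (_ : (fun h => _) = fun h : R => \sum_(J : {set 'I_n} | J \subset I)
  wedge_sign R J (I :\: J)%SET *
  (v (x + h *: unit_row R i) J * w (x + h *: unit_row R i) (I :\: J)%SET)); last first.
  by apply/funext => h; rewrite ffunE.
apply: is_derive_suml => J _.
have := is_derive_mul (is_derive_cst (wedge_sign R J (I :\: J)%SET) (0 : R) 1)
  (is_derive_mul (va J) (wb (I :\: J)%SET)).
by rewrite /= mul0r add0r scale0r addr0.
Qed.

Lemma form_derive_linear i (g : ext R n -> ext R n) w x a :
  (forall (c : R) u u', g (c *: u + u') = c *: g u + g u') ->
  form_derive i w x a -> form_derive i (fun y => g (w y)) x (g a).
Proof.
move=> gL wa.
have g0 : g 0 = 0.
  by have := gL (-1) 0 0; rewrite scaler0 addr0 scaleN1r addNr.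
have gE u : g u = \sum_J u J *: g (dx R J).
  rewrite {1}[u]ext_basis; elim: (index_enum _) => [|J r IH]; first by rewrite !big_nil.
  by rewrite !big_cons gL IH.
rewrite gE (_ : (fun y => _) = fun y => \sum_J w y J *: g (dx R J)); last first.
  by apply/funext => y; rewrite gE.
apply: form_derive_sum => J _.
have := @form_derive_scale i (fun y => w y J) _ x _ _ (wa J) (@form_derive_cst i (g (dx R J)) x).
by rewrite scaler0 addr0.
Qed.

Lemma is_derive_mukai i v w x a b : form_derive i v x a -> form_derive i w x b ->
  is_derive (0 : R) 1 (fun h : R => mukai (v (x + h *: unit_row R i)) (w (x + h *: unit_row R i)))
    (mukai a (w x) + mukai (v x) b).
Proof.
move=> va wb; have hb : form_derive i (fun y => hat (w y)) x (hat b).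
  by apply: form_derive_linear wb => c u u'; rewrite hatD hatZ.
by have := form_derive_wedge va hb (topset n); rewrite add_extE.
Qed.

Lemma form_Ck_cst k U (c : ext R n) : form_Ck k U (fun=> c).
Proof. by move=> I; exact: Ck_cst. Qed.

Lemma form_Ck_add k U v w : open U -> form_Ck k U v -> form_Ck k U w -> form_Ck k U (fun x => v x + w x).
Proof.
move=> Uo vC wC I; apply: (@Ck_ext _ _ _ _ (fun x => v x I + w x I)) => // [x _|]; first by rewrite ffunE.
exact: Ck_add.
Qed.

Lemma form_Ck_scale k U (f : 'rV[R]_n -> R) w : open U -> Ck k U f -> form_Ck k U w ->
  form_Ck k U (fun x => f x *: w x).
Proof.
move=> Uo fC wC I; apply: (@Ck_ext _ _ _ _ (fun x => f x * w x I)) => // [x _|].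
  by rewrite scale_extE.
exact: Ck_mul.
Qed.

Lemma form_Ck_sum k U (T : Type) (r : seq T) (P : pred T) (F : T -> 'rV[R]_n -> ext R n) : open U ->
  (forall a, P a -> form_Ck k U (F a)) -> form_Ck k U (fun x => \sum_(a <- r | P a) F a x).
Proof.
move=> Uo FC I; apply: (@Ck_ext _ _ _ _ (fun x => \sum_(a <- r | P a) F a x I)) => // [x _|].
  by rewrite sum_ffunE.
by apply: Ck_sum => // a Pa; exact: FC.
Qed.

Lemma form_Ck_wedge k U v w : open U -> form_Ck k U v -> form_Ck k U w ->
  form_Ck k U (fun x => wedge (v x) (w x)).
Proof.
move=> Uo vC wC I; apply: (@Ck_ext _ _ _ _ (fun x => \sum_(J : {set 'I_n} | J \subset I)
  wedge_sign R J (I :\: J)%SET * (v x J * w x (I :\: J)%SET))) => // [x _|]; first by rewrite ffunE.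
apply: Ck_sum => // J _; apply: (Ck_mul Uo); first exact: Ck_cst.
by apply: (Ck_mul Uo); [exact: vC|exact: wC].
Qed.

Lemma form_Ck_linear k U (g : ext R n -> ext R n) w : open U ->
  (forall (c : R) u u', g (c *: u + u') = c *: g u + g u') ->
  form_Ck k U w -> form_Ck k U (fun y => g (w y)).
Proof.
move=> Uo gL wC.
have g0 : g 0 = 0.
  by have := gL (-1) 0 0; rewrite scaler0 addr0 scaleN1r addNr.
have gE u : g u = \sum_J u J *: g (dx R J).
  rewrite {1}[u]ext_basis; elim: (index_enum _) => [|J r IH]; first by rewrite !big_nil.
  by rewrite !big_cons gL IH.
apply: (@form_Ck_ext _ _ (fun y => \sum_J w y J *: g (dx R J))) => //.
by apply: form_Ck_sum => // J _; apply: form_Ck_scale => //; exact: form_Ck_cst.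
Qed.

Lemma Ck_mukai k U v w : open U -> form_Ck k U v -> form_Ck k U w -> Ck k U (fun x => mukai (v x) (w x)).
Proof.
move=> Uo vC wC; have hC : form_Ck k U (fun x => hat (w x)).
  by apply: form_Ck_linear => // c u u'; rewrite hatD hatZ.
exact: form_Ck_wedge Uo vC hC (topset n).
Qed.

Lemma form_Ck_extd k U w : open U -> form_Ck k.+1 U w -> form_Ck k U (extd w).
Proof.
move=> Uo wC; apply: (@form_Ck_ext _ _ (fun x => \sum_i eps i (form_partial i w x))) => // [x _|].
  by rewrite extdE.
apply: form_Ck_sum => // i _; apply: form_Ck_linear => //; last exact: form_Ck_partial.
by move=> c u u'; rewrite epsD epsZ.
Qed.

Lemma extd_cst (c : ext R n) x : extd (fun=> c) x = 0.
Proof.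
rewrite (@form_derive_extd _ _ (fun=> 0)); last by move=> i; exact: form_derive_cst.
by rewrite big1// => i _; rewrite eps0.
Qed.

Lemma extd_sum (T : Type) (r : seq T) (P : pred T) (F : T -> 'rV[R]_n -> ext R n) U x :
  U x -> (forall a, P a -> form_Ck 1 U (F a)) ->
  extd (fun y => \sum_(a <- r | P a) F a y) x = \sum_(a <- r | P a) extd (F a) x.
Proof.
move=> Ux FC; rewrite (@form_derive_extd _ _ (fun i => \sum_(a <- r | P a) form_partial i (F a) x)).
  under eq_bigr do rewrite eps_sum.
  by rewrite exchange_big/=; apply: eq_bigr => a _; rewrite extdE.
by move=> i; apply: form_derive_sum => a Pa; exact: form_Ck_derive (FC _ Pa) Ux.
Qed.

Lemma extd_scale U (f : 'rV[R]_n -> R) w x : U x -> Ck 1 U f -> form_Ck 1 U w ->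
  extd (fun y => f y *: w y) x = wedge (covector (\row_i partial i f x)) (w x) + f x *: extd w x.
Proof.
move=> Ux fC wC.
rewrite (@form_derive_extd _ _ (fun i => partial i f x *: w x + f x *: form_partial i w x)).
  under eq_bigr do rewrite epsD !epsZ.
  rewrite big_split/= -scaler_sumr -extdE; congr (_ + _).
  rewrite covectorE wedge_suml; apply: eq_bigr => i _.
  by rewrite mxE wedgeZl.
by move=> i; apply: form_derive_scale; [exact: Ck_is_derive fC Ux|exact: form_Ck_derive wC Ux].
Qed.

Lemma extd_wedge1 U (c : 'rV[R]_n -> 'rV[R]_n) w x : U x ->
  form_Ck 1 U (fun y => covector (c y)) -> form_Ck 1 U w ->
  extd (fun y => wedge (covector (c y)) (w y)) x =
  wedge (extd (fun y => covector (c y)) x) (w x) - wedge (covector (c x)) (extd w x).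
Proof.
move=> Ux cC wC; rewrite (form_derive_extd (fun i =>
  form_derive_wedge (form_Ck_derive i cC Ux) (form_Ck_derive i wC Ux))).
under eq_bigr do rewrite epsD.
rewrite big_split/= !extdE wedge_suml; congr (_ + _).
  by apply: eq_bigr => i _; rewrite /eps wedgeA.
rewrite wedge_sumr -sumrN; apply: eq_bigr => i _.
rewrite /eps !wedgeA -[dx R [set i]]/(dx R [set i]).
have -> : dx R [set i] = covector (delta_mx ord0 i : 'rV[R]_n).
  rewrite covectorE (bigD1 i)//= big1 ?addr0 => [|j ji]; rewrite mxE eqxx/= ?eqxx ?scale1r//.
  by rewrite (negPf ji) scale0r.
by rewrite covector_anti -scaleN1r wedgeZl scaleN1r.
Qed.

End FormDerivatives.

(** * Pullback commutes with the exterior derivative *)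

Section PullbackNaturality.
Variables (R : realType) (n : nat) (U V : set 'rV[R]_n) (T : 'rV[R]_n -> 'rV[R]_n) (m : nat).
Implicit Types (w : 'rV[R]_n -> ext R n) (x : 'rV[R]_n) (i j : 'I_n).
Hypotheses (Uo : open U) (Vo : open V) (TV : forall x, U x -> V (T x)).
Hypothesis TC : forall j, Ck m.+2 U (fun x => T x ord0 j).

Let dT j x : ext R n := row_covector (jac T x) j.

Let dTE j x : dT j x = covector (\row_i partial i (fun y => T y ord0 j) x).
Proof. by rewrite /dT /row_covector; congr covector; apply/rowP => i; rewrite !mxE. Qed.

Let dTs j x : dT j x = \sum_i partial i (fun y => T y ord0 j) x *: dx R [set i].
Proof. by rewrite dTE covectorE; apply: eq_bigr => i _; rewrite mxE. Qed.

Let TC2 j : Ck 2 U (fun x => T x ord0 j). Proof. exact: Ck_le (TC j). Qed.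

Let dT_Ck j : form_Ck m.+1 U (dT j).
Proof.
apply: (@form_Ck_ext _ _ _ _ (fun x => \sum_i partial i (fun y => T y ord0 j) x *: dx R [set i]));
  [exact: Uo|by move=> x _; rewrite dTs|].
apply: form_Ck_sum => // i _; apply: form_Ck_scale => //; last exact: form_Ck_cst.
exact: Ck_partial (TC j).
Qed.

Let form_Ck1 w : form_Ck m.+1 U w -> form_Ck 1 U w. Proof. by move=> wC I; exact: Ck_le (wC I). Qed.

(** By symmetry of mixed partials and anticommutativity of the [eps i], the sum expressing d(dT_j)
    equals its own negative. *)
Let dT_closed j x : U x -> extd (dT j) x = 0.
Proof.
move=> Ux; pose a i k := partial i (partial k (fun y => T y ord0 j)) x.
have aC i k : a i k = a k i by exact: (schwarz i k Uo (TC2 j) Ux).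
have -> : extd (dT j) x = \sum_i \sum_k a i k *: eps i (eps k (ext1 R n)).
  rewrite (@form_derive_extd _ _ (dT j) x (fun i => \sum_k a i k *: dx R [set k])).
    apply: eq_bigr => i _; rewrite eps_sum; apply: eq_bigr => k _.
    by rewrite epsZ [eps k _]/eps wedge1r.
  move=> i; rewrite (_ : dT j = fun y => \sum_k partial k (fun y => T y ord0 j) y *: dx R [set k]).
    apply: form_derive_sum => k _.
    have := form_derive_scale (Ck_is_derive i (Ck_partial k (TC j)) Ux)
      (@form_derive_cst R n i (dx R [set k]) x).
    by rewrite scaler0 addr0.
  by apply/funext => y; rewrite dTs.
set S := \sum_i _.
have : S = - S.
  rewrite {1}/S exchange_big/= /S -sumrN; apply: eq_bigr => i _.
  rewrite -sumrN; apply: eq_bigr => k _; rewrite aC; have [->|ik] := eqVneq i k.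
    by rewrite eps_sqr scaler0 oppr0.
  by rewrite eps_anti 1?eq_sym// scalerN.
move=> /eqP; rewrite -subr_eq0 opprK -mulr2n -scaler_nat scaler_eq0 pnatr_eq0/=.
by move=> /eqP.
Qed.

Let prod_closed (r : seq 'I_n) : form_Ck m.+1 U (fun x => \big[@wedge R n/ext1 R n]_(j <- r) dT j x) /\
  forall x, U x -> extd (fun x => \big[@wedge R n/ext1 R n]_(j <- r) dT j x) x = 0.
Proof.
elim: r => [|j r [IC ID]].
  rewrite (_ : (fun x => _) = fun=> ext1 R n); last by apply/funext => x; rewrite big_nil.
  by split; [exact: form_Ck_cst|move=> x _; exact: extd_cst].
rewrite (_ : (fun x => _) = fun x => wedge (covector (row j (jac T x)))
  (\big[@wedge R n/ext1 R n]_(j <- r) dT j x)); last by apply/funext => x; rewrite big_cons.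
split=> [|x Ux]; first exact: (form_Ck_wedge Uo (dT_Ck j) IC).
rewrite (@extd_wedge1 _ _ U); [|exact: Ux|exact: form_Ck1 (dT_Ck j)|exact: form_Ck1].
by rewrite ID// wedge0r subr0 [extd _ x](dT_closed j Ux) wedge0l.
Qed.

(** The coefficients of the pullback involve the Jacobian of T, so T is assumed to have one
    derivative more than the conclusion. *)
Lemma form_Ck_pull w : form_Ck m.+1 V w -> form_Ck m.+1 U (fun x => pull (jac T x) (w (T x))).
Proof.
move=> wC; apply: (@form_Ck_ext _ _ _ _ (fun x => \sum_J w (T x) J *:
  \big[@wedge R n/ext1 R n]_(j <- enum (J : {set 'I_n})) dT j x)) => //.
  by move=> x _; rewrite pullE; apply: eq_bigr => J _; rewrite ordered_prod_enum.
apply: form_Ck_sum => // J _; apply: form_Ck_scale => //; last by case: (prod_closed (enum J)).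
apply: (@Ck_comp R n n m.+1 U V (fun x => w x J) T);
  [exact: Uo|exact: Vo|exact: TV|by move=> j; exact: (Ck_le _ (TC j))|exact: wC].
Qed.

Lemma partial_comp (f : 'rV[R]_n -> R) i x : U x -> Ck 1 V f ->
  partial i (fun y => f (T y)) x = \sum_k partial i (fun y => T y ord0 k) x * partial k f (T x).
Proof.
move=> Ux fC.
pose c (h : R) := T (x + h *: unit_row R i).
have c0 : c 0 = T x by rewrite /c scale0r addr0.
have fc : C1_at f (c 0) by rewrite c0; apply: (Ck_C1_at Vo fC); exact: TV.
have dc j : is_derive (0 : R) 1 (fun s => c s ord0 j) ((\row_k partial i (fun y => T y ord0 k) x) ord0 j).
  by rewrite mxE; apply: (Ck_is_derive i (TC j) Ux).
have /(partialP i (fun y => f (T y)) x)[_ ->] := is_derive_chain fc dc.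
by rewrite /gradient c0; apply: eq_bigr => k _; rewrite mxE.
Qed.

(** A pulled back form is a sum of functions w_J(T) times products of the closed one-forms dT_j.
    Only the functions get differentiated, and the chain rule rewrites their differentials in terms
    of the dT_k. *)
Theorem extd_pull w x : U x -> form_Ck 1 V w ->
  extd (fun y => pull (jac T y) (w (T y))) x = pull (jac T x) (extd w (T x)).
Proof.
move=> Ux wC.
pose P (J : {set 'I_n}) y := \big[@wedge R n/ext1 R n]_(j <- enum J) dT j y.
have wT J : Ck 1 U (fun y => w (T y) J).
  apply: (@Ck_comp R n n 1 U V (fun x => w x J) T);
    [exact: Uo|exact: Vo|exact: TV|by move=> j; exact: (Ck_le _ (TC j))|exact: wC].
have PC J : form_Ck 1 U (P J) by apply: form_Ck1; case: (prod_closed (enum J)).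
rewrite (@extd_ext _ _ U _ (fun y => \sum_J w (T y) J *: P J y))//; last first.
  by move=> y Uy; rewrite pullE; apply: eq_bigr => J _; rewrite ordered_prod_enum.
rewrite (@extd_sum _ _ _ _ _ _ U); [|exact: Ux|by move=> J _; exact: (form_Ck_scale Uo (wT J) (PC J))].
rewrite [in RHS]extdE pull_sum.
have pullP A (v : ext R n) : pull A v = \sum_J v J *: pull A (dx R J).
  by rewrite {1}[v]ext_basis pull_sum; apply: eq_bigr => J _; rewrite pullZ.
have pullk k : pull (jac T x) (eps k (form_partial k w (T x))) =
    \sum_J partial k (fun y => w y J) (T x) *: wedge (dT k x) (P J x).
  rewrite /eps pull_wedge [pull _ (form_partial _ _ _)]pullP wedge_sumr; apply: eq_bigr => J _.
  by rewrite wedgeZr !pull_dx ordered_prod1 ffunE ordered_prod_enum.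
under [RHS]eq_bigr do rewrite pullk.
rewrite exchange_big/=; apply: eq_bigr => J _.
rewrite (@extd_scale _ _ U)//.
have [_ ->//] := prod_closed (enum J); rewrite scaler0 addr0.
rewrite (_ : covector _ = \sum_k partial k (fun y => w y J) (T x) *: dT k x).
  by rewrite wedge_suml; apply: eq_bigr => k _; rewrite wedgeZl.
rewrite covectorE; under [RHS]eq_bigr do rewrite dTs scaler_sumr.
rewrite exchange_big/=; apply: eq_bigr => i _; rewrite mxE (partial_comp i Ux (wC J)) scaler_suml.
by apply: eq_bigr => k _; rewrite scalerA mulrC.
Qed.

End PullbackNaturality.

Section Jacobians.
Variables (R : realType) (n : nat) (U V : set 'rV[R]_n).
Implicit Types (S T : 'rV[R]_n -> 'rV[R]_n) (x : 'rV[R]_n).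

Lemma jac_ext S T x : open U -> U x -> (forall y, U y -> S y = T y) -> jac S x = jac T x.
Proof.
move=> Uo Ux E; apply/matrixP => j i; rewrite !mxE; apply: (partial_ext i Uo Ux) => y Uy.
by rewrite E.
Qed.

Lemma jac_comp S T x : open U -> open V -> (forall x, U x -> V (T x)) ->
  (forall j, Ck 2 U (fun x => T x ord0 j)) -> (forall j, Ck 1 V (fun x => S x ord0 j)) -> U x ->
  jac (S \o T) x = jac S (T x) *m jac T x.
Proof.
move=> Uo Vo TV TC SC Ux; apply/matrixP => j i; rewrite !mxE.
rewrite (partial_comp Vo TV TC i Ux (SC j)); apply: eq_bigr => k _.
by rewrite !mxE mulrC.
Qed.

Lemma jac_affine (A : 'M[R]_n) x0 y0 x : jac (fun x => y0 + (x - x0) *m A^T) x = A.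
Proof.
apply/matrixP => j i; rewrite mxE.
have : is_derive (0 : R) 1 (fun h : R => (y0 + (x + h *: unit_row R i - x0) *m A^T) ord0 j) (A j i).
  rewrite (_ : (fun h => _) = fun h : R => (y0 + (x - x0) *m A^T + h *: (unit_row R i *m A^T)) ord0 j).
    have := is_derive_coord (y0 + (x - x0) *m A^T) (unit_row R i *m A^T) j 0.
    by rewrite -rowE !mxE.
  by apply/funext => h; rewrite addrAC mulmxDl -scalemxAl addrA.
by move=> /(partialP i (fun x => (y0 + (x - x0) *m A^T) ord0 j) x)[].
Qed.

End Jacobians.

(** * Stokes' theorem for compactly supported forms in coordinates *)

Section Stokes.
Variables (R : realType) (n : nat).
Local Notation II := (@iterated_integral R n).
Implicit Types (w : 'rV[R]_n -> ext R n).

Lemma II_sum (I : Type) (r : seq I) (F : I -> 'rV[R]_n -> R) K : 0 < K ->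
  (forall i, continuous (F i)) -> (forall i, vanishes_beyond K (F i)) ->
  II (fun x => \sum_(i <- r) F i x) = \sum_(i <- r) II (F i).
Proof.
move=> K0 Fc FK; elim: r => [|i r IH].
  rewrite big_nil (_ : (fun x => _) = fun=> 0) ?ext0_II//.
  by apply/funext => x; rewrite big_nil.
rewrite big_cons -IH -(II_add K0)//.
- by congr iterated_integral; apply/funext => x; rewrite big_cons.
- exact: continuous_sum.
- by move=> x Kx; rewrite big1// => j _; exact: FK.
Qed.

Lemma II_divergence (F : 'I_n -> 'rV[R]_n -> R) K : 0 < K ->
  (forall i, Ck 1 setT (F i)) -> (forall i, vanishes_beyond K (F i)) ->
  II (fun x => \sum_i partial i (F i) x) = 0.
Proof.
move=> K0 FC FK; rewrite (@II_sum _ _ _ K)//.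
- by rewrite big1 => [//|i _]; exact: (@II_partial R n (F i) i K K0 (FC i) (FK i)).
- by move=> i; apply: (@Ck_continuousT R n 0); exact: Ck_partial (FC i).
- by move=> i; exact: vanishes_beyond_partial.
Qed.

(** The top coefficient of dw is the divergence of the coefficients omitting one index, each with
    the sign [s i]. *)
Lemma II_extd w K : 0 < K -> form_Ck 1 setT w -> (forall x, K < `|x| -> w x = 0) ->
  II (fun x => extd w x (topset n)) = 0.
Proof.
move=> K0 wC wK.
pose s i : R := wedge_sign R (finset.set1 i) (topset n :\ i)%SET.
rewrite -[RHS](@II_divergence (fun i x => s i * w x (topset n :\ i)%SET) K)//.
- congr iterated_integral; apply/funext => x; rewrite ffunE big_mkcond/=; apply: eq_bigr => i _.
  rewrite finset.in_setT; have wi := Ck_is_derive i (wC (topset n :\ i)%SET) (I : setT x).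
  have := is_derive_mul (is_derive_cst (s i) (0 : R) 1) wi; rewrite /= mul0r add0r.
  by move=> /(partialP i (fun x => s i * w x (topset n :\ i)%SET) x)[_ ->].
- move=> i; apply: (Ck_mul openT); [exact: Ck_cst|exact: wC].
- by move=> i x Kx; rewrite wK// ffunE mulr0.
Qed.

End Stokes.

(** * Bump functions and primitives *)

Section SmoothBumps.
Variable R : realType.
Implicit Types (t : R) (k : nat).

(** The function x^-k exp(-1/x), extended by zero. The derivative of index k combines those of index
    k + 2 and k + 1, so the span of the family is closed under differentiation. *)
Definition flat k x : R := if 0 < x then x^-1 ^+ k * expR (- x^-1) else 0.

Lemma flat_ge0 k x : 0 <= flat k x.
Proof. by rewrite /flat; case: ifP => // x0; rewrite mulr_ge0 ?expR_ge0// exprn_ge0// invr_ge0 ltW. Qed.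

Lemma flat0_gt0 x : 0 < x -> 0 < flat 0 x.
Proof. by move=> x0; rewrite /flat x0 expr0 mul1r expR_gt0. Qed.

Lemma flat_eq0 k x : x <= 0 -> flat k x = 0.
Proof. by rewrite /flat ltNge => ->. Qed.

(** With m = k + 1 and y = 1/x, exp y >= (1 + y/m)^m >= (y/m)^m; this gives the constant m^m. *)
Lemma flat_le_linear k x : 0 < x -> flat k x <= k.+1%:R ^+ k.+1 * x.
Proof.
move=> x0; set m := k.+1; have m0 : (0 : R) < m%:R by rewrite ltr0n.
rewrite /flat x0; set y := x^-1; have y0 : 0 < y by rewrite invr_gt0.
have h : y ^+ m <= m%:R ^+ m * expR y.
  have -> : y = m%:R * (y / m%:R) by rewrite mulrCA mulfV ?mulr1// gt_eqF.
  rewrite exprMn expRM_natl ler_wpM2l ?exprn_ge0 ?(ltW m0)//.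
  apply: lerXn2r; rewrite ?nnegrE ?expR_ge0 ?divr_ge0 ?(ltW y0) ?(ltW m0)//.
  by apply: le_trans (expR_ge1Dx _); rewrite lerDr.
have -> : y ^+ k * expR (- y) = (y ^+ m * expR (- y)) * x.
  by rewrite exprSr -!mulrA; congr (_ * _); rewrite mulrCA /y mulVf ?mulr1// gt_eqF.
rewrite (ler_wpM2r (ltW x0))//; apply: (le_trans (ler_wpM2r (expR_ge0 (- y)) h)).
by rewrite -mulrA -expRD addrN expR0 mulr1.
Qed.

Lemma is_derive_flat k x : is_derive x (1 : R) (flat k) (flat k.+2 x - k%:R * flat k.+1 x).
Proof.
have [x0|x0|->] := ltgtP x 0.
- rewrite !flat_eq0 ?ltW// mulr0 subr0.
  apply: (@near_eq_is_derive _ _ _ (fun=> 0)).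
  by near=> y; rewrite flat_eq0// ltW//; near: y; exact: lt_nbhsl.
- apply: (@near_eq_is_derive _ _ _ (fun y : R => y^-1 ^+ k * expR (- y^-1))).
    near=> y; rewrite /flat; suff -> : 0 < y by [].
    by near: y; exact: lt_nbhsr.
  have hv : is_derive x (1 : R) (fun y : R => y^-1) (- x ^- 2).
    have := is_deriveV (lt0r_neq0 x0) (is_derive_id x (1 : R)).
    by rewrite /GRing.scale/= mulr1.
  have he : is_derive x (1 : R) (fun y : R => expR (- y^-1)) (x ^- 2 * expR (- x^-1)).
    have hn : is_derive x (1 : R) (fun y : R => - y^-1) (x ^- 2).
      by have := is_deriveN hv; rewrite opprK.
    have := is_derive1_comp (f := expR) (g := fun y : R => - y^-1) (is_derive_expR _) hn.
    by rewrite mulrC.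
  have hk : is_derive x (1 : R) (fun y : R => y^-1 ^+ k) (- k%:R * x^-1 ^+ k.+1).
    elim: k => [|k IH]; first by rewrite oppr0 mul0r; exact: is_derive_cst.
    have := is_derive_mul hv IH; rewrite (_ : (fun h => _) = fun y : R => y^-1 ^+ k.+1).
      congr is_derive; rewrite -exprVn [k.+1%:R]mulrS !exprS; ring.
    by apply/funext => y; rewrite exprS.
  have := is_derive_mul hk he; rewrite /flat x0; congr is_derive.
  by rewrite -exprVn !exprS; ring.
(* At the origin the increment is h times [flat k.+1 h], and the linear bound for index k + 1 makes
   the second factor tend to 0. *)
rewrite !flat_eq0// mulr0 subr0; apply/is_derive1P => e e0.
set C : R := k.+2%:R ^+ k.+2; have C0 : 0 < C by rewrite exprn_gt0.
apply: (@near_norm0 R R^o (e / C)) => [|h hd]; first by rewrite divr_gt0.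
rewrite add0r mulr0 subr0 [flat k 0]flat_eq0// subr0 ger0_norm ?flat_ge0//.
have [h0|h0] := ltP 0 h; last by rewrite flat_eq0// mulr_ge0// ltW.
have -> : flat k h = h * flat k.+1 h.
  by rewrite /flat h0 exprS !mulrA mulfV ?mul1r// gt_eqF.
rewrite (gtr0_norm h0) mulrC ler_wpM2r ?(ltW h0)//.
apply: (le_trans (flat_le_linear k.+1 h0)); rewrite -/C mulrC -ler_pdivlMr//.
by rewrite ltW// -(gtr0_norm h0).
Unshelve. all: by end_near. Qed.

Lemma Ck_flat n k (U : set 'rV[R]_n) (f : 'rV[R]_n -> R) : open U -> Ck k U f -> Ck k U (fun x => flat 0 (f x)).
Proof.
move=> Uo fC.
(* Finite linear combinations of the [flat k]: this is the class closed under differentiation that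
   [Ck_comp1] requires. *)
pose p (c : seq (R * nat)) (t : R) := \sum_(a <- c) a.1 * flat a.2 t.
have h : forall q, [set q | exists c, q = p c] q -> exists2 q', [set q | exists c, q = p c] q' &
    forall t, setT t -> is_derive t (1 : R) q (q' t).
  move=> _ [c ->]; exists (fun t => \sum_(a <- c) a.1 * (flat a.2.+2 t - a.2%:R * flat a.2.+1 t)).
    exists (flatten [seq [:: (a.1, a.2.+2); (- (a.1 * a.2%:R), a.2.+1)] | a <- c]).
    apply/funext => t; rewrite /p big_flatten/= big_map; apply: eq_bigr => a _.
    by rewrite !big_cons big_nil/=; ring.
  move=> t _; apply: is_derive_suml => a _.
  have := is_derive_mul (is_derive_cst a.1 t (1 : R)) (is_derive_flat a.2 t).
  by rewrite mul0r add0r.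
have := @Ck_comp1 R _ setT h n k U (p [:: (1, 0%N)]) f Uo (ex_intro _ _ erefl) (fun _ _ => I) fC.
by congr Ck; apply/funext => x; rewrite /= /p big_seq1 mul1r.
Qed.

Definition smooth_step t : R := flat 0 t / (flat 0 t + flat 0 (1 - t)).

Let den_gt0 t : 0 < flat 0 t + flat 0 (1 - t).
Proof.
have [t0|t0] := ltP 0 t; first by rewrite ltr_wpDr ?flat_ge0// flat0_gt0.
by rewrite ltr_wpDl ?flat_ge0// flat0_gt0// subr_gt0; lra.
Qed.

Lemma smooth_step_ge0 t : 0 <= smooth_step t.
Proof. by rewrite divr_ge0 ?flat_ge0 ?addr_ge0 ?flat_ge0. Qed.

Lemma smooth_step_le1 t : smooth_step t <= 1.
Proof. by rewrite ler_pdivrMr// mul1r lerDl flat_ge0. Qed.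

Lemma smooth_step_eq0 t : t <= 0 -> smooth_step t = 0.
Proof. by move=> t0; rewrite /smooth_step flat_eq0// mul0r. Qed.

Lemma smooth_step_eq1 t : 1 <= t -> smooth_step t = 1.
Proof.
move=> t1; rewrite /smooth_step [flat 0 (1 - t)]flat_eq0 ?subr_le0// addr0 divff//.
by rewrite gt_eqF// flat0_gt0// (lt_le_trans _ t1).
Qed.

Lemma Ck_smooth_step n k (U : set 'rV[R]_n) (f : 'rV[R]_n -> R) : open U -> Ck k U f ->
  Ck k U (fun x => smooth_step (f x)).
Proof.
move=> Uo fC; apply: (Ck_mul Uo); first exact: Ck_flat.
apply: (Ck_inv Uo) => [x _|]; first by rewrite gt_eqF.
apply: (Ck_add Uo); first exact: Ck_flat.
apply: (Ck_flat Uo); apply: (Ck_add Uo); first exact: Ck_cst.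
exact: Ck_opp.
Qed.

(** The norm is the maximum of the coordinates, so a product of one-variable bumps has boxes, that
    is balls, as level regions. The one-variable bump is 1 on [-1, 1] and 0 outside (-2, 2). *)
Lemma smooth_bump n (x0 : 'rV[R]_n) (e : R) : 0 < e -> exists chi : 'rV[R]_n -> R,
  [/\ forall k, Ck k setT chi, forall x : 'rV[R]_n, 0 <= chi x <= 1,
      forall x : 'rV[R]_n, `|x - x0| <= e -> chi x = 1 &
      forall x : 'rV[R]_n, 2 * e < `|x - x0| -> chi x = 0].
Proof.
move=> e0; pose b (t : R) := smooth_step (2 + t) * smooth_step (2 - t).
have b01 t : 0 <= b t <= 1.
  by rewrite mulr_ge0 ?smooth_step_ge0//= mulr_ile1 ?smooth_step_ge0 ?smooth_step_le1.
have b1 t : `|t| <= 1 -> b t = 1.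
  by rewrite ler_norml /b => /andP[t1 t2]; rewrite !smooth_step_eq1 ?mulr1//; lra.
have b0 t : 2 <= `|t| -> b t = 0.
  rewrite /b ler_normr => /orP[t2|t2].
    by rewrite [X in _ * X]smooth_step_eq0 ?mulr0//; lra.
  by rewrite smooth_step_eq0 ?mul0r//; lra.
exists (fun x : 'rV[R]_n => \prod_i b ((x - x0) ord0 i / e)); split=> [k|x|x xe|x xe].
- apply: (Ck_prod _ openT) => i _.
  have tC : Ck k setT (fun x : 'rV[R]_n => (x - x0) ord0 i / e).
    apply: (@Ck_ext _ _ _ _ (fun x : 'rV[R]_n => (x ord0 i + - x0 ord0 i) * e^-1)).
    - exact: openT.
    - by move=> x _; rewrite !mxE.
    - apply: (Ck_mul openT); last exact: Ck_cst.
      by apply: (Ck_add openT); [exact: Ck_coord|exact: Ck_cst].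
  apply: (Ck_mul openT); apply: (Ck_smooth_step openT); apply: (Ck_add openT); try exact: Ck_cst.
    exact: tC.
  by apply: (Ck_opp openT).
- rewrite prodr_ge0 => [|i _]; last by case/andP: (b01 ((x - x0) ord0 i / e)).
  by apply: Num.Theory.prodr_ile1 => i _; exact: b01.
- rewrite big1// => i _; apply: b1; rewrite normrM normfV (gtr0_norm e0) ler_pdivrMr// mul1r.
  exact: le_trans (coord_le_norm _ _) xe.
- have [/existsP[i xi]|/existsPn no] := boolP [exists i, 2 * e < `|(x - x0) ord0 i|].
    by rewrite (bigD1 i)//= b0 ?mul0r// normrM normfV (gtr0_norm e0) ler_pdivlMr// ltW.
  move: xe; rewrite ltNge => /negP[]; apply: norm_le_coord => [|i]; first by rewrite mulr_ge0// ltW.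
  by rewrite leNgt no.
Qed.
End SmoothBumps.

Section ExtensionByZero.
Variables (R : realType) (n : nat).
Implicit Types (f g : 'rV[R]_n -> R) (U S : set 'rV[R]_n) (x : 'rV[R]_n).

Lemma Ck_extend k U S f : open U -> closed S -> S `<=` U -> (forall x, U x -> ~ S x -> f x = 0) ->
  Ck k U f -> Ck k setT (fun x => if x \in U then f x else 0).
Proof.
move=> Uo Sc SU f0 fC; apply: Ck_local => x _; have [Ux|Ux] := pselect (U x).
  exists U => //; split=> //; apply: (@Ck_ext _ _ _ _ f) => // y Uy.
  by rewrite mem_set.
exists (~` S); first exact: closed_openC.
split; first by move=> /SU.
apply: (@Ck_ext _ _ _ _ (fun=> 0)); [exact: closed_openC| |exact: Ck_cst].
by move=> y Sy; case: ifPn => // /set_mem Uy; rewrite f0.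
Qed.

Lemma compact_norm_bound S : compact S -> exists2 K : R, 0 < K & forall x, S x -> `|x| < K.
Proof.
move=> Sc; have [M [_ MS]] := compact_bounded Sc.
exists (Num.max 1 (M + 1) + 1) => [|x Sx]; first by rewrite ltr_pwDr// le_max ler01.
have := MS (M + 1); rewrite ltrDl ltr01 => /(_ isT x Sx) h.
by apply: (le_lt_trans h); rewrite ltr_pwDr// le_max lexx orbT.
Qed.

Lemma C1_bounded_support_extend U S f : open U -> compact S -> S `<=` U ->
  (forall x, U x -> ~ S x -> f x = 0) -> Ck 1 U f ->
  C1_bounded_support (fun x => if x \in U then f x else 0).
Proof.
move=> Uo Sc SU f0 fC; split.
  by apply: (@Ck_extend _ U S) => //; apply: compact_closed => //; exact: norm_hausdorff.
have [K K0 SK] := compact_norm_bound Sc; exists K => // x Kx.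
case: ifPn => // /set_mem Ux; apply: f0 => // /SK; rewrite ltNge => /negP; apply; exact: ltW.
Qed.

End ExtensionByZero.

Lemma continuous_pair (X Y Z : topologicalType) (f : X -> Y) (g : X -> Z) x :
  {for x, continuous f} -> {for x, continuous g} -> {for x, continuous (fun y => (f y, g y))}.
Proof. by move=> cf cg; exact: (cvg_pair cf cg). Qed.

Section PartialPrimitive.
Variable R : realType.
Local Notation II n := (@iterated_integral R n).

Lemma II_continuous (X : topologicalType) n (F : X -> 'rV[R]_n -> R) (x0 : X) K : 0 < K ->
  (\forall x \near x0, vanishes_beyond K (F x)) ->
  (\forall x \near x0, continuous (F x)) ->
  (forall v, {for (x0, v), continuous (fun p : X * 'rV[R]_n => F p.1 p.2)}) ->
  {for x0, continuous (fun x => II n (F x))}.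
Proof.
move=> K0 FK Fc F2; apply/cvgrPdist_le => e e0.
pose c := e / ((2 * K) ^+ n); have K2 : 0 < (2 * K) ^+ n by rewrite exprn_gt0// mulr_gt0.
have c0 : 0 < c by rewrite divr_gt0.
have FK0 := nbhs_singleton FK; have Fc0 := nbhs_singleton Fc.
have h := @uniform_near R X _ F x0 _ c (@compact_box R n K) c0 (fun v _ => F2 v).
apply: filterS3 FK Fc h => x FKx Fcx hx.
have -> : e = (2 * K) ^+ n * c by rewrite /c mulrCA mulfV ?mulr1// gt_eqF.
apply: (II_sub_bound (@II_linear_boundedP R n)) => // [|v]; first exact: ltW.
have [vK|vK] := leP `|v| K; first by rewrite distrC hx.
by rewrite FKx// FK0// subr0 normr0 ltW.
Qed.

(* The C^1 substitution s = pos_sqr r turns an integral over s >= 0 into one over the whole line. *)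
Definition pos_sqr (r : R) : R := Num.max r 0 ^+ 2.

Lemma is_derive_pos_sqr r : is_derive r (1 : R) pos_sqr (2 * Num.max r 0).
Proof.
apply/is_derive1P => e e0; apply: (@near_norm0 R R^o e) => // h he.
have : `|pos_sqr (r + h) - pos_sqr r - h * (2 * Num.max r 0)| <= h ^+ 2.
  rewrite /pos_sqr /Num.max !expr2 ler_norml.
  by case: ltP => h1; case: ltP => h2; apply/andP; split; nra.
move=> /le_trans; apply; rewrite -real_normK ?num_real// expr2 ler_wpM2r//.
exact: ltW.
Qed.

Lemma continuous_pos_part : continuous (fun r : R => Num.max r 0).
Proof.
move=> r; apply/cvgrPdist_le => e e0; near=> s.
have : `|r - s| <= e by near: s; apply: cvgr_dist_le.
rewrite !ler_norml /Num.max; case: ltP => h1; case: ltP => h2; lra.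
Unshelve. all: by end_near. Qed.


Section Primitive.
Variables (n : nat) (i : 'I_n) (K : R).
Hypothesis K0 : 0 < K.
Local Notation e := (unit_row R i).
Local Notation m v := (Num.max ((v : 'rV[R]_1) ord0 ord0) 0).

(** Integrand, after the substitution s = r^2, of the integral of h(y - s e) over s >= 0. The
    variable r is a row of length 1 so that the results on iterated integrals apply. In [L] the
    inner 1 leaves room for y to vary in a unit ball and the outer 1 ensures r <= r^2 beyond [L]. *)
Let F (h : 'rV[R]_n -> R) (y : 'rV[R]_n) (v : 'rV[R]_1) : R :=
  2 * m v * h (y - pos_sqr (v ord0 ord0) *: e).
Let L (y : 'rV[R]_n) : R := 1 + (`|y| + 1 + K).

Let L_gt0 y : 0 < L y. Proof. by rewrite /L !ltr_wpDr// ?addr_ge0// ltW. Qed.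

Let F_vanishes h y0 : vanishes_beyond K h -> \forall y \near y0, vanishes_beyond (L y0) (F h y).
Proof.
move=> hK; near=> y => v Lv.
have yy : `|y| <= `|y0| + 1.
  have : `|y0 - y| <= 1 by near: y; apply: cvgr_dist_le => //; exact: cvg_id.
  by move=> yy; rewrite -[y](subKr y0) (le_trans (ler_normB _ _))// lerD2l.
rewrite /F; set r := v ord0 ord0; have [r0|r0] := leP r 0; first by rewrite mulr0 mul0r.
have Lr : L y0 < r.
  have [//|rL] := ltP (L y0) r; move: Lv; rewrite ltNge => /negP[].
  apply: norm_le_coord => [|j]; first exact: ltW.
  by rewrite (ord1 j) -[v ord0 0]/r ger0_norm ?(ltW r0).
rewrite hK ?mulr0//.
have s2 : pos_sqr r = r ^+ 2 by rewrite /pos_sqr max_l// ltW.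
have r2 : r <= r ^+ 2.
  rewrite expr2 ler_pMr//; apply: le_trans (ltW Lr); rewrite /L lerDl !addr_ge0//; exact: ltW.
have := ler_normB (pos_sqr r *: e) y; rewrite normrZ norm_unit_row mulr1 s2 ger0_norm ?sqr_ge0//.
have := ler_normD (y - r ^+ 2 *: e) (- y); rewrite addrAC addrN sub0r !normrN normrZ norm_unit_row mulr1.
by rewrite ger0_norm ?sqr_ge0// => h1 _; move: Lr; rewrite /L; lra.
Unshelve. all: by end_near. Qed.

Let F_continuous h (p : 'rV[R]_n * 'rV[R]_1) : continuous h ->
  {for p, continuous (fun q : 'rV[R]_n * 'rV[R]_1 => F h q.1 q.2)}.
Proof.
move=> ch; pose P := ('rV[R]_n * 'rV[R]_1)%type.
have cr : continuous (fun q : P => q.2 ord0 ord0).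
  move=> q; apply: (@continuous_comp _ _ _ snd (fun v : 'rV[R]_1 => v ord0 ord0));
    [exact: cvg_snd|exact: coord_continuous].
have cm : continuous (fun q : P => m q.2).
  by move=> q; apply: (@continuous_comp _ _ _ _ (fun r : R => Num.max r 0));
    [exact: cr|exact: continuous_pos_part].
suff : continuous (fun q : P => F h q.1 q.2) by apply.
apply: continuous_mul; first by apply: continuous_mul => //; exact: continuous_cst.
move=> q; apply: (@continuous_comp _ _ _ (fun q : P => q.1 - pos_sqr (q.2 ord0 ord0) *: e) h); last exact: ch.
apply: continuous_at_row => j.
suff : continuous (fun q : P => (q.1 - pos_sqr (q.2 ord0 ord0) *: e) ord0 j) by apply.
rewrite (_ : (fun q : P => _) = fun q : P => q.1 ord0 j + (m q.2 * m q.2) * - e ord0 j).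
  apply: continuous_add; last by apply: continuous_mul; [exact: continuous_mul|exact: continuous_cst].
  move=> r; apply: (@continuous_comp _ _ _ fst (fun v : 'rV[R]_n => v ord0 j));
    [exact: cvg_fst|exact: coord_continuous].
by apply/funext => r; rewrite !mxE /pos_sqr expr2 mulrN.
Qed.

Let F_continuous_r h y : continuous h -> continuous (F h y).
Proof.
move=> ch v; apply: (@continuous_comp _ _ _ (fun v => (y, v)) (fun q : 'rV[R]_n * 'rV[R]_1 => F h q.1 q.2)).
  exact: continuous_pairl.
exact: F_continuous.
Qed.

(** The primitive integrates f along e from minus infinity. It is in general nonzero far ahead of
    the support of f, which is why only differences of its pullbacks will have compact support. *)
Lemma partial_primitive (f : 'rV[R]_n -> R) : Ck 1 setT f -> vanishes_beyond K f ->
  exists2 g : 'rV[R]_n -> R, Ck 1 setT g & partial i g = f.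
Proof.
move=> fC fK; have cf := Ck_continuousT fC.
have cpf k : continuous (partial k f) by exact: Ck_continuousT (Ck_partial k fC).
have pK k := vanishes_beyond_partial k fK.
pose g h (y : 'rV[R]_n) := iterated_integral (F h y).
have cg h : continuous h -> vanishes_beyond K h -> continuous (g h).
  move=> ch hK y; apply: (@II_continuous _ _ (F h) y (L y)) => //; first exact: F_vanishes.
    by near=> z; exact: F_continuous_r.
  by move=> v; exact: F_continuous.
have dg k y : is_derive (0 : R) 1 (fun t : R => g f (y + t *: unit_row R k)) (g (partial k f) y).
  have cl : continuous (fun t : R => y + t *: unit_row R k).
    move=> t; apply: continuous_at_row => j.
    suff : continuous (fun t : R => (y + t *: unit_row R k) ord0 j) by apply.
    rewrite (_ : (fun t : R => _) = fun t : R => y ord0 j + t * unit_row R k ord0 j).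
      apply: continuous_add; first exact: continuous_cst.
      by apply: continuous_mul; [move=> s; exact: cvg_id|exact: continuous_cst].
    by apply/funext => s; rewrite !mxE.
  have y0E : y + (0 : R) *: unit_row R k = y by rewrite scale0r addr0.
  have [||||_ _] := @is_derive_II R 1 (fun t => F f (y + t *: unit_row R k))
    (fun t => F (partial k f) (y + t *: unit_row R k)) 0 (L y) (L_gt0 y).
  - have := cl 0; rewrite /continuous_at y0E => h; exact: h (F_vanishes y fK).
  - by near=> t; exact: F_continuous_r.
  - near=> t => v; pose x := y - pos_sqr (v ord0 ord0) *: e.
    have D : has_partial k f (x + t *: unit_row R k) by exact: Ck_has_partial fC I.
    have := is_derive_mul (is_derive_cst (2 * m v) t (1 : R)) (is_derive_partial D).
    rewrite mul0r add0r /F /x (addrAC y (- _)).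
    by congr is_derive; apply/funext => s; rewrite (addrAC y (- _)).
  - move=> v; apply: (@continuous_comp _ _ _ (fun p : R * 'rV[R]_1 => (y + p.1 *: unit_row R k, p.2))
      (fun q : 'rV[R]_n * 'rV[R]_1 => F (partial k f) q.1 q.2)); last exact: F_continuous.
    apply: continuous_pair; last exact: cvg_snd.
    by apply: (@continuous_comp _ _ _ fst (fun t : R => y + t *: unit_row R k)); [exact: cvg_fst|exact: cl].
  by rewrite y0E.
exists (g f).
  apply: (@Ck_partialE R n 0 setT (g f) (fun k => g (partial k f))); first exact: openT.
  - by move=> x _; exact: cg.
  - by move=> k; split=> // x _; exact: cg.
apply/funext => y; have /(partialP i (g f) y)[_ ->] := dg i y.
rewrite /g iterated_integralS/=.
have L0 := L_gt0 y; have FL := nbhs_singleton (F_vanishes y (pK i)).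
have cG : continuous (fun r : R => F (partial i f) y (cons_row r (0 : 'rV[R]_0))).
  move=> r; apply: (@continuous_comp _ _ _ (fun r : R => cons_row r (0 : 'rV[R]_0)) (F (partial i f) y)).
    apply: (@continuous_comp _ _ _ (fun r : R => (r, 0 : 'rV[R]_0))
      (fun q : R * 'rV[R]_0 => cons_row q.1 q.2)); last exact: cons_row_continuous.
    by apply: continuous_pair; [exact: cvg_id|exact: cvg_cst].
  exact: F_continuous_r.
have dG (r : R) : is_derive r (1 : R) (fun r => - f (y - pos_sqr r *: e))
    (F (partial i f) y (cons_row r (0 : 'rV[R]_0))).
  have h1 : is_derive (- pos_sqr r) (1 : R) (fun t : R => f (y + t *: e)) (partial i f (y + - pos_sqr r *: e)).
    by apply: is_derive_partial; exact: Ck_has_partial fC I.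
  have h2 : is_derive r (1 : R) (fun r => - pos_sqr r) (- (2 * Num.max r 0)).
    exact: is_deriveN (is_derive_pos_sqr r).
  have := is_deriveN (is_derive1_comp (f := fun t : R => f (y + t *: e)) (g := fun r => - pos_sqr r) h1 h2).
  have r0 : cons_row r (0 : 'rV[R]_0) ord0 ord0 = r.
    rewrite -[RHS](cons_row_head r (0 : 'rV[R]_0)); congr (cons_row r 0 _ _); exact: val_inj.
  rewrite /F r0 scaleNr mulrN opprK mulrC.
  rewrite (_ : - (_ \o _) = fun r : R => - f (y - pos_sqr r *: e))//.
  by apply/funext => s; rewrite /GRing.opp/= scaleNr.
have G0 (r : R) : L y < `|r| -> F (partial i f) y (cons_row r (0 : 'rV[R]_0)) = 0.
  by move=> Lr; apply: FL; apply: (lt_le_trans Lr); exact: cons_row_norm_head.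
have E := Rintegral_FTC L0 cG dG G0.
(* At the lower end r = -L the substitution gives s = 0 and contributes f(y); at the upper end y -
   L^2 e has left the support of f. *)
rewrite E {2}/pos_sqr max_r ?oppr_le0 ?(ltW L0)// expr0n/= scale0r subr0 opprK.
rewrite fK ?oppr0 ?add0r//.
have s2 : pos_sqr (L y) = L y ^+ 2 by rewrite /pos_sqr max_l// ltW.
have r2 : L y <= L y ^+ 2.
  by rewrite expr2 ler_pMr// /L lerDl !addr_ge0//; exact: ltW.
have := ler_normD (y - pos_sqr (L y) *: e) (- y); rewrite addrAC addrN sub0r !normrN normrZ norm_unit_row mulr1.
by rewrite s2 ger0_norm ?sqr_ge0// => h1; move: r2; rewrite {1}/L; lra.
Unshelve. all: by end_near. Qed.

End Primitive.
End PartialPrimitive.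

(** * Local change of variables *)

Lemma continuous_dist (R : realType) n (x0 : 'rV[R]_n) : continuous (fun x : 'rV[R]_n => `|x - x0|).
Proof.
move=> x; apply: (@continuous_comp _ _ _ (fun x : 'rV[R]_n => x - x0) (fun x : 'rV[R]_n => `|x|)).
  exact: (cvgB cvg_id (cvg_cst _)).
exact: norm_continuous.
Qed.

Section LocalChangeOfVariables.
Variables (R : realType) (n : nat) (i0 : 'I_n) (U : set 'rV[R]_n) (T : 'rV[R]_n -> 'rV[R]_n).
Local Notation II := (@iterated_integral R n).
Implicit Types (f g : 'rV[R]_n -> R) (x y v : 'rV[R]_n).
Local Notation top := (dx R (topset n)).

Lemma eps_iot_top i : eps i (iot i0 top) = (i == i0)%:R *: top.
Proof.
have e0 j : eps j top = 0 by rewrite eps_dx finset.in_setT.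
have [->|ii] := eqVneq i i0.
  by have := iot_eps i0 top; rewrite e0 iot0 add0r scale1r.
by rewrite scale0r -[RHS]oppr0 -(iot0 R i0) -(e0 i) iot_eps_anti 1?eq_sym// opprK.
Qed.

Lemma extd_primitive g x : Ck 1 setT g ->
  extd (fun y => g y *: iot i0 top) x = partial i0 g x *: top.
Proof.
move=> gC; rewrite (@form_derive_extd _ _ _ _ (fun i => partial i g x *: iot i0 top)).
  rewrite (bigD1 i0)//= big1 => [|i ii]; rewrite epsZ eps_iot_top ?eqxx ?scale1r ?addr0//.
  by rewrite (negPf ii) scale0r scaler0.
move=> i; have := form_derive_scale (Ck_is_derive i gC (I : setT x)) (@form_derive_cst R n i (iot i0 top) x).
by rewrite scaler0 addr0.
Qed.

(** If A = dT(x0) satisfies |v A^T| >= c |v|, choose a ball where the remainder of T is at most c/2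
    |x - x0|. Then the interpolation T' = L + chi (T - L) with the affine map L still satisfies |T'
    x - T x0| >= c/2 |x - x0|. So only points of the small ball where T' = T can be mapped into the
    support of f, and the supports of both pullbacks are controlled. *)
Lemma local_change_of_variables x0 : open U -> U x0 -> (forall j, Ck 2 U (fun x => T x ord0 j)) ->
  (forall x, U x -> 0 < \det (jac T x)) ->
  exists r s : R, [/\ 0 < r, 0 < s, forall x, `|x - x0| < s -> U x &
    forall f, Ck 1 setT f -> (forall y, r <= `|y - T x0| -> f y = 0) ->
      II f = II (fun x => if `|x - x0| < s then \det (jac T x) * f (T x) else 0)].
Proof.
move=> Uo Ux0 TC dT; pose A := jac T x0; pose y0 := T x0.
have dA : 0 < \det A by exact: dT.
have [c c0 Ac] : exists2 c : R, 0 < c & forall v, c * `|v| <= `|v *m A^T|.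
  by apply: mulmx_expansive; rewrite det_tr gt_eqF.
pose rem x := T x - (y0 + (x - x0) *m A^T).
have c20 : 0 < c / 2 by rewrite divr_gt0.
have [e e0 eU] : exists2 e : R, 0 < e & forall v, `|v| < e -> U (x0 + v) /\ `|rem (x0 + v)| <= c / 2 * `|v|.
  have [d1 d10 h1] := near_normP (open_nbhs_nbhs (conj Uo Ux0)).
  have [d2 d20 h2] := near_normP (@nbhs_forall _ 'I_n (0 : 'rV[R]_n) _
    (fun j => taylor1 (Ck_C1_at Uo (TC j) Ux0) c20)).
  exists (Num.min d1 d2); first by rewrite lt_min d10.
  move=> v; rewrite lt_min => /andP[v1 v2]; split; first exact: h1.
  apply: norm_le_coord => [|j]; first by rewrite mulr_ge0// ltW.
  have := h2 v v2 j; rewrite add0r; congr (`|_| <= _).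
  have -> : rem (x0 + v) = T (x0 + v) - (y0 + v *m A^T) by rewrite /rem (addrC x0 v) addrK.
  rewrite !mxE opprD addrA; congr (_ - _).
  by rewrite /gradient; apply: eq_bigr => k _; rewrite !mxE.
(* The cut-off is 1 up to radius e4 and 0 beyond 2 e4, which lies inside the ball of radius e where
   the remainder is under control. *)
pose e4 := e / 4; have e40 : 0 < e4 by rewrite divr_gt0.
have [chi [chiC chi01 chi1 chi0]] := smooth_bump x0 e40.
pose S := [set x | `|x - x0| <= 2 * e4].
have e4e : 2 * e4 < e by rewrite /e4; lra.
have Sc : closed S.
  rewrite (_ : S = (fun x => `|x - x0|) @^-1` [set t | t <= 2 * e4])//.
  apply: closed_comp; last exact: closed_le.
  by move=> x _; exact: continuous_dist.
have near_x0 x : `|x - x0| < e -> U x /\ `|rem x| <= c / 2 * `|x - x0|.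
  by move=> /eU; rewrite addrC subrK.
have SU : S `<=` U by move=> x Sx; have [] := near_x0 x (le_lt_trans Sx e4e).
pose L x := y0 + (x - x0) *m A^T.
pose T' x := L x + (if x \in U then chi x *: rem x else 0).
have LC j k (V : set 'rV[R]_n) : open V -> Ck k V (fun x => L x ord0 j).
  move=> Vo; apply: (@Ck_ext _ _ _ _ (fun x => (y0 - x0 *m A^T) ord0 j + (x *m A^T) ord0 j)) => //.
    by move=> x _; rewrite /L mulmxBl !mxE; ring.
  by apply: (Ck_add Vo); [exact: Ck_cst|exact: Ck_mulmx].
have T'C j : Ck 2 setT (fun x => T' x ord0 j).
  apply: (@Ck_ext _ _ _ _ (fun x => L x ord0 j + (if x \in U then chi x * rem x ord0 j else 0))).
  - exact: openT.
  - by move=> x _; rewrite /T' [RHS]mxE; congr (_ + _); case: ifP; rewrite !mxE.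
  apply: (Ck_add openT); first by apply: LC; exact: openT.
  apply: (Ck_extend Uo Sc SU) => [x _ /negP|].
    by rewrite -ltNge => /chi0 ->; rewrite mul0r.
  apply: (Ck_mul Uo); first by apply: Ck_subset (chiC 2%N).
  apply: (@Ck_ext _ _ _ _ (fun x => T x ord0 j + - L x ord0 j)) => //.
    by move=> x _; rewrite /rem -/(L x) !mxE.
  by apply: (Ck_add Uo); [exact: TC|apply: (Ck_opp Uo); exact: LC].
have T'T x : `|x - x0| <= e4 -> T' x = T x.
  move=> xe; have xS : S x by rewrite /S/=; apply: le_trans xe _; lra.
  rewrite /T' mem_set; last exact: SU.
  by rewrite chi1// scale1r /rem -/(L x) addrC subrK.
have T'L x : 2 * e4 < `|x - x0| -> T' x = L x.
  by move=> xe; rewrite /T' chi0// scale0r if_same addr0.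
have Lfar x : c / 2 * `|x - x0| <= `|L x - y0|.
  rewrite /L addrAC addrN add0r; apply: le_trans (Ac _); rewrite ler_wpM2r//.
  by rewrite ler_pdivrMr// ler_pMr// ler1n.
have T'far x : c / 2 * `|x - x0| <= `|T' x - y0|.
  have [xe|xe] := leP `|x - x0| (2 * e4); last by rewrite T'L.
  have [Ux rx] := near_x0 x (le_lt_trans xe e4e).
  have -> : T' x - y0 = (x - x0) *m A^T + chi x *: rem x.
    by rewrite /T' mem_set// /L addrAC [y0 + _]addrC addrK.
  apply: le_trans (lerB_normD _ _).
  have : `|chi x *: rem x| <= c / 2 * `|x - x0|.
    apply: le_trans rx; rewrite normrZ; have /andP[h0 h1] := chi01 x.
    by rewrite ger0_norm// ler_piMl.
  by have := Ac (x - x0); lra.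
(* Outside the ball of radius e4 the growth estimate puts T' x at distance at least c/2 e4 from T
   x0, where f vanishes. *)
exists (c / 2 * e4), e4; split=> //.
- by rewrite mulr_gt0.
- by move=> x xe; apply: SU; rewrite /S/=; lra.
move=> f fC f0.
have [K K0 fK] : exists2 K, 0 < K & vanishes_beyond K f.
  exists (c / 2 * e4 + `|y0|) => [|y Ky]; first by rewrite ltr_wpDr// mulr_gt0.
  apply: f0; have := ler_normD (y - y0) y0; rewrite subrK -/y0 => h.
  by rewrite -(lerD2r `|y0|) ltW// (lt_le_trans Ky).
have [g gC gf] := partial_primitive i0 K0 fC fK.
pose eta y := g y *: iot i0 top.
have etaC : form_Ck 1 setT eta by apply: form_Ck_scale; [exact: openT|exact: gC|exact: form_Ck_cst].
have etad y : extd eta y = f y *: top by rewrite extd_primitive// gf.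
pose W1 x := pull (jac T' x) (eta (T' x)); pose W2 x := pull (jac L x) (eta (L x)).
have oT := @openT 'rV[R]_n.
have W1C : form_Ck 1 setT W1 by exact: (form_Ck_pull oT oT (fun _ _ => I) T'C etaC).
have W2C : form_Ck 1 setT W2 by exact: (form_Ck_pull oT oT (fun _ _ => I) (fun j => LC j 2%N _ oT) etaC).
(* In the interpolation region the Jacobian determinant of T' has no known sign, so the factor is
   kept as [top_factor]; it is identified with the determinant at the end, only where T' = T. *)
have W1d x : extd W1 x (topset n) = top_factor (jac T' x) * f (T' x).
  by rewrite (extd_pull oT oT (fun _ _ => I) T'C (I : setT x) etaC) etad pullZ scale_extE mulrC.
have W2d x : extd W2 x (topset n) = \det A * f (L x).
  rewrite (extd_pull oT oT (fun _ _ => I) (fun j => LC j 2%N _ oT) (I : setT x) etaC) etad pullZ scale_extE mulrC.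
  by rewrite jac_affine -[pull _ _ _]/(top_factor A) top_factor_det.
pose K1 := `|x0| + 2 * e4 + 1.
have K10 : 0 < K1 by rewrite ltr_wpDl// addr_ge0// mulr_ge0// ltW.
have far x : K1 < `|x| -> 2 * e4 < `|x - x0|.
  by rewrite /K1 => Kx; have := ler_normD (x - x0) x0; rewrite subrK => h; lra.
have farM x : K1 < `|x| -> c / 2 * e4 <= c / 2 * `|x - x0|.
  by move=> /far h; rewrite ler_pM2l// ltW// (le_lt_trans _ h)//; lra.
have W0 : forall x, K1 < `|x| -> W1 x + - W2 x = 0.
  move=> x Kx; rewrite /W1 /W2 T'L; last exact: far.
  rewrite (@jac_ext _ _ [set x | 2 * e4 < `|x - x0|] T' L) ?subrr//; last exact: far.
  rewrite (_ : [set _ | _] = ~` S); first exact: closed_openC.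
  by apply/seteqP; split=> z; rewrite /S/= ltNge => /negP.
have E : II (fun x => extd (fun x => W1 x + - W2 x) x (topset n)) = 0.
  apply: (II_extd K10 _ W0); apply: (form_Ck_add oT W1C).
  by apply: (@form_Ck_linear R n 1 setT (fun u => - u) W2 oT _ W2C) => a u u'; rewrite opprD scalerN.
have dW x : extd (fun x => W1 x + - W2 x) x = extd W1 x - extd W2 x.
  rewrite !extdE -sumrB; apply: eq_bigr => i _.
  have D2 : form_derive i (fun x => - W2 x) x (- form_partial i W2 x).
    apply: (@form_derive_linear R n i (fun u => - u)); first by move=> a u u'; rewrite opprD scalerN.
    exact: form_Ck_derive W2C I.
  rewrite (form_derive_partial (form_derive_add (form_Ck_derive i W1C (I : setT x)) D2)).
  by rewrite epsD -(scaleN1r (form_partial _ _ _)) epsZ scaleN1r.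
pose G1 x := top_factor (jac T' x) * f (T' x); pose G2 x := \det A * f (L x).
have G1c : continuous G1.
  apply: (@Ck_continuousT R n 0); apply: (@Ck_ext _ _ _ _ (fun x => extd W1 x (topset n)));
    [exact: oT|by move=> x _; rewrite W1d|exact: (form_Ck_extd oT W1C)].
have G2c : continuous G2.
  apply: (@Ck_continuousT R n 0); apply: (@Ck_ext _ _ _ _ (fun x => extd W2 x (topset n)));
    [exact: oT|by move=> x _; rewrite W2d|exact: (form_Ck_extd oT W2C)].
have G1K : vanishes_beyond K1 G1.
  by move=> x Kx; rewrite /G1 f0 ?mulr0//; apply: le_trans (T'far x); exact: farM.
have G2K : vanishes_beyond K1 G2.
  by move=> x Kx; rewrite /G2 f0 ?mulr0//; apply: le_trans (Lfar x); exact: farM.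
have G12 : II G1 = II G2.
  apply/eqP; rewrite -subr_eq0 -(II_opp K10 G2c G2K) -(II_add K10 G1c _ G1K).
  - rewrite -E; apply/eqP; congr iterated_integral; apply/funext => x.
    rewrite (dW x) (add_extE (extd W1 x) (- extd W2 x)) (opp_extE (extd W2 x)).
    exact: (esym (congr2 (fun a b : R => a - b) (W1d x) (W2d x))).
  - exact: continuous_opp.
  - by move=> x Kx; rewrite G2K ?oppr0.
rewrite -(II_affine x0 y0 dA) -/G2 -?G12; last by split=> //; exists K.
congr iterated_integral; apply/funext => x; case: ifPn => [xe|]; last first.
  rewrite -leNgt => xe; rewrite /G1 f0 ?mulr0//; apply: le_trans (T'far x).
  by rewrite ler_pM2l.
have jE : jac T' x = jac T x.
  apply: (@jac_ext _ _ [set x | `|x - x0| < e4]) => //; last by move=> y /ltW; exact: T'T.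
  rewrite (_ : [set _ | _] = (fun x => `|x - x0|) @^-1` [set t | t < e4])//.
  apply: open_comp; last exact: open_lt.
  by move=> y _; exact: continuous_dist.
rewrite /G1 jE T'T ?(ltW xe)// top_factor_det//; apply: dT; apply: SU.
by rewrite /S/=; lra.
Qed.

End LocalChangeOfVariables.

(** * Integration on manifolds *)

(** The near-covering form of compactness is applied to the filter of finite lists directed by
    inclusion, which returns a list of centres. *)
Lemma finite_subcover (M : topologicalType) (N : M -> set M) : compact [set: M] ->
  (forall p, nbhs p (N p)) -> exists s : seq M, forall q, exists2 p, p \in s & N p q.
Proof.
move=> /compact_near_coveringP Mc Np.
pose F : set_system (seq M) := [set S : set (seq M) | exists s0 : seq M, forall s : seq M, {subset s0 <= s} -> S s].
have FF : Filter F.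
  split; first by exists [::].
    move=> P Q [s1 h1] [s2 h2]; exists (s1 ++ s2) => s h; split.
      by apply: h1 => x xs; apply: h; rewrite mem_cat xs.
    by apply: h2 => x xs; apply: h; rewrite mem_cat xs orbT.
  by move=> P Q PQ [s0 h]; exists s0 => s /h; exact: PQ.
have [|s0 h] := Mc (seq M) F (fun s q => exists2 p, p \in s & N p q) FF.
  move=> p _; exists (N p, [set s : seq M | p \in s]).
    by split; [exact: Np|exists [:: p] => s; apply; rewrite inE].
  by case=> q s [/= Nq ps]; exists p.
by exists s0 => q; exact: (h s0 (fun _ => id) q I).
Qed.

Section Manifolds.
Variables (R : realType) (n : nat) (i0 : 'I_n) (M : topologicalType) (A : oriented_atlas R n M).
Local Notation II := (@iterated_integral R n).
Local Notation img := (@chart_img R n M A).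
Local Notation dom := (@chart_dom R n M A).
Local Notation phi := (@chart R n M A).
Local Notation psi := (@chart_inv R n M A).
Implicit Types (a b c : chart_idx A) (p q : M) (x y : 'rV[R]_n).

Lemma img_dom a x : img a x -> dom a (psi a x).
Proof. by move=> [p dp <-]; rewrite chartK. Qed.

Lemma chart_invK a x : img a x -> phi a (psi a x) = x.
Proof. by move=> [p dp <-]; rewrite chartK. Qed.

Lemma img_chart a p : dom a p -> img a (phi a p).
Proof. by move=> dp; exists p. Qed.

Lemma img_open a : open (img a). Proof. exact: chart_img_open. Qed.

Lemma overlapP a b x : overlap a b x <-> img a x /\ dom b (psi a x).
Proof.
split=> [[p [da db] <-]|[ix db]]; first by rewrite chartK//; split=> //; exists p.
by exists (psi a x); [split=> //; exact: img_dom|exact: chart_invK].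
Qed.

Lemma overlap_img a b x : overlap a b x -> img a x. Proof. by case/overlapP. Qed.

Lemma overlap_open a b : open (overlap a b).
Proof. by have [] := transition_smooth a b i0. Qed.

Lemma transition_Ck a b j k : Ck k (overlap a b) (fun x => transition a b x ord0 j).
Proof. by have /smooth_onP[] := transition_smooth a b j. Qed.

Lemma transition_img a b x : overlap a b x -> img b (transition a b x).
Proof. by move=> /overlapP[ix db]; exact: img_chart. Qed.

Lemma chart_inv_transition a b x : overlap a b x -> psi b (transition a b x) = psi a x.
Proof. by move=> /overlapP[ix db]; rewrite /transition/= chartK. Qed.

Lemma transition_overlap a b c x : overlap a b x -> dom c (psi a x) -> overlap b c (transition a b x).
Proof.
move=> ab dc; apply/overlapP; split; first exact: transition_img.
by rewrite chart_inv_transition.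
Qed.

Lemma transition_comp a b c x : overlap a b x -> transition b c (transition a b x) = transition a c x.
Proof. by move=> ab; rewrite [LHS]/transition/= chart_inv_transition. Qed.

Lemma det_transition a b x : overlap a b x -> 0 < \det (jac (transition a b) x).
Proof. exact: transition_oriented. Qed.

Lemma jac_transition_comp a b c x : overlap a b x -> dom c (psi a x) ->
  jac (transition a c) x = jac (transition b c) (transition a b x) *m jac (transition a b) x.
Proof.
move=> ab dc; pose U := overlap a b `&` overlap a c.
have Uo : open U by apply: openI; exact: overlap_open.
have Ux : U x by split=> //; apply/overlapP; split=> //; exact: overlap_img ab.
rewrite (@jac_ext _ _ U (transition a c) (transition b c \o transition a b)) //; last first.
  by move=> y [aby _]; rewrite /= transition_comp.
apply: (@jac_comp _ _ U (overlap b c)) => //; first exact: overlap_open.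
- by move=> y [aby /overlapP[_ dc']]; exact: transition_overlap.
- by move=> j; apply: (@Ck_subset _ _ _ (overlap a b)); [move=> y []|exact: transition_Ck].
- by move=> j; exact: transition_Ck.
Qed.

Lemma chart_continuous_at a p : dom a p -> {for p, continuous (phi a)}.
Proof.
move=> dp; have := @chart_continuous _ _ _ A a; rewrite continuous_open_subspace; last exact: chart_dom_open.
by apply; rewrite mem_set.
Qed.

Lemma chart_inv_continuous_at a x : img a x -> {for x, continuous (psi a)}.
Proof.
move=> ix; have := @chart_inv_continuous _ _ _ A a; rewrite continuous_open_subspace; last exact: img_open.
by apply; rewrite mem_set.
Qed.

Lemma preimage_chart_open a (O : set 'rV[R]_n) : open O -> open [set p | dom a p /\ O (phi a p)].
Proof.
move=> Oo; rewrite openE => p [dp Op]; have := chart_continuous_at dp (open_nbhs_nbhs (conj Oo Op)).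
move=> h; near=> q; split; near: q; last exact: h.
exact: open_nbhs_nbhs (conj (chart_dom_open a) dp).
Unshelve. all: by end_near. Qed.

Lemma preimage_chart_inv_open a (O : set M) : open O -> open [set x | img a x /\ O (psi a x)].
Proof.
move=> Oo; rewrite openE => x [ix Ox]; have := chart_inv_continuous_at ix (open_nbhs_nbhs (conj Oo Ox)).
move=> h; near=> y; split; near: y; last exact: h.
exact: open_nbhs_nbhs (conj (@img_open a) ix).
Unshelve. all: by end_near. Qed.

Definition smooth_function (f : M -> R) := forall a k, Ck k (img a) (f \o psi a).

(* top-degree forms, given by their coefficients *)
Definition density (u : field A R) := (forall a k, Ck k (img a) (u a)) /\
  forall a b x, overlap a b x -> u a x = \det (jac (transition a b) x) * u b (transition a b x).

Definition supported (C : set M) (u : field A R) := forall a x, img a x -> ~ C (psi a x) -> u a x = 0.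

Definition chart_integral a (u : field A R) := II (fun x => if x \in img a then u a x else 0).

Lemma density_scale (f : M -> R) (u : field A R) : smooth_function f -> density u ->
  density (fun a x => f (psi a x) * u a x).
Proof.
move=> fS [uS uT]; split=> [a k|a b x ab]; first exact: (Ck_mul (@img_open a) (fS a k) (uS a k)).
by rewrite (uT a b)// chart_inv_transition// mulrCA.
Qed.

Lemma supported_scale C D (f : M -> R) (u : field A R) : supported C u -> (forall p, ~ D p -> f p = 0) ->
  supported (D `&` C) (fun a x => f (psi a x) * u a x).
Proof.
move=> uC fD a x ix ndc; have [Dx|Dx] := pselect (D (psi a x)); last by rewrite fD// mul0r.
by rewrite uC ?mulr0// => Cx; apply: ndc.
Qed.

Lemma compact_chart a C : compact C -> C `<=` dom a -> compact (phi a @` C).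
Proof.
by move=> Cc Cd; apply: continuous_compact => //; apply: continuous_subspaceW Cd _; exact: chart_continuous.
Qed.

Lemma C1_bounded_support_density C a u : density u -> compact C -> C `<=` dom a -> supported C u ->
  C1_bounded_support (fun x => if x \in img a then u a x else 0).
Proof.
move=> [uS _] Cc Cd uC.
apply: (@C1_bounded_support_extend _ _ _ (phi a @` C) _ (@img_open a)).
- exact: compact_chart.
- by move=> _ [p Cp <-]; apply/img_chart/Cd.
- by move=> x ix nS; apply: uC => // Cx; apply: nS; exists (psi a x) => //; exact: chart_invK.
- exact: uS.
Qed.

(** [O] is the set of points that lie in the source ball in chart a and in the target ball in chart
    b, so a density supported there meets the hypotheses of the local change of variables. *)
Lemma local_chart_integral a b p : dom a p -> dom b p -> exists2 O, open O /\ O p &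
  forall C u, density u -> compact C -> C `<=` O -> supported C u -> chart_integral a u = chart_integral b u.
Proof.
move=> da db; pose T := transition a b; pose x0 := phi a p.
have Ux0 : overlap a b x0 by exists p.
have [r [s [r0 s0 sU CoV]]] := local_change_of_variables i0 (@overlap_open a b) Ux0
  (fun j => transition_Ck a b j 2) (fun x => @det_transition a b x).
have ball_open (z : 'rV[R]_n) (e : R) : open [set x | `|x - z| < e].
  rewrite (_ : [set _ | _] = (fun x => `|x - z|) @^-1` [set t | t < e])//.
  by apply: open_comp; [move=> y _; exact: continuous_dist|exact: open_lt].
pose O := [set q | dom a q /\ `|phi a q - x0| < s] `&` [set q | dom b q /\ `|phi b q - T x0| < r].
exists O.
  split; first exact: openI (@preimage_chart_open a _ (ball_open x0 s)) (@preimage_chart_open b _ (ball_open (T x0) r)).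
  split; split=> //; first by rewrite /x0 subrr normr0.
  by rewrite /T /transition/= /x0 chartK// subrr normr0.
move=> C u uD Cc CO uC.
have Cb : C `<=` dom b by move=> q /CO[_ []].
have Ca : C `<=` dom a by move=> q /CO[[]].
have [fC _] := C1_bounded_support_density uD Cc Cb uC.
rewrite [RHS](CoV _ fC); last first.
  move=> y yr; case: ifPn => // /set_mem iy; apply: uC => // /CO[_ [_]].
  by rewrite chart_invK// => yr'; have := le_lt_trans yr yr'; rewrite ltxx.
congr iterated_integral; apply/funext => x; case: (ltP `|x - x0| s) => xs.
  have ab := sU x xs; rewrite mem_set; last exact: overlap_img ab.
  by rewrite mem_set; [exact: (uD.2 a b x ab)|exact: transition_img].
case: ifPn => // /set_mem ix; apply: uC => // /CO[[_ xs'] _].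
by move: xs'; rewrite chart_invK// ltNge xs.
Qed.

Lemma chart_integral0 a (u : field A R) : (forall x, img a x -> u a x = 0) -> chart_integral a u = 0.
Proof.
move=> u0; rewrite /chart_integral (_ : (fun x => _) = fun=> 0) ?ext0_II//.
by apply/funext => x; case: ifPn => // /set_mem /u0.
Qed.

Lemma chart_integral_ext a (u v : field A R) : (forall x, img a x -> u a x = v a x) ->
  chart_integral a u = chart_integral a v.
Proof.
move=> E; congr iterated_integral; apply/funext => x.
by case: ifPn => // /set_mem /E.
Qed.

Lemma II_C1_sum (I : Type) (r : seq I) (F : I -> 'rV[R]_n -> R) : (forall i, C1_bounded_support (F i)) ->
  C1_bounded_support (fun x => \sum_(i <- r) F i x) /\
  II (fun x => \sum_(i <- r) F i x) = \sum_(i <- r) II (F i).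
Proof.
move=> FC; elim: r => [|i r [[SC [L L0 SL]] IH]].
  rewrite big_nil (_ : (fun x => _) = fun=> 0); last by apply/funext => x; rewrite big_nil.
  by split; [split; [exact: Ck_cst|exists 1]|exact: ext0_II].
have [FiC [K K0 FK]] := FC i.
rewrite (_ : (fun x => _) = fun x => F i x + \sum_(j <- r) F j x); last first.
  by apply/funext => x; rewrite big_cons.
have KL : 0 < K + L by rewrite addr_gt0.
have FKL : vanishes_beyond (K + L) (F i) by apply: vanishes_beyond_le FK; rewrite lerDl ltW.
have SKL : vanishes_beyond (K + L) (fun x => \sum_(j <- r) F j x).
  by apply: vanishes_beyond_le SL; rewrite lerDr ltW.
split; last by rewrite big_cons -IH; apply: (II_add KL) => //; apply: Ck_continuousT; eassumption.
split; first by apply: Ck_add => //; exact: openT.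
by exists (K + L) => // x Kx; rewrite FKL// SKL// addr0.
Qed.

Lemma chart_integral_sum (I : Type) (r : seq I) a (C : I -> set M) (u : I -> field A R) :
  (forall i, density (u i)) -> (forall i, compact (C i)) -> (forall i, C i `<=` dom a) ->
  (forall i, supported (C i) (u i)) ->
  \sum_(i <- r) chart_integral a (u i) = chart_integral a (fun b x => \sum_(i <- r) u i b x).
Proof.
move=> uD Cc Cd uC.
have [_ <-] := @II_C1_sum _ r (fun i x => if x \in img a then u i a x else 0)
  (fun i => C1_bounded_support_density (uD i) (Cc i) (Cd i) (uC i)).
by congr iterated_integral; apply/funext => x; case: ifP => // _; rewrite big1.
Qed.

Lemma chart_integral_scale a C (k : R) (u : field A R) : density u -> compact C -> C `<=` dom a ->
  supported C u -> chart_integral a (fun b x => k * u b x) = k * chart_integral a u.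
Proof.
move=> uD Cc Cd uC; rewrite -(II_C1_scale _ (C1_bounded_support_density uD Cc Cd uC)).
by congr iterated_integral; apply/funext => x; case: ifP; rewrite ?mulr0.
Qed.

Lemma densityZ (k : R) (u : field A R) : density u -> density (fun a x => k * u a x).
Proof. by move=> uD; apply: (density_scale (f := fun=> k)) => // a m; exact: Ck_cst. Qed.

Lemma density_sum (I : Type) (r : seq I) (u : I -> field A R) : (forall i, density (u i)) ->
  density (fun a x => \sum_(i <- r) u i a x).
Proof.
move=> uD; split=> [a k|a b x ab]; first by apply: (Ck_sum _ (@img_open a)) => i _; case: (uD i).
by rewrite mulr_sumr; apply: eq_bigr => i _; case: (uD i) => _ /(_ a b x ab).
Qed.

End Manifolds.

(** * Partitions of unity and independence of the integral from them *)

Section Integration.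
Variables (R : realType) (n : nat) (i0 : 'I_n) (M : topologicalType) (A : oriented_atlas R n M).
Hypotheses (M_hausdorff : hausdorff_space M) (M_compact : compact [set: M]).
Local Notation II := (@iterated_integral R n).
Local Notation img := (@chart_img R n M A).
Local Notation dom := (@chart_dom R n M A).
Local Notation phi := (@chart R n M A).
Local Notation psi := (@chart_inv R n M A).
Implicit Types (a b c : chart_idx A) (p q : M) (x y : 'rV[R]_n).

(** In a Hausdorff space the compact image [Q] of the coordinate ball is closed, so the bump
    extended by zero is smooth near every point: either inside the chart, or off [Q] where it
    vanishes. *)
Lemma bump_at a p (N : set M) : dom a p -> nbhs p N -> exists (f : M -> R) (Q : set M),
  [/\ smooth_function A f, forall q, 0 <= f q, compact Q /\ Q `<=` N `&` dom a, forall q, ~ Q q -> f q = 0 &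
      \forall q \near p, f q = 1].
Proof.
move=> da Np; pose x0 := phi a p.
have ix0 : img a x0 by exact: img_chart.
have px0 : psi a x0 = p by rewrite chartK.
have : \forall x \near x0, img a x /\ N (psi a x).
  have h : psi a x @[x --> x0] --> p by rewrite -px0; exact: chart_inv_continuous_at.
  near=> x; split; near: x; last exact: h Np.
  exact: open_nbhs_nbhs (conj (@img_open _ _ _ A a) ix0).
move=> /near_normP[e e0 he].
pose e3 := e / 3; have e30 : 0 < e3 by rewrite divr_gt0.
have [chi [chiC chi01 chi1 chi0]] := smooth_bump x0 e30.
pose S := [set x | `|x - x0| <= 2 * e3].
have e3e : 2 * e3 < e by rewrite /e3; lra.
have SN x : S x -> img a x /\ N (psi a x).
  by move=> Sx; have := he (x - x0) (le_lt_trans Sx e3e); rewrite addrC subrK.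
have Sc : compact S.
  have -> : S = (fun x => x + x0) @` [set v : 'rV[R]_n | `|v| <= 2 * e3].
    apply/seteqP; split=> [x Sx|_ [v vS <-]]; last by rewrite /S/= addrK.
    by exists (x - x0) => //; exact: subrK.
  apply: continuous_compact; last exact: compact_box.
  apply: continuous_subspaceT => x; exact: (cvgD cvg_id (cvg_cst _)).
pose Q := psi a @` S.
have Qc : compact Q.
  apply: continuous_compact => //; apply: (@continuous_subspaceW _ _ S (img a)).
    by move=> x /SN[].
  exact: chart_inv_continuous.
have Qcl : closed Q by exact: compact_closed.
pose f q : R := if q \in dom a then chi (phi a q) else 0.
have f0 q : ~ Q q -> f q = 0.
  move=> nQ; rewrite /f; case: ifPn => // /set_mem dq; apply: chi0; rewrite ltNge; apply/negP => Sq.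
  by apply: nQ; exists (phi a q) => //; rewrite chartK.
exists f, Q; split=> //.
- move=> b k; apply: Ck_local => x ix; have [dx|dx] := pselect (dom a (psi b x)).
    exists (overlap b a); first exact: overlap_open.
    split; first exact/overlapP.
    apply: (@Ck_ext _ _ _ _ (chi \o transition b a)); first exact: overlap_open.
      by move=> y /overlapP[iy dy]; rewrite /f/= mem_set.
    apply: (@Ck_comp R n n k (overlap b a) setT) => //; first exact: overlap_open.
      exact: openT.
    by move=> j; exact: transition_Ck.
  exists [set x | img b x /\ (~` Q) (psi b x)].
    by apply: preimage_chart_inv_open; exact: closed_openC.
  split; first by split=> // -[z /SN[iz _] E]; apply: dx; rewrite -E; exact: img_dom.
  apply: (@Ck_ext _ _ _ _ (fun=> 0)); [|by move=> y [iy nQ]; rewrite /= f0|exact: Ck_cst].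
  by apply: preimage_chart_inv_open; exact: closed_openC.
- by move=> q; rewrite /f; case: ifP => // _; case/andP: (chi01 (phi a q)).
- by split=> // _ [x /SN[ix Nx] <-]; split=> //; exact: img_dom.
near=> q; rewrite /f mem_set; last first.
  by near: q; exact: open_nbhs_nbhs (conj (chart_dom_open a) da).
apply: chi1; near: q.
have := chart_continuous_at da => /cvgrPdist_le/(_ _ e30); apply: filterS => q.
by rewrite distrC.
Unshelve. all: by end_near. Qed.

(** Finitely many bumps suffice for one of them to equal 1 at each point; their sum is then
    positive, and dividing by it normalises them. *)
Lemma fine_partition (c : M -> chart_idx A) (N : M -> set M) : (forall p, dom (c p) p) ->
  (forall p, nbhs p (N p)) -> exists m (p : 'I_m -> M) (f : 'I_m -> M -> R) (Q : 'I_m -> set M),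
  [/\ forall l, smooth_function A (f l), forall l q, 0 <= f l q,
      forall l, compact (Q l) /\ Q l `<=` N (p l) `&` dom (c (p l)), forall l q, ~ Q l q -> f l q = 0 &
      forall q, \sum_(l < m) f l q = 1].
Proof.
move=> dc Np.
have : forall p, exists fQ : (M -> R) * set M,
  [/\ smooth_function A fQ.1, forall q, 0 <= fQ.1 q, compact fQ.2 /\ fQ.2 `<=` N p `&` dom (c p),
      forall q, ~ fQ.2 q -> fQ.1 q = 0 & \forall q \near p, fQ.1 q = 1].
  by move=> p; have [f [Q h]] := bump_at (dc p) (Np p); exists (f, Q).
move=> /choice[F HF].
have [s sE] := @finite_subcover M (fun p q => (F p).1 q = 1) M_compact (fun p => let: And5 _ _ _ _ h := HF p in h).
pose m := size s; pose P (l : 'I_m) := tnth (in_tuple s) l.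
pose S q := \sum_(l < m) (F (P l)).1 q.
have S0 q : 0 < S q.
  have [p ps Fp] := sE q; have pm : (index p s < m)%N by rewrite index_mem.
  rewrite /S (bigD1 (Ordinal pm))//= ltr_pwDl ?sumr_ge0//; last first.
    by move=> l _; have [_ ->] := HF (P l).
  by rewrite /P (tnth_nth p)/= nth_index// Fp.
exists m, P, (fun l q => (S q)^-1 * (F (P l)).1 q), (fun l => (F (P l)).2); split.
- move=> l a k; apply: (Ck_mul (@img_open _ _ _ A a)); last by have [h _ _ _ _] := HF (P l); exact: (h a k).
  apply: (Ck_inv (@img_open _ _ _ A a)); first by move=> x _; rewrite gt_eqF.
  apply: (Ck_sum _ (@img_open _ _ _ A a)) => l' _; by have [h _ _ _ _] := HF (P l'); exact: (h a k).
- by move=> l q; have [_ h _ _ _] := HF (P l); rewrite mulr_ge0// invr_ge0 ltW.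
- by move=> l; have [_ _ h _ _] := HF (P l).
- by move=> l q nQ; have [_ _ _ h _] := HF (P l); rewrite h// mulr0.
- by move=> q; rewrite -mulr_sumr mulVf// gt_eqF.
Qed.

Lemma exists_chart_choice : exists c : M -> chart_idx A, forall p, dom (c p) p.
Proof. by have [c H] := choice (@chart_cover _ _ _ A); exists c. Qed.

(* Compare the integrals in different charts through a partition of unity so fine that near each of its
   supports every chart of the family is compared to a single one. *)
Lemma sum_chart_integral0 (I : finType) (c : I -> chart_idx A) (C : I -> set M) (u : I -> field A R) :
  (forall i, density (u i)) -> (forall i, compact (C i)) -> (forall i, C i `<=` dom (c i)) ->
  (forall i, supported (C i) (u i)) -> (forall a x, img a x -> \sum_i u i a x = 0) ->
  \sum_i chart_integral (c i) (u i) = 0.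
Proof.
move=> uD Cc Cd uC u0.
have [a da] := exists_chart_choice.
have Ccl i : closed (C i) by exact: compact_closed.
have : forall pi : M * I, exists W : set M, [/\ open W, W pi.1 & forall Q v, density v -> compact Q ->
    Q `<=` W -> supported (Q `&` C pi.2) v -> chart_integral (a pi.1) v = chart_integral (c pi.2) v].
  move=> [p i] /=; have [Cp|Cp] := pselect (C i p).
    have [W [Oo Op] HO] := local_chart_integral i0 (da p) (Cd i p Cp).
    exists W; split=> // Q v vD Qc QO; apply: HO => //; first exact: compact_closedI.
    by move=> q [/QO].
  exists (~` C i); split=> //; first exact: closed_openC.
  move=> Q v vD Qc QO vC; rewrite !chart_integral0// => x ix; apply: vC => // -[/QO] //.
move=> /choice[W HO].
have Np p : nbhs p [set q | forall i, W (p, i) q].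
  by apply: (@nbhs_forall _ I) => i; have [Oo Op _] := HO (p, i); exact: open_nbhs_nbhs (conj Oo Op).
have [m [P [f [Q [fS _ QN f0 f1]]]]] := fine_partition da Np.
pose w l i : field A R := fun b x => f l (psi b x) * u i b x.
have wD l i : density (w l i) by exact: density_scale.
have wc l i : compact (Q l `&` C i) by apply: compact_closedI => //; case: (QN l).
have ws l i : supported (Q l `&` C i) (w l i) by exact: (supported_scale (uC i) (f0 l)).
transitivity (\sum_i \sum_(l < m) chart_integral (c i) (w l i)).
  apply: eq_bigr => i _; rewrite (@chart_integral_sum _ _ _ _ _ _ (c i) (fun l => Q l `&` C i))//.
    by apply: chart_integral_ext => x ix; rewrite -mulr_suml f1 mul1r.
  by move=> l q [_ /Cd].
rewrite exchange_big/= big1// => l _.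
transitivity (\sum_i chart_integral (a (P l)) (w l i)).
  apply: eq_bigr => i _; have [_ _ h] := HO (P l, i); apply/esym.
  by apply: (h (Q l)) => //; have [? QNl] := QN l; first by []; move=> q /QNl[].
rewrite (@chart_integral_sum _ _ _ _ _ _ _ (fun i => Q l `&` C i))//.
  by apply: chart_integral0 => x ix; rewrite -mulr_sumr u0// mulr0.
by move=> i q [Qq _]; have [_ QNl] := QN l; have [] := QNl q Qq.
Qed.

(** Index both families by a disjoint union, the second with the opposite sign, and use the
    vanishing statement. *)
Lemma eq_sum_chart_integral (I J : finType) (c : I -> chart_idx A) (C : I -> set M) (u : I -> field A R)
    (d : J -> chart_idx A) (D : J -> set M) (v : J -> field A R) :
  (forall i, density (u i)) -> (forall i, compact (C i)) -> (forall i, C i `<=` dom (c i)) ->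
  (forall i, supported (C i) (u i)) ->
  (forall j, density (v j)) -> (forall j, compact (D j)) -> (forall j, D j `<=` dom (d j)) ->
  (forall j, supported (D j) (v j)) ->
  (forall a x, img a x -> \sum_i u i a x = \sum_j v j a x) ->
  \sum_i chart_integral (c i) (u i) = \sum_j chart_integral (d j) (v j).
Proof.
move=> uD Cc Cd uC vD Dc Dd vD' uv; apply/eqP; rewrite -subr_eq0; apply/eqP.
pose e (k : I + J) := match k with inl i => c i | inr j => d j end.
pose E (k : I + J) := match k with inl i => C i | inr j => D j end.
pose w (k : I + J) : field A R := match k with inl i => u i | inr j => fun a x => -1 * v j a x end.
have E0 : \sum_k chart_integral (e k) (w k) = 0.
  apply: (@sum_chart_integral0 _ e E w).
  - by case=> // j; exact: densityZ.
  - by case.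
  - by case.
  - by case=> // j a x ix nD; rewrite /w vD'// mulr0.
  - by move=> a x ix; rewrite big_sumType/= uv// -mulr_sumr mulN1r subrr.
rewrite -[RHS]E0 big_sumType/= -sumrN; congr (_ + _); apply: eq_bigr => j _.
by rewrite (chart_integral_scale _ (vD j) (Dc j) (Dd j) (vD' j)) mulN1r.
Qed.

Lemma exists_partition_of_unity : exists N (c : 'I_N -> chart_idx A) (chi : 'I_N -> M -> R),
  partition_of_unity c chi.
Proof.
have [a da] := exists_chart_choice.
have [m [P [f [Q [fS f0 QN fQ f1]]]]] := fine_partition da (fun p => @filterT _ (nbhs p) _).
exists m, (a \o P), f; split=> //.
- by move=> k b; apply/smooth_onP; split; [exact: img_open|move=> l; exact: fS].
- move=> k; exists (Q k) => //; last exact: fQ.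
  by have [Qc QN'] := QN k; split=> // q /QN'[].
Qed.

Lemma form_integral_ext (w w' : field A (ext R n)) :
  (forall a x, img a x -> w a x (topset n) = w' a x (topset n)) -> form_integral w = form_integral w'.
Proof.
move=> ww; rewrite /form_integral; congr xget; apply/seteqP; split=> s [N [c [chi [pu ->]]]];
  exists N, c, chi; split=> //; apply: eq_bigr => k _; congr iterated_integral; apply/funext => x;
  by case: ifPn => // /set_mem ix; rewrite ww.
Qed.

Definition density_integral (u : field A R) := form_integral (fun a x => u a x *: dx R (topset n)).

Lemma partition_smooth N (c : 'I_N -> chart_idx A) (chi : 'I_N -> M -> R) k :
  partition_of_unity c chi -> smooth_function A (chi k).
Proof. by move=> [h _ _ _] a l; have /smooth_onP[_] := h k a. Qed.

Lemma partition_support N (c : 'I_N -> chart_idx A) (chi : 'I_N -> M -> R) : partition_of_unity c chi ->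
  exists C : 'I_N -> set M, forall k, [/\ compact (C k), C k `<=` dom (c k) & forall p, ~ C k p -> chi k p = 0].
Proof.
move=> [_ _ h _]; have : forall k, exists C : set M, [/\ compact C, C `<=` dom (c k) & forall p, ~ C p -> chi k p = 0].
  by move=> k; have [C [? ?] ?] := h k; exists C.
by move=> /choice[C HC]; exists C.
Qed.

(** The given partition is a witness, so the default of [xget] is not taken, and any two partitions
    yield the same number; hence the chosen value is this sum. *)
Lemma density_integralE N (c : 'I_N -> chart_idx A) (chi : 'I_N -> M -> R) (u : field A R) :
  partition_of_unity c chi -> density u ->
  density_integral u = \sum_k chart_integral (c k) (fun a x => chi k (psi a x) * u a x).
Proof.
move=> pu uD; rewrite /density_integral /form_integral; apply: xget_unique => [|s].
  exists N, c, chi; split=> //; apply: eq_bigr => k _; congr iterated_integral; apply/funext => x.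
  by rewrite scale_extE ffunE eqxx mulr1.
move=> [N' [c' [chi' [pu' ->]]]].
transitivity (\sum_k chart_integral (c' k) (fun a x => chi' k (psi a x) * u a x)).
  apply: eq_bigr => k _; congr iterated_integral; apply/funext => x.
  by rewrite scale_extE ffunE eqxx mulr1.
have [C HC] := partition_support pu; have [C' HC'] := partition_support pu'.
have all_supported K (chi0 : M -> R) : (forall p, ~ K p -> chi0 p = 0) ->
    supported K (fun a x => chi0 (psi a x) * u a x).
  by move=> h a x ix nK; rewrite h// mul0r.
apply: (@eq_sum_chart_integral _ _ _ C' _ _ C).
- by move=> k; apply: density_scale => //; exact: partition_smooth pu'.
- by move=> k; case: (HC' k).
- by move=> k; case: (HC' k).
- by move=> k; apply: all_supported; case: (HC' k).
- by move=> k; apply: density_scale => //; exact: partition_smooth pu.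
- by move=> k; case: (HC k).
- by move=> k; case: (HC k).
- by move=> k; apply: all_supported; case: (HC k).
by move=> a x ix; rewrite -!mulr_suml; case: pu => _ _ _ ->; case: pu' => _ _ _ ->.
Qed.

Lemma density_integral_chart a C (u : field A R) : density u -> compact C -> C `<=` dom a -> supported C u ->
  density_integral u = chart_integral a u.
Proof.
move=> uD Cc Cd uC; have [N [c [chi pu]]] := exists_partition_of_unity.
rewrite (density_integralE pu uD); have [K HK] := partition_support pu.
have := @eq_sum_chart_integral 'I_N 'I_1 c K (fun k b x => chi k (psi b x) * u b x)
  (fun=> a) (fun=> C) (fun=> u).
rewrite big_ord1; apply=> //.
- by move=> k; apply: density_scale => //; exact: partition_smooth pu.
- by move=> k; case: (HK k).
- by move=> k; case: (HK k).
- by move=> k b x ix nK; have [_ _ ->//] := HK k; rewrite mul0r.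
by move=> b x ix; rewrite big_ord1 -mulr_suml; case: pu => _ _ _ ->; rewrite mul1r.
Qed.

Lemma density_integral_sum (I : Type) (r : seq I) (u : I -> field A R) : (forall i, density (u i)) ->
  density_integral (fun a x => \sum_(i <- r) u i a x) = \sum_(i <- r) density_integral (u i).
Proof.
move=> uD; have [N [c [chi pu]]] := exists_partition_of_unity; have [K HK] := partition_support pu.
rewrite (density_integralE pu (density_sum r uD)); under [RHS]eq_bigr do rewrite (density_integralE pu (uD _)).
rewrite exchange_big/=; apply: eq_bigr => k _; have [Kc Kd K0] := HK k.
rewrite (@chart_integral_sum _ _ _ _ _ _ (c k) (fun=> K k))//.
- by apply: chart_integral_ext => x ix; rewrite mulr_sumr.
- by move=> i; apply: density_scale => //; exact: partition_smooth pu.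
- by move=> i a x ix nK; rewrite K0// mul0r.
Qed.

Lemma density_integralZ (k : R) (u : field A R) : density u -> density_integral (fun a x => k * u a x) = k * density_integral u.
Proof.
move=> uD; have [N [c [chi pu]]] := exists_partition_of_unity; have [K HK] := partition_support pu.
rewrite (density_integralE pu (densityZ k uD)) (density_integralE pu uD) mulr_sumr; apply: eq_bigr => l _.
have [Kc Kd K0] := HK l; rewrite -(@chart_integral_scale _ _ _ _ _ (K l))//.
- by apply: chart_integral_ext => x ix; rewrite mulrCA.
- by apply: density_scale => //; exact: partition_smooth pu.
- by move=> a x ix nK; rewrite K0// mul0r.
Qed.

Lemma density_integral_ext (u v : field A R) : field_eq u v -> density_integral u = density_integral v.
Proof. by move=> uv; apply: form_integral_ext => a x ix; rewrite uv. Qed.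

Lemma density_integralD (u v : field A R) : density u -> density v ->
  density_integral (fun a x => u a x + v a x) = density_integral u + density_integral v.
Proof.
move=> uD vD; have := @density_integral_sum bool [:: true; false] (fun t : bool => if t then u else v).
rewrite !big_cons big_nil addr0 => <-; last by case.
by apply: density_integral_ext => a x ix; rewrite !big_cons big_nil addr0.
Qed.

End Integration.

(** * Integration by parts *)

Section Wedge3.
Variables (K : numFieldType) (n : nat).
Implicit Types (u v w H : ext K n) (J : {set 'I_n}).

Lemma wedge_dx_foldr J w : wedge (dx K J) w = foldr (@eps K n) w (enum J).
Proof.
rewrite -ordered_prod_dx ordered_prod_enum; elim: (enum J) => [|i s IH].
  by rewrite big_nil wedge1l.
by rewrite big_cons -wedgeA IH.
Qed.

(* A product of three exterior multiplications changes sign when it is reversed. *)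
Lemma mukai_wedge3 H v w : ~~ odd n -> homogeneous 3%N H -> mukai v (wedge H w) = - mukai (wedge H v) w.
Proof.
move=> n_even H3; rewrite {1 2}[H]ext_basis !wedge_suml mukai_sumr mukai_suml -sumrN.
apply: eq_bigr => J _; rewrite !wedgeZl mukaiZr mukaiZl -mulrN.
have [J3|J3] := eqVneq #|J| 3%N; last by rewrite H3// !mul0r.
congr (_ * _); rewrite !wedge_dx_foldr.
move: J3; rewrite cardE; have := enum_uniq J; case: (enum J) => [|i [|j [|k [|]]]]//=.
rewrite !inE negb_or => /andP[/andP[ij ik] /andP[jk _]] _.
have epsN l u : eps l (- u) = - eps l u by rewrite -scaleN1r epsZ scaleN1r.
rewrite -!mukai_eps// -mukaiNl; congr (mukai _ w).
have kj : k != j by rewrite eq_sym.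
have ki : k != i by rewrite eq_sym.
have ji : j != i by rewrite eq_sym.
by rewrite (eps_anti _ kj) (eps_anti _ ki) epsN opprK (eps_anti _ ji).
Qed.
End Wedge3.

Section PolyForms.
Variables (R : realType) (n : nat) (i0 : 'I_n) (M : topologicalType) (A : oriented_atlas R n M).
Hypotheses (M_hausdorff : hausdorff_space M) (M_compact : compact [set: M]) (n_even : ~~ odd n).
Local Notation II := (@iterated_integral R n).
Local Notation img := (@chart_img R n M A).
Local Notation dom := (@chart_dom R n M A).
Local Notation phi := (@chart R n M A).
Local Notation psi := (@chart_inv R n M A).
Implicit Types (a b c : chart_idx A) (p q : M) (x y : 'rV[R]_n) (u v w : field A (ext R n)).
Variable H : field A (ext R n).
Hypothesis H_form : is_form 3 H.

(** Forms of mixed degree on the manifold: what spinor fields become under [to_form]. *)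
Definition polyform w := (forall a k, form_Ck k (img a) (w a)) /\
  forall a b x, overlap a b x -> w a x = pull (jac (transition a b) x) (w b (transition a b x)).

Let H_Ck a k : form_Ck k (img a) (H a).
Proof. by move=> I; have [HS _ _] := H_form; have /smooth_onP[_] := HS a I. Qed.

Lemma field_d_pull w a b x : polyform w -> overlap a b x ->
  field_d w a x = pull (jac (transition a b) x) (field_d w b (transition a b x)).
Proof.
move=> [wS wT] ab; rewrite /field_d.
rewrite (@extd_ext _ _ (overlap a b) _ (fun y => pull (jac (transition a b) y) (w b (transition a b y)))) //.
- apply: (@extd_pull R n (overlap a b) (img b) (transition a b) 0) => //.
  + exact: overlap_open.
  + exact: img_open.
  + by move=> y; exact: transition_img.
  + by move=> j; exact: transition_Ck.
- exact: overlap_open.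
- by move=> y; exact: wT.
Qed.

Lemma polyform_twisted_d w : polyform w -> polyform (twisted_d H w).
Proof.
move=> wP; have [wS wT] := wP; split=> [a k|a b x ab].
  apply: (form_Ck_add (@img_open _ _ _ A a)); first exact: (form_Ck_extd (@img_open _ _ _ A a) (wS a k.+1)).
  exact: (form_Ck_wedge (@img_open _ _ _ A a) (@H_Ck a k) (wS a k)).
have [_ _ HT] := H_form.
by rewrite /twisted_d pullD pull_wedge (field_d_pull wP ab) (HT a b)// (wT a b).
Qed.

Lemma chiral_twisted_d e w a x : form_Ck 1 (img a) (w a) -> (forall x, img a x -> chiral e (w a x)) -> img a x ->
  chiral (~~ e) (twisted_d H w a x).
Proof.
move=> wC wc ix; apply: chiralD; last first.
  by have [_ H3 _] := H_form; exact: (chiral_wedge (H3 a x ix) (wc x ix)).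
rewrite /field_d extdE; apply: chiral_sum => i _; apply: chiral_eps => I Ie; rewrite ffunE.
rewrite (partial_ext i (@img_open _ _ _ A a) ix (_ : forall y, img a y -> w a y I = (fun=> 0) y)).
  by rewrite partial_cst.
by move=> y iy; exact: wc.
Qed.

Lemma polyform_scale (f : M -> R) w : smooth_function A f -> polyform w ->
  polyform (fun a x => f (psi a x) *: w a x).
Proof.
move=> fS [wS wT]; split=> [a k|a b x ab].
  exact: (form_Ck_scale (@img_open _ _ _ A a) (fS a k) (wS a k)).
by rewrite pullZ (wT a b)// chart_inv_transition.
Qed.

Lemma polyformZ (k : R) w : polyform w -> polyform (fun a x => k *: w a x).
Proof. by apply: (polyform_scale (f := fun=> k)) => a l; exact: Ck_cst. Qed.

Lemma polyformD v w : polyform v -> polyform w -> polyform (fun a x => v a x + w a x).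
Proof.
move=> [vS vT] [wS wT]; split=> [a k|a b x ab].
  exact: (form_Ck_add (@img_open _ _ _ A a) (vS a k) (wS a k)).
by rewrite pullD (vT a b)// (wT a b).
Qed.

Lemma density_mukai v w : polyform v -> polyform w -> density (fun a x => mukai (v a x) (w a x)).
Proof.
move=> [vS vT] [wS wT]; split=> [a k|a b x ab].
  exact: (Ck_mukai (@img_open _ _ _ A a) (vS a k) (wS a k)).
by rewrite (vT a b)// (wT a b)// mukai_pull top_factor_det ?det_transition// mulrC.
Qed.

(** The vector field with components <dx_i /\ u, w> has divergence <du, w> + <u, dw>, because
    [eps i] is self-adjoint. The contributions of H cancel, since a three-form is skew-adjoint for
    the pairing. *)
Lemma chart_stokes a C u w : polyform u -> polyform w -> compact C -> C `<=` dom a ->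
  (forall b x, img b x -> ~ C (psi b x) -> w b x = 0) ->
  chart_integral a (fun b x => mukai (u b x) (twisted_d H w b x)) =
  - chart_integral a (fun b x => mukai (twisted_d H u b x) (w b x)).
Proof.
move=> uP wP Cc Cd wC; have [uS _] := uP; have [wS _] := wP.
have io := @img_open _ _ _ A a.
pose S := phi a @` C; have Sc : compact S by exact: compact_chart.
have Scl : closed S by apply: compact_closed => //; exact: norm_hausdorff.
have SU : S `<=` img a by move=> _ [p Cp <-]; apply/img_chart/Cd.
have w0 x : img a x -> ~ S x -> w a x = 0.
  by move=> ix nS; apply: wC => // Cx; apply: nS; exists (psi a x) => //; exact: chart_invK.
pose g i x : R := if x \in img a then mukai (eps i (u a x)) (w a x) else 0.
have epsC i : form_Ck 1 (img a) (fun x => eps i (u a x)).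
  by apply: (form_Ck_linear io) (uS a 1%N) => k v v'; rewrite epsD epsZ.
have gC i : C1_bounded_support (g i).
  apply: (C1_bounded_support_extend io Sc SU) => [x ix nS|]; first by rewrite w0// mukai0r.
  exact: Ck_mukai io (epsC i) (wS a 1%N).
have dg i x : partial i (g i) x = if x \in img a then
    mukai (eps i (form_partial i (u a) x)) (w a x) + mukai (eps i (u a x)) (form_partial i (w a) x) else 0.
  case: ifPn => [/set_mem ix|/negP nx].
    rewrite (partial_ext i io ix (_ : forall y, img a y -> g i y = mukai (eps i (u a y)) (w a y))).
      have D1 : form_derive i (fun y => eps i (u a y)) x (eps i (form_partial i (u a) x)).
        by apply: form_derive_linear (form_Ck_derive i (uS a 1%N) ix) => k v v'; rewrite epsD epsZ.
      have := is_derive_mukai D1 (form_Ck_derive i (wS a 1%N) ix).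
      by move=> /(partialP i (fun y => mukai (eps i (u a y)) (w a y)) x)[].
    by move=> y iy; rewrite /g mem_set.
  have nS : (~` S) x by move=> /SU ix; apply: nx; rewrite mem_set.
  rewrite (partial_ext i (closed_openC Scl) nS (_ : forall y, (~` S) y -> g i y = (fun=> 0) y)).
    by rewrite partial_cst.
  by move=> y nSy; rewrite /g; case: ifPn => // /set_mem iy; rewrite w0// mukai0r.
have [K K0 gK] : exists2 K : R, 0 < K & forall i, vanishes_beyond K (g i).
  have [K K0 SK] := compact_norm_bound Sc; exists K => // i x Kx.
  rewrite /g; case: ifPn => // /set_mem ix; rewrite w0 ?mukai0r// => /SK; rewrite ltNge => /negP; apply.
  exact: ltW.
have E := @II_divergence R n g K K0 (fun i => (gC i).1) gK.
have duP := polyform_twisted_d uP; have dwP := polyform_twisted_d wP.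
have Z1 : supported C (fun b x => mukai (twisted_d H u b x) (w b x)).
  by move=> b x ix nC; rewrite wC// mukai0r.
have Z2 : supported C (fun b x => mukai (u b x) (twisted_d H w b x)).
  move=> b x ix nC; rewrite /twisted_d /field_d wC// wedge0r addr0.
  have Ccl : closed C by exact: compact_closed.
  pose V := [set y | img b y /\ (~` C) (psi b y)].
  have Vo : open V by apply: preimage_chart_inv_open; exact: closed_openC.
  rewrite (@extd_ext _ _ V (w b) (fun=> 0)) ?extd_cst ?mukai0r//.
  by move=> y [iy nCy]; exact: wC.
apply/eqP; rewrite -subr_eq0 opprK; apply/eqP.
have := @chart_integral_sum _ _ _ _ bool [:: true; false] a (fun=> C) (fun t : bool => if t
  then (fun b x => mukai (u b x) (twisted_d H w b x)) else (fun b x => mukai (twisted_d H u b x) (w b x))).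
rewrite !big_cons big_nil addr0 => ->//; last first.
- by case.
- by case; exact: density_mukai.
rewrite -[RHS]E; congr iterated_integral; apply/funext => x; under [RHS]eq_bigr do rewrite dg.
case: ifPn => [/set_mem ix|_]; last by rewrite big1.
rewrite !big_cons big_nil addr0 big_split/= /twisted_d /field_d mukaiDl mukaiDr.
have [_ H3 _] := H_form; rewrite (mukai_wedge3 _ _ n_even (H3 a x ix)).
rewrite !extdE mukai_suml mukai_sumr.
have -> : \sum_i mukai (eps i (u a x)) (form_partial i (w a) x) =
    \sum_i mukai (u a x) (eps i (form_partial i (w a) x)) by apply: eq_bigr => i _; rewrite mukai_eps.
by ring.
Qed.

(** Only w is cut up by the partition of unity; the pieces have supports in single charts, and by
    linearity their twisted derivatives add up to that of w. *)
Lemma density_integral_mukai_twisted_d u w : polyform u -> polyform w ->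
  density_integral (fun a x => mukai (u a x) (twisted_d H w a x)) =
  - density_integral (fun a x => mukai (twisted_d H u a x) (w a x)).
Proof.
move=> uP wP; have [N [c [chi pu]]] := exists_partition_of_unity i0 A M_hausdorff M_compact.
have [C HC] := partition_support pu.
pose wk (k : 'I_N) : field A (ext R n) := fun a x => chi k (psi a x) *: w a x.
have wkP k : polyform (wk k) by apply: polyform_scale => //; exact: partition_smooth pu.
have wk1 a x : w a x = \sum_k wk k a x.
  by rewrite /wk -scaler_suml; case: pu => _ _ _ ->; rewrite scale1r.
have dP := polyform_twisted_d; have duP := dP _ uP.
have wk0 k b x : img b x -> ~ C k (psi b x) -> wk k b x = 0.
  by move=> ix nC; have [_ _ h] := HC k; rewrite /wk h// scale0r.
have [Cc Cd] : (forall k, compact (C k)) /\ (forall k, C k `<=` dom (c k)).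
  by split=> k; case: (HC k).
transitivity (\sum_k density_integral (fun a x => mukai (u a x) (twisted_d H (wk k) a x))).
  rewrite -density_integral_sum//; last by move=> k; apply: density_mukai => //; exact: dP.
  apply: density_integral_ext => a x ix; rewrite -mukai_sumr; congr mukai.
  rewrite /twisted_d big_split/= -wedge_sumr -wk1; congr (_ + _).
  rewrite /field_d -(@extd_sum _ _ _ _ _ (fun k => wk k a) (img a))//; last first.
    by move=> k _; case: (wkP k).
  by apply: (@extd_ext _ _ (img a)) => //; exact: img_open.
rewrite (_ : density_integral _ = \sum_k density_integral (fun a x => mukai (twisted_d H u a x) (wk k a x))); last first.
  rewrite -density_integral_sum//; last by move=> k; exact: density_mukai.
  by apply: density_integral_ext => a x ix; rewrite -mukai_sumr -wk1.
rewrite -sumrN; apply: eq_bigr => k _.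
rewrite (@density_integral_chart _ _ i0 _ _ M_hausdorff M_compact (c k) (C k))//.
- rewrite (@density_integral_chart _ _ i0 _ _ M_hausdorff M_compact (c k) (C k))//.
  + exact: (chart_stokes uP (wkP k) (Cc k) (Cd k) (@wk0 k)).
  + exact: density_mukai.
  + by move=> b x ix nC; rewrite wk0// mukai0r.
- by apply: density_mukai => //; exact: dP.
move=> b x ix nC; rewrite /twisted_d /field_d wk0// wedge0r addr0.
pose V := [set y | img b y /\ (~` C k) (psi b y)].
have Vo : open V.
  by apply: preimage_chart_inv_open; apply: closed_openC; exact: compact_closed.
rewrite (@extd_ext _ _ V (wk k b) (fun=> 0)) ?extd_cst ?mukai0r//.
by move=> y [iy nCy]; exact: wk0.
Qed.

(* Spread a constant form of one chart over the manifold by pullback and a bump function. *)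
Lemma bump_form a p (N : set M) (beta : ext R n) : dom a p -> nbhs p N ->
  exists (f : M -> R) (Q : set M) (w : field A (ext R n)),
  [/\ polyform w, forall e, chiral e beta -> forall b x, img b x -> chiral e (w b x),
      compact Q /\ Q `<=` N `&` dom a, forall b x, img b x -> ~ Q (psi b x) -> w b x = 0 &
      [/\ forall q, 0 <= f q, f p = 1 & forall x, img a x -> w a x = f (psi a x) *: beta]].
Proof.
move=> da Np; have [f [Q [fS f0 QN fQ f1]]] := bump_at i0 M_hausdorff da Np.
pose w : field A (ext R n) := fun b x => f (psi b x) *: pull (jac (transition b a) x) beta.
have Qd : Q `<=` dom a by case: QN => _ h q /h[].
have Qcl : closed Q by apply: compact_closed => //; case: QN.
exists f, Q, w; split=> //; last first.
- split=> // [|x ix]; first exact: nbhs_singleton f1.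
  have io := @img_open _ _ _ A a.
  rewrite /w (@jac_ext _ _ (img a) (transition a a) (fun y => 0 + (y - 0) *m (1%:M : 'M[R]_n)^T))//.
    by rewrite jac_affine pull1.
  by move=> y iy; rewrite trmx1 mulmx1 subr0 add0r /transition/= chart_invK.
- by move=> b x ix nQ; rewrite /w fQ// scale0r.
- by move=> e be b x ix; apply: chiralZ; exact: chiral_pull.
split=> [b k I|b c x bc]; last first.
  rewrite /w pullZ pullM chart_inv_transition//.
  have [dx|dx] := pselect (dom a (psi b x)); first by rewrite -jac_transition_comp.
  by rewrite fQ ?scale0r// => /Qd.
apply: Ck_local => x ix; have [dx|dx] := pselect (dom a (psi b x)).
  exists (overlap b a); first exact: overlap_open.
  split; first exact/overlapP.
  suff FC : form_Ck k (overlap b a) (fun y => f (psi b y) *: pull (jac (transition b a) y) beta) by exact: FC.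
  apply: form_Ck_scale; first exact: overlap_open.
    by apply: Ck_subset (fS b k) => y /overlapP[].
  move=> J; apply: CkS; move: J.
  apply: (@form_Ck_pull R n (overlap b a) (img a) (transition b a) k _ _ _ _ (fun=> beta)).
  + exact: overlap_open.
  + exact: img_open.
  + by move=> y; exact: transition_img.
  + by move=> j; exact: transition_Ck.
  + exact: form_Ck_cst.
exists [set x | img b x /\ (~` Q) (psi b x)].
  by apply: preimage_chart_inv_open; exact: closed_openC.
split; first by split=> // /Qd.
apply: (@Ck_ext _ _ _ _ (fun=> 0)); [|move=> y [iy nQ]|exact: Ck_cst].
  by apply: preimage_chart_inv_open; exact: closed_openC.
by rewrite /w fQ// scale0r ffunE.
Qed.

Lemma mukai_nondegenerate e v : polyform v -> (forall a x, img a x -> chiral e (v a x)) ->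
  (forall w, polyform w -> (forall a x, img a x -> chiral e (w a x)) ->
    density_integral (fun a x => mukai (v a x) (w a x)) = 0) ->
  field_eq v (fun _ _ => 0).
Proof.
move=> vP vc v0 a x0 ix0; apply/ffunP => I; rewrite [RHS]ffunE; apply/eqP/negPn/negP => vI.
(* The test form is the monomial complementary to I, with the sign of the pairing compensated by
   [s]. The factor [t] makes its pairing with v equal to t times the coefficient I of v, which is
   positive near x0. *)
pose s : R := wedge_sign R I (~: I) * hat_sign R #|~: I|.
have s2 : s * s = 1 by rewrite /s mulrACA wedge_sign_sqr mul1r -expr2 sqrr_sign.
pose t := v a x0 I; pose beta : ext R n := (t * s) *: dx R (~: I).
have mE (u : ext R n) : mukai u beta = t * u I.
  rewrite mukaiZr mukaiE (bigD1 I)//= big1 => [|J JI].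
    by rewrite ffunE eqxx mulr1 addr0 -/s; rewrite mulrACA s2 mulr1.
  by rewrite ffunE (inj_eq (can_inj (@finset.setCK _))) (negPf JI) mulr0 mul0r.
(* In even dimension complementary index sets have the same parity, so the test form has the
   chirality of v. *)
have cbeta : chiral e beta.
  apply: chiralZ => J Je; rewrite ffunE; case: eqP => // JE; case/negP: Je; apply/eqP.
  have : odd #|I| = e by apply/eqP; apply: contraNT vI => Ie; rewrite vc.
  move=> <-; rewrite JE; have := congr1 odd (cardsC I); rewrite card_ord oddD (negPf n_even).
  by case: odd; case: odd.
have dp : dom a (psi a x0) by exact: img_dom.
have [vS _] := vP.
have Np : nbhs (psi a x0) [set q | 0 < t * v a (phi a q) I].
  have c1 : {for x0, continuous (fun x => v a x I)} by exact: Ck_continuous (vS a 0%N I) ix0.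
  have c2 : {for psi a x0, continuous (fun q => v a (phi a q) I)}.
    by apply: (@continuous_comp _ _ _ (phi a) (fun x => v a x I));
      [exact: chart_continuous_at|rewrite chart_invK].
  have c3 : {for psi a x0, continuous (fun q => t * v a (phi a q) I)} by apply: cvgM => //; exact: cvg_cst.
  have t2 : 0 < t * v a (phi a (psi a x0)) I by rewrite chart_invK// -expr2 exprn_even_gt0.
  by have /cvgr_gt/(_ _ t2) := c3.
have [f [Q [w [wP wc [Qc QN] w0 [f0 f1 wE]]]]] := bump_form beta dp Np.
have vwD := density_mukai vP wP.
have Qd : Q `<=` dom a by move=> q /QN[].
have sup : supported Q (fun a x => mukai (v a x) (w a x)) by move=> b x ix nQ; rewrite w0// mukai0r.
have := v0 w wP (wc e cbeta); rewrite (density_integral_chart i0 M_hausdorff M_compact vwD Qc Qd sup).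
have [hC [K K0 hK]] := C1_bounded_support_density vwD Qc Qd sup.
apply/eqP; rewrite gt_eqF//; apply: (II_gt0 (x0 := x0) K0 _ hK); first exact: Ck_continuousT hC.
  move=> x; case: ifPn => // /set_mem ix; rewrite wE// mukaiZr mE.
  have [Qx|Qx] := pselect (Q (psi a x)).
    by rewrite mulr_ge0// ltW//; have [+ _] := QN _ Qx; rewrite /= chart_invK.
  by have := w0 a x ix Qx; rewrite wE// => E; rewrite -mE -mukaiZr E mukai0r.
by rewrite mem_set// wE// mukaiZr mE f1 mul1r -expr2 exprn_even_gt0.
Qed.

End PolyForms.

(** * Stable spinors *)

Section ComplexForms.
Variables (R : realType) (n : nat).
Local Notation C := R[i].
Implicit Types (t u : ext R n) (rho : ext C n) (I J : {set 'I_n}).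

Definition ext_real t : ext C n := [ffun I => (t I)%:C%C].

Lemma ext_complexE t u : ext_complex t u = ext_real t + 'i%C *: ext_real u.
Proof.
apply/ffunP => I; rewrite add_extE scale_extE !ffunE.
by apply/eqP; rewrite eq_complex/=; apply/andP; split; apply/eqP; ring.
Qed.

Lemma wedge_sign_real I J : wedge_sign C I J = (wedge_sign R I J)%:C%C.
Proof. by rewrite /wedge_sign rmorphXn/= rmorphN1. Qed.

Lemma hat_sign_real k : hat_sign C k = (hat_sign R k)%:C%C.
Proof. by rewrite /hat_sign rmorphXn/= rmorphN1. Qed.

Lemma mukai_real t u : mukai (ext_real t) (ext_real u) = (mukai t u)%:C%C.
Proof.
rewrite !mukaiE rmorph_sum/=; apply: eq_bigr => J _.
by rewrite !rmorphM/= wedge_sign_real hat_sign_real !ffunE.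
Qed.

Lemma mukai_complex t u t' u' : mukai (ext_complex t u) (ext_complex t' u') =
  ((mukai t t' - mukai u u') +i* (mukai t u' + mukai u t'))%C.
Proof.
rewrite !ext_complexE mukaiDl !mukaiDr !mukaiZl !mukaiZr !mukai_real.
by apply/eqP; rewrite eq_complex/=; apply/andP; split; apply/eqP; ring.
Qed.

Lemma ext_conj_complex t u : ext_conj (ext_complex t u) = ext_complex t (- u).
Proof. by apply/ffunP => I; rewrite !ffunE. Qed.

Definition vec_real (v : 'rV[R]_n * 'rV[R]_n) : 'rV[C]_n * 'rV[C]_n :=
  (map_mx (real_complex R) v.1, map_mx (real_complex R) v.2).

Lemma edot_real v w : edot (vec_real v) (vec_real w) = (edot v w)%:C%C.
Proof.
rewrite /edot rmorphM/= fmorphV/= rmorphMn/= rmorph1; congr (_ * _).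
by rewrite rmorph_sum/=; apply: eq_bigr => i _; rewrite !mxE rmorphD !rmorphM.
Qed.

Lemma clifford_real v t : clifford (vec_real v) (ext_real t) = ext_real (clifford v t).
Proof.
apply/ffunP => I; rewrite !cliffordE [RHS]ffunE !sum_ffunE rmorph_sum/=; apply: eq_bigr => i _.
rewrite !(add_extE, opp_extE, scale_extE) !epsE !ffunE !mxE rmorphB !rmorphM/=.
by case: ifP; rewrite ?wedge_sign_real ?rmorphM ?rmorph0 ?ffunE.
Qed.

Lemma clifford_complex v t u :
  clifford (vec_real v) (ext_complex t u) = ext_complex (clifford v t) (clifford v u).
Proof. by rewrite !ext_complexE cliffordD cliffordZ !clifford_real. Qed.

End ComplexForms.

(** * Reflections and their action on pure spinors *)

Section Reflections.
Variables (K : numFieldType) (n : nat).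
Local Notation vec := ('rV[K]_n * 'rV[K]_n)%type.
Implicit Types (y z : vec) (rho : ext K n).
Variable x : vec.

(** The map by which a unit vector x acts on other vectors: y . x . rho = - x . (r y) . rho. It is
    an involutive isometry. *)
Definition reflection y : vec := y + (- (2 * edot x y)) *: x.

Fact reflection_is_linear : linear reflection.
Proof.
move=> a y z; rewrite /reflection edotDr edotZr (_ : - _ = a * - (2 * edot x y) - 2 * edot x z); last by ring.
by rewrite scalerDl scalerDr scalerA addrACA.
Qed.
HB.instance Definition _ := GRing.isLinear.Build K vec vec _ reflection reflection_is_linear.

Hypothesis x1 : edot x x = 1.

Lemma reflectionK y : reflection (reflection y) = y.
Proof.
have e : edot x (reflection y) = - edot x y by rewrite /reflection edotDr edotZr x1; ring.
by rewrite {1}/reflection e mulrN opprK /reflection scaleNr subrK.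
Qed.

Lemma edot_reflection y z : edot (reflection y) (reflection z) = edot y z.
Proof. by rewrite /reflection !edotDl !edotDr !edotZl !edotZr x1 (edotC y x); ring. Qed.

Lemma clifford_reflection y rho :
  clifford y (clifford x rho) = - clifford x (clifford (reflection y) rho).
Proof.
rewrite /reflection cliffordDl cliffordZl cliffordD cliffordZ clifford_sqr x1 scaleN1r scaleNr scalerN opprK.
have := clifford_anticomm y x rho; rewrite (edotC y x) scaleNr => E.
by rewrite opprD -E addrC addrK.
Qed.

Lemma mukai_clifford_unit rho sigma : ~~ odd n ->
  mukai (clifford x rho) (clifford x sigma) = - mukai rho sigma.
Proof. by move=> n_even; rewrite mukai_clifford// clifford_sqr x1 mukaiZr mulN1r. Qed.

Lemma clifford_opp y rho : clifford y (- rho) = - clifford y rho.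
Proof. by rewrite -(scaleN1r rho) cliffordZ scaleN1r. Qed.

(** With c = i and real rho and sigma this expands a complex form in the real basis dx_J, i dx_J;
    its coefficients can be differentiated as real functions. *)
Lemma ext_basis_pair (c : K) rho sigma : rho + c *: sigma =
  \sum_(k : bool * {set 'I_n}) (if k.1 then sigma k.2 else rho k.2) *:
    (if k.1 then c *: dx K k.2 else dx K k.2).
Proof.
rewrite -(pair_bigA _ (fun (b : bool) J => (if b then sigma J else rho J) *: (if b then c *: dx K J else dx K J)))/=.
rewrite big_bool/= addrC {1}[sigma]ext_basis {1}[rho]ext_basis scaler_sumr; congr (_ + _).
by apply: eq_bigr => J _; rewrite !scalerA mulrC.
Qed.

Lemma clifford_unit_inj rho : clifford x rho = 0 -> rho = 0.
Proof.
move=> h; have := clifford_sqr x rho; rewrite h clifford0 x1 scaleN1r => /esym/eqP.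
by rewrite oppr_eq0 => /eqP.
Qed.

End Reflections.

Section PureSpinorOrbits.
Variables (R : realType) (n : nat).
Local Notation C := R[i].
Local Notation vec := ('rV[C]_n * 'rV[C]_n)%type.
Implicit Types (y z : vec) (L : {vspace vec}) (rho : ext C n).
Variable x : vec.
Hypothesis x1 : edot x x = 1.

(** The annihilator of x . rho is the reflected annihilator of rho, and an isometry preserves
    maximal isotropy. *)
Lemma pure_clifford rho : pure rho -> pure (clifford x rho).
Proof.
move=> [L Lrho [Liso Lmax]]; pose f := linfun (reflection x).
have fE y : f y = reflection x y by rewrite lfunE.
have fK y : f (f y) = y by rewrite !fE (reflectionK x1).
exists (f @^-1: L)%VS.
  move=> y; rewrite -memv_preim fE; split=> [/Lrho h|h].
    by rewrite (clifford_reflection x1) h clifford0 oppr0.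
  apply/Lrho; apply: (clifford_unit_inj x1); have := clifford_reflection x1 y rho.
  by rewrite h => /esym/eqP; rewrite oppr_eq0 => /eqP.
have iso_preim L' : isotropic L' -> isotropic (f @^-1: L')%VS.
  by move=> h y z; rewrite -!memv_preim => /h hy /hy; rewrite !fE (edot_reflection x1).
split; first exact: iso_preim.
move=> L' L'iso LL'.
have E : (f @^-1: L' = L)%VS.
  apply: Lmax; first exact: iso_preim.
  by apply/subvP => y yL; rewrite -memv_preim; apply: (subvP LL'); rewrite -memv_preim fK.
by apply/vspaceP => y; rewrite -E -!memv_preim fK.
Qed.

End PureSpinorOrbits.

Section StableOrbits.
Variables (R : realType) (n : nat).
Hypothesis n_even : ~~ odd n.
Local Notation C := R[i].
Implicit Types (t u : ext R n).

Lemma nondegenerate_pure_clifford (v : 'rV[R]_n * 'rV[R]_n) t u : edot v v = 1 ->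
  nondegenerate_pure (ext_complex t u) ->
  nondegenerate_pure (ext_complex (clifford v t) (clifford v u)).
Proof.
move=> v1 [pu nd]; have w1 : edot (vec_real v) (vec_real v) = 1 by rewrite edot_real v1.
rewrite -clifford_complex; split; first exact: pure_clifford.
have E : ext_conj (clifford (vec_real v) (ext_complex t u)) = clifford (vec_real v) (ext_conj (ext_complex t u)).
  rewrite clifford_complex !ext_conj_complex clifford_complex; congr ext_complex.
  by rewrite clifford_opp.
by rewrite E (mukai_clifford_unit w1)// oppr_eq0.
Qed.

Lemma stable_spin_op g t : spin_op g -> stable t -> stable (g t).
Proof.
move=> [s /andP[s1 _] <-] [u tu]; exists (spin_act s u).
elim: s s1 => [_|v s IH /andP[/eqP v1 /IH h]]; first exact: tu.
exact: nondegenerate_pure_clifford v1 h.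
Qed.

Hypotheses (n2 : (2 < n)%N) (n_skew : odd 'C(n.+1, 2)).

Lemma pure_large_annihilator (rho : ext C n) : pure rho -> large_annihilator rho.
Proof.
move=> [L Lrho [Liso Lmax]]; exists L; first by move=> v /Lrho.
by apply: maximally_isotropic_dim => // L' h; exact: Lmax.
Qed.

Let basis_form (k : bool * {set 'I_n}) : ext C n := if k.1 then 'i%C *: dx C k.2 else dx C k.2.

Let ext_complex_basis t u : ext_complex t u =
  \sum_k ((if k.1 then u k.2 else t k.2)%:C)%C *: basis_form k.
Proof.
rewrite ext_complexE ext_basis_pair; apply: eq_bigr => k _; rewrite /basis_form; congr (_ *: _).
by case: k.1; rewrite /ext_real ffunE.
Qed.

(** The imaginary part of <rho_0, rho_s - rho_0> is [G s]. By purity it equals a quadratic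
    expression [F s] in the increments of the real coordinates, which has zero derivative at s =
    0. *)
Lemma pure_family_derivative (t u : R -> ext R n) (dt du : ext R n) :
  (forall I, is_derive (0 : R) 1 (fun s => t s I) (dt I)) ->
  (forall I, is_derive (0 : R) 1 (fun s => u s I) (du I)) ->
  (\forall s \near (0 : R), pure (ext_complex (t s) (u s))) ->
  mukai (t 0) du + mukai (u 0) dt = 0.
Proof.
move=> tD uD pu; have pu0 := nbhs_singleton pu.
have [v [w vw]] := pure_second_order n2 n_even n_skew (pure_large_annihilator pu0).
pose al (k : bool * {set 'I_n}) s := if k.1 then u s k.2 - u 0 k.2 else t s k.2 - t 0 k.2.
pose dal (k : bool * {set 'I_n}) := if k.1 then du k.2 else dt k.2.
pose q (k l : bool * {set 'I_n}) : R := complex.Im (mukai (basis_form k) (clifford v (clifford w (basis_form l)))).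
pose F s := \sum_k \sum_l (al k s * al l s) * q k l.
have alD k : is_derive (0 : R) 1 (al k) (dal k).
  have cst (a : R) : is_derive (0 : R) (1 : R) (fun=> a) 0 by exact: is_derive_cst.
  by rewrite /al /dal; case: k => -[] J /=; rewrite -[X in is_derive _ _ _ X]subr0; exact: is_deriveB.
have al0 k : al k 0 = 0 by rewrite /al; case: k.1; rewrite subrr.
have FD : is_derive (0 : R) 1 F 0.
  have : is_derive (0 : R) 1 F (\sum_(k : bool * {set 'I_n}) \sum_(l : bool * {set 'I_n}) 0).
    rewrite /F; apply: is_derive_suml => k _; apply: is_derive_suml => l _.
    have := is_derive_mul (is_derive_mul (alD k) (alD l)) (is_derive_cst (q k l) (0 : R) 1).
    by rewrite !al0 mulr0 mul0r addr0 mul0r mulr0 addr0.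
  by rewrite big1// => k _; rewrite big1.
pose G s := mukai (t 0) (u s - u 0) + mukai (u 0) (t s - t 0).
have GD : is_derive (0 : R) 1 G (mukai (t 0) du + mukai (u 0) dt).
  have D (a : ext R n) (b : R -> ext R n) (db : ext R n) : (forall I, is_derive (0 : R) 1 (fun s => b s I) (db I)) ->
      is_derive (0 : R) 1 (fun s => mukai a (b s - b 0)) (mukai a db).
    move=> bD; rewrite mukaiE (_ : (fun s => _) = fun s => \sum_J a J * (b s (~: J)%SET - b 0 (~: J)%SET) *
      (wedge_sign R J (~: J) * hat_sign R #|~: J|)); last first.
      by apply/funext => s; rewrite mukaiE; apply: eq_bigr => J _; rewrite add_extE opp_extE.
    apply: is_derive_suml => J _; set c := _ * hat_sign _ _.
    have h : is_derive (0 : R) 1 (fun s => b s (~: J)%SET - b 0 (~: J)%SET) (db (~: J)%SET).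
      by rewrite -[X in is_derive _ _ _ X]subr0; apply: is_deriveB; exact: is_derive_cst.
    have := is_derive_mul (is_derive_mul (is_derive_cst (a J) (0 : R) 1) h) (is_derive_cst c (0 : R) 1).
    by rewrite mul0r add0r mulr0 addr0.
  exact: is_deriveD (D _ _ _ uD) (D _ _ _ tD).
have FG : \forall s \near (0 : R), F s = G s.
  apply: filterS pu => s pus.
  have E := vw _ (pure_large_annihilator pus).
  have dE : ext_complex (t s) (u s) - ext_complex (t 0) (u 0) = ext_complex (t s - t 0) (u s - u 0).
    apply/ffunP => I; rewrite !ffunE; apply/eqP; rewrite eq_complex/=; by rewrite !eqxx.
  have := congr1 (@complex.Im R) E; rewrite dE mukai_complex/= -/(G s) => ->.
  have ImD (a b : C) : complex.Im (a + b) = complex.Im a + complex.Im b by case: a => ? ?; case: b.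
  have ImZ (r : R) (a : C) : complex.Im (r%:C%C * a) = r * complex.Im a.
    by case: a => ? ? /=; rewrite mul0r addr0.
  have Im_sum (T : finType) (h : T -> C) : complex.Im (\sum_k h k) = \sum_k complex.Im (h k).
    by elim/big_rec2: _ => // k a b _ <-.
  rewrite {1}ext_complex_basis mukai_suml Im_sum; apply: eq_bigr => k _.
  rewrite mukaiZl ext_complex_basis !clifford_sum mukai_sumr mulr_sumr Im_sum; apply: eq_bigr => l _.
  rewrite !cliffordZ mukaiZr mulrA -rmorphM ImZ; congr (_ * _ * _).
  - by rewrite /al; case: k.1; rewrite add_extE opp_extE.
  - by rewrite /al; case: l.1; rewrite add_extE opp_extE.
have := near_eq_is_derive FG FD => GD0.
by have [_ e1] := GD; have [_ e2] := GD0; rewrite -e1 e2.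
Qed.

End StableOrbits.

(** * Spinor fields *)

Section SpinorFields.
Variables (R : realType) (n : nat) (M : topologicalType) (A : oriented_atlas R n M).
Hypotheses (n2 : (2 < n)%N) (n_even : ~~ odd n).
Let i0 : 'I_n := Ordinal (leq_ltn_trans (leq0n 2) n2).
Local Notation img := (@chart_img R n M A).
Local Notation dom := (@chart_dom R n M A).
Local Notation psi := (@chart_inv R n M A).
Implicit Types (a b : chart_idx A) (x y : 'rV[R]_n) (e : bool) (rho sigma w : field A (ext R n)) (k : nat).
Variables (nu : field A R) (H B : field A (ext R n)).
Hypotheses (nu_nz : nowhere_vanishing_multivector nu) (H_form : is_form 3 H) (B_potentials : local_potentials H B).

Let io a : open (img a). Proof. exact: img_open. Qed.

Let B_Ck a k : form_Ck k (img a) (B a).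
Proof. by move=> I; have [BS _ _] := B_potentials; have /smooth_onP[_] := BS a I. Qed.

Let B2 a x : img a x -> homogeneous 2%N (B a x).
Proof. by have [_ h _] := B_potentials; exact: h. Qed.

Let homogeneousN (w : ext R n) : homogeneous 2%N w -> homogeneous 2%N (- w).
Proof. by move=> h; rewrite -scaleN1r; exact: homogeneousZ. Qed.

Let nu_neq0 a x : img a x -> nu a x != 0.
Proof. by have [_ h _] := nu_nz; exact: h. Qed.

Let s a x := Num.sqrt `|nu a x|.

Let s_gt0 a x : img a x -> 0 < s a x.
Proof. by move=> ix; rewrite sqrtr_gt0 normr_gt0 nu_neq0. Qed.

Let s_Ck a k : Ck k (img a) (s a).
Proof.
have nC : Ck k (img a) (nu a) by have [h _ _] := nu_nz; have /smooth_onP[_] := h a.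
apply: (Ck_sqrt (@io a)) => [x ix|]; first by rewrite normr_gt0 nu_neq0.
apply: (@Ck_ext _ _ _ _ (fun x => Num.sqrt (nu a x * nu a x))); first exact: io.
  by move=> x _; rewrite -expr2 sqrtr_sqr.
apply: (Ck_sqrt (@io a)) => [x ix|]; last exact: (Ck_mul (@io a) nC nC).
by rewrite -expr2 exprn_even_gt0//= nu_neq0.
Qed.

(** This factor cancels the det^(-1/2) in the spin lift, so rescaling by sqrt|nu| turns spinor
    fields into genuine forms. *)
Let s_transition a b x : overlap a b x ->
  s b (transition a b x) = Num.sqrt (\det (jac (transition a b) x)) * s a x.
Proof.
move=> ab; have [_ _ h] := nu_nz; rewrite /s h// normrM gtr0_norm ?det_transition//.
by rewrite sqrtrM// ltW// det_transition.
Qed.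

Lemma form_Ck_expact k U (v w : 'rV[R]_n -> ext R n) : open U -> form_Ck k U v -> form_Ck k U w ->
  form_Ck k U (fun x => expact (v x) (w x)).
Proof.
move=> Uo vC wC.
apply: (@form_Ck_ext _ _ _ _ (fun x => \sum_(j < n.+1) (j`!%:R)^-1 *: iter j (wedge (v x)) (w x))) => //.
  by move=> x _; rewrite expactE.
apply: form_Ck_sum => // j _; apply: form_Ck_scale => //; first exact: Ck_cst.
elim: (val j) => [|l IH] //=; exact: form_Ck_wedge.
Qed.

Let shift a b x := B a x - pull (jac (transition a b) x) (B b (transition a b x)).

Let shift2 a b x : overlap a b x -> homogeneous 2%N (shift a b x).
Proof.
move=> ab; apply: homogeneousD; first exact/B2/(overlap_img ab).
by apply: homogeneousN; apply: homogeneous_pull; apply/B2/transition_img.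
Qed.

Let pullN J (w : ext R n) : pull J (- w) = - pull J w.
Proof. by rewrite -(scaleN1r w) pullZ scaleN1r. Qed.

(** Twisting by -B_a undoes the shift B_a - J^* B_b of the transition and leaves the pullback of the
    twist by -B_b. *)
Lemma polyform_to_form e rho : is_spinor_field B e rho -> polyform (to_form B nu rho).
Proof.
move=> [rS _ rT]; split=> [a k|a b x ab].
  apply: (form_Ck_scale (@io a)); first by apply: (Ck_inv (@io a)) (s_Ck a k) => x ix; rewrite gt_eqF ?s_gt0.
  apply: (form_Ck_expact (@io a)); last by move=> I; have /smooth_onP[_] := rS a I.
  apply: (@form_Ck_linear R n k (img a) (fun u => - u) (B a) (@io a)); last exact: B_Ck.
  by move=> c u u'; rewrite opprD scalerN.
set J := jac (transition a b) x; set y := transition a b x.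
have iy : img b y by exact: transition_img.
have ix := overlap_img ab.
rewrite /to_form -!/(s _ _) (rT a b)// /spin_transition -/J -/y expactZ scalerA pullZ s_transition// -/J invfM mulrC.
congr (_ *: _); rewrite pull_expact pullN -expactD; [|exact/homogeneousN/B2|exact: shift2].
by rewrite addrA addNr add0r.
Qed.

Lemma chiral_to_form e rho a x : is_spinor_field B e rho -> img a x -> chiral e (to_form B nu rho a x).
Proof.
move=> [_ rc _] ix; apply: chiralZ; apply: chiral_expact => //; last exact: rc.
exact/homogeneousN/B2.
Qed.

Lemma spinor_of_form e w : polyform w -> (forall a x, img a x -> chiral e (w a x)) ->
  is_spinor_field B e (of_form B nu w).
Proof.
move=> [wS wT] wc; split=> [a I|a x ix|a b x ab].
- apply/smooth_onP; split; first exact: io.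
  move=> k; apply: (form_Ck_scale (@io a) (s_Ck a k) _ I); exact: (form_Ck_expact (@io a) (@B_Ck a k) (wS a k)).
- by apply: chiralZ; apply: chiral_expact => //; [exact: B2|exact: wc].
have iy : img b (transition a b x) by exact: transition_img.
have ix := overlap_img ab.
rewrite /of_form -!/(s _ _) /spin_transition (wT a b)// pullZ expactZ scalerA s_transition//.
rewrite mulrA mulVf ?mul1r; last by rewrite sqrtr_eq0 -ltNge det_transition.
congr (_ *: _); rewrite pull_expact -expactD; first by rewrite subrK.
  exact: shift2.
exact/homogeneous_pull/B2.
Qed.

Lemma of_formK w a x : img a x -> to_form B nu (of_form B nu w) a x = w a x.
Proof.
move=> ix; rewrite /of_form /to_form -!/(s _ _) expactZ scalerA mulVf ?scale1r ?gt_eqF ?s_gt0//.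
by rewrite expactK//; exact: B2.
Qed.

Lemma to_form_d_nu rho a x : img a x -> to_form B nu (d_nu H B nu rho) a x = twisted_d H (to_form B nu rho) a x.
Proof. exact: of_formK. Qed.

Lemma spinor_d_nu e rho : is_spinor_field B e rho -> is_spinor_field B (~~ e) (d_nu H B nu rho).
Proof.
move=> rS; have rP := polyform_to_form rS; apply: spinor_of_form; first exact: (polyform_twisted_d i0 H_form).
move=> a x ix; apply: (chiral_twisted_d H_form) => //; first by case: rP => h _; exact: h.
by move=> y iy; exact: chiral_to_form.
Qed.

Lemma to_form_lin rho sigma (t : R) a x : to_form B nu (fun a x => rho a x + t *: sigma a x) a x =
  to_form B nu rho a x + t *: to_form B nu sigma a x.
Proof. by rewrite /to_form expactDr expactZ scalerDr !scalerA mulrC. Qed.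

Lemma spinor_lin e rho sigma (t : R) : is_spinor_field B e rho -> is_spinor_field B e sigma ->
  is_spinor_field B e (fun a x => rho a x + t *: sigma a x).
Proof.
move=> [rS rc rT] [sS sc sT]; split=> [a I|a x ix|a b x ab].
- apply/smooth_onP; split; first exact: io.
  move=> k; apply: (@form_Ck_add R n k (img a) (rho a) (fun x => t *: sigma a x) (@io a) _ _ I).
    by move=> J; have /smooth_onP[_] := rS a J.
  apply: (form_Ck_scale (@io a)); first exact: Ck_cst.
  by move=> J; have /smooth_onP[_] := sS a J.
- by apply: chiralD; [exact: rc|apply: chiralZ; exact: sc].
rewrite (rT a b)// (sT a b)// /spin_transition pullD pullZ expactDr expactZ scalerDr.
by congr (_ + _); rewrite !scalerA mulrC.
Qed.

(** The factor nu of the pairing cancels the inverse in the dual volume form, sign included. *)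
Lemma C_functionalE rho sigma : C_functional B nu rho sigma =
  density_integral (fun a x => mukai (to_form B nu rho a x) (to_form B nu sigma a x)).
Proof.
apply: form_integral_ext => a x ix; rewrite !scale_extE !ffunE eqxx mul1r mulr1 /pairing mulrC mulrA mulVf ?mul1r//.
exact: nu_neq0.
Qed.

Lemma mukai_to_form rho sigma a x : img a x ->
  mukai (to_form B nu rho a x) (to_form B nu sigma a x) = `|nu a x|^-1 * mukai (rho a x) (sigma a x).
Proof.
move=> ix; rewrite /to_form mukaiZl mukaiZr mulrA -invfM -expr2 sqr_sqrtr// mukai_expact//.
exact/homogeneousN/B2.
Qed.

Lemma spin_op_transition a b x : overlap a b x -> spin_op (spin_transition B a b x).
Proof.
move=> ab; have h1 := spin_op_expact n2 (shift2 ab); have h2 := spin_op_pull n2 (det_transition ab).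
apply: spin_op_ext (spin_op_comp h1 h2) => t.
by rewrite /= expactZ.
Qed.

Variables (eps : bool) (dag : ext R n -> ext R n).
Hypothesis dag_choice : dagger_choice eps dag.

Lemma dag_spin_op g t : spin_op g -> chiral eps t -> stable t -> dag (g t) = g (dag t).
Proof.
move=> [u u1 uE] ct st; have [_ h _] := dag_choice.
by rewrite -!uE h//; exact: unit_product_spin_plus.
Qed.

Lemma pull_scalar (c : R) (w : ext R n) I : pull c%:M w I = c ^+ #|I| * w I.
Proof.
have E J : ordered_prod (row_covector c%:M) J = c ^+ #|J| *: dx R J.
  rewrite -[dx R J]ordered_prod_dx !ordered_prod_enum cardE.
  elim: (enum J) => [|i r IH]; first by rewrite !big_nil expr0 scale1r.
  rewrite !big_cons IH /= exprS -scalerA wedgeZr.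
  have -> : row_covector c%:M i = c *: dx R [set i].
    rewrite /row_covector covectorE (bigD1 i)//= big1 => [|j ji]; rewrite !mxE ?eqxx ?mulr1n ?addr0//.
    by rewrite eq_sym (negPf ji) mulr0n scale0r.
  by rewrite wedgeZl scalerA mulrC -scalerA.
rewrite pullE sum_ffunE (bigD1 I)//= big1 => [|J JI]; rewrite E !scale_extE ffunE.
  by rewrite eqxx mulr1 addr0 mulrC.
by rewrite eq_sym (negPf JI) !mulr0.
Qed.

(* equivariance under -1 in GL_+(n) and under -1 in Spin *)
Lemma chiral_dag t : chiral eps t -> stable t -> chiral eps (dag t).
Proof.
move=> ct st; have d1 : \det ((-1)%:M : 'M[R]_n) = 1.
  by rewrite det_scalar -signr_odd (negPf n_even).
have g1 : spin_op (fun w : ext R n => pull (-1)%:M w).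
  have := @spin_op_pull R n (-1)%:M n2; rewrite d1 ltr01 => /(_ isT).
  by apply: spin_op_ext => w; rewrite sqrtr1 invr1 scale1r.
have g2 : spin_op (fun w : ext R n => (-1) ^+ eps *: w).
  case: eps; last by apply: spin_op_ext (spin_op_id R n) => w; rewrite scale1r.
  by apply: spin_op_ext (spin_op_opp R (ltnW (ltnW n2))) => w; rewrite expr1 scaleN1r.
have pt : pull (-1)%:M t = (-1) ^+ eps *: t.
  apply/ffunP => I; rewrite pull_scalar scale_extE -[(-1) ^+ #|I|]signr_odd.
  by have [->//|/ct ->] := eqVneq (odd #|I|) eps; rewrite !mulr0.
have := dag_spin_op g1 ct st; rewrite pt (dag_spin_op g2 ct st) => /ffunP E I Ie.
have := E I; rewrite pull_scalar scale_extE -[(-1) ^+ #|I|]signr_odd => /eqP.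
have -> : odd #|I| = ~~ eps by move: Ie; case: odd; case: eps.
by rewrite signrN mulNr -subr_eq0 opprK -mulrDl mulf_eq0 -mulr2n mulrn_eq0 signr_eq0/= => /eqP.
Qed.

(** Coordinates in which [dagger_choice] states the smoothness of the dagger; composition with C^k
    maps then applies to it. *)
Definition row_of_form (w : ext R n) : 'rV[R]_#|{set 'I_n}| := \row_k w (enum_val k).

Lemma row_of_formK (w : ext R n) : chiral eps w ->
  chiral_part eps [ffun J => row_of_form w ord0 (enum_rank J)] = w.
Proof.
move=> wc; apply/ffunP => I; rewrite !ffunE; case: eqP => [_|/eqP/wc->//].
by rewrite mxE enum_rankK.
Qed.

Definition stable_rows : set 'rV[R]_#|{set 'I_n}| :=
  [set v | stable (chiral_part eps [ffun J => v ord0 (enum_rank J)])].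

Definition dag_row (v : 'rV[R]_#|{set 'I_n}|) : ext R n :=
  dag (chiral_part eps [ffun J => v ord0 (enum_rank J)]).

Lemma stable_rows_open : open stable_rows.
Proof. by have [_ _ h] := dag_choice; have [] := h finset.set0. Qed.

Lemma dag_row_Ck I k : Ck k stable_rows (fun v => dag_row v I).
Proof. by have [_ _ h] := dag_choice; have /smooth_onP[_] := h I. Qed.

Lemma spinor_dagger rho : is_spinor_field B eps rho -> stable_field rho ->
  is_spinor_field B eps (dagger dag rho).
Proof.
move=> [rS rc rT] rst; split=> [a I|a x ix|a b x ab].
- apply/smooth_onP; split; first exact: io.
  move=> k; apply: (@Ck_ext _ _ _ _ ((fun v => dag_row v I) \o (fun x => row_of_form (rho a x)))).
  + exact: io.
  + by move=> x ix; rewrite /= /dag_row row_of_formK//; exact: rc.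
  apply: (@Ck_comp R n _ k (img a) stable_rows).
  + exact: io.
  + exact: stable_rows_open.
  + by move=> x ix; rewrite /stable_rows/= row_of_formK; [exact: rst|exact: rc].
  + move=> j; apply: (@Ck_ext _ _ _ _ (fun x => rho a x (enum_val j))); first exact: io.
      by move=> x _; rewrite mxE.
    by have /smooth_onP[_] := rS a (enum_val j).
  + exact: dag_row_Ck.
- by apply: chiral_dag; [exact: rc|exact: rst].
have iy : img b (transition a b x) by exact: transition_img.
rewrite /dagger (rT a b)//; apply: dag_spin_op; first exact: spin_op_transition.
  exact: rc.
exact: rst.
Qed.

Lemma stable_transition rho a b x : is_spinor_field B eps rho -> overlap a b x ->
  stable (rho b (transition a b x)) -> stable (rho a x).
Proof.
move=> [_ _ rT] ab st; rewrite (rT a b x ab).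
exact: (stable_spin_op n_even (spin_op_transition ab) st).
Qed.

End SpinorFields.

(** * First variations *)

Section ContinuityAt.
Variables (R : realType) (T : topologicalType) (x : T).
Implicit Types f g : T -> R.

Lemma continuous_add_at f g : {for x, continuous f} -> {for x, continuous g} ->
  {for x, continuous (fun y => f y + g y)}.
Proof. by move=> cf cg; exact: (cvgD cf cg). Qed.

Lemma continuous_mul_at f g : {for x, continuous f} -> {for x, continuous g} ->
  {for x, continuous (fun y => f y * g y)}.
Proof. by move=> cf cg; exact: (cvgM cf cg). Qed.

Lemma continuous_sum_at (J : Type) (r : seq J) (f : J -> T -> R) : (forall j, {for x, continuous (f j)}) ->
  {for x, continuous (fun y => \sum_(j <- r) f j y)}.
Proof.
move=> fc; elim: r => [|j r IH].
  by rewrite (_ : (fun y => _) = fun=> 0); [exact: cvg_cst|apply/funext => y; rewrite big_nil].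
rewrite (_ : (fun y => _) = fun y => f j y + \sum_(i <- r) f i y); first exact: continuous_add_at.
by apply/funext => y; rewrite big_cons.
Qed.

End ContinuityAt.

Lemma is_derive_affine (R : realType) (a b t : R) : is_derive t (1 : R) (fun s => a + s * b) b.
Proof.
apply/is_derive1P => e e0; near=> h; rewrite (_ : _ - _ = 0) ?normr0 ?mulr_ge0// 1?ltW//; ring.
Unshelve. all: by end_near. Qed.

Section Variation.
Variables (R : realType) (n : nat) (M : topologicalType) (A : oriented_atlas R n M).
Hypotheses (M_hausdorff : hausdorff_space M) (M_compact : compact [set: M]).
Hypotheses (n2 : (2 < n)%N) (n_even : ~~ odd n) (n_skew : odd 'C(n.+1, 2)).
Let i0 : 'I_n := Ordinal (leq_ltn_trans (leq0n 2) n2).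
Local Notation II := (@iterated_integral R n).
Local Notation img := (@chart_img R n M A).
Local Notation dom := (@chart_dom R n M A).
Local Notation phi := (@chart R n M A).
Local Notation psi := (@chart_inv R n M A).
Implicit Types (a b : chart_idx A) (p q : M) (x y : 'rV[R]_n).
Variables (nu : field A R) (H B : field A (ext R n)).
Hypotheses (nu_nz : nowhere_vanishing_multivector nu) (H_form : is_form 3 H) (B_potentials : local_potentials H B).
Variables (eps : bool) (dag : ext R n -> ext R n).
Hypothesis dag_choice : dagger_choice eps dag.
Variables (tau theta : field A (ext R n)).
Hypotheses (tau_spinor : is_spinor_field B eps tau) (theta_spinor : is_spinor_field B eps theta).
Hypothesis tau_stable : stable_field tau.

Let io a : open (img a). Proof. exact: img_open. Qed.

Let line (t : R) : field A (ext R n) := fun a x => tau a x + t *: theta a x.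

Let line_spinor t : is_spinor_field B eps (line t).
Proof. exact: spinor_lin. Qed.

Let line0 : line 0 = tau.
Proof. by apply/funext => a; apply/funext => x; rewrite /line scale0r addr0. Qed.

Let tau_C a I : Ck 1 (img a) (fun x => tau a x I).
Proof. by case: tau_spinor => h _ _; have /smooth_onP[_] := h a I. Qed.

Let theta_C a I : Ck 1 (img a) (fun x => theta a x I).
Proof. by case: theta_spinor => h _ _; have /smooth_onP[_] := h a I. Qed.

Let continuous_line a x (t : R) : img a x ->
  {for (t, x), continuous (fun z : R * 'rV[R]_n => row_of_form (line z.1 a z.2))}.
Proof.
move=> ix; apply: continuous_at_row => j.
rewrite (_ : (fun z => _) = fun z : R * 'rV[R]_n =>
  tau a z.2 (enum_val j) + z.1 * theta a z.2 (enum_val j)); last first.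
  by apply/funext => z; rewrite mxE add_extE scale_extE.
have c (f : 'rV[R]_n -> R) : {for x, continuous f} -> {for (t, x), continuous (fun z : R * 'rV[R]_n => f z.2)}.
  by move=> cf; apply: (@continuous_comp _ _ _ snd f); [exact: cvg_snd|exact: cf].
have h1 := c _ (Ck_continuous (tau_C a (enum_val j)) ix).
have h2 := c _ (Ck_continuous (theta_C a (enum_val j)) ix).
have h3 : {for (t, x), continuous (fun z : R * 'rV[R]_n => z.1)} by exact: cvg_fst.
exact: (continuous_add_at h1 (continuous_mul_at h3 h2)).
Qed.

Let stable_rowsP t a x : img a x -> stable_rows eps (row_of_form (line t a x)) <-> stable (line t a x).
Proof.
by move=> ix; rewrite /stable_rows/= row_of_formK//; case: (line_spinor t) => _ h _; exact: h.
Qed.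

(** Stability is open in the fibre, so near each point it persists for small t in one chart.
    Transition functions carry it to the other charts, and compactness of M makes the range of t
    uniform. *)
Lemma stable_line : \forall t \near (0 : R), stable_field (line t).
Proof.
pose P (t : R) q := forall a, dom a q -> stable (line t a (phi a q)).
have : \forall t \near (0 : R), [set: M] `<=` P t.
  have /compact_near_coveringP Mc := M_compact.
  apply: (Mc R (nbhs (0 : R)) P) => p _; have [a da] := @chart_cover _ _ _ A p.
  have ix := img_chart da.
  have c : {for (p, 0 : R), continuous (fun z : M * R => row_of_form (line z.2 a (phi a z.1)))}.
    apply: (@continuous_comp _ _ _ (fun z : M * R => (z.2, phi a z.1))
      (fun z : R * 'rV[R]_n => row_of_form (line z.1 a z.2))); last exact: continuous_line.
    apply: continuous_pair; first exact: cvg_snd.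
    by apply: (@continuous_comp _ _ _ fst (phi a)); [exact: cvg_fst|exact: chart_continuous_at].
  have so : nbhs (row_of_form (line 0 a (phi a p))) (stable_rows eps).
    apply: open_nbhs_nbhs; split; first exact: (stable_rows_open dag_choice).
    by apply/stable_rowsP => //; rewrite line0; exact: tau_stable.
  have near_dom : \forall z \near (p, 0 : R), dom a z.1.
    exists (dom a, setT); last by case=> q t [].
    by split; [exact: open_nbhs_nbhs (conj (chart_dom_open a) da)|exact: filterT].
  have := c _ so; rewrite /nbhs/= => cs.
  apply: filterS2 near_dom cs => -[q t] /= dq /stable_rowsP sq b db.
  have ab : overlap b a (phi b q) by exists q.
  apply: (stable_transition n2 n_even B_potentials (line_spinor t) ab).
  by rewrite /transition/= chartK//; apply: sq; exact: img_chart.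
apply: filterS => t h a x [q dq <-]; exact: h.
Qed.

Let dag_line_spinor t : stable_field (line t) -> is_spinor_field B eps (dagger dag (line t)).
Proof. by apply: (spinor_dagger n2 n_even B_potentials dag_choice). Qed.

(** The derivative has two terms, one from the dagger and one from the line itself; purity of the
    family and skewness of the pairing make them equal. It is computed at every t with a stable
    line, as differentiation under the integral needs a neighbourhood of 0. *)
Let dag_line_derivative t a x : stable_field (line t) -> img a x ->
  is_derive t (1 : R) (fun s => mukai (dag (line s a x)) (line s a x)) (2 * mukai (dag (line t a x)) (theta a x)).
Proof.
move=> st ix; apply/is_derive_shift0.
have lc s : chiral eps (line s a x) by case: (line_spinor s) => _ h _; exact: h.
pose c s := row_of_form (line (t + s) a x).
have cE s : dag_row eps dag (c s) = dag (line (t + s) a x) by rewrite /dag_row row_of_formK.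
have so := stable_rows_open dag_choice.
have sc : stable_rows eps (c 0) by apply/stable_rowsP => //; rewrite addr0; exact: st.
have cD j : is_derive (0 : R) 1 (fun s => c s ord0 j) (row_of_form (theta a x) ord0 j).
  have := is_derive_coord (row_of_form (line t a x)) (row_of_form (theta a x)) j 0.
  congr is_derive; apply/funext => s.
  by rewrite /c !mxE !add_extE !scale_extE; ring.
pose dU : ext R n := [ffun I => gradient (fun v => dag_row eps dag v I) (c 0) (row_of_form (theta a x))].
have UD I : is_derive (0 : R) 1 (fun s => dag (line (t + s) a x) I) (dU I).
  have := is_derive_chain (Ck_C1_at so (dag_row_Ck dag_choice I 1) sc) cD.
  by rewrite ffunE; congr is_derive; apply/funext => s; rewrite /= cE.
have TD I : is_derive (0 : R) 1 (fun s => line (t + s) a x I) (theta a x I).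
  have := cD (enum_rank I); rewrite mxE enum_rankK.
  by congr is_derive; apply/funext => s; rewrite mxE enum_rankK.
have cc : {for (0 : R), continuous c}.
  apply: continuous_at_row => j; have [D _] := cD j.
  exact/differentiable_continuous/derivable1_diffP.
have pu : \forall s \near (0 : R), pure (ext_complex (line (t + s) a x) (dag (line (t + s) a x))).
  have cs : \forall s \near (0 : R), stable_rows eps (c s) by exact: (cc _ (open_nbhs_nbhs (conj so sc))).
  apply: filterS cs => s /stable_rowsP ss.
  by have [h _ _] := dag_choice; have [] := h _ (lc (t + s)) (ss ix).
have := pure_family_derivative n_even n2 n_skew TD UD pu; rewrite addr0 => E.
have mD : is_derive (0 : R) 1 (fun s => mukai (dag (line (t + s) a x)) (line (t + s) a x))
    (mukai dU (line t a x) + mukai (dag (line t a x)) (theta a x)).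
  rewrite !mukaiE -big_split/= (_ : (fun s => _) = fun s => \sum_J
    dag (line (t + s) a x) J * line (t + s) a x (~: J)%SET * (wedge_sign R J (~: J) * hat_sign R #|~: J|)).
    apply: is_derive_suml => J _; set k := _ * hat_sign _ _.
    have := is_derive_mul (is_derive_mul (UD J) (TD (~: J)%SET)) (is_derive_cst k (0 : R) 1).
    by rewrite addr0 mulr0 addr0 mulrDl.
  by apply/funext => s; rewrite mukaiE.
have E2 : mukai dU (line t a x) = mukai (dag (line t a x)) (theta a x).
  move: E; rewrite mukaiC -signr_odd n_skew expr1 mulN1r addrC => /eqP; rewrite subr_eq0 => /eqP ->//.
by rewrite mulr_natl mulr2n -{1}E2.
Qed.

Lemma V_variation : first_variation (V_functional B nu dag) tau theta
  (2 * C_functional B nu (dagger dag tau) theta).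
Proof.
have [N [c [chi pu]]] := exists_partition_of_unity i0 A M_hausdorff M_compact.
have [C HC] := partition_support pu.
pose u t : field A R := fun a x => mukai (to_form B nu (dagger dag (line t)) a x) (to_form B nu (line t) a x).
pose v t : field A R := fun a x => mukai (to_form B nu (dagger dag (line t)) a x) (to_form B nu theta a x).
have toP := polyform_to_form nu_nz B_potentials.
have uD t : stable_field (line t) -> density (u t).
  by move=> st; apply: density_mukai; [exact: toP (dag_line_spinor st)|exact: toP (line_spinor t)].
have vD t : stable_field (line t) -> density (v t).
  by move=> st; apply: density_mukai; [exact: toP (dag_line_spinor st)|exact: toP theta_spinor].
have st0 : stable_field (line 0) by rewrite line0.
have VE t : stable_field (line t) -> V_functional B nu dag (line t) =
    \sum_k chart_integral (c k) (fun a x => chi k (psi a x) * u t a x).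
  move=> st; rewrite -(density_integralE i0 M_hausdorff M_compact pu (uD t st)).
  by rewrite -[LHS]/(C_functional B nu (dagger dag (line t)) (line t)) (C_functionalE _ nu_nz).
have CE : 2 * C_functional B nu (dagger dag tau) theta =
    \sum_k chart_integral (c k) (fun a x => chi k (psi a x) * (2 * v 0 a x)).
  rewrite -(density_integralE i0 M_hausdorff M_compact pu (densityZ 2 (vD 0 st0))).
  rewrite (density_integralZ i0 M_hausdorff M_compact _ (vD 0 st0)); congr (_ * _).
  have E := C_functionalE B nu_nz (dagger dag tau) theta.
  by rewrite E; congr density_integral; rewrite /v line0.
rewrite /first_variation CE.
(* The expression in charts requires the dagger of the line to be a spinor field, hence stability;
   this holds for t near 0, and the derivative sees only such t. *)
apply: (@near_eq_is_derive _ _ _ (fun t => \sum_k chart_integral (c k) (fun a x => chi k (psi a x) * u t a x))).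
  by apply: filterS stable_line => t st; rewrite -VE.
apply: is_derive_suml => k _; have [Cc Cd chi0] := HC k; set a := c k.
pose S := phi a @` C k; have Sc : compact S by exact: compact_chart.
have Scl : closed S by apply: compact_closed => //; exact: norm_hausdorff.
have SU : S `<=` img a by move=> _ [p Cp <-]; exact/img_chart/Cd.
have chiS x : img a x -> ~ S x -> chi k (psi a x) = 0.
  by move=> ix nS; apply: chi0 => Cx; apply: nS; exists (psi a x) => //; exact: chart_invK.
have [K K0 SK] := compact_norm_bound Sc.
have chi_smooth := partition_smooth k pu.
pose F t x := if x \in img a then chi k (psi a x) * u t a x else 0.
pose G t x := if x \in img a then chi k (psi a x) * (2 * v t a x) else 0.
have [_ _ D] : [/\ continuous (G 0), vanishes_beyond K (G 0) & is_derive (0 : R) 1 (fun t => II (F t)) (II (G 0))].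
  apply: (is_derive_II K0).
  - near=> t => x Kx; rewrite /F; case: ifPn => // /set_mem ix; rewrite chiS ?mul0r// => /SK.
    by rewrite ltNge => /negP; apply; exact: ltW.
  - apply: filterS stable_line => t st.
    have [h _] : C1_bounded_support (F t).
      apply: (C1_bounded_support_density (density_scale chi_smooth (uD t st)) Cc Cd).
      by move=> b x ix nC; rewrite chi0// mul0r.
    exact: Ck_continuousT h.
  - apply: filterS stable_line => t st x; rewrite /F /G; case: ifPn => [/set_mem ix|_]; last exact: is_derive_cst.
    have h := is_derive_mul (is_derive_cst (chi k (psi a x) * `|nu a x|^-1) t (1 : R)) (dag_line_derivative st ix).
    rewrite mul0r add0r in h.
    have E : chi k (psi a x) * (2 * v t a x) =
        chi k (psi a x) * `|nu a x|^-1 * (2 * mukai (dag (line t a x)) (theta a x)).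
      by rewrite /v (mukai_to_form n2 n_even nu B_potentials)// /dagger; ring.
    have Ef : (fun s => chi k (psi a x) * u s a x) = fun s =>
        chi k (psi a x) * `|nu a x|^-1 * mukai (dag (line s a x)) (line s a x).
      by apply/funext => s; rewrite /u (mukai_to_form n2 n_even nu B_potentials)// /dagger mulrA.
    rewrite Ef E; exact: h.
  (* Joint continuity of [G] at (0, x). Off the chart image [G] vanishes on the complement of a
     compact support; inside, the pairing is expanded in coordinates so that the dagger appears as
     [dag_row] of a map continuous in (t, x). *)
  move=> x; have [ix|nx] := pselect (img a x); last first.
    have nS : (~` S) x by move=> /SU.
    apply: (@continuous_at_ext _ _ (snd @^-1` (~` S)) (fun=> 0)) => //; last exact: cvg_cst.
      by apply: open_comp; [move=> z _; exact: cvg_snd|exact: closed_openC].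
    by move=> [t y] /= nSy; rewrite /G; case: ifPn => // /set_mem iy; rewrite chiS ?mul0r.
  apply: (@continuous_at_ext _ _ (snd @^-1` (img a)) (fun z : R * 'rV[R]_n => chi k (psi a z.2) * `|nu a z.2|^-1 *
    (2 * \sum_J dag_row eps dag (row_of_form (line z.1 a z.2)) J * theta a z.2 (~: J)%SET *
    (wedge_sign R J (~: J) * hat_sign R #|~: J|)))).
  - by apply: open_comp; [move=> z _; exact: cvg_snd|exact: io].
  - exact: ix.
  - move=> [t y] /= iy; rewrite /G mem_set// /v (mukai_to_form n2 n_even nu B_potentials)// mukaiE.
    rewrite -mulrA; congr (_ * _); rewrite mulrCA; congr (_ * _); congr (_ * _).
    apply: eq_bigr => J _; rewrite /dag_row row_of_formK//.
    by case: (line_spinor t) => _ h _; exact: h.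
  have cs (f : 'rV[R]_n -> R) : {for x, continuous f} -> {for (0 : R, x), continuous (fun z : R * 'rV[R]_n => f z.2)}.
    by move=> cf; apply: (@continuous_comp _ _ _ snd f); [exact: cvg_snd|exact: cf].
  have nuC : Ck 0 (img a) (nu a) by have [h _ _] := nu_nz; have /smooth_onP[_] := h a.
  have h1 := cs (chi k \o psi a) (Ck_continuous (chi_smooth a 0%N) ix).
  have h2 : {for (0 : R, x), continuous (fun z : R * 'rV[R]_n => `|nu a z.2|^-1)}.
    have n0 : `|nu a x| != 0 by rewrite normr_eq0; have [_ h _] := nu_nz; exact: h.
    have cn : {for x, continuous (fun y => `|nu a y|)} by exact: (cvg_norm (Ck_continuous nuC ix)).
    exact: cs _ (cvgV n0 cn).
  have cst (r : R) : {for (0 : R, x), continuous (fun _ : R * 'rV[R]_n => r)} by exact: cvg_cst.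
  have h3 J : {for (0 : R, x), continuous (fun z : R * 'rV[R]_n => dag_row eps dag (row_of_form (line z.1 a z.2)) J)}.
    apply: (@continuous_comp _ _ _ (fun z : R * 'rV[R]_n => row_of_form (line z.1 a z.2)) (fun w => dag_row eps dag w J)).
      exact: continuous_line.
    apply: (Ck_continuous (dag_row_Ck dag_choice J 0)).
    by apply/stable_rowsP => //; exact: st0.
  have h4 (J : {set 'I_n}) := cs _ (Ck_continuous (theta_C a (~: J)%SET) ix).
  have h5 := @continuous_sum_at R _ (0 : R, x) _ (index_enum _) _ (fun J => continuous_mul_at (continuous_mul_at (h3 J) (h4 J))
    (cst (wedge_sign R J (~: J) * hat_sign R #|~: J|))).
  exact: (continuous_mul_at (continuous_mul_at h1 h2) (continuous_mul_at (cst 2) h5)).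
exact: D.
Unshelve. all: by end_near. Qed.

Lemma C_variation gamma : is_spinor_field B eps gamma ->
  first_variation (C_functional B nu gamma) tau theta (C_functional B nu gamma theta).
Proof.
move=> gS; have toP := polyform_to_form nu_nz B_potentials.
have D1 := density_mukai (toP _ _ gS) (toP _ _ tau_spinor).
have D2 := density_mukai (toP _ _ gS) (toP _ _ theta_spinor).
rewrite /first_variation (_ : (fun t => _) = fun t => C_functional B nu gamma tau + t * C_functional B nu gamma theta).
  exact: is_derive_affine.
apply/funext => t; rewrite !(C_functionalE _ nu_nz).
rewrite -(density_integralZ i0 M_hausdorff M_compact t D2).
rewrite -(density_integralD i0 M_hausdorff M_compact D1 (densityZ t D2)).
apply: density_integral_ext => a x ix.
rewrite (to_form_lin nu B tau theta t a x) mukaiDr.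
by rewrite [X in _ + X]mukaiZr.
Qed.

End Variation.

Lemma is_derive_unique (R : realType) (f : R -> R) (t a b : R) :
  is_derive t (1 : R) f a -> is_derive t (1 : R) f b -> a = b.
Proof. by move=> [_ <-] [_ <-]. Qed.

(** Values of two linear functionals at a vector, f and g, and at a reference vector, f0 and g0.
    Subtracting f/f0 times the reference vector lands in the kernel of the first functional, hence
    of the second. *)
Lemma proportional_from_kernel (F : fieldType) (f0 f g0 g : F) : f0 != 0 ->
  (f + - (f / f0) * f0 = 0 -> g + - (f / f0) * g0 = 0) -> g = g0 / f0 * f.
Proof.
move=> f00; rewrite mulNr divfK// subrr => /(_ erefl)/eqP.
by rewrite addr_eq0 mulNr opprK => /eqP ->; rewrite mulrAC [RHS]mulrAC [f * g0]mulrC.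
Qed.

(** * Constrained critical points *)

Section CriticalPoints.
Variables (R : realType) (n : nat) (M : topologicalType) (A : oriented_atlas R n M).
Hypotheses (M_hausdorff : hausdorff_space M) (M_compact : compact [set: M]).
Hypotheses (n2 : (2 < n)%N) (n_even : ~~ odd n) (n_skew : odd 'C(n.+1, 2)).
Let i0 : 'I_n := Ordinal (leq_ltn_trans (leq0n 2) n2).
Local Notation img := (@chart_img R n M A).
Implicit Types (rho sigma : field A (ext R n)).
Variables (nu : field A R) (H B : field A (ext R n)).
Hypotheses (nu_nz : nowhere_vanishing_multivector nu) (H_form : is_form 3 H) (B_potentials : local_potentials H B).
Variables (eps : bool) (dag : ext R n -> ext R n).
Hypothesis dag_choice : dagger_choice eps dag.

Let Cd rho sigma := C_functional B nu rho (d_nu H B nu sigma).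

Let CdE e e' rho sigma : is_spinor_field B e rho -> is_spinor_field B e' sigma ->
  Cd rho sigma = - density_integral (fun a x =>
    mukai (twisted_d H (to_form B nu rho) a x) (to_form B nu sigma a x)).
Proof.
move=> rS sS; have toP := polyform_to_form nu_nz B_potentials.
have E := density_integral_mukai_twisted_d i0 M_hausdorff M_compact n_even H_form (toP _ _ rS) (toP _ _ sS).
rewrite -E /Cd (C_functionalE B nu_nz); apply: density_integral_ext => a x ix.
by rewrite (to_form_d_nu nu_nz B_potentials).
Qed.

Let mukai_density e e' rho sigma : is_spinor_field B e rho -> is_spinor_field B e' sigma ->
  density (fun a x => mukai (twisted_d H (to_form B nu rho) a x) (to_form B nu sigma a x)).
Proof.
move=> rS sS; have toP := polyform_to_form nu_nz B_potentials.
by apply: density_mukai; [apply: (polyform_twisted_d i0 H_form); exact: toP rS|exact: toP sS].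
Qed.

Let Cd_lin e e' rho sigma sigma' (t : R) : is_spinor_field B e rho -> is_spinor_field B e' sigma ->
  is_spinor_field B e' sigma' ->
  Cd rho (fun a x => sigma a x + t *: sigma' a x) = Cd rho sigma + t * Cd rho sigma'.
Proof.
move=> rS sS sS'; have D := mukai_density rS sS; have D' := mukai_density rS sS'.
rewrite (CdE rS (spinor_lin t sS sS')) (CdE rS sS) (CdE rS sS') mulrN -opprD; congr (- _).
rewrite -(density_integralZ i0 M_hausdorff M_compact t D').
rewrite -(density_integralD i0 M_hausdorff M_compact D (densityZ t D')).
apply: density_integral_ext => a x ix.
by rewrite (to_form_lin nu B sigma sigma' t a x) mukaiDr [X in _ + X]mukaiZr.
Qed.

Theorem constrained_criticalP gamma tau : is_spinor_field B eps gamma -> is_spinor_field B eps tau ->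
  stable_field tau ->
  constrained_critical H B nu eps dag gamma tau <->
  exists lambda : R, field_eq (d_nu H B nu (dagger dag tau)) (fun a x => lambda *: d_nu H B nu gamma a x).
Proof.
move=> gS tS tst; have dS : is_spinor_field B eps (dagger dag tau).
  exact: (spinor_dagger n2 n_even B_potentials dag_choice).
have thS sigma : is_spinor_field B (~~ eps) sigma -> is_spinor_field B eps (d_nu H B nu sigma).
  by move=> sS; have := spinor_d_nu n2 nu_nz H_form B_potentials sS; rewrite negbK.
(* The first variations of the constraint and of the functional along d_nu sigma are
   [Cd gamma sigma] and twice [Cd (dagger dag tau) sigma]. *)
have critP : constrained_critical H B nu eps dag gamma tau <->
    forall sigma, is_spinor_field B (~~ eps) sigma -> Cd gamma sigma = 0 -> Cd (dagger dag tau) sigma = 0.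
  have Vv sigma (sS : is_spinor_field B (~~ eps) sigma) :=
    V_variation M_hausdorff M_compact n2 n_even n_skew nu_nz B_potentials dag_choice tS (thS _ sS) tst.
  have Cv sigma (sS : is_spinor_field B (~~ eps) sigma) :=
    C_variation M_hausdorff M_compact n2 nu_nz B_potentials tS (thS _ sS) gS.
  split=> h sigma sS.
    move=> C0; have := Cv _ sS; rewrite -[C_functional _ _ _ _]/(Cd gamma sigma) C0 => /(h _ sS) V0.
    have := is_derive_unique V0 (Vv _ sS) => /esym/eqP.
    by rewrite mulf_eq0 pnatr_eq0/= => /eqP.
  move=> C0; have /esym := is_derive_unique C0 (Cv _ sS) => /(h _ sS) E.
  by have := Vv _ sS; rewrite -[C_functional _ _ _ _]/(Cd (dagger dag tau) sigma) E mulr0.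
rewrite critP; split=> [crit|[lambda E] sigma sS C0].
  have [lambda lE] : exists lambda : R, forall sigma, is_spinor_field B (~~ eps) sigma ->
      Cd (dagger dag tau) sigma = lambda * Cd gamma sigma.
    (* If [Cd gamma] is identically zero, every direction is admissible and lambda = 0 works;
       otherwise lambda is the ratio of the two functionals at a [sigma0] where the first is
       nonzero. *)
    have [[sigma0 s0S s0]|no] := pselect (exists2 sigma, is_spinor_field B (~~ eps) sigma & Cd gamma sigma <> 0).
      exists (Cd (dagger dag tau) sigma0 / Cd gamma sigma0) => sigma sS.
      pose t := - (Cd gamma sigma / Cd gamma sigma0).
      have s0' : Cd gamma sigma0 != 0 by exact/eqP.
      have tS' := spinor_lin t sS s0S.
      have := crit _ tS'; rewrite (Cd_lin t gS sS s0S) (Cd_lin t dS sS s0S).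
      exact: proportional_from_kernel s0'.
    exists 0 => sigma sS; rewrite mul0r; apply: (crit _ sS).
    by apply/eqP/negPn/negP => /eqP h; apply: no; exists sigma.
  exists lambda => a x ix.
  have toP := polyform_to_form nu_nz B_potentials; have dP := polyform_twisted_d i0 H_form.
  pose v : field A (ext R n) := fun a x => twisted_d H (to_form B nu (dagger dag tau)) a x +
    (- lambda) *: twisted_d H (to_form B nu gamma) a x.
  have vP : polyform v.
    by apply: polyformD; [exact: dP (toP _ _ dS)|apply: polyformZ; exact: dP (toP _ _ gS)].
  have cP rho : is_spinor_field B eps rho -> forall a x, img a x ->
      chiral (~~ eps) (twisted_d H (to_form B nu rho) a x).
    move=> rS b y iy; apply: (chiral_twisted_d H_form) => //; first by have [h _] := toP _ _ rS; exact: h.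
    by move=> z iz; exact: (chiral_to_form n2 nu B_potentials rS iz).
  have vc b y : img b y -> chiral (~~ eps) (v b y).
    by move=> iy; apply: chiralD; [exact: cP|apply: chiralZ; exact: cP].
  have v0 : field_eq v (fun _ _ => 0).
    apply: (mukai_nondegenerate i0 M_hausdorff M_compact n_even vP vc) => w wP wc.
    (* Every test form of chirality [~~ eps] comes from a spinor field, so proportionality on
       spinors gives the vanishing of all pairings with [v]. *)
    have wS := spinor_of_form n2 nu_nz B_potentials wP wc.
    have E : field_eq (to_form B nu (of_form B nu w)) w.
      by move=> b y iy; exact: (of_formK nu_nz B_potentials).
    have D1 := mukai_density dS wS; have D2 := mukai_density gS wS.
    rewrite (density_integral_ext (v := fun a x =>
      mukai (twisted_d H (to_form B nu (dagger dag tau)) a x) (to_form B nu (of_form B nu w) a x) +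
      (- lambda) * mukai (twisted_d H (to_form B nu gamma) a x) (to_form B nu (of_form B nu w) a x))); last first.
      by move=> b y iy; rewrite /v mukaiDl mukaiZl E.
    rewrite (density_integralD i0 M_hausdorff M_compact D1 (densityZ (- lambda) D2)).
    rewrite (density_integralZ i0 M_hausdorff M_compact (- lambda) D2).
    have := lE _ wS; rewrite (CdE dS wS) (CdE gS wS) mulrN => /oppr_inj ->.
    by rewrite mulNr subrr.
  have := v0 a x ix; rewrite /v => /eqP; rewrite scaleNr subr_eq0 => /eqP E.
  by rewrite /d_nu /of_form E expactZ !scalerA mulrC.
(* Conversely, integrating by parts puts d_nu on the dagger and on gamma, where the equation makes
   one functional lambda times the other. *)
rewrite (CdE dS sS); apply/eqP; rewrite oppr_eq0; apply/eqP.
transitivity (lambda * density_integral (fun a x => mukai (twisted_d H (to_form B nu gamma) a x) (to_form B nu sigma a x))).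
  rewrite -(density_integralZ i0 M_hausdorff M_compact lambda (mukai_density gS sS)).
  apply: density_integral_ext => a x ix.
  have dE rho := to_form_d_nu nu_nz B_potentials rho ix.
  rewrite -(dE (dagger dag tau)) -(dE gamma) -mukaiZl; congr mukai.
  by rewrite /to_form (E a x ix) expactZ !scalerA mulrC.
by move: C0; rewrite (CdE gS sS) => /eqP; rewrite oppr_eq0 => /eqP ->; rewrite mulr0.
Qed.

End CriticalPoints.

Theorem proposition5p3 (R : realType) (M : topologicalType)
    (A : oriented_atlas R 6 M)
    (M_hausdorff : hausdorff_space M) (M_compact : compact [set: M])
    (nu : field A R) (nu_nz : nowhere_vanishing_multivector nu)
    (H : field A (ext R 6)) (H_form : is_form 3 H) (H_closed : closed_form H)
    (B : field A (ext R 6)) (B_potentials : local_potentials H B)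
    (eps : bool)
    (dag : ext R 6 -> ext R 6) (dag_choice : dagger_choice eps dag)
    (gamma : field A (ext R 6)) (gamma_spinor : is_spinor_field B eps gamma)
    (tau : field A (ext R 6)) (tau_spinor : is_spinor_field B eps tau)
    (tau_stable : stable_field tau)
    (tau_closed : field_eq (d_nu H B nu tau) (fun _ _ => 0)) :
  constrained_critical H B nu eps dag gamma tau <->
  exists lambda : R,
    field_eq (d_nu H B nu (dagger dag tau))
             (fun a x => lambda *: d_nu H B nu gamma a x).
(* The numerical conditions hold by computation for n = 6: 2 < 6, 6 is even, and 'C(7, 2) = 21 is
   odd. *)
Proof. exact: constrained_criticalP. Qed.
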